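(* Let $x_0\in\mathbb Z$, let $0<\beta_L\le\beta_R<\infty$ and $\kappa>0$, and let ${\rm P}(n)=\omega_{\rm B}(A_n)$, $n\in\mathbb N$, be the nonequilibrium steady state emptiness formation probability described in the context. Then, as $n\to\infty$, $$ {\rm P}(n)=\mathcal O\big({\rm e}^{-\Gamma n}\big),$$ where $\Gamma:=\Gamma_R+\Gamma_{\rm B}>0$ with $$\Gamma_R:=-\frac12\int_{-\pi}^{\pi}\frac{dk}{2\pi}\,\log[\hat s_{-,R}(k)],\qquad \Gamma_{\rm B}:=-\frac12\int_{-\pi}^{\pi}\frac{dk}{2\pi}\,\log\big[\sigma_{\rm B}(k)\hat s_{-,L}(k)+(1-\sigma_{\rm B}(k))\hat s_{-,R}(k)\big],$$ $\hat s_{-,\alpha}(k):=\tfrac12\big(1-\tanh[\tfrac12\beta_\alpha\cos k]\big)$ for $\alpha=L,R$, and $\sigma_{\rm B}(k):=\dfrac{\sin^2 k}{\sin^2 k+\kappa^2}$.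
   Context: Setting. Let $\mathfrak h=\ell^2(\mathbb Z)$ with inner product $(\cdot,\cdot)$ antilinear in the first argument, $\delta_x$ ($x\in\mathbb Z$) the Kronecker basis vectors, $u$ the shift $(uf)(x)=f(x-1)$, $p_0=(\delta_0,\cdot)\delta_0$, and ${\rm Re}(A)=(A+A^* )/2$. Fix an integer $N\ge0$ and $\kappa>0$. Define $h={\rm Re}(u)$, $h_{\rm B}=h+\kappa p_0$, $v_L={\rm Re}(u^{-(N+1)}p_0u^N)$, $v_R={\rm Re}(u^Np_0u^{-(N+1)})$, $h_0=h-v_L-v_R$. On $\mathfrak h\oplus\mathfrak h$ let $H_{\rm B}=h_{\rm B}\oplus(-h_{\rm B})$, and let $J[f_1,f_2]=[\bar f_2,\bar f_1]$. Let $\mathfrak A$ be the C*-algebra on the fermionic Fock space over $\mathfrak h$ generated by $B(F)=a^*(f_1)+a(\bar f_2)$, $F=[f_1,f_2]\in\mathfrak h\oplus\mathfrak h$ (so $\{B^*(F),B(G)\}=(F,G)$, $B^*(F)=B(JF)$), with dynamics $\tau_{\rm B}^t(B(F))=B({\rm e}^{itH_{\rm B}}F)$ (Bogoliubov automorphisms). A state $\omega$ on $\mathfrak A$ is quasifree with density $S$ (an operator on $\mathfrak h\oplus\mathfrak h$ with $0\le S=S^*\le1$, $JSJ=1-S$) if $\omega(B^*(F)B(G))=(F,SG)$, $\omega$ vanishes on odd monomials in the $B(F)$'s, and $\omega(B(F_1)\cdots B(F_{2n}))$ is the Pfaffian of the skew-symmetric matrix with entries $\omega(B(F_i)B(F_j))$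 for $i<j$. Let $\mathbb Z_L=\{x\le-(N+1)\}$, $\mathbb Z_{\mathcal S}=\{-N\le x\le N\}$, $\mathbb Z_R=\{x\ge N+1\}$, $\mathfrak h_\alpha=\ell^2(\mathbb Z_\alpha)$, $i_\alpha:\mathfrak h_\alpha\to\mathfrak h$ extension by zero, $h_\alpha=i_\alpha^*hi_\alpha$. Let $k_0=\beta_Lh_L\oplus0\oplus\beta_Rh_R$ on $\mathfrak h\cong\mathfrak h_L\oplus\mathfrak h_{\mathcal S}\oplus\mathfrak h_R$, $s_{0,\pm}=(1+{\rm e}^{\pm k_0})^{-1}$, and $\omega_0$ the quasifree state with density $S_0=s_{0,-}\oplus s_{0,+}$. The net $\{\frac1T\int_0^T\omega_0\circ\tau_{\rm B}^t\,dt\}_{T>0}$ has a unique weak-* limit point as $T\to\infty$, denoted $\omega_{\rm B}$ (the NESS). For $x_0\in\mathbb Z$ set $G_1=[0,\delta_{x_0-1}]$, $G_2=JG_1$, $F_{2i-1}=(u^i\oplus u^i)G_1$, $F_{2i}=(u^i\oplus u^i)G_2$, and $A_n=\prod_{i=1}^{2n}B(F_i)$ (equivalently $A_n=\prod_{x=x_0}^{x_0+n-1}a_xa_x^*$). *)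

(* Defs.v *)
From Stdlib Require Import Reals ZArith List.
From Coquelicot Require Import Coquelicot.
Import ListNotations.
Open Scope R_scope.

(* ---------- Matrices on l^2(Z) given by their kernels (delta_x, A delta_y) ---------- *)

Definition kron (x y : Z) : R := if Z.eq_dec x y then 1 else 0.

(* h = Re(u), (u f)(x) = f(x-1): kernel 1/2 on nearest neighbours *)
Definition hfree (x y : Z) : R := if Z.eq_dec (Z.abs (x - y)) 1 then / 2 else 0.

Definition hB (kappa : R) (x y : Z) : R :=
  hfree x y + (if (Z.eqb x 0 && Z.eqb y 0)%bool then kappa else 0).

Definition inL (N : nat) (x : Z) : bool := (x <=? - (Z.of_nat N + 1))%Z.
Definition inR (N : nat) (x : Z) : bool := (Z.of_nat N + 1 <=? x)%Z.

Definition k0 (N : nat) (bL bR : R) (x y : Z) : R :=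
  (if (inL N x && inL N y)%bool then bL * hfree x y else 0)
  + (if (inR N x && inR N y)%bool then bR * hfree x y else 0).

(* product M A of kernels, exact when A is tridiagonal (A z y = 0 for |z-y|>1) *)
Definition mulT (M A : Z -> Z -> R) (x y : Z) : R :=
  M x (y - 1)%Z * A (y - 1)%Z y + M x y * A y y + M x (y + 1)%Z * A (y + 1)%Z y.

Definition powT (A : Z -> Z -> R) (n : nat) : Z -> Z -> R :=
  Nat.iter n (fun M => mulT M A) kron.

(* Continuous functional calculus f(A) for a self-adjoint tridiagonal A with
   spectrum in [-1,1]: kernel of f(A) is the limit of the kernels of the
   Bernstein polynomials B_m f (A) (which converge in norm to f(A)). *)
Definition bernstein_term (f : R -> R) (A : Z -> Z -> R) (m : nat) (x y : Z) : R :=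
  let P := fun u v => (kron u v + A u v) / 2 in
  let Q := fun u v => (kron u v - A u v) / 2 in
  sum_f_R0 (fun k => f (-1 + 2 * INR k / INR m) * Binomial.C m k *
              Nat.iter (m - k) (fun M => mulT M Q) (Nat.iter k (fun M => mulT M P) kron) x y) m.

Definition fcalc (f : R -> R) (A : Z -> Z -> R) (x y : Z) : R :=
  real (Lim_seq (fun m => bernstein_term f A m x y)).

(* s_{0,-} = (1 + e^{-k_0})^{-1},  s_{0,+} = (1 + e^{k_0})^{-1};
   computed as g(k_0 / beta_R) with g(y) = (1+e^{-+ beta_R y})^{-1},
   since spec(k_0/beta_R) is contained in [-1,1] (beta_L <= beta_R). *)
Definition s0m (N : nat) (bL bR : R) : Z -> Z -> R :=
  fcalc (fun y => / (1 + exp (- (bR * y)))) (fun x y => k0 N bL bR x y / bR).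
Definition s0p (N : nat) (bL bR : R) : Z -> Z -> R :=
  fcalc (fun y => / (1 + exp (bR * y))) (fun x y => k0 N bL bR x y / bR).

Definition CSeries (a : nat -> C) : C :=
  (Series (fun n => Re (a n)), Series (fun n => Im (a n))).

(* sum over Z (all sums used below are absolutely convergent) *)
Definition sumZ (f : Z -> C) : C :=
  CSeries (fun n => (f (Z.of_nat n) + f (- Z.of_nat n - 1)%Z)%C).

Definition Ut (kappa t : R) (x y : Z) : C :=
  CSeries (fun n => (RtoC (t ^ n / INR (fact n) * powT (hB kappa) n x y) * Cpow Ci n)%C).

Definition Vec : Type := ((Z -> C) * (Z -> C))%type.

Definition ip (F G : Vec) : C :=
  sumZ (fun x => (Cconj (fst F x) * fst G x + Cconj (snd F x) * snd G x)%C).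

Definition Jv (F : Vec) : Vec :=
  (fun x => Cconj (snd F x), fun x => Cconj (fst F x)).

Definition S0app (N : nat) (bL bR : R) (F : Vec) : Vec :=
  (fun x => sumZ (fun y => (RtoC (s0m N bL bR x y) * fst F y)%C),
   fun x => sumZ (fun y => (RtoC (s0p N bL bR x y) * snd F y)%C)).

Definition evolve (kappa t : R) (F : Vec) : Vec :=
  (fun x => sumZ (fun y => (Ut kappa t x y * fst F y)%C),
   fun x => sumZ (fun y => (Ut kappa (- t) x y * snd F y)%C)).

(* omega_0(B(F) B(G)) = omega_0(B^*(JF) B(G)) = (JF, S_0 G) *)
Definition omega0_two (N : nat) (bL bR : R) (F G : Vec) : C :=
  ip (Jv F) (S0app N bL bR G).

Definition delta (a : Z) : Z -> C := fun x => RtoC (kron x a).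

Definition G1 (x0 : Z) : Vec := (fun _ => RtoC 0, delta (x0 - 1)%Z).
Definition G2 (x0 : Z) : Vec := Jv (G1 x0).

Definition shiftv (i : Z) (F : Vec) : Vec :=
  (fun x => fst F (x - i)%Z, fun x => snd F (x - i)%Z).

(* F_{2i-1} = (u^i (+) u^i) G_1, F_{2i} = (u^i (+) u^i) G_2, j >= 1 *)
Definition Fvec (x0 : Z) (j : nat) : Vec :=
  shiftv (Z.of_nat ((j + 1) / 2)) (if Nat.odd j then G1 x0 else G2 x0).

(* ---------- Pfaffian (expansion along the first index) ---------- *)
Fixpoint remove_nth (k : nat) (l : list nat) : list nat :=
  match k, l with
  | _, nil => nil
  | O, _ :: r => r
  | S k', a :: r => a :: remove_nth k' r
  end.

Definition Csum_list (l : list C) : C := fold_right Cplus (RtoC 0) l.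

Fixpoint pf_aux (M : nat -> nat -> C) (fuel : nat) (l : list nat) : C :=
  match fuel with
  | O => RtoC 1
  | S f =>
    match l with
    | nil => RtoC 1
    | i :: rest =>
      Csum_list (map (fun k =>
        (RtoC ((-1) ^ k) * M i (nth k rest O) * pf_aux M f (remove_nth k rest))%C)
        (seq 0 (length rest)))
    end
  end.

(* Pfaffian of the skew matrix with entries M i j (i<j), indices in l (increasing) *)
Definition pfaffian (M : nat -> nat -> C) (l : list nat) : C := pf_aux M (length l) l.

(* (omega_0 o tau_B^t)(A_n) = Pf[ omega_0(B(e^{itH_B}F_i) B(e^{itH_B}F_j)) ]_{1<=i<j<=2n} *)
Definition Pt (x0 : Z) (N : nat) (kappa bL bR : R) (n : nat) (t : R) : C :=
  pfaffian (fun i j => omega0_two N bL bR (evolve kappa t (Fvec x0 i))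
                                          (evolve kappa t (Fvec x0 j)))
           (seq 1 (2 * n)).

(* P(n) = omega_B(A_n) = lim_{T -> oo} (1/T) int_0^T omega_0(tau_B^t(A_n)) dt *)
Definition Pness (x0 : Z) (N : nat) (kappa bL bR : R) (n : nat) : C :=
  (real (Lim (fun T => / T * RInt (fun t => Re (Pt x0 N kappa bL bR n t)) 0 T) p_infty),
   real (Lim (fun T => / T * RInt (fun t => Im (Pt x0 N kappa bL bR n t)) 0 T) p_infty)).

Definition shat (b k : R) : R := (1 - tanh (b * cos k / 2)) / 2.
Definition sigmaB (kappa k : R) : R := sin k ^ 2 / (sin k ^ 2 + kappa ^ 2).

Definition GammaR (bR : R) : R :=
  - / 2 * (RInt (fun k => ln (shat bR k)) (- PI) PI / (2 * PI)).
Definition GammaB (kappa bL bR : R) : R :=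
  - / 2 * (RInt (fun k => ln (sigmaB kappa k * shat bL k + (1 - sigmaB kappa k) * shat bR k))
                (- PI) PI / (2 * PI)).
Definition Gamma (kappa bL bR : R) : R := GammaR bR + GammaB kappa bL bR.

(* Main.v *)
(* The Pfaffian of the two-point matrix is, at each time t, a determinant: that of the
   positive matrix S_t(x,y) = (e^{ith} delta_x, s e^{ith} delta_y) over the n sites, s = s_{0,-}, h = h_B.
   By Hadamard's inequality after a unitriangular change of basis, |Pt| <= prod_i (w_i, S_t w_i) for every
   family of trial vectors w_i = delta_{x_i} + (combination of delta_x, x < x_i).
   Expanding in the explicit generalised eigenfunctions of h_B, a vector w on the sites x >= 0 splits as
   t -> infinity into a wave travelling to the right reservoir, with amplitude w^(k) + r(k) w^(-k), one
   travelling to the left reservoir, with amplitude tau(k) w^(-k), and a bound state contribution; each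
   wave is eventually weighted by the Fermi function of its own reservoir.  Up to terms that are small when
   w_i sits far to the right of the impurity, (w_i, S_t w_i) is therefore at most
     1/(2 pi) int_0^pi [f_R(k) |P(k)|^2 + f_B(k) |P(-k)|^2] dk,   P(k) = sum_j w_i(x_i - j) e^{ijk},
   where f_B = (1 - sigma) f_R + sigma f_L.  Szego's theorem for the symbol equal to f_R on (0, pi) and to
   f_B(-k) on (-pi, 0) says that the infimum of this over P with P^(0) = 1 is exp of the mean of the
   logarithm of the symbol, that is e^{-Gamma}.  Truncating the exponential of the analytic part of the
   Fourier series of the logarithm gives P of degree q^4 with error O(q^{-6}), hence O(D^{-3/2}) at
   distance D ~ q^4 from the impurity; this is summable, so the product over the sites is O(e^{-Gamma n}).
   Because the bound holds for every large t, it passes to the time averages. *)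

Require Import Defs.
From mathcomp Require all_boot all_order all_algebra complex Rstruct ring zify.
From Stdlib Require Import Reals ZArith List Lra Lia Psatz FinFun.
From Coquelicot Require Import Coquelicot.
Import ListNotations.
Open Scope R_scope.

(** * Hadamard bound for Pfaffians *)

(** Everything is arranged so that only upper bounds on (w, S_t w) for one finitely supported vector
    w enter, valid for all t beyond a time that may depend on w and n, while the constants do not
    depend on n. In place of the spectral theorem, both self-adjoint operators are represented by
    explicit integral kernels: sine transforms on the decoupled half-lines, scattering states and a
    bound state for h_B. Uniform polynomial approximation identifies these kernels with the defining
    limits and series. The delicate points are the band edges k = 0 and k = PI: they are the
    critical points of cos k, and the two halves of the symbol are glued there. Since kappa > 0,
    transmission vanishes at both edges. Hence all wave amplitudes are O(sin k), which yields decay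
    in time, and f_B = f_R there, so the symbol is continuous on the circle and its logarithm has
    Fourier coefficients O(m^-2). The rate q^-6 is the square of the uniform error q^-3 of the
    truncated logarithm, whose first order effect integrates to zero. *)

Module PfaffianBound.
Import all_boot all_order all_algebra complex Rstruct ring zify.
Set Implicit Arguments. Unset Strict Implicit. Unset Printing Implicit Defensive.
Import Order.TTheory GRing.Theory Num.Theory.
Local Open Scope ring_scope.

(** * Hadamard's inequality for positive semidefinite matrices *)

Section Hadamard.
Variable C : numClosedFieldType.

Definition hform n (H : 'M[C]_n) (v : 'I_n -> C) : C :=
  \sum_i \sum_j (v i)^* * H i j * v j.

Definition psd n (H : 'M[C]_n) : Prop :=
  (forall i j, H j i = (H i j)^*) /\ (forall v, 0 <= hform H v).

Lemma psd_diag n (H : 'M[C]_n) i : psd H -> 0 <= H i i.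
Proof.
move=> [_ /(_ (fun j => (j == i)%:R))]; rewrite /hform (bigD1 i) //= [X in _ + X]big1 ?addr0.
  rewrite (bigD1 i) //= big1 ?addr0 ?eqxx ?conjC1 ?mul1r ?mulr1 //.
  by move=> j /negbTE ->; rewrite mulr0.
by move=> j /negbTE ->; rewrite conjC0 big1 // => k _; rewrite !mul0r.
Qed.

Lemma hform_block n (H : 'M[C]_(1 + n)) (x : C) (v : 'I_n -> C) :
  (forall i j, H j i = (H i j)^*) ->
  hform H (fun i => match split i with inl _ => x | inr j => v j end) =
  x^* * H (lshift n ord0) (lshift n ord0) * x
  + (x^* * (\sum_j H (lshift n ord0) (rshift 1 j) * v j)
     + x * (\sum_j H (lshift n ord0) (rshift 1 j) * v j)^*)
  + hform (drsubmx H) v.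
Proof.
move=> Hh; rewrite /hform big_split_ord /= big_ord1 big_split_ord /= big_ord1.
have El k : split (lshift n k) = inl k :> 'I_1 + 'I_n by rewrite -[lshift n k]/(unsplit (inl k)) unsplitK.
have Er k : split (rshift 1 k) = inr k :> 'I_1 + 'I_n by rewrite -[rshift 1 k]/(unsplit (inr k)) unsplitK.
rewrite El -!addrA; congr (_ + _).
under eq_bigr => j _ do rewrite Er.
rewrite [in RHS]mulr_sumr; congr (_ + _); first by apply: eq_bigr => j _; rewrite mulrA.
rewrite rmorph_sum mulr_sumr -big_split /=; apply: eq_bigr => i _.
rewrite big_split_ord /= big_ord1 El Er; congr (_ + _).
  by rewrite Hh rmorphM /=; ring.
by apply: eq_bigr => j _; rewrite Er /drsubmx !mxE.
Qed.

(** Induction through the Schur complement [S] of the corner entry [a]: [\det H = a * \det S], and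
    each diagonal entry of [S] is at most the corresponding entry of [H]. If [a = 0], positivity
    forces the whole first row to vanish. *)
Lemma psd_det n (H : 'M[C]_n) : psd H -> 0 <= \det H <= \prod_i H i i.
Proof.
elim: n H => [|n IH] H Hp; first by rewrite det_mx00 big_ord0 ler01 lexx.
have [Hh Hv] := Hp.
pose H' : 'M[C]_(1 + n) := H.
set a := H' (lshift n ord0) (lshift n ord0).
pose u j := H' (lshift n ord0) (rshift 1 j).
have a0 : 0 <= a by apply: psd_diag.
have aR : a^* = a by apply/CrealP; apply: ger0_real.
have prodE : \prod_i H i i = a * \prod_i H' (rshift 1 i) (rshift 1 i).
  by rewrite -[n.+1]/(1 + n)%N big_split_ord big_ord1.
have HB (x : C) (v : 'I_n -> C) := hform_block x v (Hh : forall i j : 'I_(1+n), _).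
have [aZ|aN] := eqVneq a 0.
  have uZ j : u j = 0.
    apply/eqP/negP => /negP uN.
    (* With [a = 0] the form at the vector with entries - s u_j and e_j is H_jj - 2 s |u_j|^2; this
       [s] makes it equal to -1. *)
    pose s := (H' (rshift 1 j) (rshift 1 j) + 1) / (2 * `|u j| ^+ 2).
    have djj : 0 <= H' (rshift 1 j) (rshift 1 j) by apply: psd_diag.
    have sR : s^* = s.
      by apply/CrealP; apply: ger0_real; rewrite divr_ge0 ?addr_ge0 ?mulr_ge0 ?exprn_ge0 ?ler01.
    have := Hv (fun i => match @split 1 n i with inl _ => - s * u j | inr k => (k == j)%:R end).
    rewrite HB -/a aZ mulr0 mul0r add0r.
    rewrite (bigD1 j) //= eqxx mulr1 big1 ?addr0; last by move=> k /negbTE ->; rewrite mulr0.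
    rewrite -/(u j) [(- s * u j)^*]rmorphM /= rmorphN /= sR.
    have -> : hform (drsubmx H') (fun k => (k == j)%:R) = H' (rshift 1 j) (rshift 1 j).
      rewrite /hform (bigD1 j) //= [X in _ + X]big1 ?addr0.
        rewrite (bigD1 j) //= big1 ?addr0 ?eqxx ?conjC1 ?mul1r ?mulr1 ?mxE //.
        by move=> k /negbTE ->; rewrite mulr0.
      by move=> k /negbTE ->; rewrite conjC0 big1 // => l _; rewrite !mul0r.
    have uu : u j * (u j)^* = `|u j| ^+ 2 by rewrite normCK.
    have -> : - s * (u j)^* * u j + - s * u j * (u j)^* = - (H' (rshift 1 j) (rshift 1 j) + 1).
      transitivity (- (s * (2 * (u j * (u j)^*)))); first by ring.
      by rewrite uu /s divfK // mulf_neq0 ?pnatr_eq0 // expf_neq0 // normr_eq0.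
    by rewrite opprD addrAC addNr add0r oppr_ge0 ler10.
  have -> : \det H = 0.
    rewrite -[\det H]/(\det H') (expand_det_row _ (lshift n ord0)) big_split_ord big_ord1 /=.
    rewrite -/a aZ mul0r add0r big1 // => j _.
    by rewrite -/(u j) uZ mul0r.
  by rewrite lexx prodE aZ mul0r lexx.
have ap : 0 < a by rewrite lt_def aN.
pose S := drsubmx H' - dlsubmx H' *m (a^-1%:M) *m ursubmx H'.
have Sij i j : S i j = H' (rshift 1 i) (rshift 1 j) - (u i)^* * a^-1 * u j.
  rewrite !mxE big_ord1 !mxE big_ord1 !mxE eqxx mulr1n; congr (_ - _ * _ * _).
  by rewrite -Hh.
have Sp : psd S.
  split=> [i j|v].
    rewrite !Sij rmorphB /= !rmorphM /= fmorphV /= aR conjCK; congr (_ - _); first exact: Hh.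
    by ring.
  pose w := \sum_j u j * v j.
  (* Completing the square: the form of [S] at [v] is the form of [H] minimised over the first
     coordinate, and - w / a is the minimiser. *)
  have := Hv (fun i => match @split 1 n i with inl _ => - w / a | inr k => v k end).
  rewrite HB -/a -/w; congr (_ <= _).
  have wS : \sum_i \sum_j (v i)^* * ((u i)^* * a^-1 * u j) * v j = w^* * a^-1 * w.
    rewrite /w rmorph_sum !mulr_suml; apply: eq_bigr => i _; rewrite mulr_sumr; apply: eq_bigr => j _.
    by rewrite rmorphM /=; ring.
  have -> : hform S v = hform (drsubmx H') v - w^* * a^-1 * w.
    rewrite -wS /hform -sumrB; apply: eq_bigr => i _; rewrite -sumrB; apply: eq_bigr => j _.
    by rewrite -mulrBl -mulrBr Sij !mxE.
  rewrite addrC; congr (_ + _).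
  have -> : (- w / a)^* = - w^* / a by rewrite rmorphM rmorphN /= fmorphV /= aR.
  by field.
have detE : \det H = a * \det S.
  rewrite -[\det H]/(\det H').
  have -> : H' = (block_mx 1%:M 0 (dlsubmx H' *m (a^-1%:M)) 1%:M) *m (block_mx (a%:M) (ursubmx H') 0 S).
    rewrite mulmx_block !mul1mx !mul0mx !addr0 /S [X in block_mx _ _ _ X]addrC subrK.
    rewrite -mulmxA -scalar_mxM mulVf // mulmx1 -[LHS]submxK.
    by congr block_mx; apply/matrixP => i j; rewrite !ord1 !mxE eqxx mulr1n /a; congr (H' _ _); apply: val_inj.
  by rewrite det_mulmx det_lblock det_ublock !det1 !mul1r det_scalar1.
have /andP [d0 d1] := IH _ Sp.
rewrite detE prodE mulr_ge0 //= ler_pM2l //.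
apply: le_trans d1 _; apply: ler_prod => i _.
rewrite psd_diag //= Sij lerBlDr lerDl mulrAC divr_ge0 //.
by rewrite mulrC mul_conjC_ge0.
Qed.

(** [K] is the Gram matrix of the rows of [W] for the form [H]. It has the determinant of [H]
    because [W] is unitriangular, and its diagonal consists of the trial values, so Hadamard's
    inequality for [K] is the claim. *)
Lemma psd_det_trial n (H W : 'M[C]_n) : psd H ->
  (forall i j : 'I_n, (i < j)%N -> W i j = 0) -> (forall i, W i i = 1) ->
  0 <= \det H <= \prod_i hform H (W i).
Proof.
move=> Hp Wt W1.
pose K : 'M[C]_n := \matrix_(i, j) \sum_k \sum_l (W i k)^* * H k l * W j l.
have hK v : hform K v = hform H (fun k => \sum_i v i * W i k).
  rewrite /hform.
  have E i j : (v i)^* * K i j * v j = \sum_k \sum_l (v i)^* * ((W i k)^* * H k l * W j l) * v j.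
    by rewrite mxE mulr_sumr mulr_suml; apply: eq_bigr => k _; rewrite mulr_sumr mulr_suml.
  under eq_bigr => i _ do under eq_bigr => j _ do rewrite E.
  under eq_bigr => i _ do rewrite exchange_big /=.
  rewrite exchange_big /=; apply: eq_bigr => k _.
  under eq_bigr => i _ do rewrite exchange_big /=.
  rewrite exchange_big /=; apply: eq_bigr => l _.
  rewrite rmorph_sum mulr_suml mulr_suml; apply: eq_bigr => i _.
  rewrite mulr_sumr; apply: eq_bigr => j _.
  by rewrite rmorphM /=; ring.
have [Hh Hv] := Hp.
have Kp : psd K.
  split=> [i j|v]; last by rewrite hK.
  rewrite !mxE rmorph_sum exchange_big /=; apply: eq_bigr => k _.
  rewrite rmorph_sum; apply: eq_bigr => l _.
  by rewrite !rmorphM /= conjCK [H l k]Hh; ring.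
have dW : \det W = 1.
  rewrite det_trig; first by rewrite big1.
  by apply/is_trig_mxP.
have KE : K = map_mx Num.conj W *m H *m W^T.
  apply/matrixP => i j; rewrite !mxE exchange_big /=; apply: eq_bigr => l _.
  rewrite !mxE mulr_suml; apply: eq_bigr => k _; by rewrite mxE.
have := psd_det Kp.
rewrite {1}KE {1}KE !det_mulmx det_tr dW mulr1 det_map_mx dW rmorph1 mul1r.
by under eq_bigr => i _ do rewrite mxE.
Qed.

End Hadamard.

(** * Pfaffians of bipartite skew matrices as determinants *)

Section BipartitePfaffian.
Variable F : comNzRingType.

Definition delnth (k : nat) (l : seq nat) := take k l ++ drop k.+1 l.

(** Mirror of [pf_aux] over an arbitrary commutative ring. Each level consumes one unit of fuel and
    two indices; the default 1 is the Pfaffian of the empty list. *)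
Fixpoint pfg (M : nat -> nat -> F) (fuel : nat) (l : seq nat) : F :=
  match fuel, l with
  | f.+1, i :: r => \sum_(k < size r) (-1) ^+ k * M i (nth 0%N r k) * pfg M f (delnth k r)
  | _, _ => 1
  end.

Definition detL (A : nat -> nat -> F) (o e : seq nat) : F :=
  \det (\matrix_(i < size o, j < size o) A (nth 0%N o i) (nth 0%N e j)).

Lemma nth_delnth k l j : nth 0%N (delnth k l) j = nth 0%N l (bump k j).
Proof.
rewrite /delnth nth_cat size_take /bump; case: (ltnP k (size l)) => kl.
  case: (ltnP j k) => jk; first by rewrite nth_take.
  by rewrite nth_drop; congr (nth _ _ _); lia.
case: (ltnP j (size l)) => jl; first by rewrite nth_take ?(leqNgt k) ?(leq_trans jl kl) //; lia.
rewrite nth_default; last by rewrite size_drop; lia.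
by rewrite nth_default //; lia.
Qed.

Lemma size_delnth k l : (k < size l)%N -> size (delnth k l) = (size l).-1.
Proof. by move=> kl; rewrite size_cat size_drop size_takel ?(ltnW kl) //; lia. Qed.

Lemma detL_row A i o e : detL A (i :: o) e =
  \sum_(b < (size o).+1) (-1) ^+ b * A i (nth 0%N e b) * detL A o (delnth b e).
Proof.
rewrite /detL /= (expand_det_row _ ord0); apply: eq_bigr => b _.
rewrite mxE /cofactor /= add0n mulrCA mulrA; congr (_ * _ * \det _).
by apply/matrixP => j k; rewrite !mxE nth_delnth.
Qed.

Lemma detL_col A o j e : size o = (size e).+1 -> detL A o (j :: e) =
  \sum_(b < size o) (-1) ^+ b * A (nth 0%N o b) j * detL A (delnth b o) e.
Proof.
move=> so.
have E n (sn : size o = n.+1) : detL A o (j :: e) =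
    \sum_(b < n.+1) (-1) ^+ b * A (nth 0%N o b) j * detL A (delnth b o) e.
  rewrite /detL sn (expand_det_col _ ord0); apply: eq_bigr => b _.
  rewrite mxE /cofactor /= addn0 mulrCA mulrA; congr (_ * _ * _).
  have -> : size (delnth b o) = n by rewrite size_delnth sn.
  by congr (\det _); apply/matrixP => i k; rewrite !mxE nth_delnth.
by rewrite (E _ so) so.
Qed.

(** Counts the pairs with an even entry standing before an odd one: the adjacent transpositions that
    bring all odd indices to the front. *)
Fixpoint inv (l : seq nat) : nat :=
  if l is x :: r then ((if odd x then 0 else count odd r) + inv r)%N else 0%N.

Lemma inv_cat r1 r2 : inv (r1 ++ r2) = (inv r1 + inv r2 + count (predC odd) r1 * count odd r2)%N.
Proof. by elim: r1 => [|x r1 IH] /=; [lia | rewrite IH count_cat; case: (odd x) => /=; lia]. Qed.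

(** Reindexing by rank: the Pfaffian expansion runs over positions in the list, the Laplace
    expansion over positions among the entries of one parity. *)
Lemma sum_count (p : pred nat) (G : nat -> F) r :
  \sum_(k < size r) (if p (nth 0%N r k) then G (count p (take k r)) else 0) =
  \sum_(b < count p r) G b.
Proof.
elim: r G => [|x r IH] G; first by rewrite !big_ord0.
rewrite big_ord_recl /=; case: (p x) => /=; last first.
  by rewrite add0r -IH; apply: eq_bigr.
rewrite add1n big_ord_recl; congr (_ + _).
by rewrite -(IH (fun b => G b.+1)); apply: eq_bigr.
Qed.

(** Only partners of opposite parity survive, so the Pfaffian expansion becomes a Laplace expansion,
    along the first row if the head is odd and along the first column if it is even. The sign
    combines the sorting of odd before even indices with the sign (-1)^'C(m, 2) of the block form
    with corners A and - A^T. *)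
Lemma pfg_det (M A : nat -> nat -> F) fuel l :
  (forall x y, odd x -> odd y -> M x y = 0) ->
  (forall x y, ~~ odd x -> ~~ odd y -> M x y = 0) ->
  (forall x y, (x < y)%N -> odd x -> ~~ odd y -> M x y = A x y) ->
  (forall x y, (x < y)%N -> ~~ odd x -> odd y -> M x y = - A y x) ->
  sorted ltn l -> count odd l = count (predC odd) l -> (count odd l <= fuel)%N ->
  pfg M fuel l =
  (-1) ^+ (inv l + 'C(count odd l, 2)) * detL A (filter odd l) (filter (predC odd) l).
Proof.
move=> Moo Mee Moe Meo.
elim: fuel l => [|f IH] [|x r] // sl cl cf.
- by rewrite /detL /= det_mx00 mulr1.
- by move: cl cf => /=; case: (odd x) => /=; lia.
- by rewrite /detL /= det_mx00 mulr1.
have xr : all (ltn x) r by exact: (order_path_min ltn_trans sl).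
have sr : sorted ltn r := path_sorted sl.
have split_r k : (k < size r)%N -> r = take k r ++ nth 0%N r k :: drop k.+1 r.
  by move=> kr; rewrite -drop_nth // cat_take_drop.
have sd k : sorted ltn (delnth k r).
  apply: (subseq_sorted ltn_trans _ sr).
  rewrite -{2}(cat_take_drop k r) cat_subseq //.
  by rewrite -add1n -drop_drop drop_subseq.
have lt k : (k < size r)%N -> (x < nth 0%N r k)%N.
  by move=> kr; move/all_nthP: xr => /(_ 0%N k kr).
have signE a b : odd a = odd b -> (-1) ^+ a = (-1) ^+ b :> F.
  by move=> ab; rewrite -signr_odd ab signr_odd.
have cnt (p : pred nat) k : (k < size r)%N ->
    count p r = (count p (take k r) + (p (nth 0%N r k) + count p (drop k.+1 r)))%N.
  by move=> kr; rewrite {1}(split_r k kr) count_cat.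
have cntd (p : pred nat) k : count p (delnth k r) = (count p (take k r) + count p (drop k.+1 r))%N.
  by rewrite /delnth count_cat.
have invd k : (k < size r)%N -> inv r = (inv (delnth k r) +
    if odd (nth 0%N r k) then count (predC odd) (take k r) else count odd (drop k.+1 r))%N.
  move=> kr; rewrite {1}(split_r k kr) /delnth !inv_cat /=; case: (odd _) => /=; lia.
have fnth (p : pred nat) k : (k < size r)%N -> p (nth 0%N r k) ->
    nth 0%N (filter p r) (count p (take k r)) = nth 0%N r k.
  move=> kr py; rewrite {1}(split_r k kr) filter_cat /= py nth_cat size_filter ltnn subnn //.
have fE (p : pred nat) k : (k < size r)%N -> filter p r = filter p (take k r) ++
    (if p (nth 0%N r k) then nth 0%N r k :: filter p (drop k.+1 r) else filter p (drop k.+1 r)).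
  by move=> kr; rewrite {1}(split_r k kr) filter_cat.
have fdel (p : pred nat) k : (k < size r)%N -> p (nth 0%N r k) ->
    filter p (delnth k r) = delnth (count p (take k r)) (filter p r).
  move=> kr py; rewrite (fE p k kr) py /delnth !filter_cat.
  rewrite take_size_cat ?size_filter // drop_cat size_filter ltnNge leqW //=.
  by rewrite subSn // subnn /= drop0.
have fdelN (p : pred nat) k : (k < size r)%N -> ~~ p (nth 0%N r k) ->
    filter p (delnth k r) = filter p r.
  by move=> kr /negbTE py; rewrite (fE p k kr) py /delnth !filter_cat.
have szk k : (k < size r)%N -> (count odd (take k r) + count (predC odd) (take k r))%N = k.
  by move=> kr; rewrite count_predC size_takel // ltnW.
move: cl cf => /=; case: (boolP (odd x)) => ox /= cl cf.
- rewrite detL_row mulr_sumr.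
  have -> : (size (filter odd r)).+1 = count (predC odd) r by rewrite size_filter; lia.
  rewrite -(sum_count _ (fun b => (-1) ^+ (0 + inv r + 'C(1 + count odd r, 2)) *
     ((-1) ^+ b * A x (nth 0%N (filter (predC odd) r) b) * detL A (filter odd r) (delnth b (filter (predC odd) r))))).
  apply: eq_bigr => -[k kr] _ /=; case: ifPn => [oy|]; last first.
    by rewrite negbK => oy; rewrite Moo // mulr0 mul0r.
  have c1 := cnt odd k kr; have c2 := cnt (predC odd) k kr; have d1 := cntd odd k; have d2 := cntd (predC odd) k.
  have iv := invd k kr; have sk := szk k kr.
  have ny := oy; rewrite /= in oy; rewrite (negbTE oy) /= in c1 c2 iv.
  rewrite Moe ?lt // IH; [|exact: sd|lia|lia].
  rewrite (fnth (predC odd)) // -(fdel (predC odd)) // (fdelN odd) //.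
  rewrite mulrACA -[in RHS](mulrA _ (A _ _)) [RHS]mulrA; congr (_ * _).
  rewrite -!exprD; apply: signE.
  have -> : count odd (delnth k r) = count odd r by lia.
  rewrite add0n add1n binS bin1; clear -iv c1 sk d1 cl. lia.
- rewrite detL_col; last by rewrite !size_filter; lia.
  rewrite mulr_sumr size_filter.
  rewrite -(sum_count _ (fun b => (-1) ^+ (count odd r + inv r + 'C(0 + count odd r, 2)) *
     ((-1) ^+ b * A (nth 0%N (filter odd r) b) x * detL A (delnth b (filter odd r)) (filter (predC odd) r)))).
  apply: eq_bigr => -[k kr] _ /=; case: ifPn => [oy|oy]; last first.
    by rewrite Mee // mulr0 mul0r.
  have c1 := cnt odd k kr; have c2 := cnt (predC odd) k kr; have d1 := cntd odd k; have d2 := cntd (predC odd) k.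
  have iv := invd k kr; have sk := szk k kr.
  rewrite oy /= in c1 c2 iv.
  rewrite Meo ?lt // IH; [|exact: sd|lia|lia].
  rewrite (fnth odd) // -(fdel odd) // (fdelN (predC odd)) /= ?oy //.
  have hm (p a s d : F) : p * - a * (s * d) = (-1) ^+ 1 * p * s * (a * d) by ring.
  rewrite hm -[in RHS](mulrA _ (A _ _)) [RHS]mulrA; congr (_ * _).
  rewrite -!exprD; apply: signE.
  have e1 : count odd r = (count odd (delnth k r)).+1 by lia.
  rewrite add0n e1 binS bin1; clear -iv e1 sk d1 d2 c2 c1 cl. lia.
Qed.

(** For the order 1, 2, ..., 2n the number of inversions is itself 'C(n, 2), so the two
    contributions to the sign cancel. *)
Lemma pfg_interleaved (M A : nat -> nat -> F) n fuel :
  (forall x y, odd x -> odd y -> M x y = 0) ->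
  (forall x y, ~~ odd x -> ~~ odd y -> M x y = 0) ->
  (forall x y, (x < y)%N -> odd x -> ~~ odd y -> M x y = A x y) ->
  (forall x y, (x < y)%N -> ~~ odd x -> odd y -> M x y = - A y x) ->
  (n <= fuel)%N ->
  pfg M fuel (iota 1 (2 * n)) = \det (\matrix_(i < n, j < n) A i.*2.+1 j.*2.+2).
Proof.
move=> H1 H2 H3 H4 nf.
have iS m : iota 1 (2 * m.+1) = iota 1 (2 * m) ++ [:: m.*2.+1; m.*2.+2].
  have -> : (2 * m.+1 = 2 * m + 2)%N by lia.
  by rewrite iotaD /=; congr (_ ++ [:: _; _]); lia.
have fo m : filter odd (iota 1 (2 * m)) = [seq i.*2.+1 | i <- iota 0 m].
  by elim: m => // m IH; rewrite iS filter_cat IH -[in RHS](addn1 m) iotaD map_cat /= odd_double.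
have fe m : filter (predC odd) (iota 1 (2 * m)) = [seq i.*2.+2 | i <- iota 0 m].
  by elim: m => // m IH; rewrite iS filter_cat IH -[in RHS](addn1 m) iotaD map_cat /= odd_double.
have co m : count odd (iota 1 (2 * m)) = m by rewrite -size_filter fo size_map size_iota.
have ce m : count (predC odd) (iota 1 (2 * m)) = m by rewrite -size_filter fe size_map size_iota.
have iv m : inv (iota 1 (2 * m)) = 'C(m, 2).
  elim: m => // m IH; rewrite iS inv_cat IH ce /= odd_double /= binS bin1; lia.
rewrite (@pfg_det M A fuel _ H1 H2 H3 H4) ?co ?ce ?iota_ltn_sorted // iv.
rewrite -signr_odd oddD addbb expr0 mul1r fo fe /detL size_map size_iota.
congr (\det _); apply/matrixP => i j; rewrite !mxE.
by rewrite !(nth_map 0%N) ?size_iota // !nth_iota.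
Qed.
End BipartitePfaffian.

(** * Transfer to the complex numbers of Coquelicot *)

Import Rdefinitions.

Local Notation C := Coquelicot.Complex.C.
(** Both types of complex numbers are pairs with the same componentwise operations, so most
    compatibility lemmas hold by conversion. *)
Definition toC (z : C) : R[i] := Complex (fst z) (snd z).

Definition csum (T : Type) (f : T -> C) (l : list T) : C := Defs.Csum_list (List.map f l).
Definition rprod (T : Type) (f : T -> R) (l : list T) : R :=
  List.fold_right Rmult R1 (List.map f l).

Lemma toCM x y : toC (Coquelicot.Complex.Cmult x y) = toC x * toC y. Proof. by []. Qed.
Lemma toC0 : toC (Coquelicot.Complex.RtoC R0) = 0. Proof. by []. Qed.
Lemma toC1 : toC (Coquelicot.Complex.RtoC R1) = 1. Proof. by []. Qed.
Lemma toC_conj x : toC (Coquelicot.Complex.Cconj x) = (toC x)^*. Proof. by []. Qed.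
Lemma toC_N x : toC (Coquelicot.Complex.Copp x) = - toC x. Proof. by []. Qed.

Lemma toC_sign k : toC (Coquelicot.Complex.RtoC (Rpow_def.pow (-1) k)) = (-1) ^+ k.
Proof.
elim: k => [|k IH]; first exact: toC1.
rewrite exprS -IH mulN1r; congr Complex; first exact: (mulN1r (Rpow_def.pow (-1) k)).
by rewrite /= oppr0.
Qed.

Lemma seq_iota m n : List.seq m n = iota m n.
Proof. by elim: n m => //= n IH m; rewrite IH. Qed.

Lemma nthE k l : List.nth k l O = nth 0%nat l k.
Proof. by elim: l k => [|x l IH] [|k] //=. Qed.

Lemma remove_nthE k l : Defs.remove_nth k l = delnth k l.
Proof. elim: l k => [|x l IH] [|k] //=; last by rewrite IH.
by rewrite /delnth /= drop0. Qed.

Lemma toC_csum n (f : nat -> C) : toC (csum f (List.seq 0 n)) = \sum_(k < n) toC (f k).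
Proof.
have E (l : seq nat) : toC (csum f l) = \sum_(k <- l) toC (f k).
  elim: l => [|x l IH]; first by rewrite big_nil.
  by rewrite big_cons -IH.
by rewrite E seq_iota -[X in iota 0 X]subn0 big_mkord.
Qed.

Lemma toC_prod n (f : nat -> R) :
  Complex (rprod f (List.seq 0 n)) 0 = \prod_(k < n) Complex (f k) 0 :> R[i].
Proof.
have E (l : seq nat) : Complex (rprod f l) 0 = \prod_(k <- l) Complex (f k) 0 :> R[i].
  elim: l => [|x l IH]; first by rewrite big_nil.
  by rewrite big_cons -IH; simpc.
by rewrite E seq_iota -[X in iota 0 X]subn0 big_mkord.
Qed.

Lemma toC_pf M fuel l : toC (Defs.pf_aux M fuel l) = pfg (fun i j => toC (M i j)) fuel l.
Proof.
elim: fuel l => [|f IH] [|i r]; try exact: toC1.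
rewrite [LHS](_ : _ = toC (csum (fun k => Coquelicot.Complex.Cmult (Coquelicot.Complex.Cmult
  (Coquelicot.Complex.RtoC (Rpow_def.pow (-1) k)) (M i (List.nth k r O)))
   (Defs.pf_aux M f (Defs.remove_nth k r))) (List.seq 0 (List.length r)))) //.
rewrite toC_csum; apply: eq_bigr => k _.
by rewrite !toCM toC_sign nthE remove_nthE IH.
Qed.

Definition qform (S : nat -> nat -> C) (v : nat -> C) (n : nat) : C :=
  csum (fun i => csum (fun j => Coquelicot.Complex.Cmult (Coquelicot.Complex.Cmult
    (Coquelicot.Complex.Cconj (v i)) (S i j)) (v j)) (List.seq 0 n)) (List.seq 0 n).

Lemma toC_qform S v n :
  toC (qform S v n) = \sum_(i < n) \sum_(j < n) (toC (v i))^* * toC (S i j) * toC (v j).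
Proof. by rewrite toC_csum; apply: eq_bigr => i _; rewrite toC_csum. Qed.

(** Odd indices label the rows and even indices the columns of [S]. The Pfaffian is then the
    determinant of a positive semidefinite matrix, hence real and nonnegative, so its modulus is the
    determinant itself and [psd_det_trial] applies. *)
Lemma pfaffian_le (M S W : nat -> nat -> C) (n : nat) :
  (forall i j, M i.*2.+1 j.*2.+1 = Coquelicot.Complex.RtoC R0) ->
  (forall i j, M i.*2.+2 j.*2.+2 = Coquelicot.Complex.RtoC R0) ->
  (forall i j, M i.*2.+1 j.*2.+2 = S i j) ->
  (forall i j, Peano.lt i j -> M i.*2.+2 j.*2.+1 = Coquelicot.Complex.Copp (S j i)) ->
  (forall i j, S j i = Coquelicot.Complex.Cconj (S i j)) ->
  (forall v, Rle R0 (fst (qform S v n))) ->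
  (forall i j, Peano.lt i j -> W i j = Coquelicot.Complex.RtoC R0) ->
  (forall i, W i i = Coquelicot.Complex.RtoC R1) ->
  Rle (Coquelicot.Complex.Cmod (Defs.pfaffian M (List.seq 1 (Nat.mul 2 n))))
      (rprod (fun i => fst (qform S (W i) n)) (List.seq 0 n)).
Proof.
move=> Moo Mee Moe Meo Sh Sp Wt W1.
pose A (x y : nat) := if (0 < y)%nat then toC (S x./2 y./2.-1) else 0.
have dE x : odd x -> x = x./2.*2.+1 by lia.
have eE x : ~~ odd x -> (0 < x)%nat -> x = x./2.-1.*2.+2 by lia.
have qim v : Complex (fst (qform S v n)) 0 = toC (qform S v n).
  have : toC (qform S v n) \is Num.real.
    apply/CrealP; rewrite toC_qform rmorph_sum exchange_big /=; apply: eq_bigr => i _.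
    rewrite rmorph_sum; apply: eq_bigr => j _.
    by rewrite !rmorphM /= conjCK -toC_conj -Sh mulrC mulrA mulrAC.
  by rewrite complex_real /toC => /eqP /= ->.
(* Index 0 is even but not of the form 2 i + 2, so the hypotheses do not constrain it; [M'] vanishes
   there, and the index list starts at 1. *)
pose M' (x y : nat) := if (0 < x)%nat && (0 < y)%nat then toC (M x y) else 0.
have pfE : toC (Defs.pfaffian M (List.seq 1 (Nat.mul 2 n))) =
   \det (\matrix_(i < n, j < n) toC (S i j)).
  rewrite /Defs.pfaffian toC_pf seq_iota.
  have lE (l : seq nat) : List.length l = size l by [].
  rewrite lE size_iota.
  have pfM' f l : all (leq 1) l -> pfg (fun i j => toC (M i j)) f l = pfg M' f l.
    elim: f l => [|f IH] [|i r] //= /andP [i0 r0]; apply: eq_bigr => k _.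
    rewrite IH; last first.
      by rewrite /delnth all_cat; move: r0; rewrite -{1}(cat_take_drop k r) all_cat => /andP [-> h];
        move: h; rewrite -{1}(cat_take_drop 1 (drop k r)) drop_drop add1n all_cat => /andP [].
    by rewrite /M' i0 /=; move/all_nthP: r0 => /(_ 0%nat k (ltn_ord k)) ->.
  rewrite pfM'; last by apply/allP => x; rewrite mem_iota => /andP [].
  rewrite (@pfg_interleaved _ M' A).
  - by congr (\det _); apply/matrixP => i j; rewrite !mxE /A /=; congr (toC (S _ _)); lia.
  - by move=> x y /dE -> /dE ->; rewrite /M' Moo /= toC0.
  - move=> x y ex ey; rewrite /M'; case: ifP => // /andP [x0 y0].
    by rewrite (eE _ ex x0) (eE _ ey y0) Mee.
  - move=> x y xy ox ey; rewrite /M' (leq_ltn_trans _ xy) // andbT.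
    have -> : (0 < x)%nat by lia.
    rewrite /A (leq_ltn_trans _ xy) //; congr toC.
    have y0 : (0 < y)%nat by lia.
    by rewrite {1}(dE _ ox) {1}(eE _ ey y0) Moe.
  - move=> x y xy ex oy; rewrite /M' (leq_ltn_trans _ xy) // andbT.
    case: ifP => [x0|].
      by rewrite {1}(dE _ oy) {1}(eE _ ex x0) Meo ?toC_N /A ?x0 //; lia.
    by rewrite /A => ->; rewrite oppr0.
  - lia.
pose H : 'M[R[i]]_n := \matrix_(i < n, j < n) toC (S i j).
pose V : 'M[R[i]]_n := \matrix_(i < n, j < n) toC (W i j).
have hE (v : nat -> C) : hform H (fun i => toC (v i)) = Complex (fst (qform S v n)) 0.
  rewrite qim toC_qform /hform; apply: eq_bigr => i _; apply: eq_bigr => j _.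
  by rewrite mxE.
have Hp : psd H.
  split=> [i j|v]; first by rewrite !mxE Sh.
  pose v' (k : nat) : C := if insub k is Some i then (complex.Re (v i), complex.Im (v i)) else (R0, R0).
  have -> : hform H v = hform H (fun i => toC (v' i)).
    have vE i : v i = toC (v' i) by rewrite /v' valK /toC /=; case: (v i).
    by apply: eq_bigr => i _; apply: eq_bigr => j _; rewrite !vE.
  by rewrite hE lecE /= eqxx /=; apply/RlebP.
have Vt : forall i j : 'I_n, (i < j)%nat -> V i j = 0.
  by move=> i j ij; rewrite mxE Wt //; lia.
have V1 i : V i i = 1 by rewrite mxE W1.
have := psd_det_trial Hp Vt V1.
have -> : \prod_i hform H (V i) = Complex (rprod (fun i => fst (qform S (W i) n)) (List.seq 0 n)) 0.
  rewrite toC_prod; apply: eq_bigr => i _; rewrite -hE.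
  by apply: eq_bigr => j _; apply: eq_bigr => k _; rewrite ![V _ _]mxE.
rewrite -pfE lecE /= lecE /= => /andP [/andP [/eqP im0 re0] /andP [_ re1]].
set z := Defs.pfaffian _ _ in im0 re0 re1 *.
have zE : z = Coquelicot.Complex.RtoC (fst z).
  by rewrite [LHS]surjective_pairing; congr pair.
rewrite zE Coquelicot.Complex.Cmod_R /=.
move/RlebP: re0 => re0; move/RlebP: re1 => re1.
by rewrite Rbasic_fun.Rabs_pos_eq.
Qed.

End PfaffianBound.
Import PfaffianBound.

(** * Finite sums *)

Definition rsum {A : Type} (f : A -> R) (l : list A) : R := fold_right Rplus 0 (map f l).

Section Rsum.
Context {A : Type}.
Implicit Types (f g : A -> R) (l : list A).

Lemma rsum_cons f a l : rsum f (a :: l) = f a + rsum f l.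
Proof. reflexivity. Qed.
Lemma rsum_app f l1 l2 : rsum f (l1 ++ l2) = rsum f l1 + rsum f l2.
Proof. induction l1; simpl; [unfold rsum; simpl; ring | rewrite !rsum_cons, IHl1; ring]. Qed.
Lemma rsum_ext f g l : (forall a, In a l -> f a = g a) -> rsum f l = rsum g l.
Proof.
  induction l as [|a l IH]; intros H; [reflexivity|]. rewrite !rsum_cons, IH, H; auto using in_eq, in_cons.
Qed.
Lemma rsum_plus f g l : rsum (fun a => f a + g a) l = rsum f l + rsum g l.
Proof. induction l as [|a l IH]; [unfold rsum; simpl; ring | rewrite !rsum_cons, IH; ring]. Qed.
Lemma rsum_scal c f l : rsum (fun a => c * f a) l = c * rsum f l.
Proof. induction l as [|a l IH]; [unfold rsum; simpl; ring | rewrite !rsum_cons, IH; ring]. Qed.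
Lemma rsum_scal_r c f l : rsum (fun a => f a * c) l = rsum f l * c.
Proof. induction l as [|a l IH]; [unfold rsum; simpl; ring | rewrite !rsum_cons, IH; ring]. Qed.
Lemma rsum_minus f g l : rsum (fun a => f a - g a) l = rsum f l - rsum g l.
Proof. induction l as [|a l IH]; [unfold rsum; simpl; ring | rewrite !rsum_cons, IH; ring]. Qed.
Lemma rsum_zero f l : (forall a, In a l -> f a = 0) -> rsum f l = 0.
Proof.
  induction l as [|a l IH]; intros H; [reflexivity|]. rewrite rsum_cons, IH, H; auto using in_eq, in_cons; ring.
Qed.
Lemma rsum_le f g l : (forall a, In a l -> f a <= g a) -> rsum f l <= rsum g l.
Proof.
  induction l as [|a l IH]; intros H; [unfold rsum; simpl; lra|]. rewrite !rsum_cons.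
  apply Rplus_le_compat; auto using in_eq, in_cons.
Qed.
Lemma rsum_pos f l : (forall a, In a l -> 0 <= f a) -> 0 <= rsum f l.
Proof.
  intros H. replace 0 with (rsum (fun _ : A => 0) l) by (apply rsum_zero; auto). now apply rsum_le.
Qed.
Lemma rsum_abs f l : Rabs (rsum f l) <= rsum (fun a => Rabs (f a)) l.
Proof.
  induction l as [|a l IH]; [unfold rsum; simpl; rewrite Rabs_R0; lra|]. rewrite !rsum_cons.
  eapply Rle_trans; [apply Rabs_triang|]. lra.
Qed.
Lemma rsum_const c l : rsum (fun _ => c) l = INR (length l) * c.
Proof. induction l as [|a l IH]; [unfold rsum; simpl; ring | rewrite rsum_cons, IH; simpl length; rewrite S_INR; ring]. Qed.
Lemma rsum_in_le f l a : (forall a, In a l -> 0 <= f a) -> In a l -> f a <= rsum f l.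
Proof.
  induction l as [|b l IH]; intros H Ha; [easy|]. rewrite rsum_cons.
  assert (0 <= rsum f l) by (apply rsum_pos; auto using in_cons).
  destruct Ha as [<-|Ha]; [lra|]. specialize (IH (fun a h => H a (in_cons _ _ _ h)) Ha).
  specialize (H b (in_eq _ _)). lra.
Qed.
End Rsum.

Lemma rsum_map {A B} (f : B -> R) (g : A -> B) l : rsum f (map g l) = rsum (fun a => f (g a)) l.
Proof. unfold rsum; now rewrite map_map. Qed.

Lemma rsum_mult {A B} (f : A -> R) (g : B -> R) l l' :
  rsum f l * rsum g l' = rsum (fun a => rsum (fun b => f a * g b) l') l.
Proof. rewrite <- rsum_scal_r. apply rsum_ext; intros. now rewrite rsum_scal. Qed.

Section Csum.
Context {A : Type}.
Implicit Types (f g : A -> C) (l : list A).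
Lemma csum_cons f a l : csum f (a :: l) = (f a + csum f l)%C.
Proof. reflexivity. Qed.
Lemma csum_nil f : csum f nil = RtoC 0.
Proof. reflexivity. Qed.
Lemma csum_app f l1 l2 : csum f (l1 ++ l2) = (csum f l1 + csum f l2)%C.
Proof. induction l1 as [|a l IH]; [cbn; now rewrite Cplus_0_l | cbn [app]; rewrite !csum_cons, IH; ring]. Qed.
Lemma csum_ext f g l : (forall a, In a l -> f a = g a) -> csum f l = csum g l.
Proof.
  induction l as [|a l IH]; intros H; [reflexivity|]. rewrite !csum_cons, IH, H; auto using in_eq, in_cons.
Qed.
Lemma csum_plus f g l : csum (fun a => (f a + g a)%C) l = (csum f l + csum g l)%C.
Proof. induction l as [|a l IH]; [rewrite !csum_nil; ring | rewrite !csum_cons, IH; ring]. Qed.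
Lemma csum_minus f g l : csum (fun a => (f a - g a)%C) l = (csum f l - csum g l)%C.
Proof. induction l as [|a l IH]; [rewrite !csum_nil; ring | rewrite !csum_cons, IH; ring]. Qed.
Lemma csum_scal c f l : csum (fun a => (c * f a)%C) l = (c * csum f l)%C.
Proof. induction l as [|a l IH]; [rewrite !csum_nil; ring | rewrite !csum_cons, IH; ring]. Qed.
Lemma csum_scal_r c f l : csum (fun a => (f a * c)%C) l = (csum f l * c)%C.
Proof. induction l as [|a l IH]; [rewrite !csum_nil; ring | rewrite !csum_cons, IH; ring]. Qed.
Lemma csum_zero f l : (forall a, In a l -> f a = RtoC 0) -> csum f l = RtoC 0.
Proof.
  induction l as [|a l IH]; intros H; [reflexivity|]. rewrite csum_cons, IH, H; auto using in_eq, in_cons; ring.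
Qed.
Lemma csum_conj f l : Cconj (csum f l) = csum (fun a => Cconj (f a)) l.
Proof.
  induction l as [|a l IH]; [rewrite !csum_nil; unfold Cconj, RtoC; simpl; f_equal; ring|].
  now rewrite !csum_cons, Cplus_conj, IH.
Qed.
Lemma csum_fst f l : fst (csum f l) = rsum (fun a => fst (f a)) l.
Proof. induction l as [|a l IH]; [reflexivity|]. rewrite csum_cons, rsum_cons, <- IH. reflexivity. Qed.
Lemma csum_snd f l : snd (csum f l) = rsum (fun a => snd (f a)) l.
Proof. induction l as [|a l IH]; [reflexivity|]. rewrite csum_cons, rsum_cons, <- IH. reflexivity. Qed.
Lemma csum_Cmod f l : Cmod (csum f l) <= rsum (fun a => Cmod (f a)) l.
Proof.
  induction l as [|a l IH]; [rewrite csum_nil, Cmod_0; unfold rsum; simpl; lra|].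
  rewrite csum_cons, rsum_cons. eapply Rle_trans; [apply Cmod_triangle|]. lra.
Qed.
End Csum.

Lemma csum_map {A B} (f : B -> C) (g : A -> B) l : csum f (map g l) = csum (fun a => f (g a)) l.
Proof. unfold csum; now rewrite map_map. Qed.

Lemma csum_exchange {A B} (f : A -> B -> C) l l' :
  csum (fun a => csum (f a) l') l = csum (fun b => csum (fun a => f a b) l) l'.
Proof.
  induction l as [|a l IH].
  - symmetry; apply csum_zero; reflexivity.
  - rewrite csum_cons, IH, <- csum_plus. reflexivity.
Qed.

Lemma csum_mult {A B} (f : A -> C) (g : B -> C) l l' :
  (csum f l * csum g l')%C = csum (fun a => csum (fun b => (f a * g b)%C) l') l.
Proof. rewrite <- csum_scal_r. apply csum_ext; intros. now rewrite csum_scal. Qed.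

(** * Squared modulus and unit complex numbers *)

Definition Cn2 (z : C) : R := fst z ^ 2 + snd z ^ 2.
Definition cis (x : R) : C := (cos x, sin x).

Lemma Cn2_Cmod z : Cn2 z = Cmod z ^ 2.
Proof. unfold Cmod, Cn2. rewrite pow2_sqrt; [reflexivity|]. apply Rplus_le_le_0_compat; apply pow2_ge_0. Qed.
Lemma Cn2_pos z : 0 <= Cn2 z.
Proof. apply Rplus_le_le_0_compat; apply pow2_ge_0. Qed.
Lemma Cn2_mult a b : Cn2 (a * b)%C = Cn2 a * Cn2 b.
Proof. unfold Cn2; simpl; ring. Qed.
Lemma Cn2_RtoC a : Cn2 (RtoC a) = a ^ 2.
Proof. unfold Cn2; simpl; ring. Qed.
Lemma Cn2_cis x : Cn2 (cis x) = 1.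
Proof. unfold Cn2, cis; simpl. generalize (sin2_cos2 x); unfold Rsqr; lra. Qed.
Lemma Cmod_cis x : Cmod (cis x) = 1.
Proof. unfold Cmod. fold (Cn2 (cis x)). rewrite Cn2_cis. apply sqrt_1. Qed.
Lemma cis_plus x y : cis (x + y) = (cis x * cis y)%C.
Proof. unfold cis, Cmult; simpl. rewrite cos_plus, sin_plus. f_equal; ring. Qed.
Lemma cis_conj x : Cconj (cis x) = cis (- x).
Proof. unfold cis, Cconj; simpl. now rewrite cos_neg, sin_neg. Qed.
Lemma cis_0 : cis 0 = RtoC 1.
Proof. unfold cis, RtoC. now rewrite cos_0, sin_0. Qed.
(** Young's inequality. A small [d] costs almost nothing on the leading term [a] and charges a large
    weight to the small term [b]. *)
Lemma Cn2_weight d (a b : C) : 0 < d -> Cn2 (a + b)%C <= (1 + d) * Cn2 a + (1 + / d) * Cn2 b.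
Proof.
  intros Hd. unfold Cn2; simpl.
  assert (H : forall x y, (x + y) ^ 2 <= (1 + d) * x ^ 2 + (1 + / d) * y ^ 2).
  { intros x y. assert (H0 : 0 <= / d * (d * x - y) ^ 2)
      by (apply Rmult_le_pos; [left; now apply Rinv_0_lt_compat | apply pow2_ge_0]).
    replace (/ d * (d * x - y) ^ 2) with (d * x ^ 2 - 2 * x * y + / d * y ^ 2) in H0 by (field; lra). nra. }
  generalize (H (fst a) (fst b)) (H (snd a) (snd b)); simpl; lra.
Qed.
Lemma Re_le_Cmod z : Rabs (fst z) <= Cmod z.
Proof. apply Rabs_le_between. pose proof (Cmod_ge_0 z). generalize (Cn2_Cmod z); unfold Cn2; intros.
  split; [|]; nra. Qed.
Lemma Im_le_Cmod z : Rabs (snd z) <= Cmod z.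
Proof. apply Rabs_le_between. pose proof (Cmod_ge_0 z). generalize (Cn2_Cmod z); unfold Cn2; intros.
  split; [|]; nra. Qed.
Lemma Cmod_le_parts z : Cmod z <= Rabs (fst z) + Rabs (snd z).
Proof.
  pose proof (Rabs_pos (fst z)); pose proof (Rabs_pos (snd z)).
  apply Rsqr_incr_0_var; [|lra]. unfold Rsqr. generalize (Cn2_Cmod z); unfold Cn2.
  rewrite <- (pow2_abs (fst z)), <- (pow2_abs (snd z)). nra.
Qed.

(** * Integrals of real and complex functions *)

(** Both derivatives are witnesses on the whole line, which keeps side conditions global; two of
    them are what Fourier coefficients of order 1 / m^2 require. *)
Definition C2 (f : R -> R) : Prop := exists f1 f2 : R -> R,
  (forall x, is_derive f x (f1 x)) /\ (forall x, is_derive f1 x (f2 x)) /\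
  (forall x, continuous f2 x).

Lemma dplus f g x a b : is_derive f x a -> is_derive g x b ->
  is_derive (fun x => f x + g x) x (a + b).
Proof. intros; now apply (is_derive_plus (V := R_NormedModule)). Qed.
Lemma dmult f g x a b : is_derive f x a -> is_derive g x b ->
  is_derive (fun x => f x * g x) x (a * g x + f x * b).
Proof. intros; apply (is_derive_mult f g x a b); auto. intros; apply Rmult_comm. Qed.
Lemma dcomp f g x a b : is_derive g x a -> is_derive f (g x) b ->
  is_derive (fun x => f (g x)) x (a * b).
Proof. intros; now apply (is_derive_comp f g x b a). Qed.
Lemma dcont (f : R -> R) x a : is_derive f x a -> continuous f x.
Proof. intros H. apply (ex_derive_continuous (V := R_NormedModule)). now exists a. Qed.
Lemma cplus (f g : R -> R) x : continuous f x -> continuous g x -> continuous (fun x => f x + g x) x.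
Proof. intros; now apply (continuous_plus (V := R_NormedModule)). Qed.
Lemma cmult (f g : R -> R) x : continuous f x -> continuous g x -> continuous (fun x => f x * g x) x.
Proof. intros; now apply (continuous_mult (K := R_AbsRing)). Qed.
Lemma copp (f : R -> R) x : continuous f x -> continuous (fun x => - f x) x.
Proof. intros; now apply (continuous_opp (V := R_NormedModule)). Qed.
Lemma cminus (f g : R -> R) x : continuous f x -> continuous g x -> continuous (fun x => f x - g x) x.
Proof. intros; now apply (continuous_minus (V := R_NormedModule)). Qed.
Lemma cconst (c x : R) : continuous (fun _ : R => c) x.
Proof. apply continuous_const. Qed.
Lemma ccomp (f g : R -> R) x : continuous g x -> continuous f (g x) -> continuous (fun x => f (g x)) x.
Proof. intros; now apply continuous_comp. Qed.
Lemma ccos x : continuous cos x.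
Proof. eapply dcont. apply is_derive_cos. Qed.
Lemma csin x : continuous sin x.
Proof. eapply dcont. apply is_derive_sin. Qed.
Lemma cont_exp x : continuous exp x.
Proof. eapply dcont. apply is_derive_exp. Qed.
Lemma cinv (f : R -> R) x : continuous f x -> f x <> 0 -> continuous (fun x => / f x) x.
Proof. intros; now apply (continuous_comp f Rinv), continuous_Rinv. Qed.
Lemma csqrt (f : R -> R) x : continuous f x -> continuous (fun x => sqrt (f x)) x.
Proof. intros; apply (continuous_comp f sqrt); auto. apply continuous_sqrt. Qed.
Lemma cabs (f : R -> R) x : continuous f x -> continuous (fun x => Rabs (f x)) x.
Proof. intros; apply (continuous_comp f Rabs); auto. apply continuous_Rabs. Qed.

Lemma C2_cont f : C2 f -> forall x, continuous f x.
Proof. intros (f1 & f2 & H & _) x. eapply dcont, H. Qed.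
Lemma C2_ext f g : (forall x, f x = g x) -> C2 f -> C2 g.
Proof.
  intros E (f1 & f2 & H & K). exists f1, f2; split; auto.
  intros x. now apply (is_derive_ext f).
Qed.
Lemma C2_const c : C2 (fun _ => c).
Proof.
  exists (fun _ => 0), (fun _ => 0); (split; [|split]); intros; try apply cconst;
    apply (is_derive_const (V := R_NormedModule)).
Qed.
Lemma C2_plus f g : C2 f -> C2 g -> C2 (fun x => f x + g x).
Proof.
  intros (f1 & f2 & H1 & H2 & H3) (g1 & g2 & K1 & K2 & K3).
  exists (fun x => f1 x + g1 x), (fun x => f2 x + g2 x); (split; [|split]); intros.
  - now apply dplus. - now apply dplus. - now apply cplus.
Qed.
Lemma C2_mult f g : C2 f -> C2 g -> C2 (fun x => f x * g x).
Proof.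
  intros (f1 & f2 & H1 & H2 & H3) (g1 & g2 & K1 & K2 & K3).
  exists (fun x => f1 x * g x + f x * g1 x),
    (fun x => (f2 x * g x + f1 x * g1 x) + (f1 x * g1 x + f x * g2 x)); (split; [|split]); intros.
  - now apply dmult. - apply dplus; now apply dmult.
  - assert (Hf : continuous f x) by exact (dcont _ _ _ (H1 x)).
    assert (Hf1 : continuous f1 x) by exact (dcont _ _ _ (H2 x)).
    assert (Hg : continuous g x) by exact (dcont _ _ _ (K1 x)).
    assert (Hg1 : continuous g1 x) by exact (dcont _ _ _ (K2 x)).
    repeat apply cplus; apply cmult; auto.
Qed.
Lemma C2_opp f : C2 f -> C2 (fun x => - f x).
Proof. intros. apply (C2_ext (fun x => -1 * f x)); [intros; ring|]. apply C2_mult; auto using C2_const. Qed.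
Lemma C2_minus f g : C2 f -> C2 g -> C2 (fun x => f x - g x).
Proof. intros. apply C2_plus; auto using C2_opp. Qed.
Lemma C2_comp (f g : R -> R) (f1 f2 : R -> R) : C2 g -> (forall x, is_derive f (g x) (f1 (g x))) ->
  (forall x, is_derive f1 (g x) (f2 (g x))) -> (forall x, continuous f2 (g x)) -> C2 (fun x => f (g x)).
Proof.
  intros (g1 & g2 & K1 & K2 & K3) H1 H2 H3.
  exists (fun x => g1 x * f1 (g x)), (fun x => g2 x * f1 (g x) + g1 x * (g1 x * f2 (g x))); (split; [|split]); intros.
  - now apply (dcomp f g). - apply (dmult g1 (fun x => f1 (g x))); auto. now apply (dcomp f1 g).
  - assert (Hg : continuous g x) by exact (dcont _ _ _ (K1 x)).
    assert (Hg1 : continuous g1 x) by exact (dcont _ _ _ (K2 x)).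
    assert (Hf1 : continuous (fun x => f1 (g x)) x) by exact (ccomp f1 g x Hg (dcont _ _ _ (H2 x))).
    assert (Hf2 : continuous (fun x => f2 (g x)) x) by exact (ccomp f2 g x Hg (H3 x)).
    apply cplus; repeat apply cmult; auto.
Qed.
Lemma C2_cos g : C2 g -> C2 (fun x => cos (g x)).
Proof.
  intros. apply (C2_comp cos g (fun x => - sin x) (fun x => - cos x)); auto; intros.
  - apply is_derive_cos. - apply (is_derive_opp (V:=R_NormedModule)), is_derive_sin. - apply copp, ccos.
Qed.
Lemma C2_sin g : C2 g -> C2 (fun x => sin (g x)).
Proof.
  intros. apply (C2_comp sin g cos (fun x => - sin x)); auto; intros.
  - apply is_derive_sin. - apply is_derive_cos. - apply copp, csin.
Qed.
Lemma C2_exp g : C2 g -> C2 (fun x => exp (g x)).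
Proof.
  intros. apply (C2_comp exp g exp exp); auto; intros; try apply is_derive_exp. apply cont_exp.
Qed.
Lemma C2_inv g : C2 g -> (forall x, g x <> 0) -> C2 (fun x => / g x).
Proof.
  intros Hg H0. apply (C2_comp Rinv g (fun y => - 1 / y ^ 2) (fun y => 2 / y ^ 3)); auto; intros; specialize (H0 x);
    assert (K2 := pow_nonzero _ 2 H0); assert (K3 := pow_nonzero _ 3 H0).
  - auto_derive; auto. field; auto.
  - auto_derive; auto. field; auto.
  - apply (dcont _ _ (- 6 / (g x) ^ 4)). auto_derive; auto. field; auto.
Qed.
Lemma C2_ln g : C2 g -> (forall x, 0 < g x) -> C2 (fun x => ln (g x)).
Proof.
  intros Hg H0. apply (C2_comp ln g Rinv (fun y => - 1 / y ^ 2)); auto; intros; specialize (H0 x);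
    assert (K0 : g x <> 0) by lra; assert (K2 := pow_nonzero _ 2 K0).
  - auto_derive; auto. field; lra.
  - auto_derive; auto. field; lra.
  - apply (dcont _ _ (2 / (g x) ^ 3)). auto_derive; auto. field; lra.
Qed.
Lemma C2_id : C2 (fun x => x).
Proof.
  exists (fun _ => 1), (fun _ => 0); (split; [|split]); intros; try apply cconst.
  - apply (is_derive_id (K:=R_AbsRing)). - apply (is_derive_const (V := R_NormedModule)).
Qed.
Lemma C2_pow f n : C2 f -> C2 (fun x => f x ^ n).
Proof. intros; induction n; simpl; [apply C2_const | now apply C2_mult]. Qed.
Lemma C2E f : C2 f -> exists f1 f2 : R -> R,
  (forall x, is_derive f x (f1 x)) /\ (forall x, is_derive f1 x (f2 x)) /\
  (forall x, continuous f2 x).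
Proof. exact (fun h => h). Qed.
Global Opaque C2.
Ltac c2 := lazymatch goal with
  | |- C2 (fun _ => ?c) => apply (C2_const c)
  | |- C2 (fun x => x) => apply C2_id
  | |- C2 (fun x => @?f x + @?g x) => apply (C2_plus f g); c2
  | |- C2 (fun x => @?f x - @?g x) => apply (C2_minus f g); c2
  | |- C2 (fun x => @?f x * @?g x) => apply (C2_mult f g); c2
  | |- C2 (fun x => - @?f x) => apply (C2_opp f); c2
  | |- C2 (fun x => cos (@?f x)) => apply (C2_cos f); c2
  | |- C2 (fun x => sin (@?f x)) => apply (C2_sin f); c2
  | |- C2 (fun x => exp (@?f x)) => apply (C2_exp f); c2
  | |- C2 (fun x => @?f x ^ ?n) => apply (C2_pow f n); c2
  | |- C2 (Rmult ?a) => apply (C2_mult (fun _ => a) (fun x => x)); c2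
  | |- C2 cos => apply (C2_cos (fun x => x)); c2
  | |- C2 sin => apply (C2_sin (fun x => x)); c2
  | _ => try assumption
  end.

Lemma cont_bound (f : R -> R) a b : (forall x, continuous f x) ->
  exists B, 0 < B /\ forall x, a <= x <= b -> Rabs (f x) <= B.
Proof.
  intros Hf. destruct (Rle_dec a b) as [ab|ab].
  - destruct (continuity_ab_maj (fun x => Rabs (f x)) a b ab) as (m & Hm & _).
    { intros c _. apply continuity_pt_filterlim. apply (cabs f c (Hf c)). }
    exists (Rabs (f m) + 1). split; [pose proof (Rabs_pos (f m)); lra|]. intros x Hx. specialize (Hm x Hx). lra.
  - exists 1; split; [lra|]. intros; lra.
Qed.

Lemma cexR (f : R -> R) a b : (forall x, continuous f x) -> ex_RInt f a b.
Proof. intros; apply (ex_RInt_continuous (V := R_CompleteNormedModule)); auto. Qed.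

Lemma RIplus (f g : R -> R) a b : (forall x, continuous f x) -> (forall x, continuous g x) ->
  RInt (fun x => f x + g x) a b = RInt f a b + RInt g a b.
Proof. intros; apply (RInt_plus (V := R_CompleteNormedModule)); now apply cexR. Qed.
Lemma RIminus (f g : R -> R) a b : (forall x, continuous f x) -> (forall x, continuous g x) ->
  RInt (fun x => f x - g x) a b = RInt f a b - RInt g a b.
Proof. intros; apply (RInt_minus (V := R_CompleteNormedModule)); now apply cexR. Qed.
Lemma RIscal (f : R -> R) c a b : (forall x, continuous f x) ->
  RInt (fun x => c * f x) a b = c * RInt f a b.
Proof. intros; apply (RInt_scal (V := R_CompleteNormedModule)); now apply cexR. Qed.
Lemma RIext (f g : R -> R) a b : a <= b -> (forall x, a < x < b -> f x = g x) -> RInt f a b = RInt g a b.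
Proof. intros ab H; apply RInt_ext. rewrite Rmin_left, Rmax_right; auto. Qed.
Lemma RIconst (c a b : R) : RInt (fun _ => c) a b = (b - a) * c.
Proof. rewrite RInt_const. reflexivity. Qed.
Lemma RIle (f g : R -> R) a b : a <= b -> (forall x, continuous f x) -> (forall x, continuous g x) ->
  (forall x, a <= x <= b -> f x <= g x) -> RInt f a b <= RInt g a b.
Proof. intros ab Hf Hg H; apply RInt_le; auto using cexR. intros; apply H; lra. Qed.
Lemma RIpos (f : R -> R) a b : a <= b -> (forall x, continuous f x) ->
  (forall x, a <= x <= b -> 0 <= f x) -> 0 <= RInt f a b.
Proof. intros ab Hf H; apply RInt_ge_0; auto using cexR. intros; apply H; lra. Qed.
Lemma RIabs (f : R -> R) a b : a <= b -> (forall x, continuous f x) ->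
  Rabs (RInt f a b) <= RInt (fun x => Rabs (f x)) a b.
Proof. intros; apply abs_RInt_le; auto using cexR. Qed.
Lemma RIabs_bound (f : R -> R) a b M : a <= b -> (forall x, continuous f x) ->
  (forall x, a <= x <= b -> Rabs (f x) <= M) -> Rabs (RInt f a b) <= (b - a) * M.
Proof. intros; apply abs_RInt_le_const; auto using cexR. Qed.
Lemma rsum_cont {A} (f : A -> R -> R) l x : (forall a, In a l -> continuous (f a) x) ->
  continuous (fun x => rsum (fun a => f a x) l) x.
Proof.
  induction l as [|a l IH]; intros H; [exact (cconst 0 x)|].
  exact (cplus (f a) _ x (H a (in_eq _ _)) (IH (fun b h => H b (in_cons _ _ _ h)))).
Qed.
Lemma RIrsum {A} (f : A -> R -> R) l a b : (forall i x, continuous (f i) x) ->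
  RInt (fun x => rsum (fun i => f i x) l) a b = rsum (fun i => RInt (f i) a b) l.
Proof.
  intros H; induction l as [|i l IH].
  - unfold rsum; simpl. rewrite RIconst; ring.
  - rewrite rsum_cons, <- IH, <- RIplus; auto. intros; apply rsum_cont; auto.
Qed.
Lemma RI_FTC (f df : R -> R) a b : (forall x, is_derive f x (df x)) -> (forall x, continuous df x) ->
  RInt df a b = f b - f a.
Proof. intros H K. apply is_RInt_unique. now apply (is_RInt_derive (V := R_CompleteNormedModule) f df). Qed.

(** * Complex-valued functions of a real variable *)

Definition Cc (f : R -> C) : Prop :=
  (forall x, continuous (fun x => fst (f x)) x) /\ (forall x, continuous (fun x => snd (f x)) x).
Definition CC2 (f : R -> C) : Prop := C2 (fun x => fst (f x)) /\ C2 (fun x => snd (f x)).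
Definition cint (f : R -> C) (a b : R) : C :=
  (RInt (fun x => fst (f x)) a b, RInt (fun x => snd (f x)) a b).

Lemma CC2_Cc f : CC2 f -> Cc f.
Proof. intros [H K]; split; now apply C2_cont. Qed.
Lemma CC2_mult f g : CC2 f -> CC2 g -> CC2 (fun x => (f x * g x)%C).
Proof. intros [] []; split; simpl; c2. Qed.
Lemma CC2_plus f g : CC2 f -> CC2 g -> CC2 (fun x => (f x + g x)%C).
Proof. intros [] []; split; simpl; c2. Qed.
Lemma CC2_minus f g : CC2 f -> CC2 g -> CC2 (fun x => (f x - g x)%C).
Proof. intros [] []; split; simpl; c2. Qed.
Lemma CC2_conj f : CC2 f -> CC2 (fun x => Cconj (f x)).
Proof. intros []; split; simpl; c2. Qed.
Lemma CC2_const c : CC2 (fun x => c).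
Proof. split; c2. Qed.
Lemma CC2_RtoC f : C2 f -> CC2 (fun x => RtoC (f x)).
Proof. split; simpl; c2. Qed.
Lemma CC2_cis f : C2 f -> CC2 (fun x => cis (f x)).
Proof. split; simpl; c2. Qed.
Lemma CC2_csum {A} (f : A -> R -> C) l : (forall a, In a l -> CC2 (f a)) -> CC2 (fun x => csum (fun a => f a x) l).
Proof.
  induction l as [|a l IH]; intros H; [exact (CC2_const (RtoC 0))|].
  exact (CC2_plus (f a) _ (H a (in_eq _ _)) (IH (fun b h => H b (in_cons _ _ _ h)))).
Qed.
Ltac cc2 := lazymatch goal with
  | |- CC2 (fun _ => ?c) => apply (CC2_const c)
  | |- CC2 (fun x => Cplus (@?f x) (@?g x)) => apply (CC2_plus f g); cc2
  | |- CC2 (fun x => Cminus (@?f x) (@?g x)) => apply (CC2_minus f g); cc2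
  | |- CC2 (fun x => Cmult (@?f x) (@?g x)) => apply (CC2_mult f g); cc2
  | |- CC2 (fun x => Cconj (@?f x)) => apply (CC2_conj f); cc2
  | |- CC2 (fun x => RtoC (@?f x)) => apply (CC2_RtoC f); c2
  | |- CC2 (fun x => cis (@?f x)) => apply (CC2_cis f); c2
  | _ => try assumption
  end.

Lemma Cc_mult f g : Cc f -> Cc g -> Cc (fun x => (f x * g x)%C).
Proof.
  intros [] []; split; simpl; intros.
  - apply (cminus (fun x => fst (f x) * fst (g x)) (fun x => snd (f x) * snd (g x))); now apply cmult.
  - apply (cplus (fun x => fst (f x) * snd (g x)) (fun x => snd (f x) * fst (g x))); now apply cmult.
Qed.
Lemma Cc_plus f g : Cc f -> Cc g -> Cc (fun x => (f x + g x)%C).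
Proof.
  intros [H1 H2] [H3 H4]; split; simpl; intros x.
  - exact (cplus _ _ _ (H1 x) (H3 x)). - exact (cplus _ _ _ (H2 x) (H4 x)).
Qed.
Lemma Cc_const c : Cc (fun x => c).
Proof. split; intros; apply cconst. Qed.
Lemma Cc_conj f : Cc f -> Cc (fun x => Cconj (f x)).
Proof. intros []; split; simpl; intros; auto. now apply (copp (fun x => snd (f x))). Qed.
Lemma Cc_csum {A} (f : A -> R -> C) l : (forall a, In a l -> Cc (f a)) -> Cc (fun x => csum (fun a => f a x) l).
Proof.
  induction l as [|a l IH]; intros H; [exact (Cc_const (RtoC 0))|].
  exact (Cc_plus (f a) _ (H a (in_eq _ _)) (IH (fun b h => H b (in_cons _ _ _ h)))).
Qed.
Lemma Cc_Cn2 f : Cc f -> forall x, continuous (fun x => Cn2 (f x)) x.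
Proof.
  intros [] x. unfold Cn2; simpl.
  apply (cplus (fun x => fst (f x) * (fst (f x) * 1)) (fun x => snd (f x) * (snd (f x) * 1)));
    repeat (apply cmult || apply cconst); auto.
Qed.
Lemma Cc_Cmod f : Cc f -> forall x, continuous (fun x => Cmod (f x)) x.
Proof. intros H x. apply (csqrt (fun x => Cn2 (f x))). now apply Cc_Cn2. Qed.

Lemma cint_ext f g a b : a <= b -> (forall x, a < x < b -> f x = g x) -> cint f a b = cint g a b.
Proof. intros ab H; unfold cint; f_equal; apply RIext; auto; intros; now rewrite H. Qed.
Lemma cint_plus f g a b : Cc f -> Cc g -> cint (fun x => (f x + g x)%C) a b = (cint f a b + cint g a b)%C.
Proof. intros [] []; unfold cint, Cplus; simpl. f_equal; now rewrite RIplus. Qed.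
Lemma cint_scal c f a b : Cc f -> cint (fun x => (c * f x)%C) a b = (c * cint f a b)%C.
Proof.
  intros []; unfold cint, Cmult; simpl. f_equal.
  - rewrite RIminus, !RIscal; auto; intros; apply cmult; auto using cconst.
  - rewrite RIplus, !RIscal; auto; intros; apply cmult; auto using cconst.
Qed.
Lemma cint_csum {A} (f : A -> R -> C) l a b : (forall i, Cc (f i)) ->
  cint (fun x => csum (fun i => f i x) l) a b = csum (fun i => cint (f i) a b) l.
Proof.
  intros H; induction l as [|i l IH].
  - rewrite csum_nil. unfold cint; simpl. rewrite !RIconst; unfold RtoC; f_equal; ring.
  - rewrite csum_cons, <- IH, <- cint_plus; auto. apply Cc_csum; auto.
Qed.
(** With [z] the integral, multiplication of [f] by [Cconj z] gives the integral |z|^2; its real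
    part is estimated under the integral sign and one factor |z| is cancelled. *)
Lemma cint_Cmod f a b : a <= b -> Cc f -> Cmod (cint f a b) <= RInt (fun x => Cmod (f x)) a b.
Proof.
  intros ab Hf. set (z := cint f a b).
  destruct (Req_dec (Cmod z) 0) as [E|E].
  { rewrite E. apply RIpos; auto. now apply Cc_Cmod. intros; apply Cmod_ge_0. }
  assert (H : Cmod z * Cmod z <= Cmod z * RInt (fun x => Cmod (f x)) a b).
  { replace (Cmod z * Cmod z) with (fst (Cconj z * z)%C).
    2:{ generalize (Cn2_Cmod z); unfold Cn2; simpl; intros; nra. }
    unfold z at 2. rewrite <- cint_scal; auto. rewrite <- RIscal by (now apply Cc_Cmod). simpl fst.
    apply RIle; auto.
    - intros x. destruct (Cc_mult (fun _ => Cconj z) f (Cc_const _) Hf) as [H _]. exact (H x).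
    - intros; apply cmult; [apply cconst | now apply Cc_Cmod].
    - intros x _. rewrite <- (Cmod_conj z), <- Cmod_mult.
      eapply Rle_trans; [|apply Re_le_Cmod]. simpl. apply Rle_abs. }
  pose proof (Cmod_ge_0 z). apply Rmult_le_reg_l with (Cmod z); lra.
Qed.
Lemma cint_bound f a b M : a <= b -> Cc f -> (forall x, a <= x <= b -> Cmod (f x) <= M) ->
  Cmod (cint f a b) <= (b - a) * M.
Proof.
  intros ab Hf H. eapply Rle_trans; [now apply cint_Cmod|].
  rewrite <- RIconst. apply RIle; auto. now apply Cc_Cmod. intros; apply cconst.
Qed.

(** Restates an equality at the plain type [R] or [C] when it is typed at the carrier of a
    Coquelicot structure, so that [field] and [ring] recognise it. *)
Ltac req := cbv beta; match goal with |- @eq _ ?a ?b => first [change (@eq R a b) | change (@eq C a b) | idtac] end.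
Ltac fld := req; field.
Ltac rng := req; ring.

(** * Bessel inequality and decay of Fourier coefficients *)

Lemma sin_IZR_PI m : sin (IZR m * PI) = 0.
Proof. apply sin_eq_0_1. now exists m. Qed.
Lemma cos_IZR_2PI m : cos (IZR m * (2 * PI)) = 1.
Proof.
  replace (IZR m * (2 * PI)) with (2 * (IZR m * PI)) by rng.
  rewrite cos_2a_sin, sin_IZR_PI. rng.
Qed.
Lemma sin_IZR_2PI m : sin (IZR m * (2 * PI)) = 0.
Proof.
  replace (IZR m * (2 * PI)) with (2 * (IZR m * PI)) by rng.
  rewrite sin_2a, sin_IZR_PI. rng.
Qed.

Lemma RI_cos_lin m a b : m <> 0 -> RInt (fun x => cos (m * x)) a b = (sin (m * b) - sin (m * a)) / m.
Proof.
  intros Hm. rewrite (RI_FTC (fun x => sin (m * x) / m)). fld; auto.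
  - intros x. auto_derive; auto. fld; auto.
  - intros x. apply (ccomp cos (fun x => m * x)); [|apply ccos]. apply cmult; [apply cconst | apply continuous_id].
Qed.
Lemma RI_sin_lin m a b : m <> 0 -> RInt (fun x => sin (m * x)) a b = (cos (m * a) - cos (m * b)) / m.
Proof.
  intros Hm. rewrite (RI_FTC (fun x => - cos (m * x) / m)). fld; auto.
  - intros x. auto_derive; auto. fld; auto.
  - intros x. apply (ccomp sin (fun x => m * x)); [|apply csin]. apply cmult; [apply cconst | apply continuous_id].
Qed.

Lemma RI_cos_PI (m : Z) : RInt (fun x => cos (IZR m * x)) 0 PI = if Z.eq_dec m 0 then PI else 0.
Proof.
  destruct (Z.eq_dec m 0) as [->|Hm].
  - rewrite (RIext _ (fun _ => 1)), RIconst; [rng | pose proof PI_RGT_0; lra|].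
    intros; rewrite Rmult_0_l; apply cos_0.
  - assert (IZR m <> 0) by now apply IZR_neq.
    rewrite RI_cos_lin; auto. rewrite sin_IZR_PI, Rmult_0_r, sin_0. fld; auto.
Qed.

Lemma cint_cis_2PI (m : Z) : cint (fun x => cis (IZR m * x)) 0 (2 * PI) =
  if Z.eq_dec m 0 then RtoC (2 * PI) else RtoC 0.
Proof.
  pose proof PI_RGT_0 as HP. unfold cint, cis; simpl. destruct (Z.eq_dec m 0) as [->|Hm].
  - rewrite (RIext _ (fun _ => 1)), (RIext (fun x => sin _) (fun _ => 0)), !RIconst; try lra.
    + unfold RtoC; f_equal; rng.
    + intros; rewrite Rmult_0_l; apply sin_0.
    + intros; rewrite Rmult_0_l; apply cos_0.
  - assert (IZR m <> 0) by now apply IZR_neq.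
    rewrite RI_cos_lin, RI_sin_lin; auto. rewrite sin_IZR_2PI, cos_IZR_2PI, !Rmult_0_r, sin_0, cos_0.
    unfold RtoC; f_equal; fld; auto.
Qed.

Lemma csum_delta (l : list Z) z (g : Z -> C) : NoDup l -> In z l ->
  csum (fun w => if Z.eq_dec z w then g w else RtoC 0) l = g z.
Proof.
  intros ND; induction ND as [|w l Hw ND IH]; intros Hz; [easy|].
  rewrite csum_cons. destruct (Z.eq_dec z w) as [->|E].
  - rewrite csum_zero; [rng|]. intros a Ha. destruct (Z.eq_dec w a) as [->|]; [easy|reflexivity].
  - destruct Hz as [->|Hz]; [easy|]. rewrite IH; auto. rng.
Qed.

Lemma RI_Chasles (f : R -> R) a b c : (forall x, continuous f x) ->
  RInt f a b + RInt f b c = RInt f a c.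
Proof. intros H. apply (RInt_Chasles (V := R_CompleteNormedModule)); now apply cexR. Qed.

Lemma CC2_cis_lin (z : R) : CC2 (fun x => cis (z * x)).
Proof. apply CC2_cis. c2. Qed.
Ltac cc := try (apply CC2_Cc; auto using CC2_cis_lin; fail).

(** [F] is regarded as a function on (0, 2 PI) vanishing on the second half, where the exponentials
    with integer frequency are orthogonal. [T] is its Fourier polynomial, and the squared distance
    is integrated over both halves; this explains 2 PI in front of an integral over (0, PI). *)
Lemma bessel (F : R -> C) (l : list Z) : Cc F -> NoDup l ->
  rsum (fun z => Cn2 (cint (fun k => (F k * cis (IZR z * k))%C) 0 PI)) l
    <= 2 * PI * RInt (fun k => Cn2 (F k)) 0 PI.
Proof.
  intros HF ND. pose proof PI_RGT_0 as HP.
  set (I := fun z => cint (fun k => (F k * cis (IZR z * k))%C) 0 PI).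
  set (a := fun z : Z => (RtoC (/ (2 * PI)) * I z)%C).
  set (T := fun k => csum (fun z => (a z * cis (IZR (- z) * k))%C) l).
  set (Sg := rsum (fun z => Cn2 (I z)) l).
  assert (cT : Cc T).
  { apply Cc_csum; intros. apply Cc_mult; [apply Cc_const | cc]. }
  assert (HT : RInt (fun k => Cn2 (T k)) 0 (2 * PI) = Sg / (2 * PI)).
  { transitivity (fst (cint (fun k => (Cconj (T k) * T k)%C) 0 (2 * PI))).
    { unfold cint; cbv beta iota delta [fst]. apply RIext; [lra|]. intros; unfold Cn2; simpl; rng. }
    rewrite (cint_ext _ (fun k => csum (fun z => csum (fun w => (Cconj (a z) * a w * cis (IZR (z - w) * k))%C) l) l)); [|lra|].
    2:{ intros k _. unfold T. rewrite csum_conj, csum_mult. apply csum_ext; intros z _; apply csum_ext; intros w _.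
        rewrite Cmult_conj, cis_conj. replace (IZR (z - w) * k) with (- (IZR (- z) * k) + IZR (- w) * k).
        rewrite cis_plus; rng. rewrite minus_IZR, !opp_IZR; rng. }
    rewrite cint_csum.
    2:{ intros z; apply Cc_csum; intros. apply Cc_mult; [apply Cc_const | cc]. }
    rewrite csum_fst. unfold Sg. unfold Rdiv. rewrite <- rsum_scal_r. apply rsum_ext; intros z Hz.
    rewrite cint_csum by (intros; apply Cc_mult; [apply Cc_const | cc]).
    rewrite (csum_ext _ (fun w => if Z.eq_dec z w then (Cconj (a z) * a w * RtoC (2 * PI))%C else RtoC 0)).
    2:{ intros w _. rewrite cint_scal by cc. rewrite cint_cis_2PI.
        destruct (Z.eq_dec (z - w) 0), (Z.eq_dec z w); try lia; rng. }
    rewrite csum_delta; auto. unfold a, Cn2; simpl. fld. lra. }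
  assert (HX : RInt (fun k => fst (Cconj (T k) * F k)%C) 0 PI = Sg / (2 * PI)).
  { transitivity (fst (cint (fun k => (Cconj (T k) * F k)%C) 0 PI)); [reflexivity|].
    rewrite (cint_ext _ (fun k => csum (fun z => (Cconj (a z) * (F k * cis (IZR z * k)))%C) l)); [|lra|].
    2:{ intros k _. unfold T. rewrite csum_conj, <- csum_scal_r. apply csum_ext; intros z _.
        rewrite Cmult_conj, cis_conj. replace (- (IZR (- z) * k)) with (IZR z * k) by (rewrite opp_IZR; rng). rng. }
    rewrite cint_csum.
    2:{ intros z; apply Cc_mult; [apply Cc_const | apply Cc_mult; auto; cc]. }
    rewrite csum_fst. unfold Sg, Rdiv. rewrite <- rsum_scal_r. apply rsum_ext; intros z Hz.
    rewrite cint_scal by (apply Cc_mult; auto; cc). fold (I z). unfold a, Cn2; simpl. fld. lra. }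
  assert (H1 : 0 <= RInt (fun k => (Cn2 (F k) - 2 * fst (Cconj (T k) * F k)%C) + Cn2 (T k)) 0 PI).
  { apply RIpos; [lra| |].
    - intros x. apply cplus; [apply cminus|]; try now apply Cc_Cn2. apply cmult; [apply cconst|].
      now destruct (Cc_mult _ _ (Cc_conj _ cT) HF) as [H _].
    - intros k _. replace (_ + _) with (Cn2 (F k - T k)%C) by (unfold Cn2; simpl; rng). apply Cn2_pos. }
  assert (cX : forall x, continuous (fun k => fst (Cconj (T k) * F k)%C) x)
    by (destruct (Cc_mult _ _ (Cc_conj _ cT) HF) as [H _]; exact H).
  rewrite RIplus, RIminus, RIscal, HX in H1; auto using Cc_Cn2.
  2:{ intros; apply cmult; [apply cconst | apply cX]. }
  2:{ intros; apply cminus; [now apply Cc_Cn2|]. apply cmult; [apply cconst | apply cX]. }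
  assert (H2 : 0 <= RInt (fun k => Cn2 (T k)) PI (2 * PI)).
  { apply RIpos; [lra| now apply Cc_Cn2 |]. intros; apply Cn2_pos. }
  rewrite <- (RI_Chasles _ 0 PI) in HT by now apply Cc_Cn2.
  fold (I : Z -> C). change (Sg <= 2 * PI * RInt (fun k => Cn2 (F k)) 0 PI).
  assert (H3 : Sg / (2 * PI) <= RInt (fun k => Cn2 (F k)) 0 PI) by lra.
  apply (Rmult_le_compat_l (2 * PI)) in H3; [|lra].
  replace (2 * PI * (Sg / (2 * PI))) with Sg in H3 by (fld; lra). exact H3.
Qed.

Lemma cos_INR_PI_bound m : Rabs (cos (INR m * PI)) <= 1.
Proof. apply Rabs_le, COS_bound. Qed.

(** Two integrations by parts. The boundary term of order 1 / m carries sin (m k), which is zero at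
    both ends for integer m; the next one is already of order 1 / m^2. *)
Lemma ibp_cos F : C2 F -> exists B, 0 < B /\ forall m : nat, (1 <= m)%nat ->
  Rabs (RInt (fun k => F k * cos (INR m * k)) 0 PI) <= B / INR m ^ 2.
Proof.
  intros HF. destruct (C2E F HF) as (F1 & F2 & D1 & D2 & K).
  destruct (cont_bound F2 0 PI K) as (B2 & B2p & HB2). pose proof PI_RGT_0 as HP.
  exists (Rabs (F1 PI) + Rabs (F1 0) + PI * B2). split.
  { pose proof (Rabs_pos (F1 PI)); pose proof (Rabs_pos (F1 0)). nra. }
  intros m Hm. assert (m0 : 0 < INR m) by (apply lt_0_INR; lia).
  assert (cF : forall x, continuous F x) by now apply C2_cont.
  assert (cc : forall x, continuous (fun k => cos (INR m * k)) x).
  { intros; apply C2_cont; c2. }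
  assert (H : RInt (fun k => F k * cos (INR m * k) + / INR m ^ 2 * (F2 k * cos (INR m * k))) 0 PI
     = / INR m ^ 2 * (F1 PI * cos (INR m * PI) - F1 0)).
  { rewrite (RI_FTC (fun k => F k * (sin (INR m * k) / INR m) + F1 k * (cos (INR m * k) / INR m ^ 2))).
    - replace (INR m * PI) with (IZR (Z.of_nat m) * PI) by now rewrite INR_IZR_INZ.
      rewrite sin_IZR_PI, !Rmult_0_r, sin_0, cos_0. fld. lra.
    - intros x. evar_last.
      { apply dplus; apply dmult; [apply D1 | | apply D2 |].
        - instantiate (1 := cos (INR m * x)). auto_derive; auto. fld; lra.
        - instantiate (1 := - sin (INR m * x) / INR m). auto_derive; [lra|]. fld; lra. }
      fld. lra.
    - intros; apply cplus; [|apply cmult; [apply cconst|]]; apply cmult; auto. }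
  rewrite RIplus, RIscal in H; auto; try (intros; apply cmult; auto).
  2:{ apply cconst. } 2:{ apply cmult; auto. }
  set (J := RInt (fun k => F2 k * cos (INR m * k)) 0 PI) in *.
  assert (HJ : Rabs J <= PI * B2).
  { replace (PI * B2) with ((PI - 0) * B2) by ring. apply RIabs_bound; [lra| |].
    - intros; apply cmult; auto.
    - intros x Hx. rewrite Rabs_mult. specialize (HB2 x Hx).
      assert (Rabs (cos (INR m * x)) <= 1) by apply Rabs_le, COS_bound.
      pose proof (Rabs_pos (F2 x)). nra. }
  replace (RInt (fun k => F k * cos (INR m * k)) 0 PI) with
    (/ INR m ^ 2 * (F1 PI * cos (INR m * PI) - F1 0 - J)) by lra.
  assert (0 < / INR m ^ 2) by (apply Rinv_0_lt_compat, pow_lt; lra).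
  rewrite Rabs_mult, (Rabs_pos_eq (/ _)) by lra. unfold Rdiv. rewrite (Rmult_comm _ (/ INR m ^ 2)).
  apply Rmult_le_compat_l; [lra|].
  assert (H1 : Rabs (F1 PI * cos (INR m * PI)) <= Rabs (F1 PI)).
  { rewrite Rabs_mult. pose proof (cos_INR_PI_bound m). pose proof (Rabs_pos (F1 PI)). nra. }
  unfold Rminus. eapply Rle_trans; [apply Rabs_triang|]. rewrite Rabs_Ropp.
  apply Rplus_le_compat; auto. eapply Rle_trans; [apply Rabs_triang|]. rewrite Rabs_Ropp. lra.
Qed.

(** Here the boundary term of order 1 / m carries cos (m k), and the vanishing of [F] at both ends
    removes it. *)
Lemma ibp_sin F : C2 F -> F 0 = 0 -> F PI = 0 -> exists B, 0 < B /\ forall m : nat, (1 <= m)%nat ->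
  Rabs (RInt (fun k => F k * sin (INR m * k)) 0 PI) <= B / INR m ^ 2.
Proof.
  intros HF F00 FPI. destruct (C2E F HF) as (F1 & F2 & D1 & D2 & K).
  destruct (cont_bound F2 0 PI K) as (B2 & B2p & HB2). pose proof PI_RGT_0 as HP.
  exists (PI * B2). split; [nra|].
  intros m Hm. assert (m0 : 0 < INR m) by (apply lt_0_INR; lia).
  assert (cF : forall x, continuous F x) by now apply C2_cont.
  assert (cc : forall x, continuous (fun k => sin (INR m * k)) x).
  { intros; apply C2_cont; c2. }
  assert (H : RInt (fun k => F k * sin (INR m * k) + / INR m ^ 2 * (F2 k * sin (INR m * k))) 0 PI = 0).
  { rewrite (RI_FTC (fun k => F k * (- cos (INR m * k) / INR m) + F1 k * (sin (INR m * k) / INR m ^ 2))).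
    - replace (INR m * PI) with (IZR (Z.of_nat m) * PI) by now rewrite INR_IZR_INZ.
      rewrite sin_IZR_PI, !Rmult_0_r, sin_0, cos_0, F00, FPI. fld. lra.
    - intros x. evar_last.
      { apply dplus; apply dmult; [apply D1 | | apply D2 |].
        - instantiate (1 := sin (INR m * x)). auto_derive; auto. fld; lra.
        - instantiate (1 := cos (INR m * x) / INR m). auto_derive; [lra|]. fld; lra. }
      fld. lra.
    - intros; apply cplus; [|apply cmult; [apply cconst|]]; apply cmult; auto. }
  rewrite RIplus, RIscal in H; auto; try (intros; apply cmult; auto).
  2:{ apply cconst. } 2:{ apply cmult; auto. }
  set (J := RInt (fun k => F2 k * sin (INR m * k)) 0 PI) in *.
  assert (HJ : Rabs J <= PI * B2).
  { replace (PI * B2) with ((PI - 0) * B2) by ring. apply RIabs_bound; [lra| |].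
    - intros; apply cmult; auto.
    - intros x Hx. rewrite Rabs_mult. specialize (HB2 x Hx).
      assert (Rabs (sin (INR m * x)) <= 1) by apply Rabs_le, SIN_bound.
      pose proof (Rabs_pos (F2 x)). nra. }
  replace (RInt (fun k => F k * sin (INR m * k)) 0 PI) with (/ INR m ^ 2 * (- J)) by lra.
  assert (0 < / INR m ^ 2) by (apply Rinv_0_lt_compat, pow_lt; lra).
  rewrite Rabs_mult, (Rabs_pos_eq (/ _)) by lra. unfold Rdiv. rewrite (Rmult_comm _ (/ INR m ^ 2)).
  apply Rmult_le_compat_l; [lra|]. now rewrite Rabs_Ropp.
Qed.

Lemma RI_FTC_loc (f df : R -> R) a b : a <= b -> (forall x, a <= x <= b -> is_derive f x (df x)) ->
  (forall x, a <= x <= b -> continuous df x) -> RInt df a b = f b - f a.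
Proof.
  intros ab H K. apply is_RInt_unique. apply (is_RInt_derive (V := R_CompleteNormedModule) f df);
  rewrite Rmin_left, Rmax_right; auto.
Qed.

(** * Nonstationary phase *)

Definition cder (f : R -> C) (x : R) (d : C) : Prop :=
  is_derive (fun x => fst (f x)) x (fst d) /\ is_derive (fun x => snd (f x)) x (snd d).

Lemma cder_mult f g x a b : cder f x a -> cder g x b ->
  cder (fun x => (f x * g x)%C) x (a * g x + f x * b)%C.
Proof.
  intros [f1 f2] [g1 g2]; split.
  - evar_last. { apply (is_derive_minus (V := R_NormedModule)); apply dmult; eassumption. }
    unfold minus, plus, opp; simpl. ring.
  - evar_last. { apply dplus; apply dmult; eassumption. }
    simpl. ring.
Qed.
Lemma cder_RtoC f x d : is_derive f x d -> cder (fun x => RtoC (f x)) x (RtoC d).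
Proof. intros H; split; simpl; auto. apply (is_derive_const (V := R_NormedModule)). Qed.
Lemma cder_cis f x d : is_derive f x d -> cder (fun x => cis (f x)) x (Ci * RtoC d * cis (f x))%C.
Proof.
  intros H; split; simpl.
  - evar_last. { apply (dcomp cos f); [exact H | apply is_derive_cos]. } ring.
  - evar_last. { apply (dcomp sin f); [exact H | apply is_derive_sin]. } ring.
Qed.
Lemma CC2_cder A : CC2 A -> exists A1, Cc A1 /\ forall x, cder A x (A1 x).
Proof.
  intros [H K]. destruct (C2E _ H) as (f1 & f2 & F1 & F2 & F3). destruct (C2E _ K) as (g1 & g2 & G1 & G2 & G3).
  exists (fun x => (f1 x, g1 x)); split; split; simpl; intros; auto.
  - exact (dcont _ _ _ (F2 x)). - exact (dcont _ _ _ (G2 x)).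
Qed.
Lemma cFTC_loc G dG a b : a <= b -> (forall x, a <= x <= b -> cder G x (dG x)) -> Cc dG ->
  cint dG a b = (G b - G a)%C.
Proof.
  intros ab H [K1 K2]. unfold cint.
  rewrite (RI_FTC_loc (fun x => fst (G x)) (fun x => fst (dG x))); auto; [|intros; now apply H].
  rewrite (RI_FTC_loc (fun x => snd (G x)) (fun x => snd (dG x))); auto. intros; now apply H.
Qed.

(** With y = k / 2 one has sin k = 2 sin y cos y >= k (cos y)^2, and (cos y)^2 >= 1 / 2 on this
    range. The auxiliary bound y cos y <= sin y comes from the integral of s sin s. *)
Lemma sin_half_lb k : 0 <= k <= PI / 2 -> k / 2 <= sin k.
Proof.
  intros Hk. pose proof PI_RGT_0.
  set (y := k / 2).
  assert (H1 : y * cos y <= sin y).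
  { assert (E : RInt (fun s => s * sin s) 0 y = (sin y - y * cos y) - (sin 0 - 0 * cos 0)).
    { apply (RI_FTC (fun s => sin s - s * cos s)).
      - intros s. auto_derive; auto. req; ring.
      - intros. apply cmult; [apply continuous_id | apply csin]. }
    rewrite sin_0 in E. assert (0 <= RInt (fun s => s * sin s) 0 y); [|lra].
    apply RIpos; [unfold y; lra| |].
    - intros. apply cmult; [apply continuous_id | apply csin].
    - intros x Hx. apply Rmult_le_pos; [lra|]. unfold y in *. apply sin_ge_0; lra. }
  replace (sin k) with (2 * sin y * cos y) by (rewrite <- sin_2a; f_equal; unfold y; field).
  assert (Hc : 0 <= cos y) by (apply cos_ge_0; unfold y; lra).
  assert (Hc2 : cos k = 2 * (cos y * cos y) - 1) by (replace k with (2 * y) by (unfold y; field); rewrite cos_2a_cos; ring).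
  assert (0 <= cos k) by (apply cos_ge_0; lra).
  assert (y * cos y * cos y <= sin y * cos y) by (apply Rmult_le_compat_r; auto).
  assert (0 <= y) by (unfold y; lra). fold y. nra.
Qed.

Lemma sin_lines k : 0 <= k <= PI -> k / 2 <= sin k \/ (PI - k) / 2 <= sin k.
Proof.
  intros Hk. destruct (Rle_dec k (PI / 2)).
  - left; apply sin_half_lb; lra.
  - right. rewrite <- (sin_PI_x k). apply sin_half_lb; lra.
Qed.

Lemma ln_sqrt_le x : 0 <= x -> ln (1 + x) <= 2 * sqrt x.
Proof.
  intros Hx. set (s := sqrt x). assert (0 <= s) by apply sqrt_pos.
  assert (E : x = s * s) by (unfold s; now rewrite sqrt_sqrt).
  apply Rle_trans with (ln ((1 + s) * (1 + s))).
  - apply Rcomplements.ln_le; nra.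
  - rewrite ln_mult by lra. assert (ln (1 + s) <= s); [|lra].
    rewrite <- (ln_exp s) at 2. apply Rcomplements.ln_le; [lra|]. destruct (Req_dec s 0) as [->|]; [rewrite exp_0; lra|].
    left; apply exp_ineq1; lra.
Qed.
Lemma ln_le_id x : 0 <= x -> ln (1 + x) <= x.
Proof.
  intros Hx. rewrite <- (ln_exp x) at 2. apply Rcomplements.ln_le; [lra|].
  destruct (Req_dec x 0) as [->|]; [rewrite exp_0; lra|]. left; apply exp_ineq1; lra.
Qed.

(** The absolute values are inert on [0, PI] but keep both denominators positive on the whole line,
    so the integrands are continuous everywhere, as the integration lemmas demand. *)
Lemma int_inv_lin t z : 0 < t -> 0 < z ->
  RInt (fun k => / (t * (Rabs k / 2) + z)) 0 PI = 2 / t * ln (1 + PI * t / (2 * z)) /\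
  RInt (fun k => / (t * (Rabs (PI - k) / 2) + z)) 0 PI = 2 / t * ln (1 + PI * t / (2 * z)).
Proof.
  intros Ht Hz. pose proof PI_RGT_0 as HP.
  assert (P0 : forall k, 0 <= k -> 0 < t * (k / 2) + z) by (intros; assert (0 <= t * (k / 2)) by (apply Rmult_le_pos; lra); lra).
  assert (E : ln (1 + PI * t / (2 * z)) = ln (t * (PI / 2) + z) - ln z).
  { rewrite <- ln_div; [|apply P0; lra | lra]. f_equal. field. lra. }
  rewrite E. split.
  - rewrite (RIext _ (fun k => / (t * (k / 2) + z))); [|lra|intros; rewrite Rabs_pos_eq; lra].
    rewrite (RI_FTC_loc (fun k => 2 / t * ln (t * (k / 2) + z))); [|lra| |].
    + replace (t * (0 / 2) + z) with z by field. req. ring.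
    + intros x Hx. assert (H := P0 x (proj1 Hx)). auto_derive; auto. req; field; lra.
    + intros x Hx. assert (H := P0 x (proj1 Hx)). apply cinv; [|lra].
      apply cplus; [|apply cconst]. apply cmult; [apply cconst|]. apply cmult; [apply continuous_id | apply cconst].
  - rewrite (RIext _ (fun k => / (t * ((PI - k) / 2) + z))); [|lra|intros; rewrite Rabs_pos_eq; lra].
    rewrite (RI_FTC_loc (fun k => - (2 / t) * ln (t * ((PI - k) / 2) + z))); [|lra| |].
    + replace (t * ((PI - PI) / 2) + z) with z by field. rewrite Rminus_0_r. req. ring.
    + intros x Hx. assert (H := P0 (PI - x) ltac:(lra)). auto_derive; auto. req; field; lra.
    + intros x Hx. assert (H := P0 (PI - x) ltac:(lra)). apply cinv; [|lra].
      apply cplus; [|apply cconst]. apply cmult; [apply cconst|].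
      apply cmult; [apply cminus; [apply cconst | apply continuous_id] | apply cconst].
Qed.

(* [1 / (t sin k + z)] is integrated by comparison with two linear denominators, giving
   [ln (1 + c t / z) / t]; the interpolation [ln^2 (1 + x) <= 2 x sqrt x] then makes it square
   summable in [z] with a total that vanishes as [t] grows. *)
Lemma nonstationary A Ca : CC2 A -> (forall k, 0 <= k <= PI -> Cmod (A k) <= Ca * sin k) ->
  exists B, 0 < B /\ forall t (z : nat), 0 < t -> (1 <= z)%nat ->
   Cn2 (cint (fun k => (cis (t * cos k - INR z * k) * A k)%C) 0 PI)
     <= B / (sqrt t * (INR z * sqrt (INR z))).
Proof.
  intros HA HC. pose proof PI_RGT_0 as HP.
  destruct (CC2_cder A HA) as (A1 & cA1 & dA1).
  destruct (cont_bound (fun k => Cmod (A1 k)) 0 PI (Cc_Cmod _ cA1)) as (B1 & B1p & HB1).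
  assert (Cap : 0 <= Ca).
  { specialize (HC (PI / 2) ltac:(lra)). rewrite sin_PI2 in HC. pose proof (Cmod_ge_0 (A (PI / 2))). lra. }
  set (B0 := B1 + Ca).
  exists (B0 ^ 2 * 256). split; [assert (0 < B0) by (unfold B0; lra); nra|].
  intros t z Ht Hz. set (w := INR z). assert (w1 : 1 <= w) by (apply (le_INR 1); lia).
  set (D := fun k => t * sin k + w). set (Da := fun k => t * Rabs (sin k) + w).
  assert (DDa : forall k, 0 <= k <= PI -> Da k = D k).
  { intros k Hk. unfold D, Da. rewrite Rabs_pos_eq; auto. apply sin_ge_0; lra. }
  assert (Dap : forall k, 0 < Da k).
  { intros k. unfold Da. pose proof (Rabs_pos (sin k)). assert (0 <= t * Rabs (sin k)) by (apply Rmult_le_pos; lra). lra. }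
  assert (cDa : forall k, continuous Da k).
  { intros k. apply cplus; [|apply cconst]. apply cmult; [apply cconst|]. apply cabs, csin. }
  assert (ciDa : forall k, continuous (fun k => / Da k) k).
  { intros k. apply cinv; auto. specialize (Dap k); lra. }
  set (e := fun k => cis (t * cos k - w * k)).
  assert (He : Cc e) by (apply CC2_Cc, CC2_cis; c2).
  assert (cA : Cc A) by now apply CC2_Cc.
  set (rest := fun k => (Ci * (e k * (RtoC (/ Da k) * A1 k + RtoC (- (t * cos k) / Da k ^ 2) * A k)))%C).
  assert (cDa2 : forall k, continuous (fun k => - (t * cos k) / Da k ^ 2) k).
  { intros k. apply cmult; [apply copp, cmult; [apply cconst | apply ccos]|].
    apply cinv. 2:{ apply pow_nonzero. specialize (Dap k); lra. }
    simpl. apply cmult; auto. apply cmult; auto using cconst. }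
  assert (cR : forall f : R -> R, (forall k, continuous f k) -> Cc (fun k => RtoC (f k))).
  { intros f Hf; split; simpl; auto. intros; apply cconst. }
  assert (crest : Cc rest).
  { apply Cc_mult; [apply Cc_const|]. apply Cc_mult; auto. apply Cc_plus; apply Cc_mult; auto; apply cR; auto. }
  (* The integrand is the derivative of e (i / D) A. Its boundary values vanish because [A] is
     dominated by sin k. *)
  assert (FTC : cint (fun k => (e k * A k + rest k)%C) 0 PI = RtoC 0).
  { rewrite (cFTC_loc (fun k => (e k * (Ci * (RtoC (/ D k) * A k)))%C)); [|lra| |].
    - assert (A PI = RtoC 0). { apply Cmod_eq_0. specialize (HC PI ltac:(lra)). rewrite sin_PI in HC. pose proof (Cmod_ge_0 (A PI)). lra. }
      assert (A 0 = RtoC 0). { apply Cmod_eq_0. specialize (HC 0 ltac:(lra)). rewrite sin_0 in HC. pose proof (Cmod_ge_0 (A 0)). lra. }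
      rewrite H, H0. ring.
    - intros x Hx. assert (Dx : 0 < D x) by (rewrite <- DDa; auto).
      evar_last.
      { apply cder_mult.
        - apply cder_cis. instantiate (1 := - D x). unfold D. auto_derive; auto. req; ring.
        - apply (cder_mult (fun _ => Ci)).
          + apply (conj (is_derive_const (V := R_NormedModule) _ _) (is_derive_const (V := R_NormedModule) _ _) : cder (fun _ => Ci) x (RtoC 0)).
          + apply (cder_mult (fun k => RtoC (/ D k))); [|apply dA1].
            apply cder_RtoC. instantiate (1 := - (t * cos x) / D x ^ 2). unfold D in *. auto_derive; [lra|]. req; field; lra. }
      cbv beta. unfold rest. rewrite (DDa x Hx). fold (e x).
      assert (Ei : (Ci * Ci = - RtoC 1)%C) by (unfold Ci, RtoC, Cmult, Copp; simpl; f_equal; ring).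
      transitivity (- (Ci * Ci) * (RtoC (D x) * RtoC (/ D x)) * e x * A x
         + Ci * (e x * (RtoC (/ D x) * A1 x + RtoC (- (t * cos x) / D x ^ 2) * A x)))%C.
      + rewrite RtoC_opp. ring.
      + rewrite Ei, <- RtoC_mult, Rinv_r by lra. ring.
    - apply Cc_plus; auto. now apply Cc_mult. }
  rewrite cint_plus in FTC; auto. 2:{ now apply Cc_mult. }
  change (Cn2 (cint (fun k => (e k * A k)%C) 0 PI) <= B0 ^ 2 * 256 / (sqrt t * (w * sqrt w))).
  replace (cint (fun k => (e k * A k)%C) 0 PI) with (- cint rest 0 PI)%C.
  2:{ rewrite <- (Cplus_0_r (- _)), <- FTC. ring. }
  assert (Hr : Cmod (cint rest 0 PI) <= B0 * (4 / t * ln (1 + PI * t / (2 * w)))).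
  { eapply Rle_trans; [apply cint_Cmod; [lra|auto]|].
    destruct (int_inv_lin t w Ht ltac:(lra)) as [I1 I2].
    replace (4 / t * ln (1 + PI * t / (2 * w))) with (2 / t * ln (1 + PI * t / (2 * w)) + 2 / t * ln (1 + PI * t / (2 * w))) by (field; lra).
    rewrite <- I1 at 1. rewrite <- I2.
    assert (Q1 : forall k, 0 < t * (Rabs k / 2) + w).
    { intros k. pose proof (Rabs_pos k). assert (0 <= t * (Rabs k / 2)) by (apply Rmult_le_pos; lra). lra. }
    assert (c1 : forall k, continuous (fun k => / (t * (Rabs k / 2) + w)) k).
    { intros k. apply cinv; [|specialize (Q1 k); lra]. apply cplus; [|apply cconst]. apply cmult; [apply cconst|].
      apply cmult; [|apply cconst]. apply (cabs (fun k => k)), continuous_id. }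
    assert (c2 : forall k, continuous (fun k => / (t * (Rabs (PI - k) / 2) + w)) k).
    { intros k. apply (ccomp (fun k => / (t * (Rabs k / 2) + w)) (fun k => PI - k)); auto.
      apply cminus; [apply cconst | apply continuous_id]. }
    rewrite <- RIplus, <- RIscal; auto.
    2:{ intros; apply cplus; auto. }
    apply RIle; [lra| now apply Cc_Cmod | |].
    { intros; apply cmult; [apply cconst|]; apply cplus; auto. }
    intros k Hk. assert (Dk := Dap k). assert (sk : 0 <= sin k) by (apply sin_ge_0; lra).
    apply Rle_trans with (B0 * / Da k).
    - unfold rest. rewrite !Cmod_mult. unfold e at 1. rewrite Cmod_cis.
      replace (Cmod Ci) with 1. 2:{ symmetry. unfold Cmod, Ci; simpl. replace (_ + _) with 1 by ring. apply sqrt_1. }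
      rewrite !Rmult_1_l. eapply Rle_trans; [apply Cmod_triangle|]. rewrite !Cmod_mult, !Cmod_R.
      unfold B0. rewrite Rmult_plus_distr_r. apply Rplus_le_compat.
      + rewrite Rabs_pos_eq by (left; now apply Rinv_0_lt_compat). rewrite Rmult_comm.
        apply Rmult_le_compat_r; [left; now apply Rinv_0_lt_compat|].
        specialize (HB1 k Hk). rewrite Rabs_pos_eq in HB1; auto. apply Cmod_ge_0.
      (* Differentiating 1 / D costs t / D^2; the factor sin k in the bound on [A] recovers one
         power, since t sin k <= D. *)
      + unfold Rdiv. rewrite Rabs_mult, Rabs_Ropp, Rabs_mult, (Rabs_pos_eq t), (Rabs_pos_eq (/ _)) by (try lra; left; apply Rinv_0_lt_compat, pow_lt; auto).
        assert (Hc : Rabs (cos k) <= 1) by apply Rabs_le, COS_bound.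
        apply Rle_trans with (t * 1 * / Da k ^ 2 * (Ca * sin k)).
        * apply Rmult_le_compat; auto using Cmod_ge_0.
          { apply Rmult_le_pos; [apply Rmult_le_pos; [lra | apply Rabs_pos]|]. left; apply Rinv_0_lt_compat, pow_lt; auto. }
          apply Rmult_le_compat_r; [left; apply Rinv_0_lt_compat, pow_lt; auto|]. apply Rmult_le_compat_l; lra.
        * replace (t * 1 * / Da k ^ 2 * (Ca * sin k)) with (Ca * / Da k * ((t * sin k) / Da k)) by (field; lra).
          rewrite <- (Rmult_1_r (Ca * / Da k)) at 2. apply Rmult_le_compat_l.
          { apply Rmult_le_pos; auto. left; now apply Rinv_0_lt_compat. }
          apply Rle_div_l; auto. rewrite (DDa k Hk). unfold D. lra.
    - apply Rmult_le_compat_l; [unfold B0; lra|].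
      assert (R1 := Q1 k). assert (R2 := Q1 (PI - k)).
      assert (0 < / (t * (Rabs k / 2) + w)) by now apply Rinv_0_lt_compat.
      assert (0 < / (t * (Rabs (PI - k) / 2) + w)) by now apply Rinv_0_lt_compat.
      rewrite (DDa k Hk) in *. rewrite (Rabs_pos_eq k), (Rabs_pos_eq (PI - k)) in * by lra.
      destruct (sin_lines k Hk) as [S|S].
      + apply Rle_trans with (/ (t * (k / 2) + w)); [|lra]. apply Rinv_le_contravar; auto.
        unfold D. apply Rplus_le_compat_r, Rmult_le_compat_l; lra.
      + apply Rle_trans with (/ (t * ((PI - k) / 2) + w)); [|lra]. apply Rinv_le_contravar; auto.
        unfold D. apply Rplus_le_compat_r, Rmult_le_compat_l; lra. }
  replace (Cn2 (- cint rest 0 PI)%C) with (Cn2 (cint rest 0 PI)) by (unfold Cn2; simpl; ring).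
  rewrite Cn2_Cmod.
  set (x := PI * t / (2 * w)) in *.
  assert (x0 : 0 < x) by (unfold x; apply Rdiv_lt_0_compat; nra).
  assert (L : ln (1 + x) ^ 2 <= 2 * x * sqrt x).
  { assert (0 <= ln (1 + x)) by (rewrite <- ln_1; apply Rcomplements.ln_le; lra).
    pose proof (ln_sqrt_le x ltac:(lra)). pose proof (ln_le_id x ltac:(lra)). pose proof (sqrt_pos x).
    replace (ln (1 + x) ^ 2) with (ln (1 + x) * ln (1 + x)) by ring.
    replace (2 * x * sqrt x) with (x * (2 * sqrt x)) by ring. apply Rmult_le_compat; lra. }
  apply Rle_trans with ((B0 * (4 / t * ln (1 + x))) ^ 2).
  { apply pow_incr. split; auto using Cmod_ge_0. }
  replace ((B0 * (4 / t * ln (1 + x))) ^ 2) with (B0 ^ 2 * (16 / t ^ 2) * ln (1 + x) ^ 2) by (field; lra).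
  assert (B0 ^ 2 >= 0) by (apply Rle_ge, pow2_ge_0).
  assert (0 < 16 / t ^ 2) by (apply Rdiv_lt_0_compat; [lra | apply pow_lt; lra]).
  apply Rle_trans with (B0 ^ 2 * (16 / t ^ 2) * (2 * x * sqrt x)).
  { apply Rmult_le_compat_l; auto. apply Rmult_le_pos; lra. }
  unfold Rdiv at 2. rewrite !Rmult_assoc. apply Rmult_le_compat_l; [lra|].
  set (st := sqrt t). set (sw := sqrt w).
  assert (st0 : 0 < st) by now apply sqrt_lt_R0. assert (sw0 : 0 < sw) by (apply sqrt_lt_R0; lra).
  assert (Et : t = st * st) by (unfold st; rewrite sqrt_sqrt; lra).
  assert (Ew : w = sw * sw) by (unfold sw; rewrite sqrt_sqrt; lra).
  assert (sx : sqrt x <= 2 * st / sw).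
  { apply Rsqr_incr_0_var; [|apply Rlt_le, Rdiv_lt_0_compat; lra]. unfold Rsqr. rewrite sqrt_sqrt by lra.
    set (r := st / sw). replace x with (PI / 2 * (r * r)) by (unfold x, r; rewrite Et, Ew; field; lra).
    replace (2 * st / sw) with (2 * r) by (unfold r; field; lra).
    pose proof PI_4. pose proof (Rle_0_sqr r) as Hr2. unfold Rsqr in Hr2. nra. }
  assert (xx : x <= 2 * t / w).
  { unfold x. pose proof PI_4. apply Rle_trans with (4 * t / (2 * w)); [|right; field; lra].
    unfold Rdiv. apply Rmult_le_compat_r; [left; apply Rinv_0_lt_compat; lra|]. apply Rmult_le_compat_r; lra. }
  pose proof (sqrt_pos x).
  apply Rle_trans with (16 / t ^ 2 * (2 * (2 * t / w) * (2 * st / sw))).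
  { apply Rmult_le_compat_l; [lra|]. rewrite <- (Rmult_assoc 2 x). apply Rmult_le_compat; try nra. }
  rewrite Et, Ew. apply Rle_trans with (128 / (st * (sw * sw * sw))); [right; field; split; lra|].
  unfold Rdiv. apply Rmult_le_compat_r; [|lra]. left; apply Rinv_0_lt_compat. repeat apply Rmult_lt_0_compat; auto.
Qed.

(** * Waves on a half-line *)

Fixpoint peval (c : list R) (x : R) : R :=
  match c with nil => 0 | a :: c' => a + x * peval c' x end.

(** The hopping operator on the sites j >= 1 with Dirichlet condition; site 0 is a dummy whose value
    is kept at 0. *)
Definition hop (u : nat -> R) (j : nat) : R :=
  match j with O => 0 | S i => (u i + u (S j)) / 2 end.

(** Horner scheme for the polynomial [c] evaluated at the operator [hop]. *)
Fixpoint papp (c : list R) (u : nat -> R) (j : nat) : R :=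
  match c with nil => 0 | a :: c' => a * u j + hop (papp c' u) j end.

Definition sines (u : nat -> R) (n : nat) (q : R) : R :=
  rsum (fun j => u j * sin (INR j * q)) (seq 1 n).

Lemma rsum_seq_S (f : nat -> R) n : rsum f (seq 1 (S n)) = rsum f (seq 1 n) + f (S n).
Proof. rewrite seq_S, rsum_app. unfold rsum at 2; simpl. ring. Qed.

(** Summation by parts: the sine transform diagonalises [hop] up to a boundary term at the upper
    end, which the two zero values remove. *)
Lemma hop_sines v n q : v O = 0 -> v (S n) = 0 -> v (S (S n)) = 0 ->
  cos q * sines v (S n) q = sines (hop v) (S n) q.
Proof.
  intros v0. assert (E : forall m, cos q * sines v m q - sines (hop v) m q =
     (v m * sin (INR (S m) * q) - v (S m) * sin (INR m * q)) / 2).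
  { induction m as [|m IH].
    - unfold sines, rsum; simpl. rewrite v0, !Rmult_0_l, sin_0. field.
    - unfold sines in *. rewrite !rsum_seq_S. cbn [hop].
      replace (sin (INR (S (S m)) * q)) with (2 * cos q * sin (INR (S m) * q) - sin (INR m * q)).
      + lra.
      + rewrite !S_INR. replace ((INR m + 1 + 1) * q) with ((INR m + 1) * q + q) by ring.
        replace (INR m * q) with ((INR m + 1) * q - q) by ring.
        rewrite sin_plus, sin_minus. ring. }
  intros v1 v2. specialize (E (S n)). rewrite v1, v2 in E. lra.
Qed.

Lemma papp_0 c u : u O = 0 -> papp c u O = 0.
Proof. intros u0. destruct c; simpl; auto. rewrite u0; ring. Qed.

Lemma papp_supp c u J : (forall j, (J < j)%nat -> u j = 0) ->
  forall j, (J + length c < S j)%nat -> papp c u j = 0.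
Proof.
  intros Hu. induction c as [|a c IH]; intros j Hj; simpl; auto. simpl in Hj.
  rewrite Hu by lia. destruct j as [|j]; simpl; [ring|]. rewrite !IH by lia. field.
Qed.

Lemma papp_sines c u J n q : u O = 0 -> (forall j, (J < j)%nat -> u j = 0) ->
  (J + length c <= n)%nat -> peval c (cos q) * sines u n q = sines (papp c u) n q.
Proof.
  intros u0 Hu. revert n. induction c as [|a c IH]; intros n Hn; simpl in *.
  - unfold sines. rewrite Rmult_0_l, rsum_zero; auto. intros; ring.
  - rewrite Rmult_plus_distr_r, Rmult_assoc, IH by lia.
    destruct n as [|n]; [lia|]. rewrite hop_sines.
    + unfold sines. rewrite <- rsum_scal, <- rsum_plus. apply rsum_ext; intros; ring.
    + now apply papp_0.
    + apply (papp_supp c u J); auto; lia.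
    + apply (papp_supp c u J); auto; lia.
Qed.

Lemma sines_cont u n q : continuous (sines u n) q.
Proof.
  apply rsum_cont. intros j _. apply cmult; [apply cconst|]. apply (ccomp sin (fun q => INR j * q)); [|apply csin].
  apply cmult; [apply cconst | apply continuous_id].
Qed.

Lemma RI_sin_sin i j : (1 <= i)%nat -> (1 <= j)%nat ->
  RInt (fun q => sin (INR i * q) * sin (INR j * q)) 0 PI = if Nat.eq_dec i j then PI / 2 else 0.
Proof.
  intros Hi Hj. pose proof PI_RGT_0.
  rewrite (RIext _ (fun q => / 2 * (cos (IZR (Z.of_nat i - Z.of_nat j) * q) - cos (IZR (Z.of_nat i + Z.of_nat j) * q)))); [|lra|].
  2:{ intros q _. rewrite minus_IZR, plus_IZR, <- !INR_IZR_INZ.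
      rewrite Rmult_minus_distr_r, Rmult_plus_distr_r, cos_minus, cos_plus. req. field. }
  assert (cl : forall m : R, forall x, continuous (fun q => cos (m * q)) x).
  { intros m x. apply (ccomp cos (fun q => m * q)); [|apply ccos]. apply cmult; [apply cconst | apply continuous_id]. }
  rewrite RIscal, RIminus, !RI_cos_PI; auto. 2:{ intros; apply cminus; auto. }
  destruct (Nat.eq_dec i j), (Z.eq_dec (Z.of_nat i - Z.of_nat j) 0), (Z.eq_dec (Z.of_nat i + Z.of_nat j) 0); try lia; req; field.
Qed.

Lemma rsum_delta (l : list nat) z (g : nat -> R) : NoDup l -> In z l ->
  rsum (fun w => if Nat.eq_dec z w then g w else 0) l = g z.
Proof.
  intros ND; induction ND as [|w l Hw ND IH]; intros Hz; [easy|].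
  rewrite rsum_cons. destruct (Nat.eq_dec z w) as [->|E].
  - rewrite rsum_zero; [ring|]. intros a Ha. destruct (Nat.eq_dec w a) as [->|]; [easy|reflexivity].
  - destruct Hz as [->|Hz]; [easy|]. rewrite IH; auto. ring.
Qed.

Lemma sines_parseval u n : 2 / PI * RInt (fun q => sines u n q ^ 2) 0 PI = rsum (fun j => u j ^ 2) (seq 1 n).
Proof.
  pose proof PI_RGT_0. assert (cs : forall j q, continuous (fun q => sin (INR j * q)) q).
  { intros. apply (ccomp sin (fun q => INR j * q)); [|apply csin]. apply cmult; [apply cconst | apply continuous_id]. }
  rewrite (RIext _ (fun q => rsum (fun i => rsum (fun j => u i * u j * (sin (INR i * q) * sin (INR j * q))) (seq 1 n)) (seq 1 n))); [|lra|].
  2:{ intros q _. simpl. rewrite Rmult_1_r. unfold sines. rewrite rsum_mult.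
      apply rsum_ext; intros; apply rsum_ext; intros. ring. }
  rewrite RIrsum. 2:{ intros; apply rsum_cont; intros. apply cmult; [apply cconst | apply cmult; auto]. }
  rewrite <- rsum_scal. apply rsum_ext; intros i Hi.
  rewrite RIrsum. 2:{ intros; apply cmult; [apply cconst | apply cmult; auto]. }
  apply in_seq in Hi as Hi'.
  rewrite (rsum_ext _ (fun j => if Nat.eq_dec i j then u i * u j * (PI / 2) else 0)).
  - rewrite rsum_delta; auto using seq_NoDup. field. lra.
  - intros j Hj. apply in_seq in Hj. rewrite RIscal, RI_sin_sin by (lia || (intros; apply cmult; auto)).
    destruct (Nat.eq_dec i j); ring.
Qed.

(** The quadratic form of f(h) at the restriction of [u] to the sites 1..n, where h is the half-line
    hopping operator, written through the sine transform. *)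
Definition qf (f : R -> R) (u : nat -> R) (n : nat) : R :=
  2 / PI * RInt (fun q => f (cos q) * sines u n q ^ 2) 0 PI.

Lemma cont_cos_sines f u n : (forall x, continuous f x) -> forall q, continuous (fun q => f (cos q) * sines u n q ^ 2) q.
Proof.
  intros Hf q. apply cmult; [apply ccomp; auto; apply ccos|]. simpl.
  apply cmult; [apply sines_cont|]. apply cmult; [apply sines_cont | apply cconst].
Qed.

Lemma peval_cont c x : continuous (peval c) x.
Proof.
  induction c as [|a c IH]; [apply cconst|]. apply (cplus (fun _ => a)); [apply cconst|].
  apply (cmult (fun x => x)); [apply continuous_id | exact IH].
Qed.

(** After the sine transform a pointwise inequality between symbols is a form inequality. The
    majorant is a square because the form of p(h)^2 is the squared norm of p(h) u, a sum over sites
    in which the motion of the wave is visible. *)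
Lemma qf_poly f c eps u J : (forall x, continuous f x) -> u O = 0 -> (forall j, (J < j)%nat -> u j = 0) ->
  (forall x, -1 <= x <= 1 -> f x <= peval c x ^ 2 + eps) ->
  qf f u J <= rsum (fun j => papp c u j ^ 2) (seq 1 (J + length c)) + eps * rsum (fun j => u j ^ 2) (seq 1 J).
Proof.
  intros cf u0 Hu Hp. pose proof PI_RGT_0.
  assert (Ls : forall q, sines u (J + length c) q = sines u J q).
  { intros q. unfold sines. rewrite seq_app, rsum_app, (rsum_zero _ (seq (1 + J) _)); [ring|].
    intros j Hj. apply in_seq in Hj. rewrite Hu by lia. ring. }
  rewrite <- !sines_parseval, <- Rmult_assoc, (Rmult_comm eps), Rmult_assoc, <- Rmult_plus_distr_l.
  assert (cs2 : forall v n q, continuous (fun q => sines v n q ^ 2) q).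
  { intros. simpl. apply cmult; [apply sines_cont|]. apply cmult; [apply sines_cont | apply cconst]. }
  rewrite <- RIscal, <- RIplus; auto. 2:{ intros; apply cmult; auto using cconst. }
  unfold qf. apply Rmult_le_compat_l; [left; apply Rdiv_lt_0_compat; lra|].
  apply RIle; [lra | now apply cont_cos_sines | intros; apply cplus; auto; apply cmult; auto using cconst |].
  intros q Hq. rewrite <- (papp_sines c u J) by (auto; lia). rewrite Ls.
  rewrite Rpow_mult_distr, <- Rmult_plus_distr_r. apply Rmult_le_compat_r; [apply pow2_ge_0|]. apply Hp, COS_bound.
Qed.

Definition l1 (c : list R) : R := rsum Rabs c.
Lemma l1_pos c : 0 <= l1 c.
Proof. apply rsum_pos. intros; apply Rabs_pos. Qed.

Lemma papp_bound c u m j : 0 <= m ->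
  (forall i, (i <= j + length c)%nat -> (j <= i + length c)%nat -> Rabs (u i) <= m) ->
  Rabs (papp c u j) <= l1 c * m.
Proof.
  intros Hm. revert j. induction c as [|a c IH]; intros j H.
  - simpl. rewrite Rabs_R0. unfold l1, rsum; simpl. lra.
  - unfold l1. rewrite rsum_cons. fold (l1 c). simpl in H |- *.
    eapply Rle_trans; [apply Rabs_triang|]. rewrite Rmult_plus_distr_r, Rabs_mult.
    apply Rplus_le_compat. { apply Rmult_le_compat_l; [apply Rabs_pos|]. apply H; lia. }
    destruct j as [|j]; simpl.
    + rewrite Rabs_R0. apply Rmult_le_pos; auto using l1_pos.
    + assert (H1 : Rabs (papp c u j) <= l1 c * m) by (apply IH; intros; apply H; lia).
      assert (H2 : Rabs (papp c u (S (S j))) <= l1 c * m) by (apply IH; intros; apply H; lia).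
      unfold Rdiv. rewrite Rabs_mult, (Rabs_pos_eq (/ 2)) by lra.
      pose proof (Rabs_triang (papp c u j) (papp c u (S (S j)))). lra.
Qed.

Lemma papp_local c u v j : (forall i, (i <= j + length c)%nat -> (j <= i + length c)%nat -> u i = v i) ->
  papp c u j = papp c v j.
Proof.
  revert j. induction c as [|a c IH]; intros j H; simpl; auto. simpl in H.
  rewrite H by lia. f_equal. destruct j as [|j]; simpl; auto. rewrite !(IH) by (intros; apply H; lia). reflexivity.
Qed.

(** For t > 0 and j > 0 the phase t cos k + j k of the [A] term is stationary where sin k = j / t,
    so this part travels outward; the phase t cos k - j k of the [B] term has no stationary
    point. *)
Definition wave (t : R) (A B : R -> C) (j : nat) : C :=
  (RtoC (/ (2 * PI)) * cint (fun k => cis (t * cos k) * (cis (INR j * k) * A k + cis (- (INR j * k)) * B k)) 0 PI)%C.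

Lemma Cc_cis_lin z : Cc (fun k => cis (z * k)).
Proof. apply CC2_Cc, CC2_cis_lin. Qed.
Lemma Cc_cis_nlin z : Cc (fun k => cis (- (z * k))).
Proof. apply CC2_Cc, CC2_cis. c2. Qed.
Lemma Cc_cis_tcos t : Cc (fun k => cis (t * cos k)).
Proof. apply CC2_Cc, CC2_cis. c2. Qed.
Lemma Cc_RtoC f : (forall x, continuous f x) -> Cc (fun x => RtoC (f x)).
Proof. intros; split; simpl; auto. intros; apply cconst. Qed.
Ltac Ccs := lazymatch goal with
  | |- Cc (fun _ => ?c) => apply (Cc_const c)
  | |- Cc (fun x => Cplus (@?f x) (@?g x)) => apply (Cc_plus f g); Ccs
  | |- Cc (fun x => Cmult (@?f x) (@?g x)) => apply (Cc_mult f g); Ccs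
  | |- Cc (fun x => Cconj (@?f x)) => apply (Cc_conj f); Ccs
  | |- Cc (fun x => cis (_ * cos x)) => apply Cc_cis_tcos
  | |- Cc (fun x => cis (_ * x)) => apply Cc_cis_lin
  | |- Cc (fun x => cis (- (_ * x))) => apply Cc_cis_nlin
  | _ => try assumption
  end.

(** Away from the end of the half-line, [hop] multiplies both exponentials by cos k. Every further
    coefficient reaches one site further, hence [length c <= j]. Real and imaginary parts are
    separate because [papp] acts on real sequences. *)
Lemma papp_wave c t A B j : Cc A -> Cc B -> (length c <= j)%nat ->
  papp c (fun i => fst (wave t A B i)) j =
    fst (wave t (fun k => RtoC (peval c (cos k)) * A k)%C (fun k => RtoC (peval c (cos k)) * B k)%C j) /\
  papp c (fun i => snd (wave t A B i)) j =
    snd (wave t (fun k => RtoC (peval c (cos k)) * A k)%C (fun k => RtoC (peval c (cos k)) * B k)%C j).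
Proof.
  intros HA HB. pose proof PI_RGT_0 as HP. revert j.
  assert (cp : forall c, Cc (fun k => RtoC (peval c (cos k)))).
  { intros c'. apply Cc_RtoC. intros x; apply (ccomp (peval c') cos); [apply ccos | apply peval_cont]. }
  assert (cw : forall c j, Cc (fun k => cis (t * cos k) * (cis (INR j * k) * (RtoC (peval c (cos k)) * A k) + cis (- (INR j * k)) * (RtoC (peval c (cos k)) * B k)))%C).
  { intros c' j; Ccs; apply cp. }
  induction c as [|a c IH]; intros j Hj.
  - cbn [papp]. unfold wave. rewrite (cint_ext _ (fun _ => RtoC 0)); [|lra|].
    + unfold cint; simpl. rewrite !RIconst. split; ring.
    + intros; cbn [peval]; ring.
  - simpl in Hj. destruct j as [|j]; [lia|].
    destruct (IH j ltac:(lia)) as [E1 E2]. destruct (IH (S (S j)) ltac:(lia)) as [E3 E4].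
    cbn [papp hop]. rewrite E1, E2, E3, E4.
    set (W := fun c j => wave t (fun k => RtoC (peval c (cos k)) * A k)%C (fun k => RtoC (peval c (cos k)) * B k)%C j).
    set (F := fun c j k => (cis (t * cos k) * (cis (INR j * k) * (RtoC (peval c (cos k)) * A k) + cis (- (INR j * k)) * (RtoC (peval c (cos k)) * B k)))%C) in cw.
    set (F0 := fun k => (cis (t * cos k) * (cis (INR (S j) * k) * A k + cis (- (INR (S j) * k)) * B k))%C).
    assert (cF : forall c j, Cc (F c j)) by exact cw.
    assert (cF0 : Cc F0) by (unfold F0; Ccs).
    assert (E : W (a :: c) (S j) = (RtoC a * wave t A B (S j) + RtoC (/ 2) * (W c j + W c (S (S j))))%C).
    { unfold W, wave. fold F0. fold (F c j) (F c (S (S j))) (F (a :: c) (S j)).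
      rewrite (cint_ext _ (fun k => (RtoC a * F0 k + RtoC (/ 2) * (F c j k + F c (S (S j)) k))%C)); [|lra|].
      2:{ intros k _. unfold F, F0. rewrite !S_INR.
          replace (INR j * k) with ((INR j + 1) * k + - k) by ring.
          replace ((INR j + 1 + 1) * k) with ((INR j + 1) * k + k) by ring. rewrite !Ropp_plus_distr, Ropp_involutive, !cis_plus.
          cbn [peval]. rewrite RtoC_plus, RtoC_mult.
          assert (Ek : RtoC (cos k) = (RtoC (/ 2) * (cis k + cis (- k)))%C).
          { unfold cis, RtoC, Cmult, Cplus; simpl. rewrite cos_neg, sin_neg. f_equal; field. }
          rewrite Ek. ring. }
      rewrite (cint_plus (fun k => RtoC a * F0 k)%C (fun k => RtoC (/ 2) * (F c j k + F c (S (S j)) k))%C).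
      2:{ Ccs. } 2:{ apply Cc_mult; [apply Cc_const | apply (Cc_plus (F c j) (F c (S (S j)))); auto]. }
      rewrite (cint_scal (RtoC a) F0), (cint_scal _ (fun k => F c j k + F c (S (S j)) k)%C), (cint_plus (F c j)); auto.
      - ring.
      - apply (Cc_plus (F c j) (F c (S (S j)))); auto. }
    unfold W in E. rewrite E. simpl. split; req; field; lra.
Qed.

(** Linear vanishing of the amplitude at 0 and PI, the critical points of cos k. *)
Definition sbound (A : R -> C) (Ca : R) : Prop := forall k, 0 <= k <= PI -> Cmod (A k) <= Ca * sin k.

(** A factor e^{i (z + 1) k} is absorbed into the amplitude, which moves the site to distance 1 on
    the incoming side, where [nonstationary] applies. *)
Lemma decay_site A Ca (z : Z) : CC2 A -> sbound A Ca -> exists B, 0 < B /\ forall t, 0 < t ->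
  Cn2 (cint (fun k => (cis (t * cos k) * (cis (IZR z * k) * A k))%C) 0 PI) <= B / sqrt t.
Proof.
  intros HA HC. pose proof PI_RGT_0.
  destruct (nonstationary (fun k => (cis (IZR (z + 1) * k) * A k)%C) Ca) as (B & Bp & HB).
  { cc2. }
  { intros k Hk. rewrite Cmod_mult, Cmod_cis, Rmult_1_l. now apply HC. }
  exists B; split; auto. intros t Ht. specialize (HB t 1%nat Ht ltac:(lia)).
  simpl INR in HB. rewrite sqrt_1, !Rmult_1_r in HB. eapply Rle_trans; [|exact HB]. right. f_equal.
  apply cint_ext; [lra|]. intros k _. rewrite plus_IZR.
  replace (t * cos k - 1 * k) with (t * cos k + - (1 * k)) by ring.
  replace (IZR z * k) with (- (1 * k) + (IZR z + 1) * k) by ring. rewrite !cis_plus. ring.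
Qed.

(** Telescoping against 2 / sqrt m: the term m = 1 gives 1 and all others together at most 2. *)
Lemma inv_zsqrtz_sum n : forall m, rsum (fun z => / (INR z * sqrt (INR z))) (seq (S m) n) <= 3 .
Proof.
  assert (H : forall n m, rsum (fun z => / (INR z * sqrt (INR z))) (seq (S (S m)) n) <= 2 / sqrt (INR (S m)) - 2 / sqrt (INR (S m + n))).
  { clear n. induction n as [|n IH]; intros m.
    - rewrite Nat.add_0_r. unfold rsum; simpl. lra.
    - cbn [seq]. rewrite rsum_cons. specialize (IH (S m)).
      replace (S m + S n)%nat with (S (S m) + n)%nat by lia.
      assert (K : / (INR (S (S m)) * sqrt (INR (S (S m)))) <= 2 / sqrt (INR (S m)) - 2 / sqrt (INR (S (S m)))); [|lra].
      set (a := sqrt (INR (S m))). set (b := sqrt (INR (S (S m)))).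
      assert (p1 : 0 < INR (S m)) by (apply lt_0_INR; lia). assert (p2 : 0 < INR (S (S m))) by (apply lt_0_INR; lia).
      assert (a0 : 0 < a) by now apply sqrt_lt_R0. assert (b0 : 0 < b) by now apply sqrt_lt_R0.
      assert (Ea : a * a = INR (S m)) by (apply sqrt_sqrt; lra). assert (Eb : b * b = INR (S (S m))) by (apply sqrt_sqrt; lra).
      assert (ab : a <= b) by (apply sqrt_le_1; try lra; rewrite (S_INR (S m)); lra).
      rewrite <- Eb. replace (2 / a - 2 / b) with (2 * (b * b - a * a) / (a * b * (a + b))) by (field; lra).
      replace (b * b - a * a) with 1 by (rewrite Ea, Eb, (S_INR (S m)); ring).
      replace (2 * 1 / (a * b * (a + b))) with (/ (a * b * (a + b) / 2)) by (field; lra).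
      assert (Q : a * (a + b) <= b * (2 * b)) by (apply Rmult_le_compat; lra).
      apply Rinv_le_contravar.
      + apply Rdiv_lt_0_compat; [|lra]. repeat apply Rmult_lt_0_compat; lra.
      + replace (a * b * (a + b) / 2) with (b * (a * (a + b)) / 2) by field.
        assert (b * (a * (a + b)) <= b * (b * (2 * b))) by (apply Rmult_le_compat_l; lra). lra. }
  intros m. destruct n as [|n]; [unfold rsum; simpl; lra|].
  destruct m as [|m].
  - specialize (H n 0%nat). change (INR 1) with 1 in H. rewrite sqrt_1 in H.
    cbn [seq]. rewrite rsum_cons. change (INR 1) with 1. rewrite sqrt_1, Rmult_1_r, Rinv_1.
    assert (0 <= 2 / sqrt (INR (1 + n))).
    { apply Rle_div_r. apply sqrt_lt_R0, lt_0_INR; lia. lra. }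
    lra.
  - specialize (H (S n) m). assert (1 <= INR (S m)) by (apply (le_INR 1); lia).
    assert (1 <= sqrt (INR (S m))) by (rewrite <- sqrt_1; apply sqrt_le_1; lra).
    assert (0 <= 2 / sqrt (INR (S m + S n))).
    { apply Rle_div_r. apply sqrt_lt_R0, lt_0_INR; lia. lra. }
    assert (2 / sqrt (INR (S m)) <= 2) by (apply Rle_div_l; lra). lra.
Qed.

Lemma wave_split t A B j : Cc A -> Cc B ->
  wave t A B j = (RtoC (/ (2 * PI)) * cint (fun k => cis (t * cos k) * A k * cis (IZR (Z.of_nat j) * k)) 0 PI
   + RtoC (/ (2 * PI)) * cint (fun k => cis (t * cos k - INR j * k) * B k) 0 PI)%C.
Proof.
  intros HA HB. pose proof PI_RGT_0. unfold wave. rewrite <- Cmult_plus_distr_l. f_equal.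
  rewrite <- cint_plus.
  - apply cint_ext; [lra|]. intros k _. rewrite <- INR_IZR_INZ.
    unfold Rminus. rewrite cis_plus. ring.
  - Ccs.
  - apply (Cc_mult (fun k => cis (t * cos k - INR j * k))); auto. apply CC2_Cc, CC2_cis. c2.
Qed.

Definition l2 (A : R -> C) : R := / (2 * PI) * RInt (fun k => Cn2 (A k)) 0 PI.

Lemma bessel_plus t A l : Cc A -> NoDup l ->
  rsum (fun j => Cn2 (RtoC (/ (2 * PI)) * cint (fun k => cis (t * cos k) * A k * cis (IZR (Z.of_nat j) * k)) 0 PI)%C) l <= l2 A.
Proof.
  intros HA ND. pose proof PI_RGT_0.
  assert (cF : Cc (fun k => cis (t * cos k) * A k)%C) by Ccs.
  assert (ND' : NoDup (map Z.of_nat l)).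
  { apply FinFun.Injective_map_NoDup; auto. intros x y; apply Nat2Z.inj. }
  pose proof (bessel _ _ cF ND') as Hb. rewrite rsum_map in Hb.
  rewrite (RIext _ (fun k => Cn2 (A k))) in Hb; [|lra|].
  2:{ intros; rewrite Cn2_mult, Cn2_cis. req; ring. }
  rewrite (rsum_ext _ (fun j => (/ (2 * PI)) ^ 2 * Cn2 (cint (fun k => (cis (t * cos k) * A k * cis (IZR (Z.of_nat j) * k))%C) 0 PI))).
  2:{ intros; rewrite Cn2_mult, Cn2_RtoC. reflexivity. }
  rewrite rsum_scal. unfold l2.
  replace (/ (2 * PI) * RInt (fun k => Cn2 (A k)) 0 PI) with ((/ (2 * PI)) ^ 2 * (2 * PI * RInt (fun k => Cn2 (A k)) 0 PI)) by (req; field; lra).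
  apply Rmult_le_compat_l; auto. apply pow2_ge_0.
Qed.

Lemma bessel_minus t B l : Cc B -> NoDup l ->
  rsum (fun j => Cn2 (RtoC (/ (2 * PI)) * cint (fun k => cis (t * cos k - INR j * k) * B k) 0 PI)%C) l <= l2 B.
Proof.
  intros HA ND. pose proof PI_RGT_0.
  assert (cF : Cc (fun k => cis (t * cos k) * B k)%C) by Ccs.
  assert (ND' : NoDup (map (fun j => - Z.of_nat j)%Z l)).
  { apply FinFun.Injective_map_NoDup; auto. intros x y; lia. }
  pose proof (bessel _ _ cF ND') as Hb. rewrite rsum_map in Hb.
  rewrite (RIext _ (fun k => Cn2 (B k))) in Hb; [|lra|].
  2:{ intros; rewrite Cn2_mult, Cn2_cis. req; ring. }
  rewrite (rsum_ext _ (fun j => (/ (2 * PI)) ^ 2 * Cn2 (cint (fun k => (cis (t * cos k) * B k * cis (IZR (- Z.of_nat j) * k))%C) 0 PI))).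
  2:{ intros j Hj; rewrite Cn2_mult, Cn2_RtoC. do 2 f_equal. apply cint_ext; [lra|]. intros k _.
      rewrite opp_IZR, <- INR_IZR_INZ. replace (t * cos k - INR j * k) with (t * cos k + - INR j * k) by ring. rewrite cis_plus. ring. }
  rewrite rsum_scal. unfold l2.
  replace (/ (2 * PI) * RInt (fun k => Cn2 (B k)) 0 PI) with ((/ (2 * PI)) ^ 2 * (2 * PI * RInt (fun k => Cn2 (B k)) 0 PI)) by (req; field; lra).
  apply Rmult_le_compat_l; auto. apply pow2_ge_0.
Qed.

(** The site bounds of [nonstationary] are summable, so the total mass of the incoming part vanishes
    as t grows, uniformly in the window of sites. *)
Lemma minus_small A Ca : CC2 A -> sbound A Ca -> exists B, 0 < B /\ forall t m n, 0 < t ->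
  rsum (fun j => Cn2 (RtoC (/ (2 * PI)) * cint (fun k => cis (t * cos k - INR j * k) * A k) 0 PI)%C) (seq (S m) n)
   <= B / sqrt t.
Proof.
  intros HA HC. pose proof PI_RGT_0. destruct (nonstationary A Ca HA HC) as (B & Bp & HB).
  assert (P : 0 < / (2 * PI)) by (apply Rinv_0_lt_compat; lra).
  exists ((/ (2 * PI)) ^ 2 * (B * 3)). split. { apply Rmult_lt_0_compat; [now apply pow_lt | lra]. }
  intros t m n Ht.
  assert (st : 0 < sqrt t) by now apply sqrt_lt_R0.
  apply Rle_trans with (rsum (fun j => (/ (2 * PI)) ^ 2 * (B / sqrt t) * / (INR j * sqrt (INR j))) (seq (S m) n)).
  - apply rsum_le. intros j Hj. apply in_seq in Hj. rewrite Cn2_mult, Cn2_RtoC, Rmult_assoc.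
    apply Rmult_le_compat_l; [apply pow2_ge_0|]. specialize (HB t j Ht ltac:(lia)).
    eapply Rle_trans; [exact HB|]. right. field.
    assert (0 < INR j) by (apply lt_0_INR; lia). assert (0 < sqrt (INR j)) by now apply sqrt_lt_R0. lra.
  - rewrite rsum_scal. pose proof (inv_zsqrtz_sum n m).
    replace ((/ (2 * PI)) ^ 2 * (B * 3) / sqrt t) with ((/ (2 * PI)) ^ 2 * (B / sqrt t) * 3) by (field; lra).
    apply Rmult_le_compat_l; auto. apply Rmult_le_pos; [apply pow2_ge_0 | left; now apply Rdiv_lt_0_compat].
Qed.

Lemma wave_site A B Ca j : CC2 A -> CC2 B -> sbound A Ca -> sbound B Ca ->
  exists K, 0 < K /\ forall t, 0 < t -> Cn2 (wave t A B j) <= K / sqrt t.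
Proof.
  intros HA HB CA CB. pose proof PI_RGT_0.
  destruct (decay_site A Ca (Z.of_nat j) HA CA) as (K1 & P1 & H1).
  destruct (decay_site B Ca (- Z.of_nat j) HB CB) as (K2 & P2 & H2).
  assert (P : 0 < / (2 * PI)) by (apply Rinv_0_lt_compat; lra).
  exists ((/ (2 * PI)) ^ 2 * (2 * K1 + 2 * K2)). split. { apply Rmult_lt_0_compat; [now apply pow_lt | lra]. }
  intros t Ht. unfold wave. rewrite Cn2_mult, Cn2_RtoC.
  assert (st : 0 < sqrt t) by now apply sqrt_lt_R0.
  unfold Rdiv. rewrite Rmult_assoc. apply Rmult_le_compat_l; [apply pow2_ge_0|].
  specialize (H1 t Ht); specialize (H2 t Ht). rewrite opp_IZR, <- INR_IZR_INZ in *.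
  apply CC2_Cc in HA, HB.
  rewrite (cint_ext _ (fun k => cis (t * cos k) * (cis (INR j * k) * A k) + cis (t * cos k) * (cis (- INR j * k) * B k))%C); [|lra|].
  2:{ intros k _. rewrite Ropp_mult_distr_l. ring. }
  rewrite cint_plus by Ccs.
  eapply Rle_trans; [apply (Cn2_weight 1); lra|]. unfold Rdiv in *. rewrite Rinv_1. lra.
Qed.

(** Otherwise infinitely many terms exceed [eps], and the partial sums exceed every multiple of
    [eps]. *)
Lemma bounded_sum_tail (a : nat -> R) K : (forall n, 0 <= a n) -> (forall n, rsum a (seq 1 n) <= K) ->
  forall eps, 0 < eps -> exists J, forall j, (J <= j)%nat -> a j <= eps.
Proof.
  intros a0 HK eps He. apply Classical_Prop.NNPP. intros Hn.
  assert (H : forall J, exists j, (J <= j)%nat /\ eps < a j).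
  { intros J. apply Classical_Prop.NNPP. intros H. apply Hn. exists J. intros j Hj. apply Rnot_lt_le. intros E. apply H; eauto. }
  assert (G : forall m, exists n, INR m * eps <= rsum a (seq 1 n)).
  { induction m as [|m [n IH]].
    - exists 0%nat. unfold rsum; simpl. lra.
    - destruct (H (S n)) as (j & Hj & Hl). exists j. rewrite S_INR.
      replace (seq 1 j) with (seq 1 n ++ seq (1 + n) (j - n)) by (rewrite <- seq_app; f_equal; lia).
      rewrite rsum_app. assert (a j <= rsum a (seq (1 + n) (j - n))) by (apply rsum_in_le; auto; apply in_seq; lia). lra. }
  destruct (nfloor_ex (K / eps) ) as [m [_ Hm]].
  { apply Rle_div_r; auto. specialize (HK 0%nat). unfold rsum in HK; simpl in HK. lra. }
  destruct (G (S m)) as [n Hn']. specialize (HK n). rewrite S_INR in Hn'.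
  apply (Rmult_lt_compat_r eps) in Hm; auto. unfold Rdiv in Hm. rewrite Rmult_assoc, Rinv_l in Hm by lra. lra.
Qed.

Lemma C2_peval c f : C2 f -> C2 (fun x => peval c (f x)).
Proof.
  intros Hf. induction c as [|a c IH]; cbn [peval]; [apply C2_const|].
  apply (C2_plus (fun _ => a)); [apply C2_const|]. now apply C2_mult.
Qed.

Definition trunc (J : nat) (u : nat -> R) (j : nat) : R :=
  if (Nat.leb 1 j && Nat.leb j J)%bool then u j else 0.

Lemma trunc_in J u j : (1 <= j <= J)%nat -> trunc J u j = u j.
Proof. intros H. unfold trunc. now rewrite (proj2 (Nat.leb_le 1 j)), (proj2 (Nat.leb_le j J)) by lia. Qed.
Lemma trunc_out J u j : (j = 0 \/ J < j)%nat -> trunc J u j = 0.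
Proof.
  intros H. unfold trunc. destruct (Nat.leb_spec 1 j), (Nat.leb_spec j J); simpl; auto; lia.
Qed.
Lemma trunc_abs J u j m : 0 <= m -> ((1 <= j <= J)%nat -> Rabs (u j) <= m) -> Rabs (trunc J u j) <= m.
Proof.
  intros Hm H. destruct (Nat.leb_spec 1 j), (Nat.leb_spec j J);
  try (rewrite trunc_out by lia; rewrite Rabs_R0; lra). rewrite trunc_in by lia. apply H; lia.
Qed.

Lemma qf_trunc f u J : qf f u J = qf f (trunc J u) J.
Proof.
  unfold qf. f_equal. apply RInt_ext. intros q _. change (f (cos q) * sines u J q ^ 2 = f (cos q) * sines (trunc J u) J q ^ 2).
  f_equal. f_equal. apply rsum_ext. intros j Hj. apply in_seq in Hj. rewrite trunc_in by lia. reflexivity.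
Qed.

Lemma site_max A B Ca n : CC2 A -> CC2 B -> sbound A Ca -> sbound B Ca ->
  exists K, 0 < K /\ forall t j, 0 < t -> (j <= n)%nat -> Cn2 (wave t A B j) <= K / sqrt t.
Proof.
  intros HA HB CA CB. induction n as [|n (K & K0 & HK)].
  - destruct (wave_site A B Ca 0 HA HB CA CB) as (K & K0 & HK). exists K; split; auto.
    intros t j Ht Hj. replace j with 0%nat by lia. auto.
  - destruct (wave_site A B Ca (S n) HA HB CA CB) as (K' & K0' & HK'). exists (K + K'); split; [lra|].
    intros t j Ht Hj. assert (st : 0 < / sqrt t) by now apply Rinv_0_lt_compat, sqrt_lt_R0.
    unfold Rdiv in *. rewrite Rmult_plus_distr_r.
    assert (0 < K * / sqrt t) by (apply Rmult_lt_0_compat; auto).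
    assert (0 < K' * / sqrt t) by (apply Rmult_lt_0_compat; auto).
    destruct (Nat.eq_dec j (S n)) as [->|]; [specialize (HK' t Ht)|specialize (HK t j Ht ltac:(lia))]; lra.
Qed.

Lemma parts_le z e : 0 <= e -> Cn2 z <= e -> Rabs (fst z) <= sqrt e /\ Rabs (snd z) <= sqrt e.
Proof.
  intros He H. unfold Cn2 in H. pose proof (pow2_ge_0 (fst z)). pose proof (pow2_ge_0 (snd z)).
  split; rewrite <- sqrt_Rsqr_abs; apply sqrt_le_1; unfold Rsqr; nra.
Qed.

Lemma wave_sum t A B l : Cc A -> Cc B -> NoDup l ->
  rsum (fun j => Cn2 (wave t A B j)) l <= 2 * l2 A + 2 * l2 B.
Proof.
  intros HA HB ND.
  eapply Rle_trans.
  { apply rsum_le. intros j _. rewrite wave_split by auto. apply (Cn2_weight 1). lra. }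
  rewrite rsum_plus, !rsum_scal, Rinv_1.
  pose proof (bessel_plus t A l HA ND). pose proof (bessel_minus t B l HB ND). lra.
Qed.

Lemma l2_pos A : Cc A -> 0 <= l2 A.
Proof.
  intros HA. pose proof PI_RGT_0. apply Rmult_le_pos; [left; apply Rinv_0_lt_compat; lra|].
  apply RIpos; [lra | now apply Cc_Cn2 | intros; apply Cn2_pos].
Qed.

(** The upper inequality bounds the form of f(h) by |p(h) u|^2; the lower one turns p^2 back into f
    in the integral over the outgoing amplitude. *)
Definition sq_approx (f : R -> R) : Prop := forall eps, 0 < eps -> exists c, forall x, -1 <= x <= 1 ->
  f x <= peval c x ^ 2 + eps /\ peval c x ^ 2 <= f x + eps.

(** Serves near the two ends of the truncated half-line, where p(h) u is not a wave but all relevant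
    entries of [u] are small. Site 0 is exempt because [trunc] clears it. *)
Lemma papp_pair_bound c u e j : 0 <= e ->
  (forall i, (i <= j + length c)%nat -> (j <= i + length c)%nat -> Cn2 (u i) <= e \/ i = 0%nat) -> forall J,
  papp c (trunc J (fun i => fst (u i))) j ^ 2 + papp c (trunc J (fun i => snd (u i))) j ^ 2 <= 2 * l1 c ^ 2 * e.
Proof.
  intros He H J.
  assert (Q : forall g, (forall i, (i <= j + length c)%nat -> (j <= i + length c)%nat -> i <> 0%nat -> Rabs (g i) <= sqrt e) ->
    papp c (trunc J g) j ^ 2 <= l1 c ^ 2 * e).
  { intros g Hg. rewrite <- pow2_abs. replace (l1 c ^ 2 * e) with ((l1 c * sqrt e) ^ 2).
    2:{ rewrite Rpow_mult_distr. f_equal. rewrite pow2_sqrt; auto. }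
    apply pow_incr. split; [apply Rabs_pos|]. apply papp_bound; [apply sqrt_pos|].
    intros i H1 H2. apply trunc_abs; [apply sqrt_pos|]. intros; apply Hg; auto; lia. }
  assert (Q1 : papp c (trunc J (fun i => fst (u i))) j ^ 2 <= l1 c ^ 2 * e).
  { apply Q. intros i H1 H2 H3. destruct (H i H1 H2); [|lia]. now apply parts_le. }
  assert (Q2 : papp c (trunc J (fun i => snd (u i))) j ^ 2 <= l1 c ^ 2 * e).
  { apply Q. intros i H1 H2 H3. destruct (H i H1 H2); [|lia]. now apply parts_le. }
  lra.
Qed.

Lemma large_sqrt a : 0 <= a -> exists T, 0 < T /\ forall t, T <= t -> a / sqrt t <= 1.
Proof.
  intros Ha. exists (a ^ 2 + 1). pose proof (pow2_ge_0 a). split; [lra|]. intros t Ht.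
  assert (0 < sqrt t) by (apply sqrt_lt_R0; lra). apply Rle_div_l; auto. rewrite Rmult_1_l.
  rewrite <- (sqrt_pow2 a) by auto. apply sqrt_le_1; lra.
Qed.

(* With [p ^ 2] close to [f], the form becomes [|p(h) u|^2] on the half-line.  Away from its two ends
   [p(h) u] is again a wave, with amplitudes multiplied by [p (cos k)]; the outgoing part is controlled by
   Bessel's inequality, the incoming part by the nonstationary bound. *)
Lemma halfline f Ap Am Ca : (forall x, continuous f x) -> sq_approx f ->
  CC2 Ap -> CC2 Am -> sbound Ap Ca -> sbound Am Ca ->
  forall eps, 0 < eps -> exists T, 0 < T /\ forall t, T <= t -> exists J0, forall J, (J0 <= J)%nat ->
   qf f (fun j => fst (wave t Ap Am j)) J + qf f (fun j => snd (wave t Ap Am j)) J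
     <= / (2 * PI) * RInt (fun k => f (cos k) * Cn2 (Ap k)) 0 PI + eps.
Proof.
  intros cf Hsq cAp cAm bAp bAm eps He. pose proof PI_RGT_0 as HP.
  assert (cA := CC2_Cc _ cAp). assert (cB := CC2_Cc _ cAm).
  set (N := l2 Ap + l2 Am + 1). assert (N1 : 1 <= N) by (unfold N; pose proof (l2_pos _ cA); pose proof (l2_pos _ cB); lra).
  (* The approximation error multiplies squared norms of the wave, which are bounded by multiples of
     [N]. *)
  set (e1 := eps / (8 * N)). assert (e1p : 0 < e1) by (apply Rdiv_lt_0_compat; lra).
  destruct (Hsq e1 e1p) as [c Hc]. set (d := length c). set (L := l1 c). assert (L0 : 0 <= L) by apply l1_pos.
  set (p := fun k => peval c (cos k)).
  assert (Cp2 : C2 p) by (apply C2_peval; c2).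
  assert (cp : forall x, continuous p x) by now apply C2_cont.
  set (Ap' := fun k => (RtoC (p k) * Ap k)%C). set (Am' := fun k => (RtoC (p k) * Am k)%C).
  assert (cAp' : CC2 Ap') by (apply CC2_mult; auto; now apply CC2_RtoC).
  assert (cAm' : CC2 Am') by (apply CC2_mult; auto; now apply CC2_RtoC).
  destruct (cont_bound p 0 PI cp) as (Cp & Cp0 & HCp).
  assert (bAm' : sbound Am' (Cp * Ca)).
  { intros k Hk. unfold Am'. rewrite Cmod_mult, Cmod_R, Rmult_assoc.
    apply Rmult_le_compat; auto using Rabs_pos, Cmod_ge_0. }
  destruct (minus_small Am' _ cAm' bAm') as (Bm & Bm0 & HBm).
  destruct (site_max Ap Am Ca (2 * d) cAp cAm bAp bAm) as (K & K0 & HK).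
  set (I := / (2 * PI) * RInt (fun k => f (cos k) * Cn2 (Ap k)) 0 PI).
  (* Weight of the cross terms between the outgoing and incoming parts: small enough for
     [dl * I <= eps / 8], and fixed before t, so that / dl times the incoming mass still tends to
     0. *)
  set (dl := Rmin 1 (eps / (8 * (Rabs I + 1)))).
  assert (I1 : 0 < 8 * (Rabs I + 1)) by (pose proof (Rabs_pos I); lra).
  assert (dl0 : 0 < dl) by (apply Rmin_glb_lt; [lra | now apply Rdiv_lt_0_compat]).
  assert (dl1 : dl <= 1) by apply Rmin_l.
  assert (dlI : dl * I <= eps / 8).
  { apply Rle_trans with (dl * Rabs I); [apply Rmult_le_compat_l; [lra | apply Rle_abs]|].
    assert (dl <= eps / (8 * (Rabs I + 1))) by apply Rmin_r.
    apply Rle_trans with (eps / (8 * (Rabs I + 1)) * Rabs I).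
    - apply Rmult_le_compat_r; auto using Rabs_pos.
    - apply Rle_trans with (eps / 8 * (Rabs I / (Rabs I + 1))); [right; field; pose proof (Rabs_pos I); lra|].
      rewrite <- (Rmult_1_r (eps / 8)) at 2. apply Rmult_le_compat_l; [lra|]. apply Rle_div_l; lra. }
  destruct (large_sqrt ((INR d * (2 * L ^ 2 * K) + (1 + / dl) * Bm) / (eps / 8))) as (T & T0 & HT).
  { apply Rle_div_r; [lra|]. rewrite Rmult_0_l. apply Rplus_le_le_0_compat.
    - apply Rmult_le_pos; [apply pos_INR|]. apply Rmult_le_pos; [|lra]. pose proof (pow2_ge_0 L); lra.
    - apply Rmult_le_pos; [|lra]. pose proof (Rinv_0_lt_compat _ dl0). lra. }
  exists T; split; auto. intros t Ht. assert (t0 : 0 < t) by lra. assert (st : 0 < sqrt t) by now apply sqrt_lt_R0.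
  specialize (HT t Ht).
  set (u := wave t Ap Am).
  (* At fixed t the wave is square summable, hence below [eta] beyond some [J1] that depends on t;
     this controls the 2 d sites around the cut [J]. *)
  set (eta := eps / (8 * (INR (2 * d) * (2 * L ^ 2) + 1))).
  assert (dp : 0 <= INR (2 * d) * (2 * L ^ 2)) by (apply Rmult_le_pos; [apply pos_INR | pose proof (pow2_ge_0 L); lra]).
  assert (eta0 : 0 < eta) by (apply Rdiv_lt_0_compat; lra).
  destruct (bounded_sum_tail (fun j => Cn2 (u j)) (2 * l2 Ap + 2 * l2 Am)) with (eps := eta) as [J1 HJ1]; auto.
  { intros; apply Cn2_pos. } { intros; apply wave_sum; auto using seq_NoDup. }
  exists (J1 + 2 * d)%nat. intros J HJ.
  set (ur := trunc J (fun j => fst (u j))). set (ui := trunc J (fun j => snd (u j))).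
  rewrite (qf_trunc f (fun j => fst (u j))), (qf_trunc f (fun j => snd (u j))). fold ur ui.
  assert (Hr := qf_poly f c e1 ur J cf (trunc_out J _ 0 ltac:(lia)) (fun j h => trunc_out J _ j (or_intror h)) (fun x h => proj1 (Hc x h))).
  assert (Hi := qf_poly f c e1 ui J cf (trunc_out J _ 0 ltac:(lia)) (fun j h => trunc_out J _ j (or_intror h)) (fun x h => proj1 (Hc x h))).
  assert (Su : rsum (fun j => ur j ^ 2) (seq 1 J) + rsum (fun j => ui j ^ 2) (seq 1 J) <= 2 * N).
  { rewrite <- rsum_plus. rewrite (rsum_ext _ (fun j => Cn2 (u j))).
    - eapply Rle_trans; [apply wave_sum; auto using seq_NoDup|]. unfold N; lra.
    - intros j Hj. apply in_seq in Hj. unfold ur, ui. rewrite !trunc_in by lia. reflexivity. }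
  set (P := fun j => papp c ur j ^ 2 + papp c ui j ^ 2).
  (* The sites 1..d feel the origin and J - d + 1..J + d feel the truncation; in between p(h) u is
     exactly the wave with amplitudes [Ap'] and [Am']. *)
  assert (SP : rsum P (seq 1 (J + d)) <= I + eps / 8 + eps / 8 + 2 * (e1 * N) + eps / 8).
  { replace (seq 1 (J + d)) with (seq 1 d ++ seq (1 + d) (J - 2 * d) ++ seq (1 + (J - d)) (2 * d)).
    2:{ replace (1 + (J - d))%nat with ((1 + d) + (J - 2 * d))%nat by lia. rewrite <- !seq_app. f_equal; lia. }
    rewrite !rsum_app.
    assert (Low : rsum P (seq 1 d) <= INR d * (2 * L ^ 2 * K) / sqrt t).
    { apply Rle_trans with (rsum (fun _ => 2 * L ^ 2 * (K / sqrt t)) (seq 1 d)).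
      - apply rsum_le. intros j Hj. apply in_seq in Hj. apply papp_pair_bound; [left; now apply Rdiv_lt_0_compat|].
        intros i H1 H2. left. apply HK; auto. fold d in H1. lia.
      - rewrite rsum_const, length_seq. right. field. lra. }
    assert (High : rsum P (seq (1 + (J - d)) (2 * d)) <= eps / 8).
    { apply Rle_trans with (rsum (fun _ => 2 * L ^ 2 * eta) (seq (1 + (J - d)) (2 * d))).
      - apply rsum_le. intros j Hj. apply in_seq in Hj. apply papp_pair_bound; [lra|].
        intros i H1 H2. left. apply HJ1. fold d in H2. lia.
      - rewrite rsum_const, length_seq. unfold eta.
        apply Rle_trans with (eps / 8 * (INR (2 * d) * (2 * L ^ 2) / (INR (2 * d) * (2 * L ^ 2) + 1))); [right; field; lra|].
        rewrite <- (Rmult_1_r (eps / 8)) at 2. apply Rmult_le_compat_l; [lra|]. apply Rle_div_l; lra. }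
    assert (Mid : rsum P (seq (1 + d) (J - 2 * d)) <= (1 + dl) * (I + e1 * N) + (1 + / dl) * (Bm / sqrt t)).
    { rewrite (rsum_ext _ (fun j => Cn2 (wave t Ap' Am' j))).
      2:{ intros j Hj. apply in_seq in Hj. unfold P.
          destruct (papp_wave c t Ap Am j cA cB) as [E1 E2]; [fold d; lia|]. unfold Cn2, Ap', Am', p.
          rewrite <- E1, <- E2. f_equal; f_equal; apply papp_local; intros i H1 H2; fold d in H1, H2;
            unfold ur, ui; rewrite trunc_in by lia; reflexivity. }
      eapply Rle_trans.
      { apply rsum_le. intros j _. rewrite wave_split by (now apply CC2_Cc). apply (Cn2_weight dl). lra. }
      rewrite rsum_plus, !rsum_scal. apply Rplus_le_compat.
      - apply Rmult_le_compat_l; [lra|]. eapply Rle_trans; [apply bessel_plus; [now apply CC2_Cc | apply seq_NoDup]|].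
        apply Rle_trans with (I + e1 * l2 Ap).
        2:{ apply Rplus_le_compat_l, Rmult_le_compat_l; [lra|]. unfold N. pose proof (l2_pos _ cB). lra. }
        unfold I, l2. replace (e1 * (/ (2 * PI) * RInt (fun k => Cn2 (Ap k)) 0 PI)) with (/ (2 * PI) * (e1 * RInt (fun k => Cn2 (Ap k)) 0 PI)) by (req; ring).
        rewrite <- Rmult_plus_distr_l. apply Rmult_le_compat_l; [left; apply Rinv_0_lt_compat; lra|].
        assert (cfc : forall x, continuous (fun k => f (cos k) * Cn2 (Ap k)) x).
        { intros x. apply cmult; [apply (ccomp f cos); auto using ccos | now apply Cc_Cn2]. }
        rewrite <- RIscal, <- RIplus; auto using Cc_Cn2. 2:{ intros; apply cmult; [apply cconst | now apply Cc_Cn2]. }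
        apply RIle; [lra | apply Cc_Cn2; now apply CC2_Cc | intros; apply cplus; auto; apply cmult; [apply cconst | now apply Cc_Cn2] |].
        intros k _. unfold Ap', p. rewrite Cn2_mult, Cn2_RtoC, <- Rmult_plus_distr_r.
        apply Rmult_le_compat_r; [apply Cn2_pos|]. apply Hc, COS_bound.
      - apply Rmult_le_compat_l; [pose proof (Rinv_0_lt_compat _ dl0); lra|]. apply (HBm t d); auto. }
    assert (HTs : INR d * (2 * L ^ 2 * K) / sqrt t + (1 + / dl) * (Bm / sqrt t) <= eps / 8).
    { replace ((INR d * (2 * L ^ 2 * K) + (1 + / dl) * Bm) / (eps / 8) / sqrt t) with
       ((INR d * (2 * L ^ 2 * K) / sqrt t + (1 + / dl) * (Bm / sqrt t)) / (eps / 8)) in HT by (field; repeat split; lra).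
      apply Rle_div_l in HT; lra. }
    assert (dl * (e1 * N) <= 1 * (e1 * N)) by (apply Rmult_le_compat_r; [apply Rmult_le_pos|]; lra).
    lra. }
  unfold P in SP. rewrite rsum_plus in SP. fold d in Hr, Hi.
  assert (e1 * (rsum (fun j => ur j ^ 2) (seq 1 J) + rsum (fun j => ui j ^ 2) (seq 1 J)) <= e1 * (2 * N)) by (apply Rmult_le_compat_l; lra).
  assert (e1 * N = eps / 8) by (unfold e1; field; lra).
  lra.
Qed.

(** * Bernstein polynomials *)

(** Expectation of g over a binomial variable with m trials, built by conditioning on one trial;
    means and variances then follow by induction without binomial coefficients. *)
Fixpoint bmean (p q : R) (m : nat) (g : nat -> R) : R :=
  match m with O => g O | S m' => p * bmean p q m' (fun k => g (S k)) + q * bmean p q m' g end.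

Lemma binom_sum_S p q m g :
  sum_f_R0 (fun k => g k * Binomial.C (S m) k * (p ^ k * q ^ (S m - k))) (S m) =
  p * sum_f_R0 (fun k => g (S k) * Binomial.C m k * (p ^ k * q ^ (m - k))) m +
  q * sum_f_R0 (fun k => g k * Binomial.C m k * (p ^ k * q ^ (m - k))) m.
Proof.
  destruct m as [|m].
  - simpl. unfold Binomial.C; simpl. field.
  - rewrite decomp_sum by lia. simpl pred.
    rewrite (decomp_sum (fun k => g k * Binomial.C (S m) k * (p ^ k * q ^ (S m - k))) (S m)) by lia. simpl pred.
    rewrite (tech5 (fun i => g (S i) * Binomial.C (S (S m)) (S i) * (p ^ S i * q ^ (S (S m) - S i)))).
    rewrite (tech5 (fun k => g (S k) * Binomial.C (S m) k * (p ^ k * q ^ (S m - k)))).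
    rewrite (sum_eq (fun i => g (S i) * Binomial.C (S (S m)) (S i) * (p ^ S i * q ^ (S (S m) - S i)))
      (fun i => g (S i) * Binomial.C (S m) i * (p ^ i * q ^ (S m - i)) * p +
                g (S i) * Binomial.C (S m) (S i) * (p ^ S i * q ^ (S m - S i)) * q)).
    2:{ intros i Hi. rewrite <- pascal by lia. replace (S (S m) - S i)%nat with (S (S m - S i)) by lia.
        replace (S m - i)%nat with (S (S m - S i)) by lia. simpl pow. ring. }
    rewrite plus_sum, <- !scal_sum.
    assert (E : forall n, Binomial.C n n = 1) by (intros n; unfold Binomial.C; rewrite Nat.sub_diag; simpl; field; apply INR_fact_neq_0).
    assert (E0 : forall n, Binomial.C n 0 = 1) by (intros n; unfold Binomial.C; rewrite Nat.sub_0_r; simpl; field; apply INR_fact_neq_0).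
    rewrite !E, !E0, !Nat.sub_diag, !Nat.sub_0_r. simpl pow.
    ring.
Qed.

Lemma bmean_binom p q m g :
  sum_f_R0 (fun k => g k * Binomial.C m k * (p ^ k * q ^ (m - k))) m = bmean p q m g.
Proof.
  revert g. induction m as [|m IH]; intros g.
  - simpl. unfold Binomial.C; simpl. field.
  - rewrite binom_sum_S. simpl. now rewrite <- !IH.
Qed.

Lemma bmean_le p q m g h : 0 <= p -> 0 <= q -> (forall k, (k <= m)%nat -> g k <= h k) -> bmean p q m g <= bmean p q m h.
Proof.
  intros Hp Hq. revert g h. induction m as [|m IH]; intros g h H; simpl; [auto|].
  apply Rplus_le_compat; apply Rmult_le_compat_l; auto; apply IH; intros; apply H; lia.
Qed.
Lemma bmean_lin p q m g h a b : bmean p q m (fun k => a * g k + b * h k) = a * bmean p q m g + b * bmean p q m h.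
Proof. revert g h. induction m as [|m IH]; intros g h; simpl; [reflexivity|]. rewrite !IH. ring. Qed.
Lemma bmean_ext p q m g h : (forall k, g k = h k) -> bmean p q m g = bmean p q m h.
Proof. revert g h. induction m as [|m IH]; intros g h H; simpl; auto. f_equal; f_equal; apply IH; auto. Qed.
Lemma bmean_const p q m c : p + q = 1 -> bmean p q m (fun _ => c) = c.
Proof. intros E. induction m as [|m IH]; simpl; auto. rewrite IH. replace c with (c * (p + q)) at 3 by (rewrite E; ring). ring. Qed.
Lemma bmean_var p q m a : p + q = 1 ->
  bmean p q m (fun k => (INR k - a) ^ 2) = INR m * (p * q) + (INR m * p - a) ^ 2.
Proof.
  intros E. revert a. induction m as [|m IH]; intros a.
  - simpl. ring.
  - cbn [bmean]. rewrite (bmean_ext p q m (fun k => (INR (S k) - a) ^ 2) (fun k => (INR k - (a - 1)) ^ 2)).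
    2:{ intros k; rewrite S_INR; ring. } rewrite !IH, S_INR. replace q with (1 - p) by lra. ring.
Qed.

Definition bern (g : R -> R) (m : nat) (x : R) : R :=
  bmean ((1 + x) / 2) ((1 - x) / 2) m (fun k => g (-1 + 2 * INR k / INR m)).

(** Uniform continuity in the shape that fits a variance: a constant plus a multiple of the squared
    distance can be averaged directly. *)
Definition modc (g : R -> R) : Prop := forall d, 0 < d -> exists K, 0 <= K /\
  forall x y, -1 <= x <= 1 -> -1 <= y <= 1 -> Rabs (g y - g x) <= d + K * (y - x) ^ 2.

(** Chebyshev's argument: the average of the bound in [modc] is d plus K times the variance 4 p q /
    m, which is at most 1 / m. *)
Lemma bern_conv g : modc g -> forall eps, 0 < eps -> exists M, forall m, (M <= m)%nat ->
  forall x, -1 <= x <= 1 -> Rabs (bern g m x - g x) <= eps.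
Proof.
  intros Hg eps He. destruct (Hg (eps / 2)) as (K & K0 & HK); [lra|].
  destruct (nfloor_ex (2 * K / eps)) as [M [_ HM]]. { apply Rle_div_r; lra. }
  exists (S M). intros m Hm x Hx. assert (m0 : 0 < INR m) by (apply lt_0_INR; lia).
  set (p := (1 + x) / 2). set (q := (1 - x) / 2). assert (pq : p + q = 1) by (unfold p, q; field).
  assert (p0 : 0 <= p) by (unfold p; lra). assert (q0 : 0 <= q) by (unfold q; lra).
  assert (Hy : forall k, (k <= m)%nat -> -1 <= -1 + 2 * INR k / INR m <= 1).
  { intros k Hk. assert (0 <= 2 * INR k / INR m). { apply Rle_div_r; auto. pose proof (pos_INR k). lra. }
    assert (2 * INR k / INR m <= 2). { apply Rle_div_l; auto. apply le_INR in Hk. lra. } lra. }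
  assert (B : bmean p q m (fun k => eps / 2 + K * (-1 + 2 * INR k / INR m - x) ^ 2) <= eps).
  { rewrite (bmean_ext p q m _ (fun k => 1 * (eps / 2) + (K * (4 / INR m ^ 2)) * (INR k - INR m * p) ^ 2)).
    2:{ intros k. unfold p. field. lra. }
    rewrite bmean_lin, bmean_const, bmean_var by auto.
    replace (INR m * p - INR m * p) with 0 by ring.
    assert (p * q <= / 4).
    { assert (0 <= (p - q) ^ 2) by apply pow2_ge_0. assert ((p + q) ^ 2 = 1) by (rewrite pq; ring). clearbody p q. nra. }
    apply Rle_trans with (eps / 2 + K / INR m).
    - replace (1 * (eps / 2) + K * (4 / INR m ^ 2) * (INR m * (p * q) + 0 ^ 2)) with (eps / 2 + K / INR m * (4 * (p * q))) by (field; lra).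
      apply Rplus_le_compat_l. rewrite <- (Rmult_1_r (K / INR m)) at 2. apply Rmult_le_compat_l; [|lra].
      apply Rle_div_r; auto. lra.
    - assert (K / INR m <= eps / 2); [|lra]. apply Rle_div_l; auto.
      apply le_INR in Hm. rewrite S_INR in Hm. apply (Rmult_lt_compat_r (eps / 2)) in HM; [|lra].
      replace (2 * K / eps * (eps / 2)) with K in HM by (field; lra).
      apply (Rmult_le_compat_r (eps / 2)) in Hm; lra. }
  assert (E : g x = bmean p q m (fun _ => g x)) by now rewrite bmean_const.
  unfold bern. fold p q. rewrite E. apply Rabs_le. split.
  - assert (H : bmean p q m (fun k => 1 * g x + -1 * (eps / 2 + K * (-1 + 2 * INR k / INR m - x) ^ 2)) <= bmean p q m (fun k => g (-1 + 2 * INR k / INR m))).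
    { apply bmean_le; auto. intros k Hk. specialize (HK x _ Hx (Hy k Hk)). apply Rabs_le_between in HK. lra. }
    rewrite bmean_lin in H. lra.
  - assert (H : bmean p q m (fun k => g (-1 + 2 * INR k / INR m)) <= bmean p q m (fun k => 1 * g x + 1 * (eps / 2 + K * (-1 + 2 * INR k / INR m - x) ^ 2))).
    { apply bmean_le; auto. intros k Hk. specialize (HK x _ Hx (Hy k Hk)). apply Rabs_le_between in HK. lra. }
    rewrite bmean_lin in H. lra.
Qed.

Fixpoint padd (c d : list R) : list R :=
  match c, d with nil, _ => d | _, nil => c | a :: c', b :: d' => (a + b) :: padd c' d' end.
Lemma peval_padd c d x : peval (padd c d) x = peval c x + peval d x.
Proof. revert d. induction c as [|a c IH]; intros [|b d]; simpl; try ring. rewrite IH; ring. Qed.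
Lemma peval_scal a c x : peval (map (Rmult a) c) x = a * peval c x.
Proof. induction c as [|b c IH]; simpl; [ring|]. rewrite IH; ring. Qed.

Lemma bmean_poly m : forall g, exists c, forall x, peval c x = bmean ((1 + x) / 2) ((1 - x) / 2) m g.
Proof.
  induction m as [|m IH]; intros g; simpl.
  - exists [g O]. intros; simpl; ring.
  - destruct (IH (fun k => g (S k))) as [c Hc]. destruct (IH g) as [d Hd].
    exists (padd (padd (map (Rmult (/ 2)) c) (0 :: map (Rmult (/ 2)) c)) (padd (map (Rmult (/ 2)) d) (0 :: map (Rmult (- / 2)) d))).
    intros x. rewrite !peval_padd. simpl. rewrite !peval_scal, Hc, Hd. field.
Qed.

Lemma sq_approx_of f g : modc g -> (forall x, -1 <= x <= 1 -> f x = g x ^ 2 /\ 0 <= g x <= 1) -> sq_approx f.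
Proof.
  intros Hg Hf eps He. set (e := Rmin 1 (eps / 3)).
  assert (e0 : 0 < e) by (apply Rmin_glb_lt; lra). assert (e1 : e <= 1) by apply Rmin_l. assert (e2 : e <= eps / 3) by apply Rmin_r.
  destruct (bern_conv g Hg e e0) as [M HM]. destruct (bmean_poly M (fun k => g (-1 + 2 * INR k / INR M))) as [c Hc].
  exists c. intros x Hx. rewrite Hc. specialize (HM M (le_n _) x Hx). unfold bern in HM.
  set (b := bmean _ _ _ _) in *. destruct (Hf x Hx) as [-> [g0 g1]]. apply Rabs_le_between in HM.
  split; nra.
Qed.

(** * The Fermi function and global continuity *)

Definition logis (b y : R) : R := / (1 + exp (- (b * y))).

Lemma logis_den b y : 0 < 1 + exp (- (b * y)).
Proof. pose proof (exp_pos (- (b * y))). lra. Qed.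
Lemma logis_pos b y : 0 < logis b y.
Proof. apply Rinv_0_lt_compat, logis_den. Qed.
Lemma logis_lt1 b y : logis b y < 1.
Proof. unfold logis. rewrite <- Rinv_1. apply Rinv_lt_contravar; pose proof (exp_pos (- (b * y))); lra. Qed.
Lemma logis_deriv b y : is_derive (logis b) y (b * (logis b y * (1 - logis b y))).
Proof.
  unfold logis. pose proof (logis_den b y). auto_derive; [lra|]. req. field. lra.
Qed.
Lemma logis_cont b y : continuous (logis b) y.
Proof. eapply dcont, logis_deriv. Qed.
Lemma logis_lip b x y : 0 <= b -> Rabs (logis b y - logis b x) <= b * Rabs (y - x).
Proof.
  intros Hb. destruct (MVT_gen (logis b) x y (fun z => b * (logis b z * (1 - logis b z)))) as [c [_ E]].
  - intros z _. apply logis_deriv.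
  - intros z _. apply continuity_pt_filterlim, logis_cont.
  - rewrite E, Rabs_mult. apply Rmult_le_compat_r; [apply Rabs_pos|].
    pose proof (logis_pos b c). pose proof (logis_lt1 b c).
    rewrite Rabs_pos_eq; [|apply Rmult_le_pos; nra]. assert (logis b c * (1 - logis b c) <= 1) by nra. nra.
Qed.
Lemma lip_modc g K : (forall x y, -1 <= x <= 1 -> -1 <= y <= 1 -> Rabs (g y - g x) <= K * Rabs (y - x)) -> modc g.
Proof.
  intros H d Hd. exists (K ^ 2 / d). split. { apply Rle_div_r; auto. rewrite Rmult_0_l. apply pow2_ge_0. }
  intros x y Hx Hy. eapply Rle_trans; [apply H; auto|]. rewrite <- (pow2_abs (y - x)). set (r := Rabs (y - x)).
  apply Rmult_le_reg_l with d; auto. replace (d * (d + K ^ 2 / d * r ^ 2)) with (d ^ 2 + (K * r) ^ 2) by (field; lra).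
  assert (0 <= (d - K * r) ^ 2) by apply pow2_ge_0. assert (0 <= d ^ 2) by apply pow2_ge_0. assert (0 <= (K * r) ^ 2) by apply pow2_ge_0. nra.
Qed.
Lemma logis_modc b : 0 <= b -> modc (logis b).
Proof. intros; apply (lip_modc _ b). intros; now apply logis_lip. Qed.

(** On [-1, 1] the Fermi function stays above its value at -1, so its square root is Lipschitz there
    and is approximated by Bernstein polynomials. *)
Lemma logis_sq_approx b : 0 <= b -> sq_approx (logis b).
Proof.
  intros Hb. apply (sq_approx_of _ (fun x => sqrt (logis b x))).
  - set (m := logis b (-1)). assert (m0 : 0 < m) by apply logis_pos.
    assert (Hm : forall x, -1 <= x <= 1 -> m <= logis b x).
    { intros x Hx. unfold m, logis. apply Rinv_le_contravar; [apply logis_den|]. apply Rplus_le_compat_l.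
      destruct (Req_dec (b * x) (b * -1)) as [->|]; [lra|]. left. apply exp_increasing. nra. }
    assert (sm : 0 < sqrt m) by now apply sqrt_lt_R0.
    apply (lip_modc _ (b / sqrt m)). intros x y Hx Hy.
    assert (S1 : sqrt m <= sqrt (logis b x)) by (apply sqrt_le_1; [lra | left; apply logis_pos | auto]).
    assert (S2 : sqrt m <= sqrt (logis b y)) by (apply sqrt_le_1; [lra | left; apply logis_pos | auto]).
    assert (E : (sqrt (logis b y) - sqrt (logis b x)) * (sqrt (logis b y) + sqrt (logis b x)) = logis b y - logis b x).
    { pose proof (sqrt_sqrt (logis b x) (Rlt_le _ _ (logis_pos b x))). pose proof (sqrt_sqrt (logis b y) (Rlt_le _ _ (logis_pos b y))). nra. }
    pose proof (logis_lip b x y Hb) as HL. rewrite <- E, Rabs_mult, (Rabs_pos_eq (_ + _)) in HL by lra.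
    set (D := Rabs (sqrt (logis b y) - sqrt (logis b x))) in *. assert (0 <= D) by apply Rabs_pos.
    apply Rmult_le_reg_r with (sqrt m); auto. replace (b / sqrt m * Rabs (y - x) * sqrt m) with (b * Rabs (y - x)) by (field; lra).
    eapply Rle_trans; [|exact HL]. apply Rmult_le_compat_l; lra.
  - intros x _. pose proof (logis_pos b x). pose proof (logis_lt1 b x). split.
    + rewrite pow2_sqrt; lra.
    + split; [apply sqrt_pos|]. rewrite <- sqrt_1. apply sqrt_le_1; lra.
Qed.

Definition gcont (g : R -> R) : Prop := forall x, continuous g x.

Lemma gcont_const c : gcont (fun _ => c).
Proof. intros l; apply cconst. Qed.
Lemma gcont_id : gcont (fun l => l).
Proof. intros l; apply continuous_id. Qed.
Lemma gcont_plus f g : gcont f -> gcont g -> gcont (fun l => f l + g l).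
Proof. intros cf cg l. apply cplus; auto. Qed.
Lemma gcont_minus f g : gcont f -> gcont g -> gcont (fun l => f l - g l).
Proof. intros cf cg l. apply cminus; auto. Qed.
Lemma gcont_mult f g : gcont f -> gcont g -> gcont (fun l => f l * g l).
Proof. intros cf cg l. apply cmult; auto. Qed.
Lemma gcont_pow f n : gcont f -> gcont (fun l => f l ^ n).
Proof. intros cf l. induction n; simpl; [apply cconst | now apply (cmult f)]. Qed.
Lemma gcont_cos f : gcont f -> gcont (fun l => cos (f l)).
Proof. intros cf l. apply (ccomp cos f); auto using ccos. Qed.
Lemma gcont_sin f : gcont f -> gcont (fun l => sin (f l)).
Proof. intros cf l. apply (ccomp sin f); auto using csin. Qed.
Lemma gcont_comp f g : gcont f -> gcont g -> gcont (fun l => f (g l)).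
Proof. intros cf cg l. apply (ccomp f g); auto. Qed.
Lemma gcont_sum (F : nat -> R -> R) m : (forall k, gcont (F k)) -> gcont (fun l => sum_f_R0 (fun k => F k l) m).
Proof. intros H l. induction m; simpl; [apply H|]. apply cplus; auto. apply H. Qed.
Lemma bern_cont f m : gcont (bern f m).
Proof.
  intros l. unfold bern. generalize (fun k : nat => f (-1 + 2 * INR k / INR m)). intros g.
  revert g. induction m as [|m IH]; intros g; simpl; [apply cconst|].
  apply cplus; apply cmult; auto; apply cmult; try apply cconst.
  - apply cplus; [apply cconst | apply continuous_id].
  - apply cminus; [apply cconst | apply continuous_id].
Qed.
Ltac gc := lazymatch goal with
  | |- gcont (fun _ => ?c) => apply (gcont_const c)
  | |- gcont (fun x => x) => apply gcont_id
  | |- gcont (fun x => @?f x + @?g x) => apply (gcont_plus f g); gc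
  | |- gcont (fun x => @?f x - @?g x) => apply (gcont_minus f g); gc
  | |- gcont (fun x => @?f x * @?g x) => apply (gcont_mult f g); gc
  | |- gcont (fun x => @?f x ^ ?n) => apply (gcont_pow f n); gc
  | |- gcont (fun x => cos (@?f x)) => apply (gcont_cos f); gc
  | |- gcont (fun x => sin (@?f x)) => apply (gcont_sin f); gc
  | |- gcont (fun x => sum_f_R0 (fun k => @?F k x) ?m) => apply (gcont_sum (fun k x => F k x) m); intros; cbv beta; gc
  | |- gcont (bern ?f ?m) => apply bern_cont
  | _ => try assumption; try (match goal with H : forall k, gcont _ |- _ => apply H end)
  end.

(** * Functional calculus by eigenfunction expansion *)

Definition Calc := (R -> R) -> Z -> Z -> R.

(* [E g] plays the role of the kernel of [g(A)] for [A] with spectrum in [[-rho, rho]]; the constant 5 leaves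
   room for the crude bounds on the integral representations below. *)
Record calculus (A : Z -> Z -> R) (rho : R) (E : Calc) : Prop := {
  calc_one : forall x y, E (fun _ => 1) x y = kron x y;
  calc_mul : forall g x y, gcont g -> mulT (E g) A x y = E (fun l => l * g l) x y;
  calc_lin : forall g h a b x y, gcont g -> gcont h ->
    E (fun l => a * g l + b * h l) x y = a * E g x y + b * E h x y;
  calc_bound : forall g e x y, gcont g -> (forall l, - rho <= l <= rho -> Rabs (g l) <= e) -> Rabs (E g x y) <= 5 * e
}.

Lemma mulT_ext M M' Q Q' x y : (forall u v, M u v = M' u v) -> (forall u v, Q u v = Q' u v) ->
  mulT M Q x y = mulT M' Q' x y.
Proof. intros H K. unfold mulT. now rewrite !H, !K. Qed.

Lemma kron_refl x : kron x x = 1.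
Proof. unfold kron. destruct (Z.eq_dec x x); congruence. Qed.
Lemma kron_neq x y : x <> y -> kron x y = 0.
Proof. intros. unfold kron. destruct (Z.eq_dec x y); congruence. Qed.
Lemma kron_sym x y : kron x y = kron y x.
Proof. unfold kron. destruct (Z.eq_dec x y), (Z.eq_dec y x); congruence. Qed.

Lemma mulT_affine M A a b x y :
  mulT M (fun u v => a * kron u v + b * A u v) x y = a * M x y + b * mulT M A x y.
Proof.
  unfold mulT. rewrite kron_refl, !kron_neq by lia. ring.
Qed.

Section Calculus.
Variables (A : Z -> Z -> R) (rho : R) (E : Calc).
Hypothesis HE : calculus A rho E.

(** The bound with e = 0, applied to the difference: [E] sees only the values on [- rho, rho]. *)
Lemma calc_ext g h x y : gcont g -> gcont h -> (forall l, - rho <= l <= rho -> g l = h l) -> E g x y = E h x y.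
Proof.
  intros cg ch H. assert (E1 := calc_lin _ _ _ HE g h 1 (-1) x y cg ch).
  assert (E2 : Rabs (E (fun l => 1 * g l + -1 * h l) x y) <= 5 * 0).
  { apply (calc_bound _ _ _ HE).
    - gc.
    - intros l Hl. rewrite (H l Hl). replace (1 * h l + -1 * h l) with 0 by ring. rewrite Rabs_R0. lra. }
  rewrite E1 in E2. apply Rabs_le_between in E2. lra.
Qed.

Lemma calc_affine g a b x y : gcont g ->
  mulT (E g) (fun u v => a * kron u v + b * A u v) x y = E (fun l => (a + b * l) * g l) x y.
Proof.
  intros cg. rewrite mulT_affine, (calc_mul _ _ _ HE) by auto.
  rewrite <- (calc_lin _ _ _ HE) by gc.
  apply calc_ext; [gc | gc | intros; ring].
Qed.

Lemma calc_iter n M Q a b g x y : gcont g -> (forall u v, M u v = E g u v) ->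
  (forall u v, Q u v = a * kron u v + b * A u v) ->
  Nat.iter n (fun M => mulT M Q) M x y = E (fun l => (a + b * l) ^ n * g l) x y.
Proof.
  intros cg HM HQ. revert x y. induction n as [|n IH]; intros x y.
  - simpl. rewrite HM. apply calc_ext; [gc | gc | intros; ring].
  - cbn [Nat.iter nat_rect].
    transitivity (mulT (E (fun l => (a + b * l) ^ n * g l)) (fun u v => a * kron u v + b * A u v) x y).
    { apply mulT_ext; auto. }
    rewrite calc_affine by gc. apply calc_ext; [gc | gc | intros; simpl; ring].
Qed.

Lemma calc_powT n x y : powT A n x y = E (fun l => l ^ n) x y.
Proof.
  unfold powT. rewrite (calc_iter n kron A 0 1 (fun _ => 1)).
  - apply calc_ext; [gc | gc | intros; rewrite Rmult_1_r; f_equal; ring].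
  - gc.
  - intros; symmetry; apply (calc_one _ _ _ HE).
  - intros; ring.
Qed.

Lemma calc_sum (a : nat -> R) (F : nat -> R -> R) m x y : (forall k, gcont (F k)) ->
  sum_f_R0 (fun k => a k * E (F k) x y) m = E (fun l => sum_f_R0 (fun k => a k * F k l) m) x y.
Proof.
  intros H.
  assert (Z1 : forall k, a k * E (F k) x y = E (fun l => a k * F k l) x y).
  { intros k. assert (G := calc_lin _ _ _ HE (F k) (F k) (a k) 0 x y (H k) (H k)). rewrite Rmult_0_l, Rplus_0_r in G.
    rewrite <- G. specialize (H k). apply calc_ext; [gc | gc | intros; ring]. }
  induction m as [|m IH]; simpl; [apply Z1|]. rewrite IH, Z1.
  assert (G := calc_lin _ _ _ HE (fun l => sum_f_R0 (fun k => a k * F k l) m) (fun l => a (S m) * F (S m) l) 1 1 x y ltac:(gc; apply H) ltac:(gc; apply H)).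
  rewrite !Rmult_1_l in G. rewrite <- G. apply calc_ext; [gc; apply H | gc; apply H | intros; ring].
Qed.

(** Multiplication by the tridiagonal kernels (1 + A) / 2 and (1 - A) / 2 multiplies the symbol, so
    the Bernstein expression in the operator is [E] of the scalar Bernstein polynomial. *)
Lemma calc_bernstein f m x y : bernstein_term f A m x y = E (bern f m) x y.
Proof.
  unfold bernstein_term. cbv zeta.
  transitivity (sum_f_R0 (fun k => (f (-1 + 2 * INR k / INR m) * Binomial.C m k) * E (fun l => (/ 2 + - / 2 * l) ^ (m - k) * ((/ 2 + / 2 * l) ^ k * 1)) x y) m).
  { apply sum_eq. intros k Hk. f_equal.
    apply calc_iter.
    - gc.
    - intros u v. apply calc_iter.
      + gc. + intros; symmetry; apply (calc_one _ _ _ HE). + intros; field.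
    - intros; field. }
  rewrite calc_sum by (intros; gc). apply calc_ext; [gc | gc |].
  intros l _. unfold bern. rewrite <- bmean_binom. apply sum_eq. intros k Hk.
  replace ((1 + l) / 2) with (/ 2 + / 2 * l) by field. replace ((1 - l) / 2) with (/ 2 + - / 2 * l) by field. ring.
Qed.

Lemma calc_close g h e x y : gcont g -> gcont h -> (forall l, - rho <= l <= rho -> Rabs (g l - h l) <= e) ->
  Rabs (E g x y - E h x y) <= 5 * e.
Proof.
  intros cg ch H. replace (E g x y - E h x y) with (1 * E g x y + (-1) * E h x y) by ring.
  rewrite <- (calc_lin _ _ _ HE) by auto. apply (calc_bound _ _ _ HE).
  - gc.
  - intros l Hl. replace (1 * g l + -1 * h l) with (g l - h l) by ring. auto.
Qed.

(** Uniform convergence on [-1, 1], which contains [- rho, rho], passes through [calc_bound]. Hence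
    every calculus for [A] computes the limit that defines [fcalc]. *)
Lemma calc_fcalc f x y : rho <= 1 -> modc f -> gcont f -> fcalc f A x y = E f x y.
Proof.
  intros Hr Hm cf. unfold fcalc.
  replace (Lim_seq (fun m => bernstein_term f A m x y)) with (Finite (E f x y)); auto.
  symmetry. apply is_lim_seq_unique. apply is_lim_seq_spec. intros eps.
  destruct (bern_conv f Hm (eps / 6)) as [M HM]. { pose proof (cond_pos eps). lra. }
  exists M. intros m Hmm. rewrite calc_bernstein.
  eapply Rle_lt_trans; [apply (calc_close _ _ (eps / 6)); auto using bern_cont|].
  - intros l Hl. apply HM; auto. lra.
  - pose proof (cond_pos eps). lra.
Qed.
End Calculus.

(** * Eigenfunctions of the decoupled initial generator *)

Definition sR (N : nat) (x : Z) (q : R) : R := if inR N x then sin (IZR (x - Z.of_nat N) * q) else 0.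
Definition sL (N : nat) (x : Z) (q : R) : R := if inL N x then sin (IZR (- x - Z.of_nat N) * q) else 0.
Definition kS (N : nat) (x y : Z) : R := if (inR N x || inL N x)%bool then 0 else kron x y.

(* [g(k0 / betaR)] with [b = betaL / betaR]: sine transforms on both half-lines, and [g(0)] on the sample *)
Definition EA (N : nat) (b : R) : Calc := fun g x y =>
  2 / PI * RInt (fun q => g (cos q) * (sR N x q * sR N y q)) 0 PI
  + 2 / PI * RInt (fun q => g (b * cos q) * (sL N x q * sL N y q)) 0 PI
  + g 0 * kS N x y.

Lemma hfree_refl x : hfree x x = 0.
Proof. unfold hfree. destruct (Z.eq_dec _ 1); [lia|reflexivity]. Qed.
Lemma hfree_pred y : hfree (y - 1) y = / 2.
Proof. unfold hfree. destruct (Z.eq_dec _ 1); [reflexivity|lia]. Qed.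
Lemma hfree_succ y : hfree (y + 1) y = / 2.
Proof. unfold hfree. destruct (Z.eq_dec _ 1); [reflexivity|lia]. Qed.

Lemma inR_spec N x : inR N x = true <-> (Z.of_nat N + 1 <= x)%Z.
Proof. unfold inR. apply Z.leb_le. Qed.
Lemma inL_spec N x : inL N x = true <-> (x <= - (Z.of_nat N + 1))%Z.
Proof. unfold inL. apply Z.leb_le. Qed.
Lemma inR_false N x : inR N x = false <-> (x < Z.of_nat N + 1)%Z.
Proof. unfold inR. apply Z.leb_gt. Qed.
Lemma inL_false N x : inL N x = false <-> (- (Z.of_nat N + 1) < x)%Z.
Proof. unfold inL. apply Z.leb_gt. Qed.

Ltac regions := repeat match goal with
  | H : inR _ _ = true |- _ => apply inR_spec in H
  | H : inL _ _ = true |- _ => apply inL_spec in H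
  | H : inR _ _ = false |- _ => apply inR_false in H
  | H : inL _ _ = false |- _ => apply inL_false in H end.

Lemma sin_IZR_succ m q : sin (IZR (m - 1) * q) + sin (IZR (m + 1) * q) = 2 * cos q * sin (IZR m * q).
Proof.
  rewrite minus_IZR, plus_IZR, Rmult_minus_distr_r, Rmult_plus_distr_r, Rmult_1_l, sin_plus, sin_minus. ring.
Qed.

Lemma fscal (c : R) (f : R -> R) : gcont f -> forall x, continuous (fun x => c * f x) x.
Proof. intros cf x. apply cmult; auto using cconst. Qed.
Lemma fplus (f g : R -> R) : gcont f -> gcont g -> forall x, continuous (fun x => f x + g x) x.
Proof. intros cf cg x. apply cplus; auto. Qed.

Lemma RI_comb2 a c (f g : R -> R) u v : gcont f -> gcont g ->
  RInt (fun q => a * f q + c * g q) u v = a * RInt f u v + c * RInt g u v.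
Proof.
  intros cf cg. rewrite (RIplus (fun q => a * f q) (fun q => c * g q)), !RIscal; auto; now apply fscal.
Qed.
Lemma RI_comb3 a c d (f g h : R -> R) u v : gcont f -> gcont g -> gcont h ->
  RInt (fun q => a * f q + c * g q + d * h q) u v = a * RInt f u v + c * RInt g u v + d * RInt h u v.
Proof.
  intros cf cg ch. rewrite (RIplus (fun q => a * f q + c * g q) (fun q => d * h q)), RI_comb2, RIscal; auto.
  - exact (fplus _ _ (fscal a f cf) (fscal c g cg)).
  - exact (fscal d h ch).
Qed.

Section EA.
Variables (N : nat) (bL bR : R).
Hypothesis (hL : 0 < bL) (hLR : bL <= bR).
Let b := bL / bR.
Let A := fun x y => k0 N bL bR x y / bR.

(** Eigenvector equation, column by column. At the first site N + 1 the neighbour N is cut off by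
    [k0], and sin 0 = 0 stands in for its term. *)
Lemma sR_eigen y q : sR N (y - 1) q * A (y - 1)%Z y + sR N y q * A y y + sR N (y + 1) q * A (y + 1)%Z y
  = cos q * sR N y q.
Proof.
  unfold A, k0, sR. rewrite hfree_refl, hfree_pred, hfree_succ.
  destruct (inR N y) eqn:Ry.
  - assert (inR N (y + 1) = true) as -> by (regions; apply inR_spec; lia).
    assert (inL N y = false) as -> by (regions; apply inL_false; lia).
    rewrite !Bool.andb_false_r.
    replace (y - 1 - Z.of_nat N)%Z with (y - Z.of_nat N - 1)%Z by lia.
    replace (y + 1 - Z.of_nat N)%Z with (y - Z.of_nat N + 1)%Z by lia.
    pose proof (sin_IZR_succ (y - Z.of_nat N) q) as S.
    destruct (inR N (y - 1)) eqn:R1; simpl.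
    + transitivity (/ 2 * (sin (IZR (y - Z.of_nat N - 1) * q) + sin (IZR (y - Z.of_nat N + 1) * q))); [field; lra | rewrite S; field].
    + regions. replace (y - Z.of_nat N - 1)%Z with 0%Z in S by lia. rewrite Rmult_0_l, sin_0 in S.
      transitivity (/ 2 * (0 + sin (IZR (y - Z.of_nat N + 1) * q))); [field; lra | rewrite S; field].
  - rewrite !Bool.andb_false_r.
    assert (HR : forall z, inR N z = true -> (Z.abs (z - y) <= 1)%Z -> inL N y = false) by (intros; regions; apply inL_false; lia).
    destruct (inL N y) eqn:Ly; rewrite ?Bool.andb_false_r; [|field; lra].
    destruct (inR N (y - 1)) eqn:E1; [specialize (HR _ E1 ltac:(lia)); discriminate|].
    destruct (inR N (y + 1)) eqn:E2; [specialize (HR _ E2 ltac:(lia)); discriminate|]. field. lra.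
Qed.

Lemma sL_eigen y q : sL N (y - 1) q * A (y - 1)%Z y + sL N y q * A y y + sL N (y + 1) q * A (y + 1)%Z y
  = b * cos q * sL N y q.
Proof.
  unfold A, k0, sL, b. rewrite hfree_refl, hfree_pred, hfree_succ.
  destruct (inL N y) eqn:Ry.
  - assert (inL N (y - 1) = true) as -> by (regions; apply inL_spec; lia).
    assert (inR N y = false) as -> by (regions; apply inR_false; lia).
    rewrite !Bool.andb_false_r.
    replace (- (y - 1) - Z.of_nat N)%Z with (- y - Z.of_nat N + 1)%Z by lia.
    replace (- (y + 1) - Z.of_nat N)%Z with (- y - Z.of_nat N - 1)%Z by lia.
    pose proof (sin_IZR_succ (- y - Z.of_nat N) q) as S.
    destruct (inL N (y + 1)) eqn:R1; simpl.
    + transitivity (bL / bR * / 2 * (sin (IZR (- y - Z.of_nat N - 1) * q) + sin (IZR (- y - Z.of_nat N + 1) * q))); [field; lra | rewrite S; field; lra].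
    + regions. replace (- y - Z.of_nat N - 1)%Z with 0%Z in S by lia. rewrite Rmult_0_l, sin_0 in S.
      transitivity (bL / bR * / 2 * (0 + sin (IZR (- y - Z.of_nat N + 1) * q))); [field; lra | rewrite S; field; lra].
  - rewrite !Bool.andb_false_r.
    assert (HR : forall z, inL N z = true -> (Z.abs (z - y) <= 1)%Z -> inR N y = false) by (intros; regions; apply inR_false; lia).
    destruct (inR N y) eqn:Ly; rewrite ?Bool.andb_false_r; [|field; lra].
    destruct (inL N (y - 1)) eqn:E1; [specialize (HR _ E1 ltac:(lia)); discriminate|].
    destruct (inL N (y + 1)) eqn:E2; [specialize (HR _ E2 ltac:(lia)); discriminate|]. field. lra.
Qed.

Lemma kS_eigen x y : kS N x (y - 1) * A (y - 1)%Z y + kS N x y * A y y + kS N x (y + 1) * A (y + 1)%Z y = 0.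
Proof.
  unfold kS. destruct (inR N x || inL N x)%bool eqn:O; [ring|].
  apply Bool.orb_false_iff in O as [O1 O2].
  assert (Q : forall z, kron x z * A z y = 0).
  { intros z. unfold kron. destruct (Z.eq_dec x z) as [<-|]; [|ring]. unfold A, k0. rewrite O1, O2. simpl. field. lra. }
  rewrite !Q. ring.
Qed.

Lemma sR_cont x : gcont (sR N x).
Proof. unfold sR. destruct (inR N x); intros q; [|apply cconst]. apply (gcont_sin (fun q => IZR (x - Z.of_nat N) * q)). gc. Qed.
Lemma sL_cont x : gcont (sL N x).
Proof. unfold sL. destruct (inL N x); intros q; [|apply cconst]. apply (gcont_sin (fun q => IZR (- x - Z.of_nat N) * q)). gc. Qed.

Lemma sR_abs x q : Rabs (sR N x q) <= 1.
Proof. unfold sR. destruct (inR N x); [apply Rabs_le, SIN_bound | rewrite Rabs_R0; lra]. Qed.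
Lemma sL_abs x q : Rabs (sL N x q) <= 1.
Proof. unfold sL. destruct (inL N x); [apply Rabs_le, SIN_bound | rewrite Rabs_R0; lra]. Qed.

Lemma sin_orth (m n : Z) : (1 <= m)%Z -> (1 <= n)%Z -> 2 / PI * RInt (fun q => sin (IZR m * q) * sin (IZR n * q)) 0 PI = kron m n.
Proof.
  intros Hm Hn. pose proof PI_RGT_0. pose proof (RI_sin_sin (Z.to_nat m) (Z.to_nat n) ltac:(lia) ltac:(lia)) as E.
  rewrite !INR_IZR_INZ, !Z2Nat.id in E by lia. rewrite E. unfold kron.
  destruct (Nat.eq_dec _ _), (Z.eq_dec m n); try lia; field; lra.
Qed.

Lemma RI0 : RInt (fun _ : R => 0) 0 PI = 0.
Proof. rewrite RIconst. rng. Qed.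

(** Completeness is the orthogonality of the sines on each half-line, and the multiplication rule is
    the eigenvector equation under the integral. The half-lines contribute 2 e each and the sample
    e, which is the constant 5. *)
Lemma EA_calculus : calculus A 1 (EA N b).
Proof.
  pose proof PI_RGT_0 as HP.
  assert (b1 : 0 <= b <= 1).
  { unfold b. split; [apply Rle_div_r; lra | apply Rle_div_l; lra]. }
  assert (cR : forall g x y, gcont g -> gcont (fun q => g (cos q) * (sR N x q * sR N y q))).
  { intros g x y cg. apply (gcont_mult (fun q => g (cos q))); [apply (gcont_comp g cos); auto; exact ccos|].
    apply gcont_mult; apply sR_cont. }
  assert (cL : forall g x y, gcont g -> gcont (fun q => g (b * cos q) * (sL N x q * sL N y q))).
  { intros g x y cg. apply (gcont_mult (fun q => g (b * cos q))); [apply (gcont_comp g (fun q => b * cos q)); auto; intros q; apply cmult; [apply cconst | apply ccos]|].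
    apply gcont_mult; apply sL_cont. }
  split.
  - intros x y. unfold EA.
    rewrite (RIext _ (fun q => sR N x q * sR N y q)), (RIext (fun q => 1 * (sL N x q * _)) (fun q => sL N x q * sL N y q)) by (lra || (intros; req; ring)).
    unfold sR, sL, kS. destruct (inR N x) eqn:Rx, (inL N x) eqn:Lx; simpl.
    + regions; lia.
    + rewrite (RIext (fun q => 0 * _) (fun _ => 0)), RI0 by (lra || (intros; req; ring)).
      destruct (inR N y) eqn:Ry.
      * regions. rewrite sin_orth by lia. unfold kron. destruct (Z.eq_dec _ _), (Z.eq_dec x y); try lia; ring.
      * rewrite (RIext _ (fun _ => 0)), RI0 by (lra || (intros; req; ring)). rewrite kron_neq; [ring|]. intros ->; congruence.
    + rewrite (RIext (fun q => 0 * _) (fun _ => 0)), RI0 by (lra || (intros; req; ring)).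
      destruct (inL N y) eqn:Ry.
      * regions. rewrite sin_orth by lia. unfold kron. destruct (Z.eq_dec _ _), (Z.eq_dec x y); try lia; ring.
      * rewrite (RIext _ (fun _ => 0)), RI0 by (lra || (intros; req; ring)). rewrite kron_neq; [ring|]. intros ->; congruence.
    + rewrite !(RIext (fun q => 0 * _) (fun _ => 0)), !RI0 by (lra || (intros; req; ring)). ring.
  - intros g x y cg. unfold EA, mulT.
    set (gl := fun l => l * g l). assert (cgl : gcont gl) by (unfold gl; gc).
    set (r1 := RInt (fun q => g (cos q) * (sR N x q * sR N (y - 1) q)) 0 PI).
    set (r2 := RInt (fun q => g (cos q) * (sR N x q * sR N y q)) 0 PI).
    set (r3 := RInt (fun q => g (cos q) * (sR N x q * sR N (y + 1) q)) 0 PI).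
    set (l1 := RInt (fun q => g (b * cos q) * (sL N x q * sL N (y - 1) q)) 0 PI).
    set (l2 := RInt (fun q => g (b * cos q) * (sL N x q * sL N y q)) 0 PI).
    set (l3 := RInt (fun q => g (b * cos q) * (sL N x q * sL N (y + 1) q)) 0 PI).
    assert (ER : RInt (fun q => cos q * g (cos q) * (sR N x q * sR N y q)) 0 PI = A (y - 1)%Z y * r1 + A y y * r2 + A (y + 1)%Z y * r3).
    { unfold r1, r2, r3. rewrite <- RI_comb3 by (apply cR; assumption).
      apply RIext; [lra|]. intros q _. rewrite (Rmult_comm (cos q)), !Rmult_assoc, (Rmult_comm (cos q)), Rmult_assoc, (Rmult_comm (sR N y q)), <- sR_eigen. req; ring. }
    assert (EL : RInt (fun q => b * cos q * g (b * cos q) * (sL N x q * sL N y q)) 0 PI = A (y - 1)%Z y * l1 + A y y * l2 + A (y + 1)%Z y * l3).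
    { unfold l1, l2, l3. rewrite <- RI_comb3 by (apply cL; assumption).
      apply RIext; [lra|]. intros q _.
        transitivity (g (b * cos q) * sL N x q * (b * cos q * sL N y q)); [req; ring|]. rewrite <- sL_eigen. req; ring. }
    rewrite ER, EL. pose proof (kS_eigen x y) as K.
    transitivity (2 / PI * (A (y - 1)%Z y * r1 + A y y * r2 + A (y + 1)%Z y * r3) + 2 / PI * (A (y - 1)%Z y * l1 + A y y * l2 + A (y + 1)%Z y * l3)
      + g 0 * (kS N x (y - 1) * A (y - 1)%Z y + kS N x y * A y y + kS N x (y + 1) * A (y + 1)%Z y)); [ring | rewrite K; ring].
  - intros g h a c x y cg ch. unfold EA.
    rewrite (RIext _ (fun q => a * (g (cos q) * (sR N x q * sR N y q)) + c * (h (cos q) * (sR N x q * sR N y q)))) by (lra || (intros; req; ring)).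
    rewrite (RIext (fun q => (a * g (b * cos q) + _) * _) (fun q => a * (g (b * cos q) * (sL N x q * sL N y q)) + c * (h (b * cos q) * (sL N x q * sL N y q)))) by (lra || (intros; req; ring)).
    rewrite !RI_comb2 by first [apply cR; assumption | apply cL; assumption]. ring.
  - intros g e x y cg Hg.
    assert (e0 : 0 <= e) by (eapply Rle_trans; [apply Rabs_pos | apply (Hg 0); lra]).
    assert (B1 : Rabs (RInt (fun q => g (cos q) * (sR N x q * sR N y q)) 0 PI) <= (PI - 0) * e).
    { apply RIabs_bound; [lra | apply cR; auto|]. intros q _. rewrite !Rabs_mult.
      pose proof (sR_abs x q); pose proof (sR_abs y q). pose proof (Hg (cos q) (COS_bound q)).
      pose proof (Rabs_pos (sR N x q)); pose proof (Rabs_pos (sR N y q)); pose proof (Rabs_pos (g (cos q))).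
      assert (Rabs (sR N x q) * Rabs (sR N y q) <= 1) by nra.
      assert (0 <= Rabs (sR N x q) * Rabs (sR N y q)) by nra. nra. }
    assert (B2 : Rabs (RInt (fun q => g (b * cos q) * (sL N x q * sL N y q)) 0 PI) <= (PI - 0) * e).
    { apply RIabs_bound; [lra | apply cL; auto|]. intros q _. rewrite !Rabs_mult.
      pose proof (sL_abs x q); pose proof (sL_abs y q). pose proof (COS_bound q).
      assert (Rabs (g (b * cos q)) <= e) by (apply Hg; nra).
      pose proof (Rabs_pos (sL N x q)); pose proof (Rabs_pos (sL N y q)); pose proof (Rabs_pos (g (b * cos q))).
      assert (Rabs (sL N x q) * Rabs (sL N y q) <= 1) by nra.
      assert (0 <= Rabs (sL N x q) * Rabs (sL N y q)) by nra. nra. }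
    assert (B3 : Rabs (g 0 * kS N x y) <= e).
    { rewrite Rabs_mult. pose proof (Hg 0 ltac:(lra)). pose proof (Rabs_pos (g 0)).
      assert (Rabs (kS N x y) <= 1); [|pose proof (Rabs_pos (kS N x y)); nra].
      unfold kS, kron. destruct (_ || _)%bool; [|destruct (Z.eq_dec x y)]; rewrite ?Rabs_R0, ?Rabs_R1; lra. }
    unfold EA. eapply Rle_trans; [apply Rabs_triang|]. eapply Rle_trans; [apply Rplus_le_compat_r, Rabs_triang|].
    rewrite !(Rabs_mult (2 / PI)), (Rabs_pos_eq (2 / PI)) by (apply Rle_div_r; lra).
    assert (Q : forall z, z <= (PI - 0) * e -> 2 / PI * z <= 2 * e).
    { intros z Hz. apply Rle_trans with (2 / PI * ((PI - 0) * e)); [|right; field; lra].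
      apply Rmult_le_compat_l; auto. apply Rle_div_r; lra. }
    apply Q in B1. apply Q in B2. lra.
Qed.
End EA.

(** * Eigenfunctions of h_B *)

Definition En (kappa : R) : R := sqrt (1 + kappa ^ 2).
(** The root in (0, 1) of z^2 + 2 kappa z = 1, so that (z + 1 / z) / 2 = z + kappa = [En kappa]: the
    decay rate of the bound state. *)
Definition z0 (kappa : R) : R := En kappa - kappa.
Definition den (kappa k : R) : R := kappa ^ 2 + sin k ^ 2.
(* real part of the reflection amplitude [-kappa / (kappa + i sin k)] times [e^{ikm}] *)
Definition rr (kappa k m : R) : R :=
  - kappa * (kappa * cos (m * k) + sin k * sin (m * k)) / den kappa k.
(** Up to normalisation, the sum over the two scattering states of energy cos k of their product at
    [x] and [y]: a free term and a term scattered at the origin, which sees only |x| + |y|. *)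
Definition kB (kappa : R) (x y : Z) (k : R) : R :=
  cos (IZR (x - y) * k) + rr kappa k (INR (Z.abs_nat x + Z.abs_nat y)).
(** The prefactor normalises: the sum of z^(2 |x|) over Z is (1 + z^2) / (1 - z^2) =
    [En kappa / kappa]. *)
Definition psi (kappa : R) (x : Z) : R := sqrt (kappa / En kappa) * z0 kappa ^ Z.abs_nat x.
(* [g(hB)]: scattering states on [0, pi] plus the bound state [psi] of energy [En] *)
Definition EB (kappa : R) : Calc := fun g x y =>
  / PI * RInt (fun k => g (cos k) * kB kappa x y k) 0 PI + g (En kappa) * (psi kappa x * psi kappa y).

Section EB.
Variable kappa : R.
Hypothesis hk : 0 < kappa.
Notation E := (En kappa).
Notation z := (z0 kappa).

Lemma En_sq : E * E = 1 + kappa ^ 2.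
Proof. apply sqrt_sqrt. nra. Qed.
Lemma En_pos : 0 < E.
Proof. apply sqrt_lt_R0. nra. Qed.
Lemma En_gt : kappa < E.
Proof. pose proof En_sq; pose proof En_pos. nra. Qed.
Lemma En_ge1 : 1 <= E.
Proof. pose proof En_sq; pose proof En_pos. nra. Qed.
Lemma z0_pos : 0 < z.
Proof. unfold z0. pose proof En_gt. lra. Qed.
Lemma z0_lt1 : z < 1.
Proof. unfold z0. pose proof En_sq; pose proof En_pos. nra. Qed.
Lemma z0_sq : z * z = 1 - 2 * kappa * z.
Proof. unfold z0. pose proof En_sq. nra. Qed.
Lemma den_pos k : 0 < den kappa k.
Proof. unfold den. pose proof (pow2_ge_0 (sin k)). nra. Qed.
Lemma psi_mul x y : psi kappa x * psi kappa y = kappa / E * z ^ (Z.abs_nat x + Z.abs_nat y).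
Proof.
  unfold psi. rewrite pow_add. set (s := sqrt (kappa / E)).
  replace (kappa / E) with (s * s). rng. apply sqrt_sqrt. apply Rle_div_r; pose proof En_pos; lra.
Qed.

Lemma den_C2 : C2 (den kappa).
Proof. unfold den. c2. Qed.
Lemma iden_C2 : C2 (fun k => / den kappa k).
Proof. apply C2_inv; [apply den_C2|]. intros k. pose proof (den_pos k). lra. Qed.
Lemma rr_C2 m : C2 (fun k => rr kappa k m).
Proof.
  unfold rr, Rdiv. apply (C2_mult (fun k => - kappa * (kappa * cos (m * k) + sin k * sin (m * k)))); [c2 | apply iden_C2].
Qed.
Lemma kB_C2 x y : C2 (kB kappa x y).
Proof. unfold kB. apply (C2_plus (fun k => cos (IZR (x - y) * k))); [c2 | apply rr_C2]. Qed.

(** The natural antiderivative atan (c tan k) with c = E / kappa jumps at PI / 2. Subtracting k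
    inside the arctangent gives atan ((c - 1) sin k cos k / D), which is smooth, and the increment
    comes from k alone. *)
Lemma int_iden : RInt (fun k => / den kappa k) 0 PI = PI / (kappa * E).
Proof.
  pose proof PI_RGT_0. pose proof En_pos. pose proof En_sq as HE.
  set (c := E / kappa).
  assert (c0 : 0 < c) by now apply Rdiv_lt_0_compat.
  set (D := fun k => cos k ^ 2 + c * sin k ^ 2).
  assert (Dp : forall k, 0 < D k).
  { intros k. unfold D. pose proof (sin2_cos2 k) as S. unfold Rsqr in S.
    destruct (Req_dec (cos k) 0) as [C0|C0]; [rewrite C0 in *; nra|].
    assert (0 < cos k ^ 2) by nra. pose proof (pow2_ge_0 (sin k)). nra. }
  rewrite (RI_FTC (fun k => (k + atan ((c - 1) * sin k * cos k / D k)) / (kappa * E))).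
  - rewrite sin_PI, sin_0. unfold Rdiv. rewrite !Rmult_0_r, !Rmult_0_l, atan_0. req. fld. lra.
  - intros k. specialize (Dp k). unfold D in *.
    assert (cE : c ^ 2 * kappa ^ 2 = 1 + kappa ^ 2).
    { unfold c. replace ((E / kappa) ^ 2 * kappa ^ 2) with (E * E) by (fld; lra). exact HE. }
    assert (Ec : kappa * E = c * kappa ^ 2) by (unfold c; fld; lra).
    rewrite Ec.
    auto_derive; [lra|]. unfold den. pose proof (sin2_cos2 k) as S. unfold Rsqr in S.
    set (s := sin k) in *. set (co := cos k) in *. clearbody s co c.
    set (P := co ^ 2 + c * s ^ 2) in *.
    replace (co * (co * 1) + c * (s * (s * 1))) with P by (unfold P; rng).
    set (W := co ^ 2 + c ^ 2 * s ^ 2).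
    assert (Q : 0 < W).
    { unfold W. destruct (Req_dec co 0) as [C0|C0]; [rewrite C0 in *; nra|]. assert (0 < co ^ 2) by nra. assert (0 <= (c * s) ^ 2) by apply pow2_ge_0. nra. }
    assert (Q3 : kappa ^ 2 + s ^ 2 = kappa ^ 2 * W) by (unfold W; nra).
    assert (Q2 : P ^ 2 + ((c - 1) * s * co) ^ 2 = W).
    { replace W with (W * (s * s + co * co)) by (rewrite S; rng). unfold P, W. rng. }
    assert (Q4 : W + ((c - 1) * (1 * co) * co + (c - 1) * s * (1 * - s)) * P
      - (c - 1) * s * co * (1 * - s * ((1 + 1) * (co * 1)) + c * (1 * co * ((1 + 1) * (s * 1)))) = c).
    { transitivity (W + (c - 1) * (s * s + co * co) * (co ^ 2 - c * s ^ 2)); [unfold P; rng|].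
      rewrite S. transitivity (c * (s * s + co * co)); [unfold W; rng | rewrite S; rng]. }
    rewrite Q3. req.
    assert (Hd : 1 + (c - 1) * s * co * / P * ((c - 1) * s * co * / P * 1) = W / P ^ 2) by (rewrite <- Q2; fld; lra).
    rewrite Hd. clearbody W P.
    transitivity ((W + ((c - 1) * (1 * co) * co + (c - 1) * s * (1 * - s)) * P
      - (c - 1) * s * co * (1 * - s * ((1 + 1) * (co * 1)) + c * (1 * co * ((1 + 1) * (s * 1))))) / W / (c * kappa ^ 2));
     [fld; repeat split; lra | rewrite Q4; fld; repeat split; lra].
  - intros k. apply C2_cont, iden_C2.
Qed.

Definition rrint (m : R) : R := RInt (fun k => rr kappa k m) 0 PI.

Lemma rrint_0 : rrint 0 = - (PI * (kappa / E)).
Proof.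
  pose proof En_pos. unfold rrint. rewrite (RIext _ (fun k => - kappa ^ 2 * / den kappa k)); [|pose proof PI_RGT_0; lra|].
  - rewrite RIscal, int_iden; [fld; lra | apply C2_cont, iden_C2].
  - intros k _. unfold rr. rewrite Rmult_0_l, cos_0, sin_0. req. fld. pose proof (den_pos k); lra.
Qed.

Lemma rrint_1 : rrint 1 = - (PI * (kappa / E)) * z.
Proof.
  pose proof En_pos. pose proof PI_RGT_0. unfold rrint.
  rewrite (RIext _ (fun k => (- kappa * (kappa * (cos k * / den kappa k)) + - kappa * 1) + kappa ^ 3 * / den kappa k)); [|lra|].
  2:{ intros k _. unfold rr. rewrite !Rmult_1_l. pose proof (den_pos k). req.
      replace (sin k * sin k) with (den kappa k - kappa ^ 2) by (unfold den; rng). fld. lra. }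
  assert (c1 : C2 (fun k => cos k * / den kappa k)) by (apply (C2_mult cos (fun k => / den kappa k)); [c2 | apply iden_C2]).
  assert (c0 : C2 (fun k => / den kappa k)) by apply iden_C2.
  rewrite RIplus, RIplus, RIscal, RIscal, RIscal, RIscal, int_iden, RIconst;
    try (apply C2_cont; c2; fail).
  replace (RInt (fun k => cos k * / den kappa k) 0 PI) with 0.
  - unfold z0. fld. lra.
  - rewrite (RI_FTC (fun k => / kappa * atan (sin k / kappa))).
    + rewrite sin_PI, sin_0. rng.
    + intros k. auto_derive; auto. unfold den. pose proof (pow2_ge_0 (sin k)). req. fld. split; [|lra]. nra.
    + intros; now apply C2_cont.
Qed.

(** Real part of r (kappa + i sin k) = - kappa, multiplied by e^{imk}. *)
Lemma rr_rec k m : kappa * rr kappa k m + / 2 * (rr kappa k (m + 1) - rr kappa k (m - 1)) = - kappa * cos (m * k).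
Proof.
  unfold rr. replace ((m + 1) * k) with (m * k + k) by rng. replace ((m - 1) * k) with (m * k - k) by rng.
  rewrite cos_plus, cos_minus, sin_plus, sin_minus. pose proof (den_pos k).
  transitivity (- kappa * cos (m * k) * (kappa ^ 2 + sin k ^ 2) / den kappa k); [fld; lra | unfold den in *; fld; lra].
Qed.

(** Integrating [rr_rec] gives X_{n+2} = X_n - 2 kappa X_{n+1}, because cos (m k) has mean zero for
    m >= 1. The powers of [z0] satisfy the same recursion, and [rrint_0], [rrint_1] start it. *)
Lemma rrint_nat n : rrint (INR n) = - (PI * (kappa / E)) * z ^ n.
Proof.
  assert (H : rrint (INR n) = - (PI * (kappa / E)) * z ^ n /\ rrint (INR (S n)) = - (PI * (kappa / E)) * z ^ S n); [|tauto].
  pose proof PI_RGT_0.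
  induction n as [|n [IH1 IH2]].
  - simpl. rewrite rrint_0, rrint_1. split; rng.
  - split; auto.
    assert (G : RInt (fun k => kappa * rr kappa k (INR (S n)) + / 2 * rr kappa k (INR (S n) + 1) + - / 2 * rr kappa k (INR (S n) - 1)) 0 PI = 0).
    { rewrite (RIext _ (fun k => - kappa * cos (IZR (Z.of_nat (S n)) * k))); [|lra|].
      - rewrite RIscal, RI_cos_PI. destruct (Z.eq_dec _ 0); [lia|]. rng. apply C2_cont. c2.
      - intros k _. rewrite <- INR_IZR_INZ, <- rr_rec. req. rng. }
    rewrite RI_comb3 in G by (exact (C2_cont _ (rr_C2 _))).
    replace (INR (S n) - 1) with (INR n) in G by (rewrite S_INR; rng).
    replace (INR (S n) + 1) with (INR (S (S n))) in G by (now rewrite (S_INR (S n))).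
    change (kappa * rrint (INR (S n)) + / 2 * rrint (INR (S (S n))) + - / 2 * rrint (INR n) = 0) in G.
    rewrite IH1, IH2 in G. pose proof z0_sq as Zs. simpl pow in *.
    replace (- (PI * (kappa / E)) * (z * (z * z ^ n))) with (- (PI * (kappa / E)) * (z * z) * z ^ n) by rng.
    rewrite Zs. lra.
Qed.

Lemma kB_abs x y k : Rabs (kB kappa x y k) <= 3.
Proof.
  unfold kB. eapply Rle_trans; [apply Rabs_triang|].
  assert (H1 : forall u, Rabs (cos u) <= 1) by (intros; apply Rabs_le, COS_bound).
  assert (H2 : forall u, Rabs (sin u) <= 1) by (intros; apply Rabs_le, SIN_bound).
  specialize (H1 (IZR (x - y) * k)) as H3. unfold rr. set (m := INR _). pose proof (den_pos k) as Hd.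
  assert (Rabs (- kappa * (kappa * cos (m * k) + sin k * sin (m * k)) / den kappa k) <= 2); [|lra].
  unfold Rdiv. rewrite Rabs_mult, (Rabs_pos_eq (/ _)) by (left; now apply Rinv_0_lt_compat).
  apply Rle_div_l; auto. rewrite Rabs_mult, Rabs_Ropp, (Rabs_pos_eq kappa) by lra.
  assert (Rabs (kappa * cos (m * k) + sin k * sin (m * k)) <= kappa + Rabs (sin k)).
  { eapply Rle_trans; [apply Rabs_triang|]. rewrite !Rabs_mult, (Rabs_pos_eq kappa) by lra.
    pose proof (H1 (m * k)). pose proof (H2 (m * k)). pose proof (Rabs_pos (sin k)). nra. }
  unfold den. rewrite <- (pow2_abs (sin k)). pose proof (Rabs_pos (sin k)).
  apply (Rmult_le_compat_l kappa) in H; [|lra]. pose proof (pow2_ge_0 (kappa - Rabs (sin k))). nra.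
Qed.

(** For y <> 0 both terms solve the free equation. At y = 0 both neighbours have |y| = 1, and the
    resulting kink of the scattered term is compensated by the potential kappa. *)
Lemma kB_eigen x y k : kB kappa x (y - 1) k * hB kappa (y - 1) y + kB kappa x y k * hB kappa y y
   + kB kappa x (y + 1) k * hB kappa (y + 1) y = cos k * kB kappa x y k.
Proof.
  unfold hB. rewrite hfree_refl, hfree_pred, hfree_succ. unfold kB.
  pose proof (den_pos k) as Hd.
  replace (IZR (x - (y - 1)) * k) with (IZR (x - y) * k + k) by (rewrite !minus_IZR; rng).
  replace (IZR (x - (y + 1)) * k) with (IZR (x - y) * k - k) by (rewrite !minus_IZR, plus_IZR; rng).
  set (th := IZR (x - y) * k). rewrite cos_plus, cos_minus.
  destruct (Z.eqb_spec y 0) as [->|Hy].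
  - change (0 - 1)%Z with (-1)%Z. change (0 + 1)%Z with 1%Z. simpl (_ =? _)%Z. simpl andb. cbv iota.
    change (Z.abs_nat (-1)) with 1%nat. change (Z.abs_nat 1) with 1%nat. change (Z.abs_nat 0) with 0%nat.
    rewrite Nat.add_0_r, plus_INR. change (INR 1) with 1. set (m := INR (Z.abs_nat x)).
    assert (Ec : cos th = cos (m * k)).
    { unfold th, m. rewrite Z.sub_0_r, INR_IZR_INZ, Zabs2Nat.id_abs, abs_IZR.
      destruct (Rle_dec 0 (IZR x)); [rewrite Rabs_pos_eq; auto|]. rewrite Rabs_left by lra. rewrite <- Ropp_mult_distr_l. now rewrite cos_neg. }
    unfold rr. replace ((m + 1) * k) with (m * k + k) by rng. rewrite cos_plus, sin_plus.
    rewrite Ec. set (C0 := cos (m * k)). set (S0 := sin (m * k)).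
    assert (Q : kappa ^ 2 + sin k ^ 2 = den kappa k) by reflexivity.
    transitivity (cos k * cos th + kappa * C0 + (- kappa * (kappa * (C0 * cos k - S0 * sin k) + sin k * (S0 * cos k + C0 * sin k)
       + kappa * (kappa * C0 + sin k * S0)) / den kappa k)); [rewrite Ec; fold C0; fld; lra|].
    rewrite Ec; fold C0. transitivity (cos k * C0 + (kappa * C0 * (kappa ^ 2 + sin k ^ 2) +
      - kappa * (kappa * (C0 * cos k - S0 * sin k) + sin k * (S0 * cos k + C0 * sin k)
       + kappa * (kappa * C0 + sin k * S0))) / den kappa k); [rewrite Q; fld; lra | fld; lra].
  - rewrite !Bool.andb_false_r.
    assert (Hr : forall m, / 2 * (rr kappa k (m - 1) + rr kappa k (m + 1)) = cos k * rr kappa k m).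
    { intros m. unfold rr. replace ((m + 1) * k) with (m * k + k) by rng. replace ((m - 1) * k) with (m * k - k) by rng.
      rewrite cos_plus, cos_minus, sin_plus, sin_minus. fld. lra. }
    specialize (Hr (INR (Z.abs_nat x + Z.abs_nat y))).
    assert (Hs : (INR (Z.abs_nat x + Z.abs_nat (y - 1)) = INR (Z.abs_nat x + Z.abs_nat y) - 1 /\
                  INR (Z.abs_nat x + Z.abs_nat (y + 1)) = INR (Z.abs_nat x + Z.abs_nat y) + 1) \/
                 (INR (Z.abs_nat x + Z.abs_nat (y - 1)) = INR (Z.abs_nat x + Z.abs_nat y) + 1 /\
                  INR (Z.abs_nat x + Z.abs_nat (y + 1)) = INR (Z.abs_nat x + Z.abs_nat y) - 1)).
    { rewrite !plus_INR, !INR_IZR_INZ, !Zabs2Nat.id_abs. destruct (Z_lt_le_dec y 0).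
      - right. rewrite (Z.abs_neq (y - 1)), (Z.abs_neq (y + 1)), (Z.abs_neq y), !opp_IZR, minus_IZR, plus_IZR by lia. split; rng.
      - left. rewrite (Z.abs_eq (y - 1)), (Z.abs_eq (y + 1)), (Z.abs_eq y), minus_IZR, plus_IZR by lia. split; rng. }
    destruct Hs as [[-> ->]|[-> ->]]; lra.
Qed.

Lemma psi_eigen y : psi kappa (y - 1) * hB kappa (y - 1) y + psi kappa y * hB kappa y y
   + psi kappa (y + 1) * hB kappa (y + 1) y = E * psi kappa y.
Proof.
  unfold hB, psi. rewrite hfree_refl, hfree_pred, hfree_succ. pose proof z0_sq as Zs. set (s := sqrt _).
  assert (Ez : E = z + kappa) by (unfold z0; rng).
  destruct (Z.eqb_spec y 0) as [->|Hy].
  - change (0 - 1)%Z with (-1)%Z. change (0 + 1)%Z with 1%Z. simpl (_ =? _)%Z. simpl andb. cbv iota.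
    change (Z.abs_nat (-1)) with 1%nat. change (Z.abs_nat 1) with 1%nat. change (Z.abs_nat 0) with 0%nat.
    rewrite Ez at 1. simpl. fld.
  - rewrite !Bool.andb_false_r.
    assert (Hs : exists n, Z.abs_nat y = S n /\ ((Z.abs_nat (y - 1) = n /\ Z.abs_nat (y + 1) = S (S n)) \/
       (Z.abs_nat (y - 1) = S (S n) /\ Z.abs_nat (y + 1) = n))).
    { exists (Z.abs_nat y - 1)%nat. lia. }
    destruct Hs as (n & -> & Hs). replace (E * (s * z ^ S n)) with (s * z ^ n * (z * (z + kappa))) by (rewrite <- Ez; simpl; rng).
    replace (z * (z + kappa)) with (/ 2 * (1 + z * z)) by (rewrite Zs; lra).
    destruct Hs as [[-> ->]|[-> ->]]; simpl; fld.
Qed.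

(** Completeness holds because, by [rrint_nat], the scattered term integrates to minus the bound
    state projection. The bound is 3 e from [kB_abs] plus e from the bound state. *)
Lemma EB_calculus : calculus (hB kappa) E (EB kappa).
Proof.
  pose proof PI_RGT_0 as HP. pose proof En_ge1 as HE1. pose proof En_gt as HEk.
  assert (ck : forall g x y, gcont g -> gcont (fun k => g (cos k) * kB kappa x y k)).
  { intros g x y cg. apply (gcont_mult (fun q => g (cos q))); [apply (gcont_comp g cos); auto; exact ccos|].
    exact (C2_cont _ (kB_C2 x y)). }
  split.
  - intros x y. unfold EB. rewrite Rmult_1_l, psi_mul.
    rewrite (RIext _ (fun k => cos (IZR (x - y) * k) + rr kappa k (INR (Z.abs_nat x + Z.abs_nat y)))) by (lra || (intros; req; unfold kB; rng)).
    rewrite RIplus, RI_cos_PI; [| apply C2_cont; c2 | exact (C2_cont _ (rr_C2 _))].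
    change (RInt (fun k => rr kappa k (INR (Z.abs_nat x + Z.abs_nat y))) 0 PI) with (rrint (INR (Z.abs_nat x + Z.abs_nat y))).
    rewrite rrint_nat. unfold kron. destruct (Z.eq_dec (x - y) 0), (Z.eq_dec x y); try lia; fld; lra.
  - intros g x y cg. unfold EB, mulT.
    set (r1 := RInt (fun k => g (cos k) * kB kappa x (y - 1) k) 0 PI).
    set (r2 := RInt (fun k => g (cos k) * kB kappa x y k) 0 PI).
    set (r3 := RInt (fun k => g (cos k) * kB kappa x (y + 1) k) 0 PI).
    assert (ER : RInt (fun k => cos k * g (cos k) * kB kappa x y k) 0 PI = hB kappa (y - 1) y * r1 + hB kappa y y * r2 + hB kappa (y + 1) y * r3).
    { unfold r1, r2, r3. rewrite <- RI_comb3 by (apply ck; assumption). apply RIext; [lra|]. intros k _.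
      transitivity (g (cos k) * (cos k * kB kappa x y k)); [req; rng|]. rewrite <- kB_eigen. req; rng. }
    rewrite ER. pose proof (psi_eigen y) as K.
    transitivity (/ PI * (hB kappa (y - 1) y * r1 + hB kappa y y * r2 + hB kappa (y + 1) y * r3)
      + g E * psi kappa x * (psi kappa (y - 1) * hB kappa (y - 1) y + psi kappa y * hB kappa y y
   + psi kappa (y + 1) * hB kappa (y + 1) y)); [rng | rewrite K; rng].
  - intros g h a c x y cg ch. unfold EB.
    rewrite (RIext _ (fun k => a * (g (cos k) * kB kappa x y k) + c * (h (cos k) * kB kappa x y k))) by (lra || (intros; req; rng)).
    rewrite RI_comb2 by (apply ck; assumption). rng.
  - intros g e x y cg Hg.
    assert (e0 : 0 <= e) by (eapply Rle_trans; [apply Rabs_pos | apply (Hg 0); lra]).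
    assert (B1 : Rabs (RInt (fun k => g (cos k) * kB kappa x y k) 0 PI) <= (PI - 0) * (e * 3)).
    { apply RIabs_bound; [lra | apply ck; auto|]. intros k _. rewrite Rabs_mult.
      pose proof (COS_bound k). apply Rmult_le_compat; auto using Rabs_pos, kB_abs. apply Hg. lra. }
    assert (B2 : Rabs (g E * (psi kappa x * psi kappa y)) <= e * 1).
    { rewrite Rabs_mult. apply Rmult_le_compat; auto using Rabs_pos. { apply Hg; lra. }
      rewrite psi_mul. pose proof z0_pos. pose proof z0_lt1.
      assert (0 <= z ^ (Z.abs_nat x + Z.abs_nat y) <= 1).
      { split; [apply pow_le; lra|]. rewrite <- (pow1 (Z.abs_nat x + Z.abs_nat y)). apply pow_incr. lra. }
      assert (0 <= kappa / E <= 1). { split; [apply Rle_div_r; lra | apply Rle_div_l; lra]. }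
      rewrite Rabs_pos_eq; [|apply Rmult_le_pos; lra]. nra. }
    unfold EB. eapply Rle_trans; [apply Rabs_triang|].
    rewrite Rabs_mult, (Rabs_pos_eq (/ PI)) by (left; apply Rinv_0_lt_compat; lra).
    assert (/ PI * Rabs (RInt (fun k => g (cos k) * kB kappa x y k) 0 PI) <= / PI * ((PI - 0) * (e * 3))).
    { apply Rmult_le_compat_l; auto. left; apply Rinv_0_lt_compat; lra. }
    replace (/ PI * ((PI - 0) * (e * 3))) with (3 * e) in H by (fld; lra). lra.
Qed.

Lemma EB_sym g x y : EB kappa g x y = EB kappa g y x.
Proof.
  unfold EB. f_equal; [|rng]. f_equal. apply RInt_ext. intros k _. unfold kB.
  rewrite Nat.add_comm. replace (IZR (x - y) * k) with (- (IZR (y - x) * k)) by (rewrite !minus_IZR; rng). now rewrite cos_neg.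
Qed.
End EB.

(** * Time evolution *)

Lemma exp_partial x K : 0 <= x -> sum_f_R0 (fun n => x ^ n / INR (fact n)) K <= exp x.
Proof.
  intros Hx. apply sum_incr.
  - pose proof (is_exp_Reals x) as H. apply is_pseries_R in H. apply is_series_Reals in H.
    intros eps He. destruct (H eps He) as [N HN]. exists N. intros n Hn. specialize (HN n Hn).
    rewrite (sum_eq _ (fun k => / INR (fact k) * x ^ k)); auto. intros; field. apply INR_fact_neq_0.
  - intros n. apply Rle_div_r; [apply INR_fact_lt_0|]. rewrite Rmult_0_l. now apply pow_le.
Qed.

Lemma pow_fact_small x : forall eps, 0 < eps -> exists N, forall n, (N <= n)%nat -> Rabs (x ^ n / INR (fact n)) <= eps.
Proof.
  intros eps He. destruct (cv_speed_pow_fact x eps He) as [N HN]. exists N. intros n Hn.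
  specialize (HN n Hn). unfold Rdist in HN. rewrite Rminus_0_r in HN. lra.
Qed.

Definition cexp (z : C) : C := (RtoC (exp (fst z)) * cis (snd z))%C.

Fixpoint tayl (K : nat) (z : C) : C :=
  match K with O => RtoC 1 | S k => (tayl k z + RtoC (/ INR (fact (S k))) * Cpow z (S k))%C end.

Lemma Cpow_scal (s : R) z n : Cpow (RtoC s * z)%C n = (RtoC (s ^ n) * Cpow z n)%C.
Proof.
  induction n as [|n IH]; simpl; [ring|]. rewrite IH, RtoC_mult. ring.
Qed.

Lemma cder_ext f g x d : (forall y, f y = g y) -> cder f x d -> cder g x d.
Proof.
  intros H [H1 H2]. split; eapply is_derive_ext; try eassumption; intros; simpl; now rewrite H.
Qed.

Lemma cder_plus f g x a b : cder f x a -> cder g x b -> cder (fun x => (f x + g x)%C) x (a + b)%C.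
Proof. intros [] []. split; simpl; now apply dplus. Qed.

Lemma cder_tayl K z s : cder (fun s => tayl K (RtoC s * z)) s
  (z * (tayl K (RtoC s * z) - RtoC (/ INR (fact K)) * Cpow (RtoC s * z) K))%C.
Proof.
  induction K as [|K IH].
  - simpl. replace (z * (RtoC 1 - RtoC (/ 1) * RtoC 1))%C with (RtoC 0) by (rewrite Rinv_1; ring).
    split; simpl; apply (is_derive_const (V := R_NormedModule)).
  - cbn [tayl]. evar_last.
    { apply cder_plus; [exact IH|].
      apply (cder_ext (fun s => (RtoC (s ^ S K) * (RtoC (/ INR (fact (S K))) * Cpow z (S K)))%C)).
      { intros y. rewrite Cpow_scal. ring. }
      apply (cder_mult (fun s => RtoC (s ^ S K))).
      - apply cder_RtoC. instantiate (1 := INR (S K) * s ^ K). evar_last; [apply (is_derive_pow (fun y => y) (S K) s 1); apply (is_derive_id (K := R_AbsRing))|]. change (pred (S K)) with K. rng.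
      - apply (conj (is_derive_const (V := R_NormedModule) _ _) (is_derive_const (V := R_NormedModule) _ _) : cder (fun _ => (RtoC (/ INR (fact (S K))) * Cpow z (S K))%C) s (RtoC 0)). }
    cbv beta. rewrite !Cpow_scal. assert (E : RtoC (/ INR (fact K)) = (RtoC (INR (S K)) * RtoC (/ INR (fact (S K))))%C).
    { rewrite <- RtoC_mult. f_equal. rewrite fact_simpl, mult_INR. field. split; [apply INR_fact_neq_0 | apply not_0_INR; lia]. }
    rewrite E, (RtoC_mult (INR (S K))). change (Cpow z (S K)) with (z * Cpow z K)%C. ring.
Qed.

Lemma exp_le_compat x y : x <= y -> exp x <= exp y.
Proof. intros [H| ->]; [left; now apply exp_increasing | lra]. Qed.

(** The function s -> tayl K (s z) e^{- s z} starts at 1 and has derivative - z (s z)^K / K! e^{- s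
    z}. The relative form of the error serves both for e^{ith} and for the modulus of the trial
    polynomials. *)
Lemma tayl_bound K z : Cmod (tayl K z * cexp (- z) - RtoC 1)%C <= Cmod z ^ S K / INR (fact K) * exp (Cmod z).
Proof.
  set (e := fun s : R => (RtoC (exp (- fst z * s)) * cis (- snd z * s))%C).
  set (dG := fun s => (- z * (RtoC (/ INR (fact K)) * (RtoC (s ^ K) * Cpow z K)) * e s)%C).
  assert (He : Cc e).
  { apply CC2_Cc. unfold e. cc2. }
  assert (cd : Cc dG).
  { apply Cc_mult; auto. apply Cc_mult; [apply Cc_const|]. apply Cc_mult; [apply Cc_const|]. apply Cc_mult; [|apply Cc_const].
    apply CC2_Cc, CC2_RtoC. apply (C2_pow (fun x => x)). c2. }
  assert (F : cint dG 0 1 = (tayl K (RtoC 1 * z) * e 1 - tayl K (RtoC 0 * z) * e 0)%C).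
  { apply (cFTC_loc (fun s => (tayl K (RtoC s * z) * e s)%C)); [lra| |auto].
    intros s _. evar_last.
    { apply cder_mult; [apply cder_tayl|]. unfold e. apply cder_mult.
      - apply cder_RtoC. instantiate (1 := - fst z * exp (- fst z * s)). auto_derive; auto. req; ring.
      - apply cder_cis. instantiate (1 := - snd z). auto_derive; auto. req; ring. }
    unfold dG. rewrite Cpow_scal. fold (e s).
    assert (Ez : z = (RtoC (fst z) + Ci * RtoC (snd z))%C) by (unfold Ci, RtoC, Cmult, Cplus; simpl; rewrite (surjective_pairing z) at 1; f_equal; ring).
    transitivity (z * (tayl K (RtoC s * z) - RtoC (/ INR (fact K)) * (RtoC (s ^ K) * Cpow z K)) * e s + tayl K (RtoC s * z) * (- (RtoC (fst z) + Ci * RtoC (snd z)) * e s))%C.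
    { f_equal. f_equal. unfold e. rewrite RtoC_mult, !RtoC_opp. ring. }
    rewrite <- Ez. ring. }
  replace (tayl K z * cexp (- z) - RtoC 1)%C with (cint dG 0 1).
  2:{ rewrite F. replace (RtoC 1 * z)%C with z by ring.
      replace (e 1) with (cexp (- z)) by (unfold e, cexp; simpl; now rewrite !Rmult_1_r).
      replace (e 0) with (RtoC 1) by (unfold e; rewrite !Rmult_0_r, exp_0, cis_0; ring).
      replace (tayl K (RtoC 0 * z)) with (RtoC 1). ring.
      clear. induction K as [|K IH]; simpl; auto. rewrite <- IH. ring. }
  eapply Rle_trans; [apply (cint_bound _ 0 1 (Cmod z ^ S K / INR (fact K) * exp (Cmod z))); [lra|auto|]|lra].
  intros s Hs. unfold dG, e. rewrite !Cmod_mult, Cmod_opp, !Cmod_R, Cmod_cis, Cmod_pow.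
  rewrite (Rabs_pos_eq (/ _)) by (left; apply Rinv_0_lt_compat, INR_fact_lt_0).
  rewrite (Rabs_pos_eq (s ^ K)) by (apply pow_le; lra). rewrite (Rabs_pos_eq (exp _)) by (left; apply exp_pos).
  assert (S1 : s ^ K <= 1) by (rewrite <- (pow1 K); apply pow_incr; lra).
  assert (S0 : 0 <= s ^ K) by (apply pow_le; lra).
  assert (E1 : exp (- fst z * s) <= exp (Cmod z)).
  { apply exp_le_compat. pose proof (Re_le_Cmod z) as R1. apply Rabs_le_between in R1. pose proof (Cmod_ge_0 z). nra. }
  replace (Cmod z ^ S K / INR (fact K) * exp (Cmod z)) with (Cmod z * (/ INR (fact K) * (1 * Cmod z ^ K)) * (exp (Cmod z) * 1)) by (simpl; field; apply INR_fact_neq_0).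
  pose proof (Cmod_ge_0 z). assert (0 < / INR (fact K)) by apply Rinv_0_lt_compat, INR_fact_lt_0.
  assert (0 <= Cmod z ^ K) by now apply pow_le.
  apply Rmult_le_compat.
  - apply Rmult_le_pos; auto. apply Rmult_le_pos; [lra|]. now apply Rmult_le_pos.
  - rewrite Rmult_1_r. left; apply exp_pos.
  - apply Rmult_le_compat_l; auto. apply Rmult_le_compat_l; [lra|]. apply Rmult_le_compat_r; auto.
  - lra.
Qed.

Lemma tayl_cis K th : Cmod (tayl K (Ci * RtoC th) - cis th)%C <= Rabs th ^ S K / INR (fact K) * exp (Rabs th).
Proof.
  assert (M : Cmod (Ci * RtoC th)%C = Rabs th) by (rewrite Cmod_mult, Cmod_Ci, Cmod_R; ring).
  pose proof (tayl_bound K (Ci * RtoC th)%C) as H. rewrite M in H.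
  eapply Rle_trans; [|exact H]. right.
  assert (E : cexp (- (Ci * RtoC th)) = cis (- th)).
  { unfold cexp; simpl. replace (- (0 * th - 1 * 0)) with 0 by ring. replace (- (0 * 0 + 1 * th)) with (- th) by ring.
    rewrite exp_0. ring. }
  rewrite E.
  assert (E1 : (cis th * cis (- th))%C = RtoC 1) by (rewrite <- cis_plus, Rplus_opp_r; apply cis_0).
  replace (tayl K (Ci * RtoC th) * cis (- th) - RtoC 1)%C with ((tayl K (Ci * RtoC th) - cis th) * cis (- th))%C by (rewrite <- E1; ring).
  rewrite Cmod_mult, Cmod_cis. ring.
Qed.

Lemma tayl_unif B eps : 0 <= B -> 0 < eps -> exists K0, forall K th, (K0 <= K)%nat -> Rabs th <= B ->
  Cmod (tayl K (Ci * RtoC th) - cis th)%C <= eps.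
Proof.
  intros HB He. assert (Q : 0 < (B + 1) * exp B) by (apply Rmult_lt_0_compat; [lra | apply exp_pos]).
  destruct (pow_fact_small B (eps / ((B + 1) * exp B))) as [N HN]; [now apply Rdiv_lt_0_compat|].
  exists N. intros K th HK Hth. eapply Rle_trans; [apply tayl_cis|].
  specialize (HN K HK). pose proof (INR_fact_lt_0 K) as F0.
  rewrite Rabs_pos_eq in HN by (apply Rle_div_r; auto; rewrite Rmult_0_l; now apply pow_le).
  pose proof (Rabs_pos th). pose proof (exp_pos B).
  assert (0 <= B ^ K) by now apply pow_le.
  apply Rle_trans with (B ^ K / INR (fact K) * ((B + 1) * exp B)).
  - simpl pow. replace (B ^ K / INR (fact K) * ((B + 1) * exp B)) with ((B + 1) * (B ^ K / INR (fact K)) * exp B) by (field; lra).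
    apply Rmult_le_compat; [|left; apply exp_pos| |now apply exp_le_compat].
    + apply Rle_div_r; auto. rewrite Rmult_0_l. apply Rmult_le_pos; auto. now apply pow_le.
    + unfold Rdiv. rewrite Rmult_assoc. apply Rmult_le_compat; [auto| |lra|].
      * apply Rmult_le_pos; [now apply pow_le | left; now apply Rinv_0_lt_compat].
      * apply Rmult_le_compat_r; [left; now apply Rinv_0_lt_compat|]. apply pow_incr; auto.
  - apply (Rmult_le_compat_r ((B + 1) * exp B)) in HN; [|lra].
    replace (eps / ((B + 1) * exp B) * ((B + 1) * exp B)) with eps in HN by (field; lra). exact HN.
Qed.

Definition te (t : R) (n : nat) : C := (RtoC (t ^ n / INR (fact n)) * Cpow Ci n)%C.

Lemma tayl_te K t l :
  fst (tayl K (Ci * RtoC (t * l))) = sum_f_R0 (fun n => fst (te t n) * l ^ n) K /\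
  snd (tayl K (Ci * RtoC (t * l))) = sum_f_R0 (fun n => snd (te t n) * l ^ n) K.
Proof.
  induction K as [|K [IH1 IH2]]; [simpl; split; field|].
  assert (E : (RtoC (/ INR (fact (S K))) * Cpow (Ci * RtoC (t * l)) (S K))%C = (te t (S K) * RtoC (l ^ S K))%C).
  { unfold te. rewrite (Cmult_comm Ci), Cpow_scal, Rpow_mult_distr. unfold Rdiv. rewrite !RtoC_mult. ring. }
  cbn [tayl sum_f_R0]. rewrite E. cbn [fst snd Cplus]. rewrite IH1, IH2.
  split; f_equal; simpl fst; simpl snd; simpl; ring.
Qed.

Section Evolution.
Variable kappa : R.
Hypothesis hk : 0 < kappa.
Notation E := (En kappa).

(** The propagator in the eigenfunction expansion; [Ut_uu] identifies it with the exponential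
    series. *)
Definition uu (t : R) (x y : Z) : C :=
  (EB kappa (fun l => cos (t * l)) x y, EB kappa (fun l => sin (t * l)) x y).

Lemma gcont_ct t : gcont (fun l => cos (t * l)).
Proof. gc. Qed.
Lemma gcont_st t : gcont (fun l => sin (t * l)).
Proof. gc. Qed.

Definition TS (a : nat -> R) (K : nat) (x y : Z) : R := sum_f_R0 (fun n => a n * powT (hB kappa) n x y) K.

Lemma TS_EB a K x y : TS a K x y = EB kappa (fun l => sum_f_R0 (fun n => a n * l ^ n) K) x y.
Proof.
  unfold TS. rewrite (sum_eq _ (fun n => a n * EB kappa (fun l => l ^ n) x y)).
  - apply (calc_sum (hB kappa) E); [now apply EB_calculus|]. intros k. apply (gcont_pow (fun l => l)). apply gcont_id.
  - intros n _. now rewrite (calc_powT (hB kappa) E (EB kappa) (EB_calculus kappa hk)).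
Qed.

Lemma En_abs l : - E <= l <= E -> forall t, Rabs (t * l) <= Rabs t * E.
Proof. intros H t. rewrite Rabs_mult. apply Rmult_le_compat_l; [apply Rabs_pos|]. now apply Rabs_le. Qed.

Lemma TS_close t eps : 0 < eps -> exists K0, forall K x y, (K0 <= K)%nat ->
  Rabs (TS (fun n => fst (te t n)) K x y - fst (uu t x y)) <= eps /\
  Rabs (TS (fun n => snd (te t n)) K x y - snd (uu t x y)) <= eps.
Proof.
  intros He. destruct (tayl_unif (Rabs t * E) (eps / 5)) as [K0 HK]; [|lra|].
  { apply Rmult_le_pos; [apply Rabs_pos|]. pose proof (En_pos kappa). lra. }
  exists K0. intros K x y HKK.
  assert (gs : forall a : nat -> R, gcont (fun l => sum_f_R0 (fun n => a n * l ^ n) K)).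
  { intros a. apply (gcont_sum (fun n l => a n * l ^ n)). intros k. gc. }
  rewrite !TS_EB. unfold uu. cbn [fst snd].
  replace eps with (5 * (eps / 5)) by field.
  split; apply (calc_close (hB kappa) E _ (EB_calculus kappa hk)); auto using gcont_ct, gcont_st; intros l Hl;
    specialize (HK K (t * l) HKK (En_abs l Hl t)); destruct (tayl_te K t l) as [E1 E2].
  - rewrite <- E1. eapply Rle_trans; [|exact HK]. eapply Rle_trans; [|apply Re_le_Cmod]. simpl. right; f_equal; ring.
  - rewrite <- E2. eapply Rle_trans; [|exact HK]. eapply Rle_trans; [|apply Im_le_Cmod]. simpl. right; f_equal; ring.
Qed.

Lemma Series_TS (f : nat -> R) l : (forall eps, 0 < eps -> exists K0, forall K, (K0 <= K)%nat -> Rabs (sum_f_R0 f K - l) <= eps) ->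
  Series f = l.
Proof.
  intros H. apply is_series_unique. apply is_series_Reals. intros eps He.
  destruct (H (eps / 2)) as [K0 HK]; [lra|]. exists K0. intros n Hn. unfold Rdist. specialize (HK n Hn). lra.
Qed.

Lemma Ut_uu t x y : Ut kappa t x y = uu t x y.
Proof.
  unfold Ut, CSeries.
  assert (E1 : forall n, (RtoC (t ^ n / INR (fact n) * powT (hB kappa) n x y) * Cpow Ci n)%C = (te t n * RtoC (powT (hB kappa) n x y))%C).
  { intros n. unfold te. rewrite RtoC_mult. ring. }
  apply injective_projections; cbn [fst snd].
  - apply Series_TS. intros eps He. destruct (TS_close t eps He) as [K0 HK]. exists K0. intros K HKK.
    destruct (HK K x y HKK) as [H _]. unfold TS in H. erewrite sum_eq; [exact H|]. intros n _. cbv beta. rewrite E1. unfold Re. simpl. ring.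
  - apply Series_TS. intros eps He. destruct (TS_close t eps He) as [K0 HK]. exists K0. intros K HKK.
    destruct (HK K x y HKK) as [_ H]. unfold TS in H. erewrite sum_eq; [exact H|]. intros n _. cbv beta. rewrite E1. unfold Im. simpl. ring.
Qed.

Definition dist (x y : Z) : nat := Z.abs_nat (x - y).

Lemma half_pow_pos n : 0 < (/ 2) ^ n.
Proof. apply pow_lt; lra. Qed.

Lemma half_dist x y y' : (Z.abs (y - y') <= 1)%Z -> (/ 2) ^ dist x y' <= 2 * (/ 2) ^ dist x y.
Proof.
  intros H. assert (dist x y <= S (dist x y'))%nat as L by (unfold dist; lia).
  pose proof (half_pow_pos (dist x y')) as P.
  apply Rle_trans with (2 * (/ 2) ^ S (dist x y')); [simpl; lra|]. apply Rmult_le_compat_l; [lra|].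
  generalize (S (dist x y')) (dist x y) L. clear. intros m n L.
  replace m with (n + (m - n))%nat by lia. rewrite pow_add. pose proof (half_pow_pos n).
  assert ((/ 2) ^ (m - n) <= 1) by (rewrite <- (pow1 (m - n)); apply pow_incr; lra). pose proof (half_pow_pos (m - n)). nra.
Qed.

(** One hop changes the weight 2^(- |x - y|) by at most a factor 2, so one application of h_B costs
    1/2 * 2 + kappa + 1/2 * 2 = 2 + kappa. *)
Lemma powT_decay n x y : Rabs (powT (hB kappa) n x y) <= (2 + kappa) ^ n * (/ 2) ^ dist x y.
Proof.
  revert y. induction n as [|n IH]; intros y.
  - simpl. rewrite Rmult_1_l. unfold kron. destruct (Z.eq_dec x y) as [->|].
    + unfold dist. rewrite Z.sub_diag. simpl. rewrite Rabs_R1. lra.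
    + rewrite Rabs_R0. left; apply half_pow_pos.
  - change (powT (hB kappa) (S n) x y) with (mulT (powT (hB kappa) n) (hB kappa) x y). unfold mulT, hB.
    rewrite hfree_refl, hfree_pred, hfree_succ.
    assert ((y - 1 =? 0)%Z && (y =? 0)%Z = false)%bool as -> by (destruct (Z.eqb_spec (y - 1) 0), (Z.eqb_spec y 0); auto; lia).
    assert ((y + 1 =? 0)%Z && (y =? 0)%Z = false)%bool as -> by (destruct (Z.eqb_spec (y + 1) 0), (Z.eqb_spec y 0); auto; lia).
    set (c := if ((y =? 0)%Z && (y =? 0)%Z)%bool then kappa else 0). assert (Hc : 0 <= c <= kappa) by (unfold c; destruct (_ && _)%bool; lra).
    rewrite !Rplus_0_r, Rplus_0_l. set (h := (/ 2) ^ dist x y). set (p := (2 + kappa) ^ n).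
    assert (p0 : 0 < p) by (apply pow_lt; lra). assert (h0 : 0 < h) by apply half_pow_pos.
    pose proof (IH (y - 1)%Z) as I1. pose proof (IH y) as I2. pose proof (IH (y + 1)%Z) as I3. fold p h in I1, I2, I3.
    pose proof (half_dist x y (y - 1) ltac:(lia)) as D1. pose proof (half_dist x y (y + 1) ltac:(lia)) as D3. fold h in D1, D3.
    eapply Rle_trans; [apply Rabs_triang|]. eapply Rle_trans; [apply Rplus_le_compat_r, Rabs_triang|].
    rewrite !Rabs_mult, (Rabs_pos_eq c), (Rabs_pos_eq (/ 2)) by lra.
    replace ((2 + kappa) ^ S n * h) with (p * (2 * h) * / 2 + p * h * kappa + p * (2 * h) * / 2) by (simpl; fold p; field).
    repeat apply Rplus_le_compat.
    + apply Rmult_le_compat_r; [lra|]. eapply Rle_trans; [exact I1|]. apply Rmult_le_compat_l; lra.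
    + apply Rmult_le_compat; auto using Rabs_pos; lra.
    + apply Rmult_le_compat_r; [lra|]. eapply Rle_trans; [exact I3|]. apply Rmult_le_compat_l; lra.
Qed.

Definition ubd (T : R) : R := exp (T * (2 + kappa)).

Lemma TS_decay (a : nat -> R) t T K x y : (forall n, Rabs (a n) <= Rabs t ^ n / INR (fact n)) -> Rabs t <= T ->
  Rabs (TS a K x y) <= ubd T * (/ 2) ^ dist x y.
Proof.
  intros Ha Ht. unfold TS. eapply Rle_trans; [apply (Rabs_triang_gen (fun n => a n * powT (hB kappa) n x y))|].
  pose proof (Rabs_pos t) as Hp.
  apply Rle_trans with (sum_f_R0 (fun n => (Rabs t * (2 + kappa)) ^ n / INR (fact n)) K * (/ 2) ^ dist x y).
  - rewrite Rmult_comm, scal_sum. apply sum_Rle. intros n _. rewrite Rabs_mult, Rpow_mult_distr.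
    replace (Rabs t ^ n * (2 + kappa) ^ n / INR (fact n) * (/ 2) ^ dist x y) with (Rabs t ^ n / INR (fact n) * ((2 + kappa) ^ n * (/ 2) ^ dist x y)) by (field; apply INR_fact_neq_0).
    apply Rmult_le_compat; auto using Rabs_pos, powT_decay.
  - apply Rmult_le_compat_r; [left; apply half_pow_pos|]. eapply Rle_trans; [apply exp_partial|].
    + apply Rmult_le_pos; lra.
    + apply exp_le_compat. apply Rmult_le_compat_r; lra.
Qed.

Lemma te_abs t n : Cmod (te t n) = Rabs t ^ n / INR (fact n).
Proof.
  unfold te. rewrite Cmod_mult, Cmod_R, Cmod_pow, Cmod_Ci, pow1, Rmult_1_r. unfold Rdiv.
  rewrite Rabs_mult, <- RPow_abs, (Rabs_pos_eq (/ _)); auto. left; apply Rinv_0_lt_compat, INR_fact_lt_0.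
Qed.

Lemma Rle_eps a b : (forall eps, 0 < eps -> a <= b + eps) -> a <= b.
Proof. intros H. apply Rnot_lt_le. intros L. specialize (H ((a - b) / 2)). lra. Qed.

(** Exponential localisation, uniform over bounded times. It lets every sum over Z be replaced by a
    finite window with an error halved at each enlargement. *)
Lemma uu_decay t T x y : Rabs t <= T -> Cmod (uu t x y) <= 2 * ubd T * (/ 2) ^ dist x y.
Proof.
  intros Ht. eapply Rle_trans; [apply Cmod_le_parts|].
  assert (Rabs (fst (uu t x y)) <= ubd T * (/ 2) ^ dist x y /\ Rabs (snd (uu t x y)) <= ubd T * (/ 2) ^ dist x y); [|lra].
  split; apply Rle_eps; intros eps He; destruct (TS_close t eps He) as [K HK]; specialize (HK K x y (le_n _)); destruct HK as [H1 H2].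
  - assert (H3 := TS_decay (fun n => fst (te t n)) t T K x y (fun n => Rle_trans _ _ _ (Re_le_Cmod _) (Req_le _ _ (te_abs t n))) Ht).
    rewrite Rabs_minus_sym in H1. pose proof (Rabs_triang_inv (fst (uu t x y)) (TS (fun n => fst (te t n)) K x y)). lra.
  - assert (H3 := TS_decay (fun n => snd (te t n)) t T K x y (fun n => Rle_trans _ _ _ (Im_le_Cmod _) (Req_le _ _ (te_abs t n))) Ht).
    rewrite Rabs_minus_sym in H2. pose proof (Rabs_triang_inv (snd (uu t x y)) (TS (fun n => snd (te t n)) K x y)). lra.
Qed.

Lemma uu_sym t x y : uu t x y = uu t y x.
Proof. unfold uu. now rewrite !(EB_sym kappa _ x y). Qed.

Lemma uu_opp t x y : uu (- t) x y = Cconj (uu t x y).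
Proof.
  unfold uu, Cconj. apply injective_projections; cbn [fst snd].
  - apply (calc_ext (hB kappa) E _ (EB_calculus kappa hk)); auto using gcont_ct.
    intros l _. rewrite Ropp_mult_distr_l_reverse. apply cos_neg.
  - pose proof (calc_lin _ _ _ (EB_calculus kappa hk) (fun l => sin (t * l)) (fun l => sin (t * l)) (-1) 0 x y (gcont_st t) (gcont_st t)) as L.
    replace (- EB kappa (fun l => sin (t * l)) x y) with (-1 * EB kappa (fun l => sin (t * l)) x y + 0 * EB kappa (fun l => sin (t * l)) x y) by ring.
    rewrite <- L. apply (calc_ext (hB kappa) E _ (EB_calculus kappa hk)); auto using gcont_st.
    + gc. + intros l _. rewrite Ropp_mult_distr_l_reverse, sin_neg. ring.
Qed.

(** The phase t l varies by at most E |t - s| over the spectrum. This is the source of the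
    continuity in t behind the time averages. *)
Lemma uu_lip t s x y : Cmod (uu t x y - uu s x y)%C <= 10 * E * Rabs (t - s).
Proof.
  pose proof (En_pos kappa) as Ep.
  assert (H : forall f f' : R -> R, (forall z, is_derive f z (f' z)) -> (forall z, Rabs (f' z) <= 1) ->
     forall a b, Rabs (f a - f b) <= Rabs (a - b)).
  { intros f f' Hd Hb a b. destruct (MVT_gen f b a f') as [c [_ Ec]].
    - intros; apply Hd. - intros z _. apply continuity_pt_filterlim. exact (dcont _ _ _ (Hd z)).
    - rewrite Ec, Rabs_mult. rewrite <- (Rmult_1_l (Rabs (a - b))) at 2. apply Rmult_le_compat_r; auto using Rabs_pos. }
  eapply Rle_trans; [apply Cmod_le_parts|]. unfold uu; simpl.
  assert (A : forall l, - E <= l <= E -> Rabs (t * l - s * l) <= E * Rabs (t - s)).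
  { intros l Hl. rewrite <- Rmult_minus_distr_r, Rabs_mult, Rmult_comm. apply Rmult_le_compat_r; [apply Rabs_pos|]. now apply Rabs_le. }
  assert (H1 : Rabs (EB kappa (fun l => cos (t * l)) x y - EB kappa (fun l => cos (s * l)) x y) <= 5 * (E * Rabs (t - s))).
  { apply (calc_close (hB kappa) E _ (EB_calculus kappa hk)); auto using gcont_ct. intros l Hl.
    eapply Rle_trans; [apply (H cos (fun z => - sin z))|auto].
    - intros; apply is_derive_cos. - intros; rewrite Rabs_Ropp. apply Rabs_le, SIN_bound. }
  assert (H2 : Rabs (EB kappa (fun l => sin (t * l)) x y - EB kappa (fun l => sin (s * l)) x y) <= 5 * (E * Rabs (t - s))).
  { apply (calc_close (hB kappa) E _ (EB_calculus kappa hk)); auto using gcont_st. intros l Hl.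
    eapply Rle_trans; [apply (H sin cos)|auto].
    - intros; apply is_derive_sin. - intros; apply Rabs_le, COS_bound. }
  unfold Rminus in *. lra.
Qed.
End Evolution.

(** * Sums over windows and unitarity *)

(** The sites - M - 1..M in the grouping of the partial sums of [sumZ], which pair n with - n -
    1. *)
Fixpoint win (M : nat) : list Z :=
  match M with O => [0; -1]%Z | S m => Z.of_nat (S m) :: (- Z.of_nat (S m) - 1)%Z :: win m end.

Lemma win_spec M x : In x (win M) <-> (- Z.of_nat M - 1 <= x <= Z.of_nat M)%Z.
Proof.
  induction M as [|M IH]; [simpl; lia|]. cbn [win In]. rewrite IH. lia.
Qed.
Lemma win_NoDup M : NoDup (win M).
Proof.
  induction M as [|M IH].
  - repeat constructor; simpl; lia.
  - cbn [win]. constructor; [|constructor; auto].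
    + cbn [In]. rewrite win_spec. lia.
    + rewrite win_spec. lia.
Qed.

Definition zh (x : Z) : R := (/ 2) ^ Z.abs_nat x.
Lemma zh_pos x : 0 < zh x. Proof. apply pow_lt; lra. Qed.

Lemma rsum_zh M : rsum zh (win M) <= 3.
Proof.
  assert (H : rsum zh (win M) = 3 - 3 * (/ 2) ^ S M).
  { induction M as [|M IH].
    - unfold rsum, zh; simpl. lra.
    - cbn [win]. rewrite !rsum_cons, IH. unfold zh.
      replace (Z.abs_nat (Z.of_nat (S M))) with (S M) by lia.
      replace (Z.abs_nat (- Z.of_nat (S M) - 1)) with (S (S M)) by lia. simpl. lra. }
  rewrite H. pose proof (pow_lt (/ 2) (S M)). lra.
Qed.

Lemma Series_tail (a : nat -> R) c M : 0 <= c -> (forall n, Rabs (a n) <= c * (/ 2) ^ n) ->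
  Rabs (Series a - sum_f_R0 a M) <= c * (/ 2) ^ M.
Proof.
  intros Hc Ha.
  assert (Eg : ex_series (fun n => (/ 2) ^ n)) by (apply ex_series_geom; rewrite Rabs_pos_eq; lra).
  assert (Ec : ex_series (fun n => c * (/ 2) ^ n)) by now apply (ex_series_scal (V := R_NormedModule) c).
  assert (Ea : ex_series a) by (apply (ex_series_le (V := R_CompleteNormedModule) a (fun n => c * (/ 2) ^ n)); auto).
  rewrite (Series_incr_n a (S M)) by (auto; lia). simpl pred.
  replace (_ + _ - _) with (Series (fun k => a (S M + k)%nat)) by (cbv beta; ring).
  assert (Hk : forall k, Rabs (a (S M + k)%nat) <= c * (/ 2) ^ S M * (/ 2) ^ k).
  { intros k. rewrite Rmult_assoc, <- pow_add. apply Ha. }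
  assert (Ed : ex_series (fun k => c * (/ 2) ^ S M * (/ 2) ^ k)) by now apply (ex_series_scal (V := R_NormedModule) (c * (/ 2) ^ S M)).
  assert (Eb : ex_series (fun k => Rabs (a (S M + k)%nat))).
  { apply (ex_series_le (V := R_CompleteNormedModule) _ (fun k => c * (/ 2) ^ S M * (/ 2) ^ k)); auto.
    intros k. unfold norm; simpl. unfold abs; simpl. rewrite Rabs_Rabsolu. apply Hk. }
  eapply Rle_trans; [now apply Series_Rabs|].
  eapply Rle_trans; [apply (Series_le _ (fun k => c * (/ 2) ^ S M * (/ 2) ^ k)); auto|].
  - intros k; split; auto using Rabs_pos.
  - rewrite Series_scal_l, Series_geom by (rewrite Rabs_pos_eq; lra). simpl. right. field.
Qed.

Lemma csum_win_series f M : csum f (win M) =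
  (sum_f_R0 (fun n => fst (f (Z.of_nat n) + f (- Z.of_nat n - 1)%Z)%C) M,
   sum_f_R0 (fun n => snd (f (Z.of_nat n) + f (- Z.of_nat n - 1)%Z)%C) M).
Proof.
  induction M as [|M IH].
  - cbn [win sum_f_R0]. rewrite !csum_cons, csum_nil. simpl. apply injective_projections; simpl; ring.
  - cbn [win]. rewrite !csum_cons, IH. cbn [sum_f_R0]. apply injective_projections; simpl; ring.
Qed.

Lemma sumZ_win (f : Z -> C) B : 0 <= B -> (forall x, Cmod (f x) <= B * zh x) ->
  forall M, Cmod (sumZ f - csum f (win M))%C <= 4 * B * (/ 2) ^ M.
Proof.
  intros HB Hf M. rewrite csum_win_series. unfold sumZ, CSeries.
  assert (Hn : forall n, Cmod (f (Z.of_nat n) + f (- Z.of_nat n - 1)%Z)%C <= 2 * B * (/ 2) ^ n).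
  { intros n. eapply Rle_trans; [apply Cmod_triangle|].
    pose proof (Hf (Z.of_nat n)) as H1. pose proof (Hf (- Z.of_nat n - 1)%Z) as H2. unfold zh in *.
    replace (Z.abs_nat (Z.of_nat n)) with n in H1 by lia. replace (Z.abs_nat (- Z.of_nat n - 1)) with (S n) in H2 by lia.
    simpl in H2. pose proof (half_pow_pos n). nra. }
  eapply Rle_trans; [apply Cmod_le_parts|].
  assert (H1 := Series_tail (fun n => fst (f (Z.of_nat n) + f (- Z.of_nat n - 1)%Z)%C) (2 * B) M ltac:(lra)
     (fun n => Rle_trans _ _ _ (Re_le_Cmod _) (Hn n))).
  assert (H2 := Series_tail (fun n => snd (f (Z.of_nat n) + f (- Z.of_nat n - 1)%Z)%C) (2 * B) M ltac:(lra)
     (fun n => Rle_trans _ _ _ (Im_le_Cmod _) (Hn n))).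
  unfold Rminus in H1, H2. cbn [fst snd Cminus Cplus Copp] in *. unfold Re, Im. cbn [fst snd Cplus]. lra.
Qed.

Lemma sumZ_ext f g : (forall x, f x = g x) -> sumZ f = sumZ g.
Proof.
  intros H. unfold sumZ, CSeries. f_equal; apply Series_ext; intros n; now rewrite !H.
Qed.

Lemma half_small eps K : 0 < eps -> 0 <= K -> exists M0, forall M, (M0 <= M)%nat -> K * (/ 2) ^ M <= eps.
Proof.
  intros He HK. destruct (pow_lt_1_zero (/ 2) ltac:(rewrite Rabs_pos_eq; lra) (eps / (K + 1))) as [M0 HM].
  { apply Rdiv_lt_0_compat; lra. }
  exists M0. intros M HMM. specialize (HM M HMM). rewrite Rabs_pos_eq in HM by (apply pow_le; lra).
  pose proof (half_pow_pos M). apply (Rmult_lt_compat_r (K + 1)) in HM; [|lra].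
  unfold Rdiv in HM. rewrite Rmult_assoc, Rinv_l in HM by lra. nra.
Qed.

Lemma Cmod_small_eq (z w : C) : (forall eps, 0 < eps -> Cmod (z - w)%C <= eps) -> z = w.
Proof.
  intros H. assert (Cmod (z - w)%C = 0).
  { pose proof (Cmod_ge_0 (z - w)%C). apply Rle_antisym; auto. apply Rle_eps. intros; rewrite Rplus_0_l; auto. }
  apply Cmod_eq_0 in H0. rewrite <- (Cplus_0_r w), <- H0. ring.
Qed.

Lemma Cmod_sub_tri (a b c : C) : Cmod (a - c)%C <= Cmod (a - b)%C + Cmod (c - b)%C.
Proof.
  replace (a - c)%C with ((a - b) + - (c - b))%C by ring. eapply Rle_trans; [apply Cmod_triangle|]. rewrite Cmod_opp. lra.
Qed.

Lemma sumZ_single (g : Z -> C) a : sumZ (fun x => (g x * RtoC (kron x a))%C) = g a.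
Proof.
  apply Cmod_small_eq. intros eps He.
  assert (P : 0 < 2 ^ Z.abs_nat a) by (apply pow_lt; lra).
  set (B := Cmod (g a) * 2 ^ Z.abs_nat a).
  assert (B0 : 0 <= B) by (apply Rmult_le_pos; [apply Cmod_ge_0 | lra]).
  destruct (half_small eps (4 * B)) as [M0 HM]; [auto|lra|].
  set (M := (M0 + Z.abs_nat a)%nat).
  replace (g a) with (csum (fun x => (g x * RtoC (kron x a))%C) (win M)).
  - eapply Rle_trans; [apply sumZ_win with (B := B); auto|apply HM; unfold M; lia].
    intros x. unfold kron. destruct (Z.eq_dec x a) as [->|].
    + unfold B, zh. rewrite Cmult_1_r. rewrite Rmult_assoc, <- Rpow_mult_distr. replace (2 * / 2) with 1 by field. rewrite pow1. lra.
    + rewrite Cmult_0_r, Cmod_0. apply Rmult_le_pos; auto. left; apply zh_pos.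
  - rewrite <- (csum_delta (win M) a g); [|apply win_NoDup | apply win_spec; unfold M; lia].
    apply csum_ext. intros x _. unfold kron. destruct (Z.eq_dec x a), (Z.eq_dec a x); subst; try congruence; ring.
Qed.

Lemma sumZ_zero f : (forall x, f x = RtoC 0) -> sumZ f = RtoC 0.
Proof.
  intros H. rewrite (sumZ_ext f (fun x => (RtoC 0 * RtoC (kron x 0))%C)).
  - apply (sumZ_single (fun _ => RtoC 0)). - intros; rewrite H; ring.
Qed.

Definition dblW (s : Z -> Z -> R) (f g : Z -> C) (M : nat) : C :=
  csum (fun a => (f a * csum (fun b => (RtoC (s a b) * g b)%C) (win M))%C) (win M).

(** The outer truncation contributes 4 * 35 and the inner ones 3 * 20; the total 200 has no
    significance beyond being uniform in M. *)
Lemma dbl_close s f g B1 B2 : (forall a b, Rabs (s a b) <= 5) -> 0 <= B1 -> 0 <= B2 ->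
  (forall a, Cmod (f a) <= B1 * zh a) -> (forall a, Cmod (g a) <= B2 * zh a) -> forall M,
  Cmod (sumZ (fun a => (f a * sumZ (fun b => (RtoC (s a b) * g b)%C))%C) - dblW s f g M)%C <= 200 * (B1 * B2) * (/ 2) ^ M.
Proof.
  intros Hs H1 H2 Hf Hg M.
  set (G := fun a => sumZ (fun b => (RtoC (s a b) * g b)%C)). set (W := fun m a => csum (fun b => (RtoC (s a b) * g b)%C) (win m)).
  assert (Ht : forall a b, Cmod (RtoC (s a b) * g b)%C <= (5 * B2) * zh b).
  { intros a b. rewrite Cmod_mult, Cmod_R, Rmult_assoc. apply Rmult_le_compat; auto using Rabs_pos, Cmod_ge_0. }
  assert (HGW : forall a m, Cmod (G a - W m a)%C <= 20 * B2 * (/ 2) ^ m).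
  { intros a m. replace (20 * B2) with (4 * (5 * B2)) by ring. apply sumZ_win; auto. lra. }
  assert (HW : forall a m, Cmod (W m a) <= 15 * B2).
  { intros a m. eapply Rle_trans; [apply csum_Cmod|]. eapply Rle_trans; [apply rsum_le; intros b _; apply Ht|].
    rewrite rsum_scal. pose proof (rsum_zh m). replace (15 * B2) with (5 * B2 * 3) by ring. apply Rmult_le_compat_l; lra. }
  assert (HG : forall a, Cmod (G a) <= 35 * B2).
  { intros a. replace (G a) with ((G a - W 0%nat a) + W 0%nat a)%C by ring. eapply Rle_trans; [apply Cmod_triangle|].
    pose proof (HGW a 0%nat) as Q. simpl in Q. pose proof (HW a 0%nat). lra. }
  assert (HfG : forall a, Cmod (f a * G a)%C <= (35 * (B1 * B2)) * zh a).
  { intros a. rewrite Cmod_mult. replace (35 * (B1 * B2) * zh a) with ((B1 * zh a) * (35 * B2)) by ring.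
    apply Rmult_le_compat; auto using Cmod_ge_0. }
  pose proof (sumZ_win (fun a => (f a * G a)%C) (35 * (B1 * B2)) ltac:(apply Rmult_le_pos; [lra|now apply Rmult_le_pos]) HfG M) as HO.
  replace (sumZ _ - dblW s f g M)%C with ((sumZ (fun a => (f a * G a)%C) - csum (fun a => (f a * G a)%C) (win M)) + csum (fun a => (f a * (G a - W M a))%C) (win M))%C.
  2:{ unfold dblW. fold (W M). change (fun a => (f a * csum (fun b => (s a b * g b)%C) (win M))%C) with (fun a => (f a * W M a)%C).
      rewrite (csum_ext (fun a => (f a * (G a - W M a))%C) (fun a => (f a * G a - f a * W M a)%C)) by (intros; ring).
      rewrite csum_minus. unfold G. ring. }
  eapply Rle_trans; [apply Cmod_triangle|].
  assert (HD : Cmod (csum (fun a => (f a * (G a - W M a))%C) (win M)) <= 60 * (B1 * B2) * (/ 2) ^ M).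
  { eapply Rle_trans; [apply csum_Cmod|].
    eapply Rle_trans; [apply rsum_le with (g := fun a => (B1 * (20 * B2 * (/ 2) ^ M)) * zh a)|].
    - intros a _. rewrite Cmod_mult. replace (B1 * (20 * B2 * (/ 2) ^ M) * zh a) with ((B1 * zh a) * (20 * B2 * (/ 2) ^ M)) by ring.
      apply Rmult_le_compat; auto using Cmod_ge_0.
    - rewrite rsum_scal. pose proof (rsum_zh M). pose proof (half_pow_pos M).
      replace (60 * (B1 * B2) * (/ 2) ^ M) with ((B1 * (20 * B2 * (/ 2) ^ M)) * 3) by ring. apply Rmult_le_compat_l; auto.
      apply Rmult_le_pos; auto. apply Rmult_le_pos; lra. }
  lra.
Qed.

Lemma dblW_swap s f g M : (forall a b, s a b = s b a) -> dblW s f g M = dblW s g f M.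
Proof.
  intros Hs. unfold dblW.
  rewrite (csum_ext _ (fun a => csum (fun b => (f a * (RtoC (s a b) * g b))%C) (win M))) by (intros; now rewrite csum_scal).
  rewrite csum_exchange. apply csum_ext. intros b _. rewrite <- csum_scal. apply csum_ext. intros a _. rewrite (Hs a b). ring.
Qed.
Lemma dblW_conj s f g M : Cconj (dblW s f g M) = dblW s (fun a => Cconj (f a)) (fun a => Cconj (g a)) M.
Proof.
  unfold dblW. rewrite csum_conj. apply csum_ext; intros a _. rewrite Cmult_conj. f_equal. rewrite csum_conj.
  apply csum_ext; intros b _. rewrite Cmult_conj. f_equal. unfold Cconj, RtoC; simpl. f_equal. ring.
Qed.
Lemma dblW_minus s s' f g M : dblW (fun a b => s a b - s' a b) f g M = (dblW s f g M - dblW s' f g M)%C.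
Proof.
  unfold dblW. rewrite <- csum_minus. apply csum_ext; intros a _.
  rewrite (csum_ext _ (fun b => (RtoC (s a b) * g b - RtoC (s' a b) * g b)%C)), csum_minus by (intros; rewrite RtoC_minus; ring). ring.
Qed.
Lemma dblW_kron f g M : dblW kron f g M = csum (fun a => (f a * g a)%C) (win M).
Proof.
  unfold dblW. apply csum_ext. intros a Ha. f_equal.
  rewrite <- (csum_delta (win M) a g); [|apply win_NoDup | auto].
  apply csum_ext. intros x _. unfold kron. destruct (Z.eq_dec a x); ring.
Qed.

(** * Unitarity of the propagator *)

Section Uni.
Variable kappa : R.
Hypothesis hk : 0 < kappa.
Notation E := (En kappa).

Definition ucst (T : R) (x : Z) : R := 2 * ubd kappa T * 2 ^ Z.abs_nat x.
Lemma ucst_pos T x : 0 < ucst T x.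
Proof. unfold ucst, ubd. apply Rmult_lt_0_compat; [|apply pow_lt; lra]. pose proof (exp_pos (T * (2 + kappa))). lra. Qed.

Lemma uu_zh t T a x : Rabs t <= T -> Cmod (uu kappa t a x) <= ucst T x * zh a.
Proof.
  intros Ht. eapply Rle_trans; [apply uu_decay; eauto|]. unfold ucst. rewrite (Rmult_assoc (2 * ubd kappa T)).
  assert (0 < 2 * ubd kappa T) by (unfold ubd; pose proof (exp_pos (T * (2 + kappa))); lra).
  apply Rmult_le_compat_l; [lra|]. unfold zh, dist.
  assert (L : (Z.abs_nat a <= Z.abs_nat (a - x) + Z.abs_nat x)%nat) by lia.
  set (d := Z.abs_nat (a - x)) in *. set (m := Z.abs_nat a) in *. set (n := Z.abs_nat x) in *.
  apply Rle_trans with (2 ^ n * (/ 2) ^ (d + n)).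
  - rewrite pow_add, (Rmult_comm (2 ^ n)), Rmult_assoc, <- Rpow_mult_distr. replace (/ 2 * 2) with 1 by field. rewrite pow1. lra.
  - apply Rmult_le_compat_l; [apply pow_le; lra|]. replace (d + n)%nat with (m + (d + n - m))%nat by lia.
    rewrite pow_add. pose proof (half_pow_pos m). assert ((/ 2) ^ (d + n - m) <= 1) by (rewrite <- (pow1 (d + n - m)); apply pow_incr; lra).
    rewrite <- (Rmult_1_r ((/ 2) ^ m)) at 2. apply Rmult_le_compat_l; lra.
Qed.

(** A power of h_B is banded, so composition with it is a finite sum, already complete on any window
    containing all sites within n of y. *)
Lemma EB_powT_sum h n x y M : gcont h -> (Z.abs_nat y + n <= M)%nat ->
  rsum (fun a => EB kappa h x a * powT (hB kappa) n a y) (win M) = EB kappa (fun l => h l * l ^ n) x y.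
Proof.
  intros ch. revert y. induction n as [|n IH]; intros y HM.
  - transitivity (EB kappa h x y).
    + pose proof (csum_delta (win M) y (fun a => RtoC (EB kappa h x a)) (win_NoDup M) ltac:(apply win_spec; lia)) as D.
      apply (f_equal fst) in D. rewrite csum_fst in D. simpl in D. rewrite <- D. apply rsum_ext. intros a _.
      simpl. unfold kron. destruct (Z.eq_dec a y), (Z.eq_dec y a); subst; try congruence; simpl; ring.
    + apply (calc_ext (hB kappa) E _ (EB_calculus kappa hk)); auto; [gc | intros; simpl; ring].
  - assert (G := calc_mul _ _ _ (EB_calculus kappa hk) (fun l => h l * l ^ n) x y ltac:(gc)).
    rewrite (calc_ext (hB kappa) E _ (EB_calculus kappa hk) (fun l => h l * l ^ S n) (fun l => l * (h l * l ^ n))) by (gc || (intros; simpl; ring)).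
    rewrite <- G. unfold mulT. rewrite <- !IH by lia. rewrite <- !rsum_scal_r, <- !rsum_plus.
    apply rsum_ext; intros a _. change (powT (hB kappa) (S n) a y) with (mulT (powT (hB kappa) n) (hB kappa) a y). unfold mulT. ring.
Qed.

Lemma EB_TS_sum h a K x y M : gcont h -> (Z.abs_nat y + K <= M)%nat ->
  rsum (fun b => EB kappa h x b * TS kappa a K b y) (win M) = EB kappa (fun l => h l * sum_f_R0 (fun n => a n * l ^ n) K) x y.
Proof.
  intros ch. unfold TS. induction K as [|K IH]; intros HM.
  - cbn [sum_f_R0]. rewrite (rsum_ext _ (fun b => a 0%nat * (EB kappa h x b * powT (hB kappa) 0 b y))) by (intros; ring).
    rewrite rsum_scal, EB_powT_sum by auto.
    pose proof (calc_lin _ _ _ (EB_calculus kappa hk) (fun l => h l * l ^ 0) (fun l => h l * l ^ 0) (a 0%nat) 0 x y ltac:(gc) ltac:(gc)) as L.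
    rewrite Rmult_0_l, Rplus_0_r in L. rewrite <- L. apply (calc_ext (hB kappa) E _ (EB_calculus kappa hk)); [gc | gc | intros; simpl; ring].
  - cbn [sum_f_R0]. rewrite (rsum_ext _ (fun b => EB kappa h x b * sum_f_R0 (fun n => a n * powT (hB kappa) n b y) K + a (S K) * (EB kappa h x b * powT (hB kappa) (S K) b y))) by (intros; ring).
    rewrite rsum_plus, rsum_scal, IH, EB_powT_sum by (auto; lia).
    assert (gs : gcont (fun l => sum_f_R0 (fun n => a n * l ^ n) K)) by (apply (gcont_sum (fun n l => a n * l ^ n)); intros; gc).
    pose proof (calc_lin _ _ _ (EB_calculus kappa hk) (fun l => h l * sum_f_R0 (fun n => a n * l ^ n) K) (fun l => h l * l ^ S K) 1 (a (S K)) x y ltac:(gc) ltac:(gc)) as L.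
    rewrite Rmult_1_l in L. rewrite <- L. apply (calc_ext (hB kappa) E _ (EB_calculus kappa hk)); [gc | gc | intros; ring].
Qed.

Lemma EB_const c x y : EB kappa (fun _ => c) x y = c * kron x y.
Proof.
  pose proof (calc_lin _ _ _ (EB_calculus kappa hk) (fun _ => 1) (fun _ => 1) c 0 x y ltac:(gc) ltac:(gc)) as L.
  rewrite (calc_one _ _ _ (EB_calculus kappa hk)) in L.
  replace (c * kron x y) with (c * kron x y + 0 * kron x y) by ring. rewrite <- L.
  apply (calc_ext (hB kappa) E _ (EB_calculus kappa hk)); [gc | gc | intros; ring].
Qed.

(** The calculus composes kernels only with polynomials in h_B. One factor is therefore replaced by
    its Taylor polynomial, the composition is exact on a large window, and the resulting symbol is
    uniformly close to cos^2 + sin^2 = 1. *)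
Lemma unitary t x y eps : 0 < eps -> exists M0, forall M, (M0 <= M)%nat ->
  Cmod (csum (fun a => (Cconj (uu kappa t a x) * uu kappa t a y)%C) (win M) - RtoC (kron x y))%C <= eps.
Proof.
  intros He. set (Cx := ucst (Rabs t) x). assert (Cx0 : 0 < Cx) by apply ucst_pos.
  set (e := eps / (20 + 6 * Cx)). assert (e0 : 0 < e) by (apply Rdiv_lt_0_compat; lra).
  destruct (TS_close kappa hk t e e0) as [K1 HK1].
  destruct (tayl_unif (Rabs t * E) e) as [K2 HK2]; [apply Rmult_le_pos; [apply Rabs_pos|]; pose proof (En_pos kappa); lra|auto|].
  set (K := (K1 + K2)%nat). exists (Z.abs_nat y + K)%nat. intros M HM.
  set (ta := fun n => fst (te t n)). set (tb := fun n => snd (te t n)).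
  set (V := fun a => (TS kappa ta K a y, TS kappa tb K a y) : C).
  assert (HV : forall a, Cmod (uu kappa t a y - V a)%C <= 2 * e).
  { intros a. destruct (HK1 K a y ltac:(unfold K; lia)) as [A1 A2]. fold ta tb in A1, A2.
    eapply Rle_trans; [apply Cmod_le_parts|]. unfold V. cbn [fst snd Cminus Cplus Copp].
    rewrite Rabs_minus_sym in A1, A2. unfold Rminus in *. lra. }
  assert (D1 : Cmod (csum (fun a => (Cconj (uu kappa t a x) * (uu kappa t a y - V a))%C) (win M)) <= 6 * Cx * e).
  { eapply Rle_trans; [apply csum_Cmod|]. eapply Rle_trans; [apply rsum_le with (g := fun a => (Cx * (2 * e)) * zh a)|].
    - intros a _. rewrite Cmod_mult, Cmod_conj. pose proof (uu_zh t (Rabs t) a x (Rle_refl _)). fold Cx in H.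
      replace (Cx * (2 * e) * zh a) with ((Cx * zh a) * (2 * e)) by ring. apply Rmult_le_compat; auto using Cmod_ge_0.
    - rewrite rsum_scal. pose proof (rsum_zh M). replace (6 * Cx * e) with (Cx * (2 * e) * 3) by ring. apply Rmult_le_compat_l; [nra|auto]. }
  set (ct := fun l => cos (t * l)). set (st := fun l => sin (t * l)).
  set (pa := fun l => sum_f_R0 (fun n => ta n * l ^ n) K). set (pb := fun l => sum_f_R0 (fun n => tb n * l ^ n) K).
  assert (gct : gcont ct) by apply gcont_ct. assert (gst : gcont st) by apply gcont_st.
  assert (gpa : gcont pa) by (apply (gcont_sum (fun n l => ta n * l ^ n)); intros; gc).
  assert (gpb : gcont pb) by (apply (gcont_sum (fun n l => tb n * l ^ n)); intros; gc).
  assert (EV : csum (fun a => (Cconj (uu kappa t a x) * V a)%C) (win M) =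
     (EB kappa (fun l => 1 * (ct l * pa l) + 1 * (st l * pb l)) x y, EB kappa (fun l => 1 * (ct l * pb l) + (-1) * (st l * pa l)) x y)).
  { rewrite !(calc_lin _ _ _ (EB_calculus kappa hk)) by gc.
    unfold pa, pb. rewrite <- !(EB_TS_sum _ _ K x y M) by (auto; lia). rewrite <- !rsum_scal, <- !rsum_plus.
    apply injective_projections; [rewrite csum_fst | rewrite csum_snd]; apply rsum_ext; intros a _;
      rewrite (uu_sym kappa t a x); unfold uu, V, ct, st; simpl; ring. }
  assert (Hl : forall l, - E <= l <= E -> Rabs (pa l - ct l) <= e /\ Rabs (pb l - st l) <= e).
  { intros l Hl. specialize (HK2 K (t * l) ltac:(unfold K; lia) (En_abs kappa l Hl t)).
    destruct (tayl_te K t l) as [T1 T2]. fold ta tb in T1, T2.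
    split; (eapply Rle_trans; [|exact HK2]).
    - eapply Rle_trans; [|apply Re_le_Cmod]. right. unfold pa, ct, ta. rewrite <- T1. reflexivity.
    - eapply Rle_trans; [|apply Im_le_Cmod]. right. unfold pb, st, tb. rewrite <- T2. reflexivity. }
  assert (F1 : Rabs (EB kappa (fun l => 1 * (ct l * pa l) + 1 * (st l * pb l)) x y - EB kappa (fun _ => 1) x y) <= 5 * (2 * e)).
  { apply (calc_close (hB kappa) E _ (EB_calculus kappa hk)); [gc | gc|]. intros l L. destruct (Hl l L) as [A B].
    assert (S : ct l * ct l + st l * st l = 1) by (unfold ct, st; pose proof (sin2_cos2 (t * l)) as Q; unfold Rsqr in Q; lra).
    replace (1 * (ct l * pa l) + 1 * (st l * pb l) - 1) with (ct l * (pa l - ct l) + st l * (pb l - st l)).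
    2:{ transitivity (ct l * pa l + st l * pb l - (ct l * ct l + st l * st l)); [ring | rewrite S; ring]. }
    assert (Rabs (ct l) <= 1) by apply Rabs_le, COS_bound. assert (Rabs (st l) <= 1) by apply Rabs_le, SIN_bound.
    eapply Rle_trans; [apply Rabs_triang|]. rewrite !Rabs_mult.
    pose proof (Rabs_pos (ct l)); pose proof (Rabs_pos (st l)); pose proof (Rabs_pos (pa l - ct l)); pose proof (Rabs_pos (pb l - st l)). nra. }
  assert (F2 : Rabs (EB kappa (fun l => 1 * (ct l * pb l) + (-1) * (st l * pa l)) x y - EB kappa (fun _ => 0) x y) <= 5 * (2 * e)).
  { apply (calc_close (hB kappa) E _ (EB_calculus kappa hk)); [gc | gc|]. intros l L. destruct (Hl l L) as [A B].
    replace (1 * (ct l * pb l) + -1 * (st l * pa l) - 0) with (ct l * (pb l - st l) + - st l * (pa l - ct l)) by ring.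
    assert (Rabs (ct l) <= 1) by apply Rabs_le, COS_bound. assert (Rabs (st l) <= 1) by apply Rabs_le, SIN_bound.
    eapply Rle_trans; [apply Rabs_triang|]. rewrite !Rabs_mult, Rabs_Ropp.
    pose proof (Rabs_pos (ct l)); pose proof (Rabs_pos (st l)); pose proof (Rabs_pos (pa l - ct l)); pose proof (Rabs_pos (pb l - st l)). nra. }
  rewrite !EB_const, Rmult_1_l, Rmult_0_l in *.
  replace (csum _ (win M) - _)%C with ((csum (fun a => (Cconj (uu kappa t a x) * V a)%C) (win M) - RtoC (kron x y)) + csum (fun a => (Cconj (uu kappa t a x) * (uu kappa t a y - V a))%C) (win M))%C.
  2:{ rewrite (csum_ext (fun a => (Cconj (uu kappa t a x) * (uu kappa t a y - V a))%C) (fun a => (Cconj (uu kappa t a x) * uu kappa t a y - Cconj (uu kappa t a x) * V a)%C)) by (intros; ring).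
      rewrite csum_minus. ring. }
  eapply Rle_trans; [apply Cmod_triangle|].
  assert (D2 : Cmod (csum (fun a => (Cconj (uu kappa t a x) * V a)%C) (win M) - RtoC (kron x y))%C <= 20 * e).
  { eapply Rle_trans; [apply Cmod_le_parts|]. rewrite EV. cbn [fst snd Cminus Cplus Copp RtoC]. unfold Rminus in F1, F2. lra. }
  apply Rle_trans with (20 * e + 6 * Cx * e); [lra|]. right. unfold e. field. lra.
Qed.
End Uni.

(** * Two-point function *)

Section TwoPoint.
Variables (N : nat) (kappa bL bR : R).
Hypothesis (hk : 0 < kappa) (hL : 0 < bL) (hLR : bL <= bR).

Definition sk : Z -> Z -> R := EA N (bL / bR) (logis bR).

Lemma EAc : calculus (fun x y => k0 N bL bR x y / bR) 1 (EA N (bL / bR)).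
Proof. now apply EA_calculus. Qed.
Lemma logis_gcont b : gcont (logis b).
Proof. intros x; apply logis_cont. Qed.

Lemma s0m_eq x y : s0m N bL bR x y = sk x y.
Proof.
  unfold s0m. apply (calc_fcalc _ 1 _ EAc (logis bR)); [lra | apply logis_modc; lra | apply logis_gcont].
Qed.

Lemma logis_compl b y : / (1 + exp (b * y)) = 1 - logis b y.
Proof.
  unfold logis. rewrite exp_Ropp. pose proof (exp_pos (b * y)). field. lra.
Qed.

Lemma s0p_eq x y : s0p N bL bR x y = kron x y - sk x y.
Proof.
  set (g := fun y => / (1 + exp (bR * y))).
  assert (cg : gcont g).
  { intros l. apply continuous_ext with (fun y => 1 - logis bR y); [intros; unfold g; now rewrite logis_compl|].
    apply cminus; [apply cconst | apply logis_cont]. }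
  unfold s0p. fold g. rewrite (calc_fcalc _ 1 _ EAc g); auto; [|lra|].
  - rewrite <- (calc_one _ _ _ EAc). unfold sk.
    pose proof (calc_lin _ _ _ EAc (fun _ => 1) (logis bR) 1 (-1) x y (gcont_const 1) (logis_gcont bR)) as L.
    replace (_ - _) with (1 * EA N (bL / bR) (fun _ => 1) x y + -1 * EA N (bL / bR) (logis bR) x y) by ring.
    rewrite <- L. apply (calc_ext _ _ _ EAc); auto.
    + apply gcont_plus; apply gcont_mult; try apply gcont_const. apply logis_gcont.
    + intros l _. unfold g. rewrite logis_compl. ring.
  - apply (lip_modc _ bR). intros u v _ _. unfold g. rewrite !logis_compl.
    replace (1 - logis bR v - (1 - logis bR u)) with (- (logis bR v - logis bR u)) by ring. rewrite Rabs_Ropp. apply logis_lip. lra.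
Qed.

Lemma sk_sym x y : sk x y = sk y x.
Proof.
  unfold sk, EA. f_equal; [f_equal|]; f_equal.
  - apply RInt_ext; intros; rng. - apply RInt_ext; intros; rng.
  - unfold kS. rewrite (kron_sym x y). destruct (inR N x) eqn:A, (inL N x) eqn:B, (inR N y) eqn:C, (inL N y) eqn:D; simpl; auto;
      apply kron_neq || (symmetry; apply kron_neq); congruence.
Qed.
Lemma sk_abs x y : Rabs (sk x y) <= 5.
Proof.
  replace 5 with (5 * 1) by ring. apply (calc_bound _ _ _ EAc); [apply logis_gcont|].
  intros l _. pose proof (logis_pos bR l). pose proof (logis_lt1 bR l). rewrite Rabs_pos_eq; lra.
Qed.

Definition Sfull (t : R) (x y : Z) : C :=
  sumZ (fun a => (Cconj (uu kappa t a x) * sumZ (fun b => (RtoC (sk a b) * uu kappa t b y)%C))%C).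
Definition SW (t : R) (x y : Z) (M : nat) : C :=
  dblW sk (fun a => Cconj (uu kappa t a x)) (fun b => uu kappa t b y) M.

Definition Scst (T : R) (x y : Z) : R := 200 * (ucst kappa T x * ucst kappa T y).
Lemma Scst_pos T x y : 0 <= Scst T x y.
Proof. unfold Scst. pose proof (ucst_pos kappa T x). pose proof (ucst_pos kappa T y). nra. Qed.

Lemma Sfull_close t T x y M : Rabs t <= T -> Cmod (Sfull t x y - SW t x y M)%C <= Scst T x y * (/ 2) ^ M.
Proof.
  intros Ht. apply dbl_close.
  - apply sk_abs. - left; now apply ucst_pos. - left; now apply ucst_pos.
  - intros a. rewrite Cmod_conj. now apply uu_zh. - intros a. now apply uu_zh.
Qed.

Lemma SW_herm t x y M : SW t y x M = Cconj (SW t x y M).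
Proof.
  unfold SW. rewrite dblW_conj, dblW_swap by apply sk_sym. unfold dblW. apply csum_ext; intros a _.
  now rewrite Cconj_conj.
Qed.

Lemma Sfull_herm t x y : Sfull t y x = Cconj (Sfull t x y).
Proof.
  apply Cmod_small_eq. intros eps He.
  destruct (half_small (eps / 2) (Scst (Rabs t) x y + Scst (Rabs t) y x)) as [M HM]; [lra|pose proof (Scst_pos (Rabs t) x y); pose proof (Scst_pos (Rabs t) y x); lra|].
  specialize (HM M (le_n _)).
  pose proof (Sfull_close t (Rabs t) x y M (Rle_refl _)) as H1. pose proof (Sfull_close t (Rabs t) y x M (Rle_refl _)) as H2.
  eapply Rle_trans; [apply (Cmod_sub_tri _ (SW t y x M))|].
  assert (H3 : Cmod (Cconj (Sfull t x y) - SW t y x M)%C <= Scst (Rabs t) x y * (/ 2) ^ M).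
  { rewrite SW_herm, <- Cminus_conj, Cmod_conj. exact H1. }
  lra.
Qed.

Lemma shift_kron x i x0 : kron (x - (i + 1))%Z (x0 - 1)%Z = kron x (x0 + i)%Z.
Proof. unfold kron. destruct (Z.eq_dec (x - (i + 1)) (x0 - 1)), (Z.eq_dec x (x0 + i)); auto; lia. Qed.

Lemma Fvec_odd x0 i x : fst (Fvec x0 (2 * i + 1)) x = RtoC 0 /\ snd (Fvec x0 (2 * i + 1)) x = RtoC (kron x (x0 + Z.of_nat i)).
Proof.
  unfold Fvec. replace (Nat.odd (2 * i + 1)) with true by (symmetry; apply Nat.odd_spec; exists i; lia).
  replace ((2 * i + 1 + 1) / 2)%nat with (i + 1)%nat by (apply Nat.div_unique with 0%nat; lia).
  unfold shiftv, G1; cbn [fst snd]. split; auto. unfold delta. rewrite Nat2Z.inj_add. simpl (Z.of_nat 1). now rewrite shift_kron.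
Qed.
Lemma Fvec_even x0 i x : snd (Fvec x0 (2 * i + 2)) x = RtoC 0 /\ fst (Fvec x0 (2 * i + 2)) x = RtoC (kron x (x0 + Z.of_nat i)).
Proof.
  unfold Fvec. replace (Nat.odd (2 * i + 2)) with false.
  2:{ symmetry. rewrite <- Nat.negb_even. replace (Nat.even (2 * i + 2)) with true; auto. symmetry. apply Nat.even_spec. exists (i + 1)%nat; lia. }
  replace ((2 * i + 2 + 1) / 2)%nat with (i + 1)%nat by (apply Nat.div_unique with 1%nat; lia).
  unfold shiftv, G2, Jv, G1; cbn [fst snd]. split.
  - unfold Cconj, RtoC; simpl. f_equal; ring.
  - unfold delta. rewrite Nat2Z.inj_add. simpl (Z.of_nat 1). rewrite shift_kron. unfold Cconj, RtoC; simpl. f_equal; ring.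
Qed.

Lemma ev_fst_zero t F x : (forall y, fst F y = RtoC 0) -> fst (evolve kappa t F) x = RtoC 0.
Proof. intros H. unfold evolve; cbn [fst]. apply sumZ_zero. intros y. rewrite H. ring. Qed.
Lemma ev_snd_zero t F x : (forall y, snd F y = RtoC 0) -> snd (evolve kappa t F) x = RtoC 0.
Proof. intros H. unfold evolve; cbn [snd]. apply sumZ_zero. intros y. rewrite H. ring. Qed.
Lemma ev_fst_kron t F a x : (forall y, fst F y = RtoC (kron y a)) -> fst (evolve kappa t F) x = uu kappa t x a.
Proof.
  intros H. unfold evolve; cbn [fst]. rewrite (sumZ_ext _ (fun y => (Ut kappa t x y * RtoC (kron y a))%C)) by (intros; now rewrite H).
  rewrite sumZ_single. now apply Ut_uu.
Qed.
Lemma ev_snd_kron t F a x : (forall y, snd F y = RtoC (kron y a)) -> snd (evolve kappa t F) x = Cconj (uu kappa t x a).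
Proof.
  intros H. unfold evolve; cbn [snd]. rewrite (sumZ_ext _ (fun y => (Ut kappa (- t) x y * RtoC (kron y a))%C)) by (intros; now rewrite H).
  rewrite sumZ_single, Ut_uu by auto. now apply uu_opp.
Qed.

Lemma Cconj_0 : Cconj (RtoC 0) = RtoC 0.
Proof. unfold Cconj, RtoC; simpl; f_equal; ring. Qed.

Variables (x0 : Z) (t : R).
Let site i := (x0 + Z.of_nat i)%Z.
Let om i j := omega0_two N bL bR (evolve kappa t (Fvec x0 i)) (evolve kappa t (Fvec x0 j)).

Lemma om_oo i j : om (2 * i + 1) (2 * j + 1) = RtoC 0.
Proof.
  unfold om, omega0_two, ip, Jv, S0app; cbn [fst snd]. apply sumZ_zero. intros x.
  rewrite (sumZ_zero (fun y => (RtoC (s0m N bL bR x y) * _)%C)).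
  2:{ intros y. rewrite ev_fst_zero; [ring|]. intros; apply Fvec_odd. }
  rewrite (ev_fst_zero t (Fvec x0 (2 * i + 1))), !Cconj_0 by (intros; apply Fvec_odd). ring.
Qed.
Lemma om_ee i j : om (2 * i + 2) (2 * j + 2) = RtoC 0.
Proof.
  unfold om, omega0_two, ip, Jv, S0app; cbn [fst snd]. apply sumZ_zero. intros x.
  rewrite (sumZ_zero (fun y => (RtoC (s0p N bL bR x y) * _)%C)).
  2:{ intros y. rewrite ev_snd_zero; [ring|]. intros; apply Fvec_even. }
  rewrite (ev_snd_zero t (Fvec x0 (2 * i + 2))), !Cconj_0 by (intros; apply Fvec_even). ring.
Qed.
Lemma om_oe i j : om (2 * i + 1) (2 * j + 2) = Sfull t (site i) (site j).
Proof.
  unfold om, omega0_two, ip, Jv, S0app; cbn [fst snd]. apply sumZ_ext. intros x.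
  rewrite (ev_fst_zero t (Fvec x0 (2 * i + 1))), !Cconj_0 by (intros; apply Fvec_odd).
  rewrite (ev_snd_kron t _ (site i)) by (intros; apply Fvec_odd). rewrite Cconj_conj.
  rewrite (sumZ_ext (fun y => (RtoC (s0m N bL bR x y) * _)%C) (fun b => (RtoC (sk x b) * uu kappa t b (site j))%C)).
  - ring.
  - intros y. rewrite s0m_eq. f_equal. apply ev_fst_kron. intros; apply Fvec_even.
Qed.
(** The anticommutation relation in disguise: s_{0,+} = 1 - s_{0,-}, and the identity term is
    carried to the Kronecker symbol by unitarity. *)
Lemma om_eo i j : om (2 * i + 2) (2 * j + 1) = (RtoC (kron (site j) (site i)) - Sfull t (site j) (site i))%C.
Proof.
  unfold om, omega0_two, ip, Jv, S0app; cbn [fst snd].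
  set (sp := fun x y => kron x y - sk x y). set (a := site i). set (b := site j).
  rewrite (sumZ_ext _ (fun x => (uu kappa t x a * sumZ (fun y => (RtoC (sp x y) * Cconj (uu kappa t y b))%C))%C)).
  2:{ intros x. rewrite (ev_snd_zero t (Fvec x0 (2 * i + 2))), !Cconj_0 by (intros; apply Fvec_even).
      rewrite (ev_fst_kron t _ a) by (intros; apply Fvec_even). rewrite Cconj_conj.
      rewrite (sumZ_ext (fun y => (RtoC (s0p N bL bR x y) * _)%C) (fun y => (RtoC (sp x y) * Cconj (uu kappa t y b))%C)).
      - ring.
      - intros y. rewrite s0p_eq. f_equal. apply ev_snd_kron. intros; apply Fvec_odd. }
  set (T := Rabs t). set (K := 200 * (ucst kappa T a * ucst kappa T b)).
  assert (skb : forall u v, Rabs (sp u v) <= 5).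
  { intros u v. unfold sp. rewrite <- s0p_eq.
    assert (E0 : s0p N bL bR u v = EA N (bL / bR) (fun l => 1 * 1 + -1 * logis bR l) u v).
    { rewrite s0p_eq, (calc_lin _ _ _ EAc (fun _ => 1) (logis bR)) by (apply gcont_const || apply logis_gcont).
      rewrite (calc_one _ _ _ EAc). unfold sk. ring. }
    change (Rabs (s0p N bL bR u v) <= 5). rewrite E0. replace 5 with (5 * 1) by ring. apply (calc_bound _ _ _ EAc).
    - apply gcont_plus; apply gcont_mult; try apply gcont_const. apply logis_gcont.
    - intros l _. pose proof (logis_pos bR l). pose proof (logis_lt1 bR l). apply Rabs_le. lra. }
  assert (H1 : forall M, Cmod (sumZ (fun x => (uu kappa t x a * sumZ (fun y => (RtoC (sp x y) * Cconj (uu kappa t y b))%C))%C)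
     - dblW sp (fun x => uu kappa t x a) (fun y => Cconj (uu kappa t y b)) M)%C <= K * (/ 2) ^ M).
  { intros M. apply dbl_close; auto; try (left; now apply ucst_pos).
    - intros; apply uu_zh; auto; apply Rle_refl. - intros; rewrite Cmod_conj. apply uu_zh; auto; apply Rle_refl. }
  apply Cmod_small_eq. intros eps He.
  assert (K0 : 0 <= K) by (unfold K; pose proof (ucst_pos kappa T a); pose proof (ucst_pos kappa T b); nra).
  destruct (half_small (eps / 3) (K + Scst T b a)) as [M1 HM1]; [lra| pose proof (Scst_pos T b a); lra |].
  destruct (unitary kappa hk t b a (eps / 3)) as [M2 HM2]; [lra|].
  set (M := (M1 + M2)%nat). specialize (HM1 M ltac:(unfold M; lia)). specialize (HM2 M ltac:(unfold M; lia)). specialize (H1 M).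
  pose proof (Sfull_close t T b a M (Rle_refl _)) as H2.
  assert (EW : dblW sp (fun x => uu kappa t x a) (fun y => Cconj (uu kappa t y b)) M =
     (csum (fun z => (Cconj (uu kappa t z b) * uu kappa t z a)%C) (win M) - SW t b a M)%C).
  { unfold sp. rewrite dblW_minus, dblW_kron. f_equal.
    - apply csum_ext; intros; ring. - unfold SW. apply dblW_swap, sk_sym. }
  rewrite EW in H1. set (X := sumZ _) in *. set (U := csum _ (win M)) in *. set (W := SW t b a M) in *.
  replace (X - (RtoC (kron b a) - Sfull t b a))%C with ((X - (U - W)) + (U - RtoC (kron b a)) + (Sfull t b a - W))%C by ring.
  eapply Rle_trans; [apply Cmod_triangle|]. eapply Rle_trans; [apply Rplus_le_compat_r, Cmod_triangle|].
  rewrite Rmult_plus_distr_r in HM1. lra.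
Qed.
End TwoPoint.

Lemma rsum_deltaZ (l : list Z) a (g : Z -> R) : NoDup l -> In a l -> rsum (fun b => kron a b * g b) l = g a.
Proof.
  intros ND Hin. pose proof (csum_delta l a (fun b => RtoC (g b)) ND Hin) as D. apply (f_equal fst) in D.
  rewrite csum_fst in D. simpl in D. rewrite <- D. apply rsum_ext. intros b _. unfold kron. destruct (Z.eq_dec a b); simpl; ring.
Qed.

(** * Quadratic forms of the evolved density *)

Section Form.
Variables (N : nat) (kappa bL bR : R).
Hypothesis (hk : 0 < kappa) (hL : 0 < bL) (hLR : bL <= bR).
Notation sk := (sk N bL bR).
Notation Sfull := (Sfull N kappa bL bR).

(** Real vectors suffice: the kernel is real and symmetric, so a complex vector contributes the sum
    of the forms of its real and imaginary parts. *)
Definition qg (g : R -> R) (l : list Z) (u : Z -> R) : R := rsum (fun a => rsum (fun b => EA N (bL / bR) g a b * (u a * u b)) l) l.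
Definition qr : list Z -> (Z -> R) -> R := qg (logis bR).

Definition qR (g : R -> R) (l : list Z) (u : Z -> R) : R :=
  2 / PI * RInt (fun q => g (cos q) * rsum (fun a => u a * sR N a q) l ^ 2) 0 PI.
Definition qL (g : R -> R) (l : list Z) (u : Z -> R) : R :=
  2 / PI * RInt (fun q => g (bL / bR * cos q) * rsum (fun a => u a * sL N a q) l ^ 2) 0 PI.
Definition qS (g : R -> R) (l : list Z) (u : Z -> R) : R :=
  g 0 * rsum (fun a => if (inR N a || inL N a)%bool then 0 else u a ^ 2) l.

Lemma quad_int (g : R -> R) (s : Z -> R -> R) l u : gcont g -> (forall a, gcont (s a)) ->
  rsum (fun a => rsum (fun b => 2 / PI * RInt (fun q => g q * (s a q * s b q)) 0 PI * (u a * u b)) l) l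
  = 2 / PI * RInt (fun q => g q * rsum (fun a => u a * s a q) l ^ 2) 0 PI.
Proof.
  intros cg cs. pose proof PI_RGT_0.
  assert (cc : forall a b, gcont (fun q => g q * (s a q * s b q))) by (intros; pose proof (cs a); pose proof (cs b); gc).
  rewrite (RIext (fun q => g q * rsum (fun a => u a * s a q) l ^ 2) (fun q => rsum (fun a => rsum (fun b => (u a * u b) * (g q * (s a q * s b q))) l) l)); [|lra|].
  2:{ intros q _. simpl. rewrite Rmult_1_r, rsum_mult, <- rsum_scal. apply rsum_ext; intros a _.
      rewrite <- rsum_scal. apply rsum_ext; intros; ring. }
  rewrite RIrsum by (intros a; intros; apply rsum_cont; intros; apply (fscal _ _ (cc a _))).
  rewrite <- rsum_scal. apply rsum_ext; intros a _. rewrite RIrsum by (intros b; apply (fscal _ _ (cc a b))).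
  rewrite <- rsum_scal. apply rsum_ext; intros b _. rewrite RIscal by apply cc. rng.
Qed.

Lemma gcont_R g : gcont g -> gcont (fun q => g (cos q)).
Proof. intros cg. apply (gcont_comp g cos); [auto | exact ccos]. Qed.
Lemma gcont_L g : gcont g -> gcont (fun q => g (bL / bR * cos q)).
Proof. intros cg. apply (gcont_comp g (fun q => bL / bR * cos q)); auto. intros q. apply cmult; [apply cconst | apply ccos]. Qed.

Lemma qg_eq g l u : gcont g -> NoDup l -> qg g l u = qR g l u + qL g l u + qS g l u.
Proof.
  intros cg ND. unfold qg, qR, qL, qS.
  rewrite <- (quad_int (fun q => g (cos q)) (sR N)) by (auto using gcont_R; intros; apply sR_cont).
  rewrite <- (quad_int (fun q => g (bL / bR * cos q)) (sL N)) by (auto using gcont_L; intros; apply sL_cont).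
  rewrite <- rsum_scal, <- !rsum_plus. apply rsum_ext. intros a Ha. rewrite <- rsum_plus.
  replace (g 0 * (if (inR N a || inL N a)%bool then 0 else u a ^ 2)) with
    (rsum (fun b => g 0 * kS N a b * (u a * u b)) l).
  2:{ unfold kS. destruct (inR N a || inL N a)%bool.
      - rewrite rsum_zero; [ring | intros; ring].
      - rewrite (rsum_ext _ (fun b => kron a b * (g 0 * (u a * u b)))) by (intros; ring).
        rewrite rsum_deltaZ by auto. ring. }
  rewrite <- rsum_plus. apply rsum_ext. intros b _. unfold EA. ring.
Qed.

Lemma rsum_s_cont (s : Z -> R -> R) l (u : Z -> R) : (forall a, gcont (s a)) -> gcont (fun q => rsum (fun a => u a * s a q) l).
Proof. intros cs q. apply rsum_cont. intros a _. apply cmult; [apply cconst | apply cs]. Qed.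

Lemma qg_pos g l u : gcont g -> (forall x, 0 <= g x) -> NoDup l -> 0 <= qg g l u.
Proof.
  intros cg g0 ND. rewrite qg_eq by auto. pose proof PI_RGT_0. assert (0 <= 2 / PI) by (apply Rle_div_r; lra).
  apply Rplus_le_le_0_compat; [apply Rplus_le_le_0_compat; apply Rmult_le_pos; auto; apply RIpos; try lra |].
  - apply (gcont_mult (fun q => g (cos q))); [now apply gcont_R|]. apply gcont_pow, rsum_s_cont, sR_cont.
  - intros q _. apply Rmult_le_pos; [apply g0 | apply pow2_ge_0].
  - apply (gcont_mult (fun q => g (bL / bR * cos q))); [now apply gcont_L|]. apply gcont_pow, rsum_s_cont, sL_cont.
  - intros q _. apply Rmult_le_pos; [apply g0 | apply pow2_ge_0].
  - apply Rmult_le_pos; [apply g0|]. apply rsum_pos. intros a _. destruct (_ || _)%bool; [lra | apply pow2_ge_0].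
Qed.

Lemma qr_eq l u : NoDup l -> qr l u = qR (logis bR) l u + qL (logis bR) l u + qS (logis bR) l u.
Proof. apply qg_eq, logis_gcont. Qed.
Lemma qr_pos l u : NoDup l -> 0 <= qr l u.
Proof. apply qg_pos; [apply logis_gcont | intros; left; apply logis_pos]. Qed.

(** Positivity of the form attached to 1 - logis, which is a nonnegative symbol. *)
Lemma qr_le_l2 l u : NoDup l -> qr l u <= rsum (fun a => u a ^ 2) l.
Proof.
  intros ND. pose proof (EAc N bL bR hL hLR) as CA.
  assert (c1 : gcont (fun x => 1 * 1 + (-1) * logis bR x)).
  { intros x. apply cplus; [apply cconst | apply cmult; [apply cconst | apply logis_gcont]]. }
  pose proof (qg_pos _ l u c1 ltac:(intros x; pose proof (logis_lt1 bR x); lra) ND) as P. revert P. unfold qr, qg.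
  rewrite (rsum_ext (fun a => rsum _ l) (fun a => u a ^ 2 - rsum (fun b => EA N (bL / bR) (logis bR) a b * (u a * u b)) l)).
  - rewrite rsum_minus. lra.
  - intros a Ha. replace (u a ^ 2) with (rsum (fun b => kron a b * (u a * u b)) l) by (rewrite (rsum_deltaZ l a (fun b => u a * u b)) by auto; ring).
    replace (rsum (fun b : Z => kron a b * (u a * u b)) l - _) with
     (rsum (fun b : Z => kron a b * (u a * u b) - EA N (bL / bR) (logis bR) a b * (u a * u b)) l) by apply rsum_minus.
    apply rsum_ext. intros b _.
    rewrite (calc_lin _ _ _ CA (fun _ => 1) (logis bR) 1 (-1)) by (try apply logis_gcont; gc). rewrite (calc_one _ _ _ CA). ring.
Qed.

(** The difference of the two sides is / d times the form at d u - w. Same role as [Cn2_weight]. *)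
Lemma qr_weight d l u w : 0 < d -> NoDup l -> qr l (fun a => u a + w a) <= (1 + d) * qr l u + (1 + / d) * qr l w.
Proof.
  intros Hd ND. pose proof (qr_pos l (fun a => d * u a - w a) ND) as P.
  assert (Hi : 0 < / d) by now apply Rinv_0_lt_compat.
  assert (Eq : qr l (fun a => u a + w a) + / d * qr l (fun a => d * u a - w a) = (1 + d) * qr l u + (1 + / d) * qr l w).
  { unfold qr, qg. rewrite <- !rsum_scal, <- !rsum_plus. apply rsum_ext; intros a _. rewrite <- !rsum_scal, <- !rsum_plus.
    apply rsum_ext; intros b _. field. lra. }
  rewrite <- Eq. pose proof (Rmult_le_pos _ _ (Rlt_le _ _ Hi) P). lra.
Qed.

Lemma csum_form {I} (li : list I) (lw : list Z) (v w : I -> C) (f g : Z -> I -> C) (s : Z -> Z -> R) :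
  csum (fun i => csum (fun j => (v i * csum (fun a => f a i * csum (fun b => RtoC (s a b) * g b j) lw) lw * w j)%C) li) li
  = csum (fun a => csum (fun b => (csum (fun i => v i * f a i) li * (RtoC (s a b) * csum (fun j => g b j * w j) li))%C) lw) lw.
Proof.
  transitivity (csum (fun i => csum (fun j => csum (fun a => csum (fun b => ((v i * f a i) * (RtoC (s a b) * (g b j * w j)))%C) lw) lw) li) li).
  { apply csum_ext; intros i _; apply csum_ext; intros j _. rewrite <- csum_scal, <- csum_scal_r. apply csum_ext; intros a _.
    rewrite <- csum_scal, <- csum_scal, <- csum_scal_r. apply csum_ext; intros b _. ring. }
  rewrite (csum_ext _ (fun i => csum (fun a => csum (fun j => csum (fun b => ((v i * f a i) * (RtoC (s a b) * (g b j * w j)))%C) lw) li) lw)) by (intros; apply csum_exchange).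
  rewrite csum_exchange. apply csum_ext; intros a _.
  rewrite (csum_ext _ (fun i => csum (fun b => csum (fun j => ((v i * f a i) * (RtoC (s a b) * (g b j * w j)))%C) li) lw)) by (intros; apply csum_exchange).
  rewrite csum_exchange. apply csum_ext; intros b _.
  rewrite <- csum_scal, csum_mult. reflexivity.
Qed.

Variable x0 : Z.
Definition site (i : nat) : Z := (x0 + Z.of_nat i)%Z.
Definition phi (t : R) (v : nat -> C) (n : nat) (a : Z) : C := csum (fun j => (uu kappa t a (site j) * v j)%C) (seq 0 n).

Lemma qform_SW t v n M :
  fst (qform (fun i j => SW N kappa bL bR t (site i) (site j) M) v n) =
  qr (win M) (fun a => fst (phi t v n a)) + qr (win M) (fun a => snd (phi t v n a)).
Proof.
  unfold qform, SW, dblW.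
  rewrite (csum_form (seq 0 n) (win M) (fun i => Cconj (v i)) v (fun a i => Cconj (uu kappa t a (site i))) (fun b j => uu kappa t b (site j)) sk).
  unfold qr, qg. change (EA N (bL / bR) (logis bR)) with sk. rewrite <- rsum_plus, csum_fst. apply rsum_ext; intros a _. rewrite <- rsum_plus, csum_fst. apply rsum_ext; intros b _.
  assert (E : csum (fun i => (Cconj (v i) * Cconj (uu kappa t a (site i)))%C) (seq 0 n) = Cconj (phi t v n a)).
  { unfold phi. rewrite csum_conj. apply csum_ext; intros. rewrite Cmult_conj. ring. }
  rewrite E. fold (phi t v n b). simpl. ring.
Qed.

Definition vcst (T : R) (v : nat -> C) (n : nat) : R :=
  rsum (fun i => rsum (fun j => Cmod (v i) * Scst kappa T (site i) (site j) * Cmod (v j)) (seq 0 n)) (seq 0 n).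
Lemma vcst_pos T v n : 0 <= vcst T v n.
Proof.
  apply rsum_pos; intros; apply rsum_pos; intros. apply Rmult_le_pos; [|apply Cmod_ge_0]. apply Rmult_le_pos; [apply Cmod_ge_0|].
  now apply Scst_pos.
Qed.

Definition S_ (t : R) (i j : nat) : C := Sfull t (site i) (site j).

Lemma qform_close t T v n M : Rabs t <= T ->
  Rabs (fst (qform (S_ t) v n) - (qr (win M) (fun a => fst (phi t v n a)) + qr (win M) (fun a => snd (phi t v n a)))) <= vcst T v n * (/ 2) ^ M.
Proof.
  intros Ht. rewrite <- qform_SW.
  set (D := (qform (S_ t) v n - qform (fun i j => SW N kappa bL bR t (site i) (site j) M) v n)%C).
  apply Rle_trans with (Cmod D); [apply (Re_le_Cmod D)|]. unfold D, qform. rewrite <- csum_minus.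
  eapply Rle_trans; [apply csum_Cmod|]. unfold vcst. rewrite <- rsum_scal_r. apply rsum_le; intros i _.
  rewrite <- csum_minus. eapply Rle_trans; [apply csum_Cmod|]. rewrite <- rsum_scal_r. apply rsum_le; intros j _.
  replace (_ - _)%C with (Cconj (v i) * (S_ t i j - SW N kappa bL bR t (site i) (site j) M) * v j)%C by ring.
  rewrite !Cmod_mult, Cmod_conj.
  replace (Cmod (v i) * Scst kappa T (site i) (site j) * Cmod (v j) * (/ 2) ^ M) with (Cmod (v i) * (Scst kappa T (site i) (site j) * (/ 2) ^ M) * Cmod (v j)) by ring.
  apply Rmult_le_compat_r; [apply Cmod_ge_0|]. apply Rmult_le_compat_l; [apply Cmod_ge_0|]. unfold S_; apply Sfull_close; [assumption..|exact Ht].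
Qed.

Lemma qform_le t v n B : (exists M0, forall M, (M0 <= M)%nat ->
   qr (win M) (fun a => fst (phi t v n a)) + qr (win M) (fun a => snd (phi t v n a)) <= B) -> fst (qform (S_ t) v n) <= B.
Proof.
  intros [M0 H]. apply Rle_eps. intros eps He.
  destruct (half_small eps (vcst (Rabs t) v n) He (vcst_pos _ _ _)) as [M1 HM1].
  specialize (H (M0 + M1)%nat ltac:(lia)). specialize (HM1 (M0 + M1)%nat ltac:(lia)).
  pose proof (qform_close t (Rabs t) v n (M0 + M1) (Rle_refl _)) as C. apply Rabs_le_between in C. lra.
Qed.

Lemma qform_pos t v n : 0 <= fst (qform (S_ t) v n).
Proof.
  apply Rle_eps. intros eps He.
  destruct (half_small eps (vcst (Rabs t) v n) He (vcst_pos _ _ _)) as [M HM]. specialize (HM M (le_n _)).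
  pose proof (qform_close t (Rabs t) v n M (Rle_refl _)) as C. apply Rabs_le_between in C.
  pose proof (qr_pos (win M) (fun a => fst (phi t v n a)) (win_NoDup M)).
  pose proof (qr_pos (win M) (fun a => snd (phi t v n a)) (win_NoDup M)). lra.
Qed.

Lemma doubleE i : ssrnat.double i = (2 * i)%nat.
Proof. induction i as [|i IH]; auto. change (ssrnat.double (S i)) with (S (S (ssrnat.double i))). rewrite IH. lia. Qed.

Lemma Pt_le n t (W : nat -> nat -> C) :
  (forall i j, (i < j)%nat -> W i j = RtoC 0) -> (forall i, W i i = RtoC 1) ->
  Cmod (Pt x0 N kappa bL bR n t) <= rprod (fun i => fst (qform (S_ t) (W i) n)) (seq 0 n).
Proof.
  intros W0 W1. unfold Pt. apply pfaffian_le; auto.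
  - intros i j. rewrite !doubleE. replace (S (2 * i)) with (2 * i + 1)%nat by lia. replace (S (2 * j)) with (2 * j + 1)%nat by lia.
    now apply om_oo.
  - intros i j. rewrite !doubleE. replace (S (S (2 * i))) with (2 * i + 2)%nat by lia. replace (S (S (2 * j))) with (2 * j + 2)%nat by lia.
    now apply om_ee.
  - intros i j. rewrite !doubleE. replace (S (2 * i)) with (2 * i + 1)%nat by lia. replace (S (S (2 * j))) with (2 * j + 2)%nat by lia.
    now apply om_oe.
  - intros i j Hij. rewrite !doubleE. replace (S (S (2 * i))) with (2 * i + 2)%nat by lia. replace (S (2 * j)) with (2 * j + 1)%nat by lia.
    rewrite om_eo by auto. rewrite kron_neq by lia. unfold S_, site. ring.
  - intros i j. unfold S_. apply Sfull_herm; assumption.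
  - intros v. apply qform_pos.
Qed.

Lemma uu_Cc a x : Cc (fun t => uu kappa t a x).
Proof.
  pose proof (En_pos kappa) as Ep.
  assert (H : forall f : R -> R, (forall t s, Rabs (f t - f s) <= 10 * En kappa * Rabs (t - s)) -> forall t, continuous f t).
  { intros f Hf t. apply continuity_pt_filterlim. intros eps He. exists (eps / (10 * En kappa + 1)). split.
    { apply Rdiv_lt_0_compat; lra. }
    intros s [_ Hs]. simpl in *. unfold Rdist in *. eapply Rle_lt_trans; [apply Hf|].
    apply (Rmult_lt_compat_l (10 * En kappa + 1)) in Hs; [|lra].
    replace ((10 * En kappa + 1) * (eps / (10 * En kappa + 1))) with eps in Hs by (field; lra).
    pose proof (Rabs_pos (s - t)). lra. }
  split; apply H; intros t s; pose proof (uu_lip kappa hk t s a x) as L.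
  - eapply Rle_trans; [|exact L]. eapply Rle_trans; [|apply Re_le_Cmod]. right. reflexivity.
  - eapply Rle_trans; [|exact L]. eapply Rle_trans; [|apply Im_le_Cmod]. right. reflexivity.
Qed.

Lemma SW_Cc x y M : Cc (fun t => SW N kappa bL bR t x y M).
Proof.
  unfold SW, dblW. apply Cc_csum. intros a _. apply Cc_mult; [apply Cc_conj, uu_Cc|].
  apply Cc_csum. intros b _. apply Cc_mult; [apply Cc_const | apply uu_Cc].
Qed.

(** The window sums are continuous in t and converge locally uniformly. *)
Lemma Sfull_Cc x y : Cc (fun t => Sfull t x y).
Proof.
  assert (H : forall (f : R -> R) (g : nat -> R -> R), (forall M t, continuous (g M) t) ->
    (forall t T M, Rabs t <= T -> Rabs (f t - g M t) <= Scst kappa T x y * (/ 2) ^ M) -> forall t, continuous f t).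
  { intros f g cg Hfg t. apply continuity_pt_filterlim. intros eps He.
    destruct (half_small (eps / 4) (Scst kappa (Rabs t + 1) x y)) as [M HM]; [lra | now apply Scst_pos|]. specialize (HM M (le_n _)).
    pose proof (cg M t) as cM. apply continuity_pt_filterlim in cM. destruct (cM (eps / 4) ltac:(lra)) as [d [d0 Hd]].
    exists (Rmin d 1). split; [apply Rmin_glb_lt; lra|]. intros s [Hs1 Hs]. simpl in *. unfold Rdist in *.
    assert (Hs2 : Rabs (s - t) < d) by (eapply Rlt_le_trans; [exact Hs | apply Rmin_l]).
    assert (Hs3 : Rabs (s - t) < 1) by (eapply Rlt_le_trans; [exact Hs | apply Rmin_r]).
    specialize (Hd s (conj Hs1 Hs2)).
    pose proof (Hfg t (Rabs t + 1) M ltac:(lra)) as A1.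
    assert (St : Rabs s <= Rabs t + 1). { replace s with (t + (s - t)) by ring. eapply Rle_trans; [apply Rabs_triang|]. lra. }
    pose proof (Hfg s (Rabs t + 1) M St) as A2.
    replace (f s - f t) with ((f s - g M s) + (g M s - g M t) + - (f t - g M t)) by ring.
    eapply Rle_lt_trans; [apply Rabs_triang|]. rewrite Rabs_Ropp.
    eapply Rle_lt_trans; [apply Rplus_le_compat_r, Rabs_triang|]. lra. }
  split.
  - apply (H _ (fun M t => fst (SW N kappa bL bR t x y M))); [intros M; apply (SW_Cc x y M)|]. intros t T M Ht.
    eapply Rle_trans; [|now apply (Sfull_close N kappa bL bR hk hL hLR t T x y M)]. eapply Rle_trans; [|apply Re_le_Cmod]. right; reflexivity.
  - apply (H _ (fun M t => snd (SW N kappa bL bR t x y M))); [intros M; apply (SW_Cc x y M)|]. intros t T M Ht.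
    eapply Rle_trans; [|now apply (Sfull_close N kappa bL bR hk hL hLR t T x y M)]. eapply Rle_trans; [|apply Im_le_Cmod]. right; reflexivity.
Qed.

Lemma Cc_ext f g : (forall t, f t = g t) -> Cc f -> Cc g.
Proof.
  intros H [H1 H2]. split; intros x; [apply (continuous_ext (fun x => fst (f x))) | apply (continuous_ext (fun x => snd (f x)))]; auto; intros; simpl; now rewrite H.
Qed.

Lemma om_Cc i j : (1 <= i)%nat -> (1 <= j)%nat ->
  Cc (fun t => omega0_two N bL bR (evolve kappa t (Fvec x0 i)) (evolve kappa t (Fvec x0 j))).
Proof.
  intros Hi Hj.
  destruct (Nat.Even_or_Odd i) as [[m Em]|[m Em]], (Nat.Even_or_Odd j) as [[m' Em']|[m' Em']].
  - apply (Cc_ext (fun _ => RtoC 0)); [|apply Cc_const]. intros t. symmetry.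
    replace i with (2 * (m - 1) + 2)%nat by lia. replace j with (2 * (m' - 1) + 2)%nat by lia. now apply om_ee.
  - apply (Cc_ext (fun t => RtoC (kron (x0 + Z.of_nat m') (x0 + Z.of_nat (m - 1))) - Sfull t (x0 + Z.of_nat m') (x0 + Z.of_nat (m - 1))))%C.
    + intros t. symmetry. replace i with (2 * (m - 1) + 2)%nat at 1 by lia. rewrite Em'. now apply om_eo.
    + apply (Cc_plus (fun _ => _)); [apply Cc_const|]. destruct (Sfull_Cc (x0 + Z.of_nat m') (x0 + Z.of_nat (m - 1))) as [A B].
      split; intros t; [apply (copp (fun t => fst (Sfull t _ _))) | apply (copp (fun t => snd (Sfull t _ _)))]; auto.
  - apply (Cc_ext (fun t => Sfull t (x0 + Z.of_nat m) (x0 + Z.of_nat (m' - 1)))); [|apply Sfull_Cc].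
    intros t. symmetry. rewrite Em. replace j with (2 * (m' - 1) + 2)%nat at 1 by lia. now apply om_oe.
  - apply (Cc_ext (fun _ => RtoC 0)); [|apply Cc_const]. intros t. symmetry. rewrite Em, Em'. now apply om_oo.
Qed.

Lemma remove_nth_in k l x : In x (remove_nth k l) -> In x l.
Proof.
  revert k. induction l as [|a l IH]; intros [|k]; simpl; auto.
  intros [->|H]; auto. right; eauto.
Qed.

Lemma pf_aux_Cc (M : R -> nat -> nat -> C) f l : (forall i j, In i l -> In j l -> Cc (fun t => M t i j)) ->
  Cc (fun t => pf_aux (M t) f l).
Proof.
  revert l. induction f as [|f IH]; intros l H; [exact (Cc_const (RtoC 1))|].
  destruct l as [|i r]; [exact (Cc_const (RtoC 1))|]. cbn [pf_aux].
  change (Cc (fun t => csum (fun k => (RtoC ((-1) ^ k) * M t i (nth k r 0%nat) * pf_aux (M t) f (remove_nth k r))%C) (seq 0 (length r)))).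
  apply Cc_csum. intros k Hk. apply in_seq in Hk. apply Cc_mult.
  - apply Cc_mult; [apply Cc_const|]. apply H; [now left|]. right. apply nth_In. lia.
  - apply IH. intros i' j' Hi Hj. apply H; right; eapply remove_nth_in; eauto.
Qed.

Lemma Pt_Cc n : Cc (fun t => Pt x0 N kappa bL bR n t).
Proof.
  unfold Pt, pfaffian. apply (pf_aux_Cc (fun t i j => omega0_two N bL bR (evolve kappa t (Fvec x0 i)) (evolve kappa t (Fvec x0 j)))).
  intros i j Hi Hj. apply in_seq in Hi, Hj. apply om_Cc; lia.
Qed.
End Form.

(** * Scattering and the large time limit *)

Lemma win_R N (F : Z -> R) M : rsum (fun a => if inR N a then F a else 0) (win M) = rsum (fun j => F (Z.of_nat N + Z.of_nat j)%Z) (seq 1 (M - N)).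
Proof.
  induction M as [|M IH].
  - unfold rsum; cbn [win map fold_right]. assert (inR N 0 = false) as -> by (apply inR_false; lia).
    assert (inR N (-1) = false) as -> by (apply inR_false; lia). simpl. ring.
  - cbn [win]. rewrite !rsum_cons, IH. assert (inR N (- Z.of_nat (S M) - 1) = false) as -> by (apply inR_false; lia).
    destruct (inR N (Z.of_nat (S M))) eqn:Hr; regions.
    + replace (S M - N)%nat with (S (M - N)) by lia. rewrite rsum_seq_S. replace (Z.of_nat N + Z.of_nat (S (M - N)))%Z with (Z.of_nat (S M)) by lia. ring.
    + replace (S M - N)%nat with (M - N)%nat by lia. ring.
Qed.
Lemma win_L N (F : Z -> R) M : rsum (fun a => if inL N a then F a else 0) (win M) = rsum (fun j => F (- (Z.of_nat N + Z.of_nat j))%Z) (seq 1 (S M - N)).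
Proof.
  induction M as [|M IH].
  - unfold rsum; cbn [win map fold_right]. assert (inL N 0 = false) as -> by (apply inL_false; lia).
    destruct (inL N (-1)) eqn:Hl; regions.
    + replace N with 0%nat by lia. simpl. ring.
    + replace (1 - N)%nat with 0%nat by lia. simpl. ring.
  - cbn [win]. rewrite !rsum_cons, IH. assert (inL N (Z.of_nat (S M)) = false) as -> by (apply inL_false; lia).
    destruct (inL N (- Z.of_nat (S M) - 1)) eqn:Hr; regions.
    + replace (S (S M) - N)%nat with (S (S M - N)) by lia. rewrite rsum_seq_S.
      replace (- (Z.of_nat N + Z.of_nat (S (S M - N))))%Z with (- Z.of_nat (S M) - 1)%Z by lia. ring.
    + replace (S (S M) - N)%nat with (S M - N)%nat by lia. ring.
Qed.
Lemma win_S N (F : Z -> R) M : (N <= M)%nat ->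
  rsum (fun a => if (inR N a || inL N a)%bool then 0 else F a) (win M) = rsum (fun a => if (inR N a || inL N a)%bool then 0 else F a) (win N).
Proof.
  induction M as [|M IH]; intros HM; [now replace N with 0%nat by lia|].
  destruct (Nat.eq_dec N (S M)) as [->|]; auto. cbn [win]. rewrite !rsum_cons, IH by lia.
  assert (inR N (Z.of_nat (S M)) = true) as -> by (apply inR_spec; lia).
  assert (inL N (- Z.of_nat (S M) - 1) = true) as -> by (apply inL_spec; lia). rewrite Bool.orb_true_r. simpl. ring.
Qed.

(** The reflection amplitude - kappa / (kappa + i sin k) with its denominator made real. *)
Definition rC (kappa k : R) : C := (RtoC (- kappa * / den kappa k) * (kappa, (- sin k)%R))%C.
Definition tauC (kappa k : R) : C := (RtoC 1 + rC kappa k)%C.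

Section Scatter.
Variables (N : nat) (kappa bL bR : R).
Hypothesis (hk : 0 < kappa) (hL : 0 < bL) (hLR : bL <= bR).
Notation E := (En kappa).

Lemma rC_CC2 : CC2 (rC kappa).
Proof.
  apply (CC2_mult (fun k => RtoC (- kappa * / den kappa k)) (fun k => (kappa, - sin k))).
  - apply (CC2_RtoC (fun k => - kappa * / den kappa k)). apply (C2_mult (fun _ => - kappa) (fun k => / den kappa k)); [c2 | now apply iden_C2].
  - split; simpl; c2.
Qed.
Lemma tauC_CC2 : CC2 (tauC kappa).
Proof. apply (CC2_plus (fun _ => RtoC 1) (rC kappa)); [apply CC2_const | apply rC_CC2]. Qed.

Lemma rC_cis k m : rr kappa k m = fst (rC kappa k * cis (m * k))%C.
Proof. unfold rr, rC, cis; simpl. field. pose proof (den_pos kappa hk k); lra. Qed.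
Lemma tauC_eq k : tauC kappa k = (RtoC (sin k * / den kappa k) * (sin k, kappa))%C.
Proof.
  unfold tauC, rC, Cmult, Cplus, RtoC; simpl. pose proof (den_pos kappa hk k). unfold den in *.
  f_equal; field; lra.
Qed.
(** tau = sin k (sin k + i kappa) / den vanishes at the band edges; the constant comes from kappa
    (sin k + kappa) <= 2 den. *)
Lemma tauC_abs k : 0 <= sin k -> Cmod (tauC kappa k) <= 2 / kappa * sin k.
Proof.
  intros Hs. rewrite tauC_eq, Cmod_mult, Cmod_R. pose proof (den_pos kappa hk k) as Hd.
  assert (0 < / den kappa k) by now apply Rinv_0_lt_compat.
  rewrite Rabs_pos_eq by (apply Rmult_le_pos; lra).
  assert (Cmod (sin k, kappa) <= sin k + kappa).
  { eapply Rle_trans; [apply Cmod_le_parts|]. simpl. rewrite !Rabs_pos_eq; lra. }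
  apply Rle_trans with (sin k * / den kappa k * (sin k + kappa)).
  { apply Rmult_le_compat_l; auto. apply Rmult_le_pos; lra. }
  replace (sin k * / den kappa k * (sin k + kappa)) with (((sin k + kappa) / den kappa k) * sin k) by (field; lra).
  apply Rmult_le_compat_r; auto. apply Rle_div_l; auto.
  replace (2 / kappa * den kappa k) with (2 * (den kappa k) / kappa) by (field; lra). apply Rle_div_r; auto.
  unfold den. nra.
Qed.
Lemma Cn2_tau k : Cn2 (tauC kappa k) = sigmaB kappa k.
Proof.
  rewrite tauC_eq, Cn2_mult, Cn2_RtoC. unfold Cn2, sigmaB; simpl. pose proof (den_pos kappa hk k). unfold den in *.
  field. lra.
Qed.
Lemma Cn2_rC k : Cn2 (rC kappa k) = 1 - sigmaB kappa k.
Proof.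
  unfold rC. rewrite Cn2_mult, Cn2_RtoC. unfold Cn2, sigmaB; simpl. pose proof (den_pos kappa hk k). unfold den in *.
  field. lra.
Qed.

Lemma sin_mult_bound (y : nat) k : 0 <= k <= PI -> Rabs (sin (INR y * k)) <= INR y * sin k.
Proof.
  intros Hk. assert (0 <= sin k) by (apply sin_ge_0; lra). induction y as [|y IH].
  - simpl. rewrite !Rmult_0_l, sin_0, Rabs_R0. lra.
  - rewrite S_INR, Rmult_plus_distr_r, Rmult_1_l, sin_plus, Rmult_plus_distr_r.
    eapply Rle_trans; [apply Rabs_triang|]. rewrite !Rabs_mult.
    assert (Rabs (cos k) <= 1) by apply Rabs_le, COS_bound. assert (Rabs (cos (INR y * k)) <= 1) by apply Rabs_le, COS_bound.
    rewrite (Rabs_pos_eq (sin k)) by auto. pose proof (Rabs_pos (sin (INR y * k))). pose proof (Rabs_pos (cos k)). nra.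
Qed.

(* amplitudes on the right ([fAp], [fAm]) and on the left ([fBp], [fBm]) of the impurity of a particle
   started at [y >= 0]; [c] shifts the origin of the half-line *)
Definition fAp (c y k : R) : C := (cis (c * k) * (cis (- (y * k)) + rC kappa k * cis (y * k)))%C.
Definition fAm (c y k : R) : C := (cis (- (c * k)) * (cis (y * k) + Cconj (rC kappa k) * cis (- (y * k))))%C.
Definition fBp (c y k : R) : C := (cis (c * k) * (tauC kappa k * cis (y * k)))%C.
Definition fBm (c y k : R) : C := (cis (- (c * k)) * (Cconj (tauC kappa k) * cis (- (y * k))))%C.

Lemma fAp_CC2 c y : CC2 (fAp c y).
Proof. pose proof rC_CC2. unfold fAp. cc2. Qed.
Lemma fAm_CC2 c y : CC2 (fAm c y).
Proof. pose proof rC_CC2. unfold fAm. cc2. Qed.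
Lemma fBp_CC2 c y : CC2 (fBp c y).
Proof. pose proof tauC_CC2. unfold fBp. cc2. Qed.
Lemma fBm_CC2 c y : CC2 (fBm c y).
Proof. pose proof tauC_CC2. unfold fBm. cc2. Qed.

Lemma fAm_conj c y k : fAm c y k = Cconj (fAp c y k).
Proof.
  unfold fAm, fAp. rewrite Cmult_conj, Cplus_conj, Cmult_conj, !cis_conj, Ropp_involutive. reflexivity.
Qed.
Lemma fBm_conj c y k : fBm c y k = Cconj (fBp c y k).
Proof. unfold fBm, fBp. rewrite !Cmult_conj, !cis_conj. reflexivity. Qed.

(** e^{-iyk} + r e^{iyk} = - 2 i sin (y k) + tau e^{iyk}: incident and reflected waves cancel at the
    band edges, where r = -1 and tau = 0. *)
Lemma fAp_bound c (y : nat) : sbound (fAp c (INR y)) (2 * INR y + 2 / kappa).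
Proof.
  intros k Hk. assert (s0 : 0 <= sin k) by (apply sin_ge_0; lra). unfold fAp. rewrite Cmod_mult, Cmod_cis, Rmult_1_l.
  replace (cis (- (INR y * k)) + rC kappa k * cis (INR y * k))%C with
    (RtoC (sin (INR y * k)) * (RtoC (-2) * Ci) + tauC kappa k * cis (INR y * k))%C.
  2:{ unfold tauC. replace (cis (- (INR y * k))) with (cis (INR y * k) + RtoC (sin (INR y * k)) * (RtoC (-2) * Ci))%C. ring.
      unfold cis, RtoC, Ci, Cmult, Cplus; simpl. rewrite cos_neg, sin_neg. f_equal; ring. }
  eapply Rle_trans; [apply Cmod_triangle|]. rewrite !Cmod_mult, Cmod_cis, Cmod_Ci, !Cmod_R, (Rabs_left (-2)) by lra.
  pose proof (sin_mult_bound y k Hk). pose proof (tauC_abs k s0). lra.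
Qed.
Lemma fBp_bound c y : sbound (fBp c y) (2 / kappa).
Proof.
  intros k Hk. assert (s0 : 0 <= sin k) by (apply sin_ge_0; lra). unfold fBp. rewrite !Cmod_mult, !Cmod_cis, Rmult_1_l, Rmult_1_r.
  now apply tauC_abs.
Qed.
Lemma fAm_bound c (y : nat) : sbound (fAm c (INR y)) (2 * INR y + 2 / kappa).
Proof. intros k Hk. rewrite fAm_conj, Cmod_conj. now apply fAp_bound. Qed.
Lemma fBm_bound c y : sbound (fBm c y) (2 / kappa).
Proof. intros k Hk. rewrite fBm_conj, Cmod_conj. now apply fBp_bound. Qed.

(** For sites on the same side the kernel is the real part of e^{ijk} [fAp], hence half the sum of
    that wave and its conjugate. *)
Lemma kB_right (c j y : nat) k : RtoC (kB kappa (Z.of_nat c + Z.of_nat j) (Z.of_nat y) k) =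
  (RtoC (/ 2) * (cis (INR j * k) * fAp (INR c) (INR y) k + cis (- (INR j * k)) * fAm (INR c) (INR y) k))%C.
Proof.
  unfold kB. rewrite rC_cis, fAm_conj, <- cis_conj, <- Cmult_conj.
  set (X := (cis (INR j * k) * fAp (INR c) (INR y) k)%C).
  assert (EX : X = (cis ((INR c + INR j - INR y) * k) + rC kappa k * cis ((INR c + INR j + INR y) * k))%C).
  { unfold X, fAp. replace ((INR c + INR j - INR y) * k) with (INR j * k + INR c * k + - (INR y * k)) by ring.
    replace ((INR c + INR j + INR y) * k) with (INR j * k + INR c * k + INR y * k) by ring. rewrite !cis_plus. ring. }
  rewrite <- Nat2Z.inj_add, !Zabs2Nat.id, !plus_INR.
  replace (IZR (Z.of_nat (c + j) - Z.of_nat y)) with (INR c + INR j - INR y) by (rewrite minus_IZR, <- !INR_IZR_INZ, plus_INR; ring).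
  transitivity (RtoC (fst X)); [rewrite EX; reflexivity|]. clearbody X. unfold Cconj, RtoC, Cmult, Cplus; simpl. f_equal; field.
Qed.
Lemma kB_left (c j y : nat) k : (1 <= c + j)%nat -> RtoC (kB kappa (- (Z.of_nat c + Z.of_nat j)) (Z.of_nat y) k) =
  (RtoC (/ 2) * (cis (INR j * k) * fBp (INR c) (INR y) k + cis (- (INR j * k)) * fBm (INR c) (INR y) k))%C.
Proof.
  intros _. unfold kB. rewrite rC_cis, fBm_conj, <- cis_conj, <- Cmult_conj.
  set (X := (cis (INR j * k) * fBp (INR c) (INR y) k)%C).
  assert (EX : X = (cis ((INR c + INR j + INR y) * k) + rC kappa k * cis ((INR c + INR j + INR y) * k))%C).
  { unfold X, fBp, tauC.
    replace ((INR c + INR j + INR y) * k) with (INR j * k + INR c * k + INR y * k) by ring. rewrite !cis_plus. ring. }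
  replace (Z.abs_nat (- (Z.of_nat c + Z.of_nat j)) + Z.abs_nat (Z.of_nat y))%nat with (c + j + y)%nat by lia.
  replace (IZR (- (Z.of_nat c + Z.of_nat j) - Z.of_nat y) * k) with (- ((INR c + INR j + INR y) * k)) by (rewrite minus_IZR, opp_IZR, plus_IZR, <- !INR_IZR_INZ; ring).
  rewrite cos_neg, !plus_INR.
  transitivity (RtoC (fst X)); [rewrite EX; reflexivity|]. clearbody X. unfold Cconj, RtoC, Cmult, Cplus; simpl. f_equal; field.
Qed.

Definition uac (t : R) (a y : Z) : C := (RtoC (/ PI) * cint (fun k => (cis (t * cos k) * RtoC (kB kappa a y k))%C) 0 PI)%C.

Lemma uu_split t a y : uu kappa t a y = (uac t a y + cis (t * E) * RtoC (psi kappa a * psi kappa y))%C.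
Proof.
  unfold uu, uac, EB, cint, cis, RtoC, Cmult, Cplus; cbn [fst snd].
  apply injective_projections; cbn [fst snd].
  - rewrite (RInt_ext (fun x => cos (t * cos x) * kB kappa a y x - sin (t * cos x) * 0) (fun k => cos (t * cos k) * kB kappa a y k)) by (intros; rng). ring.
  - rewrite (RInt_ext (fun x => cos (t * cos x) * 0 + sin (t * cos x) * kB kappa a y x) (fun k => sin (t * cos k) * kB kappa a y k)) by (intros; rng). ring.
Qed.

Lemma uac_wave t a y j A B : Cc A -> Cc B ->
  (forall k, RtoC (kB kappa a y k) = (RtoC (/ 2) * (cis (INR j * k) * A k + cis (- (INR j * k)) * B k))%C) ->
  uac t a y = wave t A B j.
Proof.
  intros HA HB H. unfold uac, wave. pose proof PI_RGT_0.
  rewrite (cint_ext _ (fun k => RtoC (/ 2) * (cis (t * cos k) * (cis (INR j * k) * A k + cis (- (INR j * k)) * B k)))%C); [|lra|].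
  - rewrite cint_scal by Ccs. rewrite Cmult_assoc, <- RtoC_mult. do 2 f_equal. field. lra.
  - intros k _. rewrite H. ring.
Qed.

Lemma wave_csum {I} t (A B : I -> R -> C) (v : I -> C) l j : (forall i, Cc (A i)) -> (forall i, Cc (B i)) ->
  csum (fun i => (wave t (A i) (B i) j * v i)%C) l = wave t (fun k => csum (fun i => (A i k * v i)%C) l) (fun k => csum (fun i => (B i k * v i)%C) l) j.
Proof.
  intros HA HB. pose proof PI_RGT_0. unfold wave.
  rewrite (cint_ext (fun k => cis (t * cos k) * (cis (INR j * k) * csum _ l + _))%C
     (fun k => csum (fun i => v i * (cis (t * cos k) * (cis (INR j * k) * A i k + cis (- (INR j * k)) * B i k)))%C l)); [|lra|].
  - assert (cF : forall i, Cc (fun k => cis (t * cos k) * (cis (INR j * k) * A i k + cis (- (INR j * k)) * B i k))%C).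
    { intros i. pose proof (HA i). pose proof (HB i). Ccs. }
    rewrite cint_csum by (intros i; apply Cc_mult; [apply Cc_const | apply cF]).
    rewrite <- csum_scal. apply csum_ext. intros i _. rewrite cint_scal by apply cF. ring.
  - intros k _. rewrite <- !csum_scal, <- csum_plus, <- csum_scal. apply csum_ext; intros; ring.
Qed.
End Scatter.

(** * Late time bound on the form of a fixed vector *)

Section MainForm.
Variables (N : nat) (kappa bL bR : R).
Hypothesis (hk : 0 < kappa) (hL : 0 < bL) (hLR : bL <= bR).
Variable x0 : Z.
Notation E := (En kappa).
Notation site := (site x0).
Notation S_ := (S_ N kappa bL bR x0).
Notation uac := (uac kappa).
Notation uu := (uu kappa).

(** S_t <= 1 by unitarity. This is the bound used at the finitely many sites that have no room for a
    trial vector to the right of the impurity. *)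
Lemma qform_delta_le t n i : (i < n)%nat -> fst (qform (S_ t) (fun j => if Nat.eq_dec j i then RtoC 1 else RtoC 0) n) <= 1.
Proof.
  intros Hi. apply Rle_eps. intros eps He. apply qform_le; auto.
  destruct (unitary kappa hk t (site i) (site i) eps He) as [M0 HM]. exists M0. intros M HMM. specialize (HM M HMM).
  assert (EP : forall a, phi kappa x0 t (fun j => if Nat.eq_dec j i then RtoC 1 else RtoC 0) n a = uu t a (site i)).
  { intros a. unfold phi. rewrite (csum_ext _ (fun j => (RtoC (if Nat.eq_dec j i then 1 else 0) * uu t a (site j))%C)).
    2:{ intros j _. destruct (Nat.eq_dec j i); ring. }
    assert (G : forall l, NoDup l -> csum (fun j => (RtoC (if Nat.eq_dec j i then 1 else 0) * uu t a (site j))%C) l = if in_dec Nat.eq_dec i l then uu t a (site i) else RtoC 0).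
    { induction l as [|b l IH]; intros ND; [reflexivity|]. rewrite csum_cons, IH by now inversion ND. inversion ND; subst.
      destruct (Nat.eq_dec b i) as [->|].
      - destruct (in_dec Nat.eq_dec i l) as [HH|]; [contradiction|]. destruct (in_dec Nat.eq_dec i (i :: l)) as [|F]; [ring | destruct F; now left].
      - destruct (in_dec Nat.eq_dec i l), (in_dec Nat.eq_dec i (b :: l)) as [F|F]; try ring.
        + destruct F; now right. + destruct F; congruence. }
    rewrite G by apply seq_NoDup. destruct (in_dec _ _ _) as [|F]; auto. destruct F. apply in_seq. lia. }
  pose proof (win_NoDup M) as ND.
  eapply Rle_trans; [apply Rplus_le_compat; apply qr_le_l2; auto|]. rewrite <- rsum_plus.
  rewrite (rsum_ext _ (fun a => fst (Cconj (uu t a (site i)) * uu t a (site i))%C)) by (intros; rewrite EP; simpl; ring).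
  rewrite <- csum_fst. eapply Rle_trans in HM; [|apply Re_le_Cmod].
  assert (kron (site i) (site i) = 1) as K by (unfold kron; now destruct (Z.eq_dec _ _)). rewrite K in HM.
  apply Rabs_le_between in HM. simpl in HM. lra.
Qed.

(** Meaningful only at nonnegative sites; at the others [Z.to_nat] returns 0 and the support
    condition [Hv] kills the coefficient. *)
Definition yp (j : nat) : nat := Z.to_nat (site j).
Definition ampR (c : R) (v : nat -> C) (n : nat) (k : R) : C := csum (fun j => (fAp kappa c (INR (yp j)) k * v j)%C) (seq 0 n).
Definition ampR' (c : R) (v : nat -> C) (n : nat) (k : R) : C := csum (fun j => (fAm kappa c (INR (yp j)) k * v j)%C) (seq 0 n).
Definition ampL (c : R) (v : nat -> C) (n : nat) (k : R) : C := csum (fun j => (fBp kappa c (INR (yp j)) k * v j)%C) (seq 0 n).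
Definition ampL' (c : R) (v : nat -> C) (n : nat) (k : R) : C := csum (fun j => (fBm kappa c (INR (yp j)) k * v j)%C) (seq 0 n).
Definition IR (v : nat -> C) (n : nat) : R := / (2 * PI) * RInt (fun k => logis bR (cos k) * Cn2 (ampR 0 v n k)) 0 PI.
Definition IL (v : nat -> C) (n : nat) : R := / (2 * PI) * RInt (fun k => logis bL (cos k) * Cn2 (ampL 0 v n k)) 0 PI.

Lemma ampR_CC2 c v n : CC2 (ampR c v n).
Proof. apply CC2_csum. intros j _. apply (CC2_mult (fAp kappa c (INR (yp j)))); [now apply fAp_CC2 | apply CC2_const]. Qed.
Lemma ampR'_CC2 c v n : CC2 (ampR' c v n).
Proof. apply CC2_csum. intros j _. apply (CC2_mult (fAm kappa c (INR (yp j)))); [now apply fAm_CC2 | apply CC2_const]. Qed.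
Lemma ampL_CC2 c v n : CC2 (ampL c v n).
Proof. apply CC2_csum. intros j _. apply (CC2_mult (fBp kappa c (INR (yp j)))); [now apply fBp_CC2 | apply CC2_const]. Qed.
Lemma ampL'_CC2 c v n : CC2 (ampL' c v n).
Proof. apply CC2_csum. intros j _. apply (CC2_mult (fBm kappa c (INR (yp j)))); [now apply fBm_CC2 | apply CC2_const]. Qed.

Lemma sbound_csum {I} (f : I -> R -> C) (c : I -> R) (v : I -> C) l : (forall i, sbound (f i) (c i)) ->
  sbound (fun k => csum (fun i => (f i k * v i)%C) l) (rsum (fun i => c i * Cmod (v i)) l).
Proof.
  intros H k Hk. eapply Rle_trans; [apply csum_Cmod|]. rewrite <- rsum_scal_r. apply rsum_le. intros i _.
  rewrite Cmod_mult. pose proof (H i k Hk). pose proof (Cmod_ge_0 (v i)). nra.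
Qed.

Definition cstv (v : nat -> C) (n : nat) : R := rsum (fun i => (2 * INR (yp i) + 2 / kappa) * Cmod (v i)) (seq 0 n).
Lemma ampL_le v n (F : R -> R -> R -> C) c : (forall y, sbound (F c y) (2 / kappa)) ->
  sbound (fun k => csum (fun j => (F c (INR (yp j)) k * v j)%C) (seq 0 n)) (cstv v n).
Proof.
  intros HF. apply sbound_csum. intros j k Hk. eapply Rle_trans; [now apply HF|].
  apply Rmult_le_compat_r; [apply sin_ge_0; lra|]. pose proof (pos_INR (yp j)). lra.
Qed.

Definition phiac (t : R) (v : nat -> C) (n : nat) (a : Z) : C := csum (fun j => (uac t a (site j) * v j)%C) (seq 0 n).
Definition psiv (v : nat -> C) (n : nat) : C := csum (fun j => (RtoC (psi kappa (site j)) * v j)%C) (seq 0 n).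

Lemma phi_split t v n a : phi kappa x0 t v n a = (phiac t v n a + RtoC (psi kappa a) * (cis (t * E) * psiv v n))%C.
Proof.
  unfold phi, phiac, psiv. rewrite <- !csum_scal, <- csum_plus. apply csum_ext. intros j _.
  rewrite (uu_split kappa), RtoC_mult. ring.
Qed.

Section Supp.
Variables (v : nat -> C) (n : nat).
Hypothesis Hv : forall j, (j < n)%nat -> (site j < 0)%Z -> v j = RtoC 0.

Lemma phiac_right t c j : phiac t v n (Z.of_nat c + Z.of_nat j) = wave t (ampR (INR c) v n) (ampR' (INR c) v n) j.
Proof.
  unfold ampR, ampR'. rewrite <- (wave_csum t (fun j => fAp kappa (INR c) (INR (yp j))) (fun j => fAm kappa (INR c) (INR (yp j)))).
  - apply csum_ext. intros i Hi. apply in_seq in Hi.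
    destruct (Z_lt_le_dec (site i) 0) as [H|H]; [rewrite Hv by (auto; lia); ring|]. f_equal.
    replace (site i) with (Z.of_nat (yp i)) by (unfold yp; lia).
    apply uac_wave; auto; [apply CC2_Cc; now apply fAp_CC2 | apply CC2_Cc; now apply fAm_CC2 | intros k; now apply kB_right].
  - intros; apply CC2_Cc; now apply fAp_CC2.
  - intros; apply CC2_Cc; now apply fAm_CC2.
Qed.
Lemma phiac_left t c j : (1 <= c + j)%nat -> phiac t v n (- (Z.of_nat c + Z.of_nat j)) = wave t (ampL (INR c) v n) (ampL' (INR c) v n) j.
Proof.
  intros Hc. unfold ampL, ampL'. rewrite <- (wave_csum t (fun j => fBp kappa (INR c) (INR (yp j))) (fun j => fBm kappa (INR c) (INR (yp j)))).
  - apply csum_ext. intros i Hi. apply in_seq in Hi.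
    destruct (Z_lt_le_dec (site i) 0) as [H|H]; [rewrite Hv by (auto; lia); ring|]. f_equal.
    replace (site i) with (Z.of_nat (yp i)) by (unfold yp; lia).
    apply uac_wave; auto; [apply CC2_Cc; now apply fBp_CC2 | apply CC2_Cc; now apply fBm_CC2 | intros k; now apply kB_left].
  - intros; apply CC2_Cc; now apply fBp_CC2.
  - intros; apply CC2_Cc; now apply fBm_CC2.
Qed.

(** The continuous-spectrum part leaves every fixed site: near the site it is a wave whose
    amplitudes vanish at the band edges. *)
Lemma phiac_decay a eps : 0 < eps -> exists T, 0 < T /\ forall t, T <= t -> Cn2 (phiac t v n a) <= eps.
Proof.
  intros He.
  assert (G : exists A B Ca j, CC2 A /\ CC2 B /\ sbound A Ca /\ sbound B Ca /\ forall t, phiac t v n a = wave t A B j).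
  { destruct (Z_lt_le_dec a 0) as [Ha|Ha].
    - exists (ampL (INR 0) v n), (ampL' (INR 0) v n), (cstv v n), (Z.to_nat (- a)).
      split; [apply ampL_CC2|]. split; [apply ampL'_CC2|]. split; [apply (ampL_le v n (fBp kappa)); intros; now apply fBp_bound|].
      split; [apply (ampL_le v n (fBm kappa)); intros; now apply fBm_bound|].
      intros t. rewrite <- phiac_left by lia. f_equal. lia.
    - exists (ampR (INR 0) v n), (ampR' (INR 0) v n), (cstv v n), (Z.to_nat a).
      split; [apply ampR_CC2|]. split; [apply ampR'_CC2|]. split; [apply sbound_csum; intros; now apply fAp_bound|].
      split; [apply sbound_csum; intros; now apply fAm_bound|].
      intros t. rewrite <- phiac_right. f_equal. lia. }
  destruct G as (A & B & Ca & j & cA & cB & bA & bB & G).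
  destruct (wave_site A B Ca j cA cB bA bB) as (K & K0 & HK).
  destruct (large_sqrt (K / eps)) as (T & T0 & HT). { apply Rlt_le, Rdiv_lt_0_compat; lra. }
  exists T. split; auto. intros t Ht. rewrite G. eapply Rle_trans; [apply HK; lra|].
  specialize (HT t Ht). assert (0 < sqrt t) by (apply sqrt_lt_R0; lra).
  replace (K / sqrt t) with (eps * (K / eps / sqrt t)) by (field; lra). nra.
Qed.
Lemma phiac_decay_list l eps : 0 < eps -> exists T, 0 < T /\ forall t, T <= t -> rsum (fun a => Cn2 (phiac t v n a)) l <= eps.
Proof.
  revert eps. induction l as [|a l IH]; intros eps He.
  - exists 1. split; [lra|]. intros t _. unfold rsum; simpl. lra.
  - destruct (IH (eps / 2) ltac:(lra)) as (T1 & P1 & H1). destruct (phiac_decay a (eps / 2) ltac:(lra)) as (T2 & P2 & H2).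
    exists (T1 + T2). split; [lra|]. intros t Ht. rewrite rsum_cons. specialize (H1 t ltac:(lra)). specialize (H2 t ltac:(lra)). lra.
Qed.

(** Moving the origin from the impurity to the wall of the half-line only changes a common phase. *)
Lemma ampR_shift c k : Cn2 (ampR c v n k) = Cn2 (ampR 0 v n k).
Proof.
  assert (H : forall c, ampR c v n k = (cis (c * k) * csum (fun j => ((cis (- (INR (yp j) * k)) + rC kappa k * cis (INR (yp j) * k)) * v j)%C) (seq 0 n))%C).
  { intros d. unfold ampR. rewrite <- csum_scal. apply csum_ext; intros. unfold fAp. ring. }
  rewrite !H, !Cn2_mult, !Cn2_cis. reflexivity.
Qed.
Lemma ampL_shift c k : Cn2 (ampL c v n k) = Cn2 (ampL 0 v n k).
Proof.
  assert (H : forall c, ampL c v n k = (cis (c * k) * csum (fun j => ((tauC kappa k * cis (INR (yp j) * k)) * v j)%C) (seq 0 n))%C).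
  { intros d. unfold ampL. rewrite <- csum_scal. apply csum_ext; intros. unfold fBp. ring. }
  rewrite !H, !Cn2_mult, !Cn2_cis. reflexivity.
Qed.

Lemma qR_qf (u : Z -> R) M : qR N (logis bR) (win M) u = qf (logis bR) (fun j => u (Z.of_nat N + Z.of_nat j)%Z) (M - N).
Proof.
  unfold qR, qf. f_equal. apply RIext; [pose proof PI_RGT_0; lra|]. intros q _. req. do 2 f_equal.
  rewrite (rsum_ext _ (fun a => if inR N a then u a * sin (IZR (a - Z.of_nat N) * q) else 0)).
  - rewrite win_R. unfold sines. apply rsum_ext. intros j _. rewrite INR_IZR_INZ. do 4 f_equal. lia.
  - intros a _. unfold sR. destruct (inR N a); ring.
Qed.
(** The rescaling by bL / bR inside [EA] turns the Fermi function of the right reservoir into that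
    of the left one. *)
Lemma qL_qf (u : Z -> R) M : qL N bL bR (logis bR) (win M) u = qf (logis bL) (fun j => u (- (Z.of_nat N + Z.of_nat j))%Z) (S M - N).
Proof.
  unfold qL, qf. f_equal. apply RIext; [pose proof PI_RGT_0; lra|]. intros q _. req. f_equal.
  - unfold logis. do 3 f_equal. field. lra.
  - f_equal. rewrite (rsum_ext _ (fun a => if inL N a then u a * sin (IZR (- a - Z.of_nat N) * q) else 0)).
    + rewrite win_L. unfold sines. apply rsum_ext. intros j _. rewrite INR_IZR_INZ. do 4 f_equal. lia.
    + intros a _. unfold sL. destruct (inL N a); ring.
Qed.

(** [halfline] is applied to each reservoir with the wall at distance N, and local decay empties the
    sample. The time threshold depends only on [v], [n] and [eps]; the window size also depends on
    t. *)
Lemma ac_bound eps : 0 < eps -> exists T, 0 < T /\ forall t, T <= t -> exists M0, forall M, (M0 <= M)%nat ->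
  (qr N bL bR) (win M) (fun a => fst (phiac t v n a)) + qr N bL bR (win M) (fun a => snd (phiac t v n a)) <= IR v n + IL v n + eps.
Proof.
  intros He. set (c := INR N).
  destruct (halfline (logis bR) (ampR c v n) (ampR' c v n) (cstv v n) (logis_cont bR) (logis_sq_approx bR ltac:(lra))
     (ampR_CC2 _ _ _) (ampR'_CC2 _ _ _) ltac:(apply sbound_csum; intros; now apply fAp_bound) ltac:(apply sbound_csum; intros; now apply fAm_bound) (eps / 4) ltac:(lra)) as (T1 & P1 & H1).
  destruct (halfline (logis bL) (ampL c v n) (ampL' c v n) (cstv v n) (logis_cont bL) (logis_sq_approx bL ltac:(lra))
     (ampL_CC2 _ _ _) (ampL'_CC2 _ _ _) ltac:(apply (ampL_le v n (fBp kappa)); intros; now apply fBp_bound) ltac:(apply (ampL_le v n (fBm kappa)); intros; now apply fBm_bound) (eps / 4) ltac:(lra)) as (T2 & P2 & H2).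
  destruct (phiac_decay_list (win N) (eps / 4) ltac:(lra)) as (T3 & P3 & H3).
  exists (T1 + T2 + T3). split; [lra|]. intros t Ht. specialize (H3 t ltac:(lra)).
  destruct (H1 t ltac:(lra)) as [J1 HJ1]. destruct (H2 t ltac:(lra)) as [J2 HJ2].
  exists (N + J1 + J2)%nat. intros M HM. specialize (HJ1 (M - N)%nat ltac:(lia)). specialize (HJ2 (S M - N)%nat ltac:(lia)).
  rewrite !qr_eq by (auto; apply win_NoDup). rewrite !qR_qf, !qL_qf.
  assert (IRe : / (2 * PI) * RInt (fun k => logis bR (cos k) * Cn2 (ampR c v n k)) 0 PI = IR v n).
  { unfold IR. f_equal. apply RIext; [pose proof PI_RGT_0; lra|]. intros k _. req. now rewrite ampR_shift. }
  assert (ILe : / (2 * PI) * RInt (fun k => logis bL (cos k) * Cn2 (ampL c v n k)) 0 PI = IL v n).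
  { unfold IL. f_equal. apply RIext; [pose proof PI_RGT_0; lra|]. intros k _. req. now rewrite ampL_shift. }
  rewrite IRe in HJ1. rewrite ILe in HJ2.
  assert (ex : forall p : C -> R, forall J, qf (logis bR) (fun j => p (phiac t v n (Z.of_nat N + Z.of_nat j)%Z)) J = qf (logis bR) (fun j => p (wave t (ampR c v n) (ampR' c v n) j)) J).
  { intros p J. unfold qf, sines. f_equal. apply RIext; [pose proof PI_RGT_0; lra|]. intros q _. req. do 2 f_equal. apply rsum_ext. intros; now rewrite phiac_right. }
  assert (ex' : forall p : C -> R, forall J, qf (logis bL) (fun j => p (phiac t v n (- (Z.of_nat N + Z.of_nat j))%Z)) J = qf (logis bL) (fun j => p (wave t (ampL c v n) (ampL' c v n) j)) J).
  { intros p J. unfold qf, sines. f_equal. apply RIext; [pose proof PI_RGT_0; lra|]. intros q _. req. do 2 f_equal. apply rsum_ext. intros j Hj. apply in_seq in Hj. now rewrite phiac_left by lia. }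
  rewrite (ex fst), (ex snd), (ex' fst), (ex' snd).
  assert (HS : qS N (logis bR) (win M) (fun a => fst (phiac t v n a)) + qS N (logis bR) (win M) (fun a => snd (phiac t v n a)) <= eps / 4).
  { unfold qS. rewrite <- Rmult_plus_distr_l.
    rewrite (win_S N (fun a => fst (phiac t v n a) ^ 2)), (win_S N (fun a => snd (phiac t v n a) ^ 2)) by lia. rewrite <- rsum_plus.
    pose proof (logis_pos bR 0). pose proof (logis_lt1 bR 0).
    assert (0 <= rsum (fun a => Cn2 (phiac t v n a)) (win N)) by (apply rsum_pos; intros; apply Cn2_pos).
    apply Rle_trans with (1 * rsum (fun a => Cn2 (phiac t v n a)) (win N)); [|lra].
    apply Rmult_le_compat; [lra | | lra | ].
    - apply rsum_pos. intros a _. destruct (_ || _)%bool; [lra|]. pose proof (Cn2_pos (phiac t v n a)). unfold Cn2 in *. lra.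
    - apply rsum_le. intros a _. destruct (_ || _)%bool; [pose proof (Cn2_pos (phiac t v n a)); lra|]. unfold Cn2. lra. }
  lra.
Qed.

Lemma z0_win M : rsum (fun a => z0 kappa ^ Z.abs_nat a) (win M) <= 2 / (1 - z0 kappa).
Proof.
  pose proof (z0_pos kappa hk) as zp. pose proof (z0_lt1 kappa hk) as zl.
  assert (H : rsum (fun a => z0 kappa ^ Z.abs_nat a) (win M) <= 2 / (1 - z0 kappa) * (1 - z0 kappa ^ S M)).
  { induction M as [|M IH].
    - unfold rsum; simpl. field_simplify; lra.
    - cbn [win]. rewrite !rsum_cons. replace (Z.abs_nat (Z.of_nat (S M))) with (S M) by lia.
      replace (Z.abs_nat (- Z.of_nat (S M) - 1)) with (S (S M)) by lia.
      assert (0 < z0 kappa ^ S M) by (apply pow_lt; lra). change (z0 kappa ^ S (S M)) with (z0 kappa * z0 kappa ^ S M) in *.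
      set (X := z0 kappa ^ S M) in *.
      replace (2 / (1 - z0 kappa) * (1 - z0 kappa * X)) with (2 / (1 - z0 kappa) * (1 - X) + 2 * X) by (field; lra). nra. }
  eapply Rle_trans; [exact H|]. assert (0 < z0 kappa ^ S M) by (apply pow_lt; lra).
  rewrite <- (Rmult_1_r (2 / (1 - z0 kappa))) at 2. apply Rmult_le_compat_l; [|lra]. apply Rlt_le, Rdiv_lt_0_compat; lra.
Qed.
Lemma psi_l2 M : rsum (fun a => psi kappa a ^ 2) (win M) <= 2 / (1 - z0 kappa).
Proof.
  eapply Rle_trans; [|apply (z0_win M)]. apply rsum_le. intros a _.
  pose proof (z0_pos kappa hk) as zp. pose proof (z0_lt1 kappa hk) as zl. unfold psi. rewrite Rpow_mult_distr, pow2_sqrt.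
  2:{ apply Rlt_le, Rdiv_lt_0_compat; auto. apply En_pos. }
  assert (kappa / E <= 1). { apply Rle_div_l; [apply En_pos|]. pose proof (En_gt kappa hk). lra. }
  assert (0 < kappa / E) by (apply Rdiv_lt_0_compat; auto; apply En_pos).
  assert (0 < z0 kappa ^ Z.abs_nat a <= 1). { split; [apply pow_lt; lra|]. rewrite <- (pow1 (Z.abs_nat a)). apply pow_incr. lra. }
  set (X := z0 kappa ^ Z.abs_nat a) in *. assert (X ^ 2 <= X) by nra. nra.
Qed.

(* At late times the continuous-spectrum part of the form splits into the contributions of the two
   reservoirs; the bound state only sees the overlap with [(psi kappa)]. *)
Lemma main_form d eps : 0 < d -> 0 < eps -> exists T, 0 < T /\ forall t, T <= t ->
  fst (qform (S_ t) v n) <= (1 + d) * (IR v n + IL v n) + (1 + / d) * (2 / (1 - z0 kappa)) * Cn2 (psiv v n) + eps.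
Proof.
  intros Hd He. assert (Hi : 0 < / d) by now apply Rinv_0_lt_compat.
  destruct (ac_bound (eps / (1 + d))) as (T & T0 & HT); [apply Rdiv_lt_0_compat; lra|].
  exists T. split; auto. intros t Ht. destruct (HT t Ht) as [M0 HM]. apply qform_le; auto. exists M0. intros M HMM. specialize (HM M HMM).
  pose proof (win_NoDup M) as ND. set (z := (cis (t * E) * psiv v n)%C).
  assert (Hz : Cn2 z = Cn2 (psiv v n)) by (unfold z; rewrite Cn2_mult, Cn2_cis; ring).
  assert (W : forall p : C -> R, (forall a, p (phi kappa x0 t v n a) = p (phiac t v n a) + psi kappa a * p z) ->
    (qr N bL bR) (win M) (fun a => p (phi kappa x0 t v n a)) <= (1 + d) * qr N bL bR (win M) (fun a => p (phiac t v n a)) + (1 + / d) * (p z ^ 2 * (2 / (1 - z0 kappa)))).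
  { intros p Hp. replace (qr N bL bR (win M) (fun a => p (phi kappa x0 t v n a))) with (qr N bL bR (win M) (fun a => p (phiac t v n a) + psi kappa a * p z)).
    2:{ unfold qr, qg. apply rsum_ext; intros a _; apply rsum_ext; intros b _. now rewrite !Hp. }
    eapply Rle_trans; [apply qr_weight with (d := d) (w := fun a => psi kappa a * p z); auto|]. apply Rplus_le_compat_l, Rmult_le_compat_l; [lra|].
    eapply Rle_trans; [now apply qr_le_l2|]. rewrite (rsum_ext _ (fun a => p z ^ 2 * psi kappa a ^ 2)) by (intros; ring).
    rewrite rsum_scal. apply Rmult_le_compat_l; [apply pow2_ge_0 | apply psi_l2]. }
  pose proof (W fst) as W1. pose proof (W snd) as W2.
  specialize (W1 ltac:(intros a; rewrite phi_split; fold z; simpl; ring)). specialize (W2 ltac:(intros a; rewrite phi_split; fold z; simpl; ring)).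
  rewrite <- Hz. unfold Cn2.
  apply (Rmult_le_compat_l (1 + d)) in HM; [|lra].
  replace ((1 + d) * (IR v n + IL v n + eps / (1 + d))) with ((1 + d) * (IR v n + IL v n) + eps) in HM by (field; lra). lra.
Qed.
End Supp.
End MainForm.

(** * Fourier inversion *)

(** The Fejer kernel multiplied by n: away from cos v = 1 it equals (1 - cos (n v)) / (1 - cos
    v). *)
Definition fejer (n : nat) (v : R) : R := INR n + rsum (fun m => 2 * (INR n - INR m) * cos (INR m * v)) (seq 1 n).
Definition dirichlet (n : nat) (v : R) : R := 1 + rsum (fun m => 2 * cos (INR m * v)) (seq 1 n).

Lemma fejer_S n v : fejer (S n) v = fejer n v + dirichlet n v.
Proof.
  unfold fejer, dirichlet. rewrite rsum_seq_S.
  rewrite (rsum_ext (fun m => 2 * (INR (S n) - INR m) * cos (INR m * v)) (fun m => 2 * (INR n - INR m) * cos (INR m * v) + 2 * cos (INR m * v)))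
    by (intros; rewrite S_INR; ring).
  rewrite rsum_plus, S_INR. ring.
Qed.
Lemma dirichlet_S n v : dirichlet (S n) v = dirichlet n v + 2 * cos (INR (S n) * v).
Proof. unfold dirichlet. rewrite rsum_seq_S. ring. Qed.
Lemma dirichlet_id n v : (1 - cos v) * dirichlet n v = cos (INR n * v) - cos (INR (S n) * v).
Proof.
  induction n as [|n IH].
  - unfold dirichlet, rsum; simpl. rewrite Rmult_0_l, Rmult_1_l, cos_0. ring.
  - rewrite dirichlet_S, Rmult_plus_distr_l, IH, (S_INR (S n)).
    replace ((INR (S n) + 1) * v) with (INR (S n) * v + v) by ring. replace (INR n * v) with (INR (S n) * v - v) by (rewrite S_INR; ring).
    rewrite cos_plus, cos_minus. ring.
Qed.
Lemma fejer_id n v : (1 - cos v) * fejer n v = 1 - cos (INR n * v).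
Proof.
  induction n as [|n IH].
  - unfold fejer, rsum; simpl. rewrite Rmult_0_l, cos_0. ring.
  - rewrite fejer_S, Rmult_plus_distr_l, IH, dirichlet_id. ring.
Qed.
Lemma fejer_pos n v : 0 <= fejer n v.
Proof.
  destruct (Req_dec (cos v) 1) as [Hc|Hc].
  - assert (Hs : sin v = 0). { pose proof (sin2_cos2 v) as H. unfold Rsqr in H. rewrite Hc in H. nra. }
    assert (Hm : forall m, cos (INR m * v) = 1).
    { induction m as [|m IH]; [simpl; now rewrite Rmult_0_l, cos_0|]. rewrite S_INR, Rmult_plus_distr_r, Rmult_1_l, cos_plus, IH, Hc, Hs. ring. }
    unfold fejer. apply Rplus_le_le_0_compat; [apply pos_INR|]. apply rsum_pos. intros m Hi. apply in_seq in Hi. rewrite Hm.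
    assert (INR m <= INR n) by (apply le_INR; lia). lra.
  - pose proof (COS_bound v). pose proof (COS_bound (INR n * v)). pose proof (fejer_id n v).
    assert (E : fejer n v = (1 - cos (INR n * v)) / (1 - cos v)) by (apply Rmult_eq_reg_l with (1 - cos v); [rewrite fejer_id; field|]; lra).
    rewrite E. apply Rmult_le_pos; [lra|]. left. apply Rinv_0_lt_compat. lra.
Qed.

Lemma lin_cont (f : R -> R) a b : gcont f -> gcont (fun u => f (a + b * u)).
Proof.
  intros cf. apply (gcont_comp f (fun u => a + b * u)); auto. intros u. apply cplus; [apply cconst|]. apply cmult; [apply cconst | apply continuous_id].
Qed.
Lemma fejer_cont n : gcont (fejer n).
Proof.
  intros v. apply (cplus (fun _ => INR n)); [apply cconst|]. apply rsum_cont. intros m _. apply cmult; [apply cconst|].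
  apply (ccomp cos (fun v => INR m * v)); [|apply ccos]. apply cmult; [apply cconst | apply continuous_id].
Qed.

(* [tr m k] stands for [cos (m k)] when [s = 1] and for [sin (m k)] when [s = -1]. *)
Section FejerMean.
Variables (s : R) (tr : nat -> R -> R).
Hypothesis (s2 : s * s = 1).
Hypothesis (trE : forall m k u, cos (INR m * (k + - 1 * u)) + s * cos (INR m * (k + 1 * u)) = 2 * tr m k * tr m u).
Hypothesis (trb : forall m k, Rabs (tr m k) <= 1) (trc : forall m, gcont (tr m)).

Definition fcoef (a : R -> R) (m : nat) : R := 2 / PI * RInt (fun u => a u * tr m u) 0 PI.

Lemma fejer_mean a n k : gcont a ->
  RInt (fun u => a u * (fejer n (k + - 1 * u) + s * fejer n (k + 1 * u))) 0 PI
  = PI * (INR n * (fcoef a 0 * tr 0 k) + rsum (fun m => 2 * (INR n - INR m) * (fcoef a m * tr m k)) (seq 1 n)).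
Proof.
  intros ca. pose proof PI_RGT_0. unfold fcoef.
  assert (c1 : forall m, gcont (fun u => a u * tr m u)) by (intros m u; apply cmult; [apply ca | apply trc]).
  rewrite (RIext _ (fun u => (2 * INR n * tr 0 k) * (a u * tr 0 u) + rsum (fun m => (2 * (INR n - INR m) * 2 * tr m k) * (a u * tr m u)) (seq 1 n))); [|lra|].
  - rewrite RIplus.
    2:{ apply (fscal _ _ (c1 0%nat)). }
    2:{ intros u. apply rsum_cont. intros m _. apply (fscal _ _ (c1 m)). }
    rewrite RIscal by apply c1. rewrite RIrsum by (intros m; apply (fscal _ _ (c1 m))).
    rewrite Rmult_plus_distr_l, <- rsum_scal. req. f_equal; [field; lra|]. apply rsum_ext. intros m _. rewrite RIscal by apply c1. fld. lra.
  - intros u _. pose proof (trE 0 k u) as E0. simpl in E0. rewrite !Rmult_0_l, cos_0 in E0.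
    unfold fejer. replace (INR n + rsum (fun m => 2 * (INR n - INR m) * cos (INR m * (k + - 1 * u))) (seq 1 n) +
      s * (INR n + rsum (fun m => 2 * (INR n - INR m) * cos (INR m * (k + 1 * u))) (seq 1 n)))
      with (INR n * (1 + s * 1) + (rsum (fun m => 2 * (INR n - INR m) * cos (INR m * (k + - 1 * u))) (seq 1 n) +
      s * rsum (fun m => 2 * (INR n - INR m) * cos (INR m * (k + 1 * u))) (seq 1 n))) by ring.
    rewrite E0, <- rsum_scal, <- rsum_plus.
    rewrite (rsum_ext _ (fun m => 2 * (INR n - INR m) * (2 * tr m k * tr m u))) by (intros m _; rewrite <- trE; ring).
    rewrite Rmult_plus_distr_l, <- rsum_scal. f_equal; [ring|]. apply rsum_ext; intros; ring.
Qed.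
End FejerMean.

Lemma cos_tr m k u : cos (INR m * (k + - 1 * u)) + 1 * cos (INR m * (k + 1 * u)) = 2 * cos (INR m * k) * cos (INR m * u).
Proof.
  replace (INR m * (k + - 1 * u)) with (INR m * k - INR m * u) by ring. replace (INR m * (k + 1 * u)) with (INR m * k + INR m * u) by ring.
  rewrite cos_plus, cos_minus. ring.
Qed.
Lemma sin_tr m k u : cos (INR m * (k + - 1 * u)) + - 1 * cos (INR m * (k + 1 * u)) = 2 * sin (INR m * k) * sin (INR m * u).
Proof.
  replace (INR m * (k + - 1 * u)) with (INR m * k - INR m * u) by ring. replace (INR m * (k + 1 * u)) with (INR m * k + INR m * u) by ring.
  rewrite cos_plus, cos_minus. ring.
Qed.
Lemma cos_lin_gcont m : gcont (fun k => cos (INR m * k)).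
Proof. apply (gcont_comp cos (fun k => INR m * k)); [exact ccos|]. intros u. apply cmult; [apply cconst | apply continuous_id]. Qed.
Lemma sin_lin_gcont m : gcont (fun k => sin (INR m * k)).
Proof. apply (gcont_comp sin (fun k => INR m * k)); [exact csin|]. intros u. apply cmult; [apply cconst | apply continuous_id]. Qed.

Lemma fejer_mass n k : RInt (fun u => fejer n (k + - 1 * u) + fejer n (k + 1 * u)) 0 PI = 2 * PI * INR n.
Proof.
  pose proof PI_RGT_0.
  pose proof (fejer_mean 1 (fun m k => cos (INR m * k)) cos_tr cos_lin_gcont (fun _ => 1) n k ltac:(intros u; apply cconst)) as H1.
  rewrite (RIext _ (fun u => fejer n (k + - 1 * u) + fejer n (k + 1 * u))) in H1 by (try lra; intros; ring).
  rewrite H1. unfold fcoef.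
  assert (Z : forall m, RInt (fun u => 1 * cos (INR m * u)) 0 PI = if Z.eq_dec (Z.of_nat m) 0 then PI else 0).
  { intros m. rewrite <- RI_cos_PI. apply RIext; [lra|]. intros u _. rewrite INR_IZR_INZ. rng. }
  rewrite rsum_zero.
  - rewrite Z. simpl. rewrite Rmult_0_l, cos_0. fld. lra.
  - intros m Hm. apply in_seq in Hm. rewrite Z. destruct (Z.eq_dec _ _); [lia|]. ring.
Qed.

(** Write |g| <= e + g^2 / e. The hypothesis and [fejer_id] bound g^2 times the kernel by 2 B,
    uniformly in n, so no neighbourhood of the peak has to be split off. *)
Lemma fejer_small (g : R -> R) n a b B e : gcont g -> 0 < e -> 0 <= B -> (b = 1 \/ b = -1) ->
  (forall u, 0 <= u <= PI -> g u ^ 2 <= B * (1 - cos (a + b * u))) ->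
  Rabs (RInt (fun u => g u * fejer n (a + b * u)) 0 PI) <= e * RInt (fun u => fejer n (a + b * u)) 0 PI + 2 * B / e * PI.
Proof.
  intros cg He HB Hb Hg. pose proof PI_RGT_0. assert (cf := lin_cont (fejer n) a b (fejer_cont n)).
  assert (cgf : gcont (fun u => g u * fejer n (a + b * u))) by (intros u; apply cmult; [apply cg | apply cf]).
  eapply Rle_trans; [apply RIabs; [lra | exact cgf]|].
  rewrite <- RIscal by apply cf. replace (2 * B / e * PI) with (RInt (fun _ => 2 * B / e) 0 PI) by (rewrite RIconst; rng).
  rewrite <- RIplus; [|apply (fscal _ _ cf) | intros u; apply cconst].
  apply RIle; [lra| | |].
  - intros u. apply cabs, cgf.
  - intros u. apply cplus; [apply (fscal _ _ cf) | apply cconst].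
  - intros u Hu. rewrite Rabs_mult, (Rabs_pos_eq (fejer _ _)) by apply fejer_pos.
    pose proof (fejer_pos n (a + b * u)) as fp. pose proof (fejer_id n (a + b * u)) as fi. pose proof (COS_bound (INR n * (a + b * u))) as cb.
    assert (Ha : Rabs (g u) <= e + g u ^ 2 / e).
    { apply Rmult_le_reg_r with e; auto. replace ((e + g u ^ 2 / e) * e) with (e ^ 2 + g u ^ 2) by (field; lra).
      rewrite <- (pow2_abs (g u)). pose proof (Rabs_pos (g u)). nra. }
    apply Rle_trans with ((e + g u ^ 2 / e) * fejer n (a + b * u)); [now apply Rmult_le_compat_r|].
    rewrite Rmult_plus_distr_r. apply Rplus_le_compat_l.
    apply Rle_trans with ((B * (1 - cos (a + b * u))) / e * fejer n (a + b * u)).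
    { apply Rmult_le_compat_r; auto. apply Rmult_le_compat_r; [left; now apply Rinv_0_lt_compat|]. apply Hg. lra. }
    replace (B * (1 - cos (a + b * u)) / e * fejer n (a + b * u)) with (B / e * ((1 - cos (a + b * u)) * fejer n (a + b * u))) by (field; lra).
    rewrite fi. replace (2 * B / e) with (B / e * 2) by (field; lra). apply Rmult_le_compat_l; [|lra].
    apply Rmult_le_pos; auto. left; now apply Rinv_0_lt_compat.
Qed.

Lemma sum_inv_sq M n : (1 <= M)%nat -> rsum (fun m => / INR m ^ 2) (seq (S M) n) <= / INR M - / INR (M + n).
Proof.
  intros HM. revert M HM. induction n as [|n IH]; intros M HM.
  - unfold rsum; simpl. rewrite Nat.add_0_r. lra.
  - cbn [seq]. rewrite rsum_cons. specialize (IH (S M) ltac:(lia)). replace (M + S n)%nat with (S M + n)%nat by lia.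
    assert (1 <= INR M) by (apply (le_INR 1); lia).
    assert (/ INR (S M) ^ 2 <= / INR M - / INR (S M)).
    { rewrite S_INR. replace (/ INR M - / (INR M + 1)) with (/ (INR M * (INR M + 1))) by (field; lra). apply Rinv_le_contravar; nra. }
    lra.
Qed.

Section FejerLimit.
Variables (s : R) (tr : nat -> R -> R).
Hypothesis (s2 : s * s = 1).
Hypothesis (trE : forall m k u, cos (INR m * (k + - 1 * u)) + s * cos (INR m * (k + 1 * u)) = 2 * tr m k * tr m u).
Hypothesis (trb : forall m k, Rabs (tr m k) <= 1) (trc : forall m, gcont (tr m)).
Notation fcoef := (fcoef tr).

(** The sign [s] selects the even or odd extension of [a] across 0; the two hypotheses compare a(u)
    with the extension at k and at - k, in terms of chords on the circle. *)
Lemma fejer_conv a k B : gcont a -> 0 <= B ->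
  (forall u, 0 <= u <= PI -> (a u - a k) ^ 2 <= B * (1 - cos (k + - 1 * u))) ->
  (forall u, 0 <= u <= PI -> (a u - s * a k) ^ 2 <= B * (1 - cos (k + 1 * u))) ->
  forall e, 0 < e -> exists n0, forall n, (n0 <= n)%nat ->
  Rabs ((fcoef a 0 * tr 0 k) / 2 + rsum (fun m => (1 - INR m / INR n) * (fcoef a m * tr m k)) (seq 1 n) - a k) <= e.
Proof.
  intros ca HB H1 H2 e He. pose proof PI_RGT_0 as HP. set (e1 := e / 2). assert (e1p : 0 < e1) by (unfold e1; lra).
  destruct (INR_unbounded (2 * B / e1 / e1 + 1)) as [n0 Hn0].
  exists (S n0). intros n Hn. assert (1 <= INR n) by (apply (le_INR 1); lia).
  assert (INR n0 <= INR n) by (apply le_INR; lia).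
  set (X := fcoef a 0 * tr 0 k). set (Sn := rsum _ _).
  pose proof (fejer_mean s tr trE trc a n k ca) as Hm. fold X in Hm.
  assert (ES : rsum (fun m => 2 * (INR n - INR m) * (fcoef a m * tr m k)) (seq 1 n) = 2 * INR n * Sn).
  { unfold Sn. rewrite <- rsum_scal. apply rsum_ext; intros. field. lra. }
  rewrite ES in Hm.
  pose proof (lin_cont (fejer n) k (-1) (fejer_cont n)) as cm. pose proof (lin_cont (fejer n) k 1 (fejer_cont n)) as cp.
  assert (cg1 : gcont (fun u => a u - a k)) by (intros u; apply cminus; [apply ca | apply cconst]).
  assert (cg2 : gcont (fun u => a u - s * a k)) by (intros u; apply cminus; [apply ca | apply cconst]).
  pose proof (fejer_small _ n k (-1) B e1 cg1 e1p HB (or_intror eq_refl) H1) as F1.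
  pose proof (fejer_small _ n k 1 B e1 cg2 e1p HB (or_introl eq_refl) H2) as F2.
  pose proof (fejer_mass n k) as Mass. rewrite RIplus in Mass by auto.
  assert (Eq : 2 * PI * INR n * (X / 2 + Sn - a k) = RInt (fun u => (a u - a k) * fejer n (k + -1 * u)) 0 PI + s * RInt (fun u => (a u - s * a k) * fejer n (k + 1 * u)) 0 PI).
  { rewrite <- RIscal by (intros u; apply cmult; [apply cg2 | apply cp]).
    rewrite <- RIplus; [|intros u; apply cmult; [apply cg1 | apply cm] | intros u; apply cmult; [apply cconst|apply cmult; [apply cg2 | apply cp]]].
    transitivity (RInt (fun u => a u * (fejer n (k + - 1 * u) + s * fejer n (k + 1 * u))) 0 PI - a k * (RInt (fun u => fejer n (k + -1 * u)) 0 PI + RInt (fun u => fejer n (k + 1 * u)) 0 PI)).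
    - rewrite Hm, Mass. fld.
    - rewrite <- RIplus, <- RIscal by (auto; intros u; apply cplus; auto).
      rewrite <- RIminus; [apply RIext; [lra|]; intros u _ | | ].
      + replace (s * ((a u - s * a k) * fejer n (k + 1 * u))) with (s * a u * fejer n (k + 1 * u) - (s * s) * a k * fejer n (k + 1 * u)) by ring.
        rewrite s2. rng.
      + intros u. apply cmult; [apply ca|]. apply cplus; [apply cm|]. apply cmult; [apply cconst | apply cp].
      + intros u. apply cmult; [apply cconst|]. apply cplus; [apply cm | apply cp]. }
  assert (As : Rabs s = 1). { unfold Rabs. destruct (Rcase_abs s); nra. }
  apply Rmult_le_reg_l with (2 * PI * INR n). { apply Rmult_lt_0_compat; lra. }
  rewrite <- (Rabs_pos_eq (2 * PI * INR n)) at 1 by (apply Rmult_le_pos; lra). rewrite <- Rabs_mult, Eq.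
  eapply Rle_trans; [apply Rabs_triang|]. rewrite Rabs_mult, As, Rmult_1_l.
  eapply Rle_trans; [apply Rplus_le_compat; [exact F1 | exact F2]|].
  set (I1 := RInt (fun u => fejer n (k + -1 * u)) 0 PI) in *. set (I2 := RInt (fun u => fejer n (k + 1 * u)) 0 PI) in *.
  replace (e1 * I1 + 2 * B / e1 * PI + (e1 * I2 + 2 * B / e1 * PI)) with (e1 * (I1 + I2) + 4 * B / e1 * PI) by (fld; lra).
  rewrite Mass. assert (2 * B / e1 <= e1 * INR n).
  { replace (2 * B / e1) with (e1 * (2 * B / e1 / e1)) by (field; lra). apply Rmult_le_compat_l; lra. }
  unfold e1 in *. replace (4 * B / (e / 2) * PI) with (2 * PI * (2 * B / (e / 2))) by (field; lra).
  assert (2 * PI * (2 * B / (e / 2)) <= 2 * PI * (e / 2 * INR n)) by (apply Rmult_le_compat_l; lra). lra.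
Qed.

(** The Cesaro means converge to a(k). For large n they differ from the M-th partial sum essentially
    by a damped tail, at most Ca times the sum of 1 / m^2 over m > M, that is Ca / M. *)
Lemma inversion a k B Ca M : gcont a -> 0 <= B ->
  (forall u, 0 <= u <= PI -> (a u - a k) ^ 2 <= B * (1 - cos (k + - 1 * u))) ->
  (forall u, 0 <= u <= PI -> (a u - s * a k) ^ 2 <= B * (1 - cos (k + 1 * u))) ->
  0 <= Ca -> (forall m, (1 <= m)%nat -> Rabs (fcoef a m) <= Ca / INR m ^ 2) -> (1 <= M)%nat ->
  Rabs (a k - fcoef a 0 * tr 0 k / 2 - rsum (fun m => fcoef a m * tr m k) (seq 1 M)) <= Ca / INR M.
Proof.
  intros ca HB H1 H2 HC Hc HM. apply Rle_eps. intros e He.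
  destruct (fejer_conv a k B ca HB H1 H2 (e / 2) ltac:(lra)) as [n0 Hn].
  assert (M1 : 1 <= INR M) by (apply (le_INR 1); lia).
  destruct (INR_unbounded (2 * Ca * INR M / e)) as [n1 Hn1].
  set (n := (M + n0 + n1)%nat). specialize (Hn n ltac:(unfold n; lia)).
  assert (tb : forall m, (1 <= m)%nat -> Rabs (fcoef a m * tr m k) <= Ca / INR m ^ 2).
  { intros m Hm. rewrite Rabs_mult. pose proof (trb m k). pose proof (Hc m Hm). pose proof (Rabs_pos (fcoef a m)). pose proof (Rabs_pos (tr m k)). nra. }
  assert (Nn : INR M <= INR n) by (apply le_INR; unfold n; lia).
  set (X := fcoef a 0 * tr 0 k / 2) in *.
  assert (En : seq 1 n = seq 1 M ++ seq (1 + M) (n0 + n1)) by (rewrite <- seq_app; f_equal; unfold n; lia). rewrite En, rsum_app in Hn.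
  set (A := rsum (fun m => (1 - INR m / INR n) * (fcoef a m * tr m k)) (seq 1 M)) in *.
  set (R2 := rsum (fun m => (1 - INR m / INR n) * (fcoef a m * tr m k)) (seq (1 + M) (n0 + n1))) in *.
  set (G := rsum (fun m => fcoef a m * tr m k) (seq 1 M)).
  assert (B1 : Rabs (G - A) <= e / 2).
  { unfold G, A. rewrite <- rsum_minus. eapply Rle_trans; [apply rsum_abs|].
    apply Rle_trans with (rsum (fun _ => Ca / INR n) (seq 1 M)).
    - apply rsum_le. intros m Hm. apply in_seq in Hm. assert (1 <= INR m) by (apply (le_INR 1); lia).
      replace (fcoef a m * tr m k - (1 - INR m / INR n) * (fcoef a m * tr m k)) with ((INR m / INR n) * (fcoef a m * tr m k)) by (field; lra).
      assert (0 < INR m / INR n) by (apply Rdiv_lt_0_compat; lra).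
      rewrite Rabs_mult, Rabs_pos_eq by lra. pose proof (tb m ltac:(lia)) as T.
      apply Rle_trans with (INR m / INR n * (Ca / INR m ^ 2)); [apply Rmult_le_compat_l; lra|].
      replace (INR m / INR n * (Ca / INR m ^ 2)) with (Ca / INR n * / INR m) by (field; lra).
      assert (/ INR m <= 1) by (rewrite <- Rinv_1; apply Rinv_le_contravar; lra).
      assert (0 <= Ca / INR n) by (apply Rmult_le_pos; auto; left; apply Rinv_0_lt_compat; lra). nra.
    - rewrite rsum_const, length_seq.
      assert (INR n1 <= INR n) by (apply le_INR; unfold n; lia).
      apply Rmult_le_reg_r with (INR n); [lra|]. replace (INR M * (Ca / INR n) * INR n) with (Ca * INR M) by (field; lra).
      assert (2 * Ca * INR M <= e * INR n); [|lra]. apply Rmult_lt_compat_l with (r := e) in Hn1; auto.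
      replace (e * (2 * Ca * INR M / e)) with (2 * Ca * INR M) in Hn1 by (field; lra). nra. }
  assert (B2 : Rabs R2 <= Ca / INR M).
  { unfold R2. eapply Rle_trans; [apply rsum_abs|].
    apply Rle_trans with (rsum (fun m => Ca * / INR m ^ 2) (seq (1 + M) (n0 + n1))).
    - apply rsum_le. intros m Hm. apply in_seq in Hm. rewrite Rabs_mult. pose proof (tb m ltac:(lia)) as T.
      assert (1 <= INR m) by (apply (le_INR 1); lia). assert (INR m <= INR n) by (apply le_INR; unfold n; lia).
      assert (0 <= INR m / INR n <= 1). { split; [apply Rmult_le_pos; [lra|]; left; apply Rinv_0_lt_compat; lra|]. apply Rle_div_l; lra. }
      rewrite Rabs_pos_eq by lra. pose proof (Rabs_pos (fcoef a m * tr m k)). unfold Rdiv in T. nra.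
    - rewrite rsum_scal. apply Rmult_le_compat_l; auto. eapply Rle_trans; [apply (sum_inv_sq M); auto|].
      assert (0 < / INR (M + (n0 + n1))); [|lra]. apply Rinv_0_lt_compat. rewrite plus_INR. pose proof (pos_INR (n0 + n1)). lra. }
  apply Rabs_le_between in Hn. apply Rabs_le_between in B1. apply Rabs_le_between in B2. apply Rabs_le. lra.
Qed.
End FejerLimit.

Lemma logis_mono b x y : 0 <= b -> x <= y -> logis b x <= logis b y.
Proof.
  intros Hb H. unfold logis. apply Rinv_le_contravar; [apply logis_den|]. apply Rplus_le_compat_l, exp_le_compat. nra.
Qed.
Lemma logis_C2 b : C2 (fun k => logis b (cos k)).
Proof. unfold logis. apply (C2_inv (fun k => 1 + exp (- (b * cos k)))); [c2|]. intros k. pose proof (logis_den b (cos k)). lra. Qed.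

Lemma ln_lip m p q : 0 < m -> m <= p -> m <= q -> Rabs (ln p - ln q) <= / m * Rabs (p - q).
Proof.
  intros Hm.
  assert (G : forall p q, m <= p -> m <= q -> ln p - ln q <= / m * Rabs (p - q)).
  { intros p' q' Hp Hq. rewrite <- ln_div by lra. apply Rle_trans with ((p' - q') / q').
    - replace (ln (p' / q')) with (ln (1 + (p' - q') / q')) by (f_equal; field; lra).
      assert (0 < 1 + (p' - q') / q') by (replace (1 + (p' - q') / q') with (p' / q') by (field; lra); apply Rdiv_lt_0_compat; lra).
      pose proof (exp_ineq1_le (ln (1 + (p' - q') / q'))). rewrite exp_ln in H0 by auto. lra.
    - apply Rle_trans with (Rabs (p' - q') / q').
      + apply Rmult_le_compat_r; [left; apply Rinv_0_lt_compat; lra | apply Rle_abs].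
      + unfold Rdiv. rewrite Rmult_comm. apply Rmult_le_compat_r; [apply Rabs_pos | apply Rinv_le_contravar; lra]. }
  intros Hp Hq. apply Rabs_le. pose proof (G p q Hp Hq). pose proof (G q p Hq Hp). rewrite (Rabs_minus_sym q p) in *. lra.
Qed.

(** * The symbol *)

Section Symbols.
Variables (kappa bL bR : R).
Hypothesis (hk : 0 < kappa) (hL : 0 < bL) (hLR : bL <= bR).

Definition fR (k : R) : R := logis bR (cos k).
Definition fL (k : R) : R := logis bL (cos k).
Definition fB (k : R) : R := (1 - sigmaB kappa k) * fR k + sigmaB kappa k * fL k.
Definition lR (k : R) : R := ln (fR k).
Definition lB (k : R) : R := ln (fB k).
(** A common lower bound for f_R, f_L and f_B: the larger of the two inverse temperatures, at the
    bottom of the band. *)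
Definition fmin : R := logis bR (-1).

Lemma sigma_den k : sigmaB kappa k = 1 - kappa ^ 2 * / den kappa k.
Proof. unfold sigmaB. pose proof (den_pos kappa hk k). unfold den in *. field. lra. Qed.
Lemma sigma_01 k : 0 <= sigmaB kappa k <= 1.
Proof. pose proof (Cn2_tau kappa hk k). pose proof (Cn2_rC kappa hk k). pose proof (Cn2_pos (tauC kappa k)). pose proof (Cn2_pos (rC kappa k)). lra. Qed.
Lemma sigma_C2 : C2 (sigmaB kappa).
Proof.
  apply (C2_ext (fun k => 1 - kappa ^ 2 * / den kappa k)); [intros; now rewrite sigma_den|].
  apply (C2_minus (fun _ => 1)); [c2|]. apply (C2_mult (fun _ => kappa ^ 2)); [c2 | now apply iden_C2].
Qed.
Lemma fmin_pos : 0 < fmin. Proof. apply logis_pos. Qed.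
Lemma fR_bd k : fmin <= fR k < 1.
Proof. split; [|apply logis_lt1]. apply logis_mono; [lra|]. pose proof (COS_bound k). lra. Qed.
Lemma fL_bd k : fmin <= fL k < 1.
Proof.
  split; [|apply logis_lt1]. apply Rle_trans with (logis bL (-1)).
  - unfold fmin, logis. apply Rinv_le_contravar; [apply logis_den|]. apply Rplus_le_compat_l, exp_le_compat. lra.
  - apply logis_mono; [lra|]. pose proof (COS_bound k). lra.
Qed.
Lemma fB_bd k : fmin <= fB k < 1.
Proof. pose proof (sigma_01 k). pose proof (fR_bd k). pose proof (fL_bd k). unfold fB. set (s := sigmaB kappa k) in *.
  split; [nra|]. destruct (Rle_dec (fR k) (fL k)); nra. Qed.
Lemma fR_C2 : C2 fR. Proof. apply logis_C2. Qed.
Lemma fB_C2 : C2 fB.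
Proof.
  unfold fB. apply (C2_plus (fun k => (1 - sigmaB kappa k) * fR k) (fun k => sigmaB kappa k * fL k)).
  - apply (C2_mult (fun k => 1 - sigmaB kappa k) fR); [|apply fR_C2]. apply (C2_minus (fun _ => 1) (sigmaB kappa)); [c2 | apply sigma_C2].
  - apply (C2_mult (sigmaB kappa) fL); [apply sigma_C2 | apply logis_C2].
Qed.
Lemma lR_C2 : C2 lR.
Proof. apply C2_ln; [apply fR_C2|]. intros k. pose proof (fR_bd k). pose proof fmin_pos. lra. Qed.
Lemma lB_C2 : C2 lB.
Proof. apply C2_ln; [apply fB_C2|]. intros k. pose proof (fB_bd k). pose proof fmin_pos. lra. Qed.

(** A Lipschitz constant for both logarithms as functions of cos k: the Fermi functions contribute
    bR + bL, the transmission probability 2 / kappa^2, and the logarithm / fmin. *)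
Definition Lc : R := / fmin * (bR + bL + 2 / kappa ^ 2).
Lemma lR_lip u k : Rabs (lR u - lR k) <= Lc * Rabs (cos u - cos k).
Proof.
  pose proof fmin_pos. pose proof (fR_bd u). pose proof (fR_bd k). eapply Rle_trans; [apply (ln_lip fmin); lra|].
  unfold Lc. rewrite Rmult_assoc. apply Rmult_le_compat_l; [left; now apply Rinv_0_lt_compat|].
  eapply Rle_trans; [apply logis_lip; lra|]. apply Rmult_le_compat_r; [apply Rabs_pos|].
  assert (0 < 2 / kappa ^ 2) by (apply Rdiv_lt_0_compat; [lra | apply pow_lt; lra]). lra.
Qed.
Lemma lB_lip u k : Rabs (lB u - lB k) <= Lc * Rabs (cos u - cos k).
Proof.
  pose proof fmin_pos. pose proof (fB_bd u). pose proof (fB_bd k). eapply Rle_trans; [apply (ln_lip fmin); lra|].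
  unfold Lc. rewrite Rmult_assoc. apply Rmult_le_compat_l; [left; now apply Rinv_0_lt_compat|].
  replace (fB u - fB k) with ((1 - sigmaB kappa u) * (fR u - fR k) + sigmaB kappa u * (fL u - fL k) + (fL k - fR k) * (sigmaB kappa u - sigmaB kappa k)) by (unfold fB; ring).
  pose proof (logis_lip bR (cos k) (cos u) ltac:(lra)) as H1'. pose proof (logis_lip bL (cos k) (cos u) ltac:(lra)) as H2'. fold (fR u) (fR k) in H1'. fold (fL u) (fL k) in H2'.
  pose proof (sigma_01 u) as su. pose proof (fR_bd k). pose proof (fL_bd k).
  assert (H3s : Rabs (sigmaB kappa u - sigmaB kappa k) <= 2 / kappa ^ 2 * Rabs (cos u - cos k)).
  { rewrite !sigma_den. pose proof (den_pos kappa hk u) as du. pose proof (den_pos kappa hk k) as dk.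
    assert (k2 : 0 < kappa ^ 2) by (apply pow_lt; lra).
    replace (1 - kappa ^ 2 * / den kappa u - (1 - kappa ^ 2 * / den kappa k)) with ((- (cos u + cos k) * (kappa ^ 2 / (den kappa u * den kappa k))) * (cos u - cos k)).
    2:{ assert (T : den kappa u - den kappa k = - (cos u + cos k) * (cos u - cos k)).
        { unfold den. pose proof (sin2_cos2 u). pose proof (sin2_cos2 k). unfold Rsqr in *. nra. }
        replace (- (cos u + cos k) * (kappa ^ 2 / (den kappa u * den kappa k)) * (cos u - cos k)) with
          (kappa ^ 2 / (den kappa u * den kappa k) * (- (cos u + cos k) * (cos u - cos k))) by ring. rewrite <- T. field. lra. }
    rewrite Rabs_mult. apply Rmult_le_compat_r; [apply Rabs_pos|]. rewrite Rabs_mult. unfold Rdiv at 2.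
    apply Rmult_le_compat; try apply Rabs_pos.
    - pose proof (COS_bound u). pose proof (COS_bound k). apply Rabs_le. lra.
    - assert (kappa ^ 2 <= den kappa u) by (unfold den; pose proof (pow2_ge_0 (sin u)); lra).
      assert (kappa ^ 2 <= den kappa k) by (unfold den; pose proof (pow2_ge_0 (sin k)); lra).
      assert (0 < den kappa u * den kappa k) by (apply Rmult_lt_0_compat; auto).
      rewrite Rabs_pos_eq by (apply Rlt_le, Rdiv_lt_0_compat; auto). apply Rle_div_l; auto.
      apply Rmult_le_reg_l with (kappa ^ 2); [lra|].
      replace (kappa ^ 2 * (/ kappa ^ 2 * (den kappa u * den kappa k))) with (den kappa u * den kappa k) by (field; lra). apply Rmult_le_compat; lra. }
  eapply Rle_trans; [apply Rabs_triang|]. eapply Rle_trans; [apply Rplus_le_compat_r, Rabs_triang|]. rewrite !Rabs_mult.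
  rewrite (Rabs_pos_eq (1 - _)), (Rabs_pos_eq (sigmaB kappa u)) by lra.
  assert (Rabs (fL k - fR k) <= 1) by (apply Rabs_le; lra).
  pose proof (Rabs_pos (fR u - fR k)). pose proof (Rabs_pos (fL u - fL k)). pose proof (Rabs_pos (sigmaB kappa u - sigmaB kappa k)).
  assert ((1 - sigmaB kappa u) * Rabs (fR u - fR k) <= Rabs (fR u - fR k)) by nra.
  assert (sigmaB kappa u * Rabs (fL u - fL k) <= Rabs (fL u - fL k)) by nra.
  assert (Rabs (fL k - fR k) * Rabs (sigmaB kappa u - sigmaB kappa k) <= Rabs (sigmaB kappa u - sigmaB kappa k)) by nra.
  rewrite !Rmult_plus_distr_r. lra.
Qed.
Lemma Lc_pos : 0 < Lc.
Proof.
  apply Rmult_lt_0_compat; [apply Rinv_0_lt_compat, fmin_pos|].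
  assert (0 < 2 / kappa ^ 2) by (apply Rdiv_lt_0_compat; [lra | apply pow_lt; lra]). lra.
Qed.
(** The transmission probability vanishes at the band edges, so f_B = f_R there. The odd part of the
    logarithmic symbol therefore vanishes at 0 and PI, as [ibp_sin] requires. *)
Lemma ldiff_bd k : 0 <= k <= PI -> Rabs (lR k - lB k) <= Lc * sin k.
Proof.
  intros Hk. assert (s0 : 0 <= sin k) by (apply sin_ge_0; lra). pose proof (SIN_bound k).
  pose proof fmin_pos. pose proof (fB_bd k). pose proof (fR_bd k). pose proof (fL_bd k). eapply Rle_trans; [apply (ln_lip fmin); lra|].
  unfold Lc. rewrite Rmult_assoc. apply Rmult_le_compat_l; [left; now apply Rinv_0_lt_compat|].
  replace (fR k - fB k) with (sigmaB kappa k * (fR k - fL k)) by (unfold fB; ring).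
  rewrite Rabs_mult. pose proof (sigma_01 k). rewrite Rabs_pos_eq by lra.
  assert (Rabs (fR k - fL k) <= 1) by (apply Rabs_le; lra).
  assert (0 < kappa ^ 2) by (apply pow_lt; lra).
  assert (sigmaB kappa k <= 2 / kappa ^ 2 * sin k).
  { unfold sigmaB. pose proof (den_pos kappa hk k) as dp. unfold den in dp. apply Rle_div_l; [lra|].
    replace (2 / kappa ^ 2 * sin k * (sin k ^ 2 + kappa ^ 2)) with (2 * sin k + 2 * sin k ^ 3 / kappa ^ 2) by (field; lra).
    assert (0 <= 2 * sin k ^ 3 / kappa ^ 2). { apply Rmult_le_pos; [|left; now apply Rinv_0_lt_compat]. pose proof (pow_le _ 3 s0). lra. } nra. }
  pose proof (Rabs_pos (fR k - fL k)). nra.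
Qed.

Definition c0 : R := / (2 * PI) * RInt (fun k => lR k + lB k) 0 PI.
Definition alpha (m : nat) : R := / PI * RInt (fun k => (lR k + lB k) * cos (INR m * k)) 0 PI.
Definition beta (m : nat) : R := / PI * RInt (fun k => (lR k - lB k) * sin (INR m * k)) 0 PI.

(** The difference of cosines is at most the chord between e^{iu} and e^{ik}, and equally at most
    the chord between e^{iu} and e^{-ik}. *)
Lemma quarter u k x L : 0 <= L -> Rabs x <= L * Rabs (cos u - cos k) ->
  x ^ 2 <= 2 * L ^ 2 * (1 - cos (k + - 1 * u)) /\ x ^ 2 <= 2 * L ^ 2 * (1 - cos (k + 1 * u)).
Proof.
  intros HL Hx. replace (k + - 1 * u) with (k - u) by ring. replace (k + 1 * u) with (k + u) by ring. rewrite cos_minus, cos_plus.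
  assert (x ^ 2 <= L ^ 2 * (cos u - cos k) ^ 2).
  { rewrite <- (pow2_abs x), <- (pow2_abs (cos u - cos k)), <- Rpow_mult_distr. apply pow_incr. split; [apply Rabs_pos | auto]. }
  pose proof (sin2_cos2 u). pose proof (sin2_cos2 k). unfold Rsqr in *.
  assert ((cos u - cos k) ^ 2 <= 2 * (1 - (cos k * cos u + sin k * sin u))) by (pose proof (pow2_ge_0 (sin u - sin k)); nra).
  assert ((cos u - cos k) ^ 2 <= 2 * (1 - (cos k * cos u - sin k * sin u))) by (pose proof (pow2_ge_0 (sin u + sin k)); nra).
  pose proof (pow2_ge_0 L). split; nra.
Qed.

(** (lR + lB) / 2 is the even part of the logarithmic symbol and gets a cosine series, (lR - lB) / 2
    is the odd part and gets a sine series. Their sum and difference give the symbol on the two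
    halves of the circle, each with uniform error O(1 / M). *)
Lemma expansion : exists Ca, 0 < Ca /\
  (forall m, (1 <= m)%nat -> Rabs (alpha m) <= Ca / INR m ^ 2 /\ Rabs (beta m) <= Ca / INR m ^ 2) /\
  (forall k M, 0 <= k <= PI -> (1 <= M)%nat ->
     Rabs (lR k - c0 - rsum (fun m => alpha m * cos (INR m * k) + beta m * sin (INR m * k)) (seq 1 M)) <= Ca / INR M /\
     Rabs (lB k - c0 - rsum (fun m => alpha m * cos (INR m * k) - beta m * sin (INR m * k)) (seq 1 M)) <= Ca / INR M).
Proof.
  pose proof PI_RGT_0 as HP. pose proof lR_C2 as CR. pose proof lB_C2 as CB. pose proof Lc_pos as L0.
  destruct (ibp_cos (fun k => lR k + lB k)) as (B1 & B1p & H1); [now apply C2_plus|].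
  destruct (ibp_sin (fun k => lR k - lB k)) as (B2 & B2p & H2); [now apply C2_minus| | |].
  { pose proof (ldiff_bd 0 ltac:(lra)) as H. rewrite sin_0, Rmult_0_r in H. apply Rabs_le_between in H. lra. }
  { pose proof (ldiff_bd PI ltac:(lra)) as H. rewrite sin_PI, Rmult_0_r in H. apply Rabs_le_between in H. lra. }
  set (a := fun k => / 2 * (lR k + lB k)). set (b := fun k => / 2 * (lR k - lB k)).
  assert (ca : gcont a). { intros k. apply cmult; [apply cconst|]. apply cplus; apply C2_cont; auto. }
  assert (cb : gcont b). { intros k. apply cmult; [apply cconst|]. apply cminus; apply C2_cont; auto. }
  assert (cS : gcont (fun k => lR k + lB k)). { intros k. apply cplus; apply C2_cont; auto. }
  assert (cD : gcont (fun k => lR k - lB k)). { intros k. apply cminus; apply C2_cont; auto. }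
  assert (Fa : forall m, fcoef (fun m k => cos (INR m * k)) a m = alpha m).
  { intros m. unfold fcoef, alpha, a. rewrite (RIext _ (fun k => / 2 * ((lR k + lB k) * cos (INR m * k)))) by (try lra; intros; ring).
    rewrite RIscal by (intros k; apply cmult; [apply cS | apply cos_lin_gcont]). fld. lra. }
  assert (Fb : forall m, fcoef (fun m k => sin (INR m * k)) b m = beta m).
  { intros m. unfold fcoef, beta, b. rewrite (RIext _ (fun k => / 2 * ((lR k - lB k) * sin (INR m * k)))) by (try lra; intros; ring).
    rewrite RIscal by (intros k; apply cmult; [apply cD | apply sin_lin_gcont]). fld. lra. }
  assert (Ip : 0 < / PI <= 1). { split; [now apply Rinv_0_lt_compat|]. rewrite <- Rinv_1. apply Rinv_le_contravar; [lra|]. pose proof PI2_1. lra. }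
  assert (Ha : forall m, (1 <= m)%nat -> Rabs (alpha m) <= (B1 + B2) / INR m ^ 2).
  { intros m Hm. unfold alpha. rewrite Rabs_mult, Rabs_pos_eq by lra. specialize (H1 m Hm).
    assert (0 < / INR m ^ 2) by (apply Rinv_0_lt_compat, pow_lt, lt_0_INR; lia).
    set (X := Rabs (RInt _ _ _)) in *. assert (0 <= X) by apply Rabs_pos. unfold Rdiv in *. nra. }
  assert (Hb : forall m, (1 <= m)%nat -> Rabs (beta m) <= (B1 + B2) / INR m ^ 2).
  { intros m Hm. unfold beta. rewrite Rabs_mult, Rabs_pos_eq by lra. specialize (H2 m Hm).
    assert (0 < / INR m ^ 2) by (apply Rinv_0_lt_compat, pow_lt, lt_0_INR; lia).
    set (X := Rabs (RInt _ _ _)) in *. assert (0 <= X) by apply Rabs_pos. unfold Rdiv in *. nra. }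
  exists (2 * (B1 + B2)). split; [lra|]. split.
  { intros m Hm. pose proof (Ha m Hm). pose proof (Hb m Hm). assert (0 < / INR m ^ 2) by (apply Rinv_0_lt_compat, pow_lt, lt_0_INR; lia). unfold Rdiv in *. split; nra. }
  intros k M Hk HM. set (B := 2 * Lc ^ 2).
  assert (La : forall u, Rabs (a u - a k) <= Lc * Rabs (cos u - cos k)).
  { intros u. unfold a. pose proof (lR_lip u k) as E1. pose proof (lB_lip u k) as E2.
    apply Rabs_le_between in E1. apply Rabs_le_between in E2. apply Rabs_le. lra. }
  assert (Lb : forall u, Rabs (b u - b k) <= Lc * Rabs (cos u - cos k)).
  { intros u. unfold b. pose proof (lR_lip u k) as E1. pose proof (lB_lip u k) as E2.
    apply Rabs_le_between in E1. apply Rabs_le_between in E2. apply Rabs_le. lra. }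
  pose proof (inversion 1 (fun m k => cos (INR m * k)) ltac:(ring) cos_tr ltac:(intros; apply Rabs_le, COS_bound) cos_lin_gcont a k B (B1 + B2) M ca) as IA.
  pose proof (inversion (-1) (fun m k => sin (INR m * k)) ltac:(ring) sin_tr ltac:(intros; apply Rabs_le, SIN_bound) sin_lin_gcont b k B (B1 + B2) M cb) as IB.
  assert (B0 : 0 <= B) by (unfold B; pose proof (pow2_ge_0 Lc); lra).
  specialize (IA B0 ltac:(intros u _; apply quarter; [lra | apply La]) ltac:(intros u _; rewrite Rmult_1_l; apply quarter; [lra | apply La]) ltac:(lra) ltac:(intros m Hm; rewrite Fa; auto) HM).
  (* For the odd extension the comparison at - k involves b(u) + b(k); both terms are O(sin), and
     sin u + sin k is at most the chord between e^{iu} and e^{-ik}. *)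
  assert (Lb2 : forall u, 0 <= u <= PI -> (b u - -1 * b k) ^ 2 <= B * (1 - cos (k + 1 * u))).
  { intros u Hu. replace (k + 1 * u) with (k + u) by ring. rewrite cos_plus.
    assert (Hb' : forall x, 0 <= x <= PI -> Rabs (b x) <= Lc * sin x).
    { intros x Hx. unfold b. pose proof (ldiff_bd x Hx) as E1. apply Rabs_le_between in E1. apply Rabs_le. lra. }
    pose proof (Hb' u Hu) as E1. pose proof (Hb' k Hk) as E2.
    assert (E3 : Rabs (b u - -1 * b k) <= Lc * (sin u + sin k)).
    { apply Rabs_le_between in E1. apply Rabs_le_between in E2. apply Rabs_le. lra. }
    assert (E4 : (b u - -1 * b k) ^ 2 <= Lc ^ 2 * (sin u + sin k) ^ 2).
    { rewrite <- (pow2_abs (b u - _)), <- Rpow_mult_distr. apply pow_incr. split; [apply Rabs_pos | auto]. }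
    pose proof (sin2_cos2 u). pose proof (sin2_cos2 k). unfold Rsqr in *.
    assert ((sin u + sin k) ^ 2 <= 2 * (1 - (cos k * cos u - sin k * sin u))) by (pose proof (pow2_ge_0 (cos u - cos k)); nra).
    pose proof (pow2_ge_0 Lc). unfold B. nra. }
  specialize (IB B0 ltac:(intros u _; apply quarter; [lra | apply Lb]) Lb2 ltac:(lra) ltac:(intros m Hm; rewrite Fb; auto) HM).
  cbv beta in IA, IB. simpl in IA, IB. rewrite !Rmult_0_l, ?cos_0, ?sin_0 in IA, IB.
  rewrite (rsum_ext _ (fun m => alpha m * cos (INR m * k))) in IA by (intros; now rewrite Fa).
  rewrite (rsum_ext _ (fun m => beta m * sin (INR m * k))) in IB by (intros; now rewrite Fb).
  assert (E0 : fcoef (fun m k => cos (INR m * k)) a 0 / 2 = c0).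
  { rewrite Fa. unfold alpha, c0. rewrite (RIext _ (fun k => lR k + lB k)) by (try lra; intros; simpl; rewrite Rmult_0_l, cos_0; ring). fld. lra. }
  rewrite cos_0, Rmult_1_r, E0 in IA. rewrite sin_0, Rmult_0_r in IB. rewrite rsum_plus, rsum_minus.
  replace (lR k) with (a k + b k) by (unfold a, b; field). replace (lB k) with (a k - b k) by (unfold a, b; field).
  unfold Rdiv in *. apply Rabs_le_between in IA. apply Rabs_le_between in IB. split; apply Rabs_le; lra.
Qed.
End Symbols.

(** * Trial vectors *)

(* trigonometric polynomials as unsorted lists of (frequency, coefficient) *)
Definition tpoly : Type := list (nat * C).
Definition teval (L : tpoly) (k : R) : C := csum (fun p => (snd p * cis (INR (fst p) * k))%C) L.
Definition tnorm (L : tpoly) : R := rsum (fun p => Cmod (snd p)) L.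
Definition tscal (c : C) (L : tpoly) : tpoly := map (fun p => (fst p, (c * snd p)%C)) L.
Definition tmul (A B : tpoly) : tpoly := flat_map (fun p => map (fun q => ((fst p + fst q)%nat, (snd p * snd q)%C)) B) A.
Fixpoint tpow (X : tpoly) (n : nat) : tpoly := match n with O => [(O, RtoC 1)] | S m => tmul X (tpow X m) end.
(** The constant term of the exponential is left out, so that all frequencies are positive;
    restoring it as a separate entry gives the trial vector leading coefficient exactly 1. *)
Fixpoint texp (K : nat) (X : tpoly) : tpoly :=
  match K with O => nil | S m => texp m X ++ tscal (RtoC (/ INR (fact (S m)))) (tpow X (S m)) end.

Lemma csum_flat_map {A B} (f : B -> C) (g : A -> list B) l : csum f (flat_map g l) = csum (fun a => csum f (g a)) l.
Proof. induction l as [|a l IH]; [reflexivity|]. simpl flat_map. now rewrite csum_app, csum_cons, IH. Qed.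
Lemma rsum_flat_map {A B} (f : B -> R) (g : A -> list B) l : rsum f (flat_map g l) = rsum (fun a => rsum f (g a)) l.
Proof. induction l as [|a l IH]; [reflexivity|]. simpl flat_map. now rewrite rsum_app, rsum_cons, IH. Qed.

Lemma teval_scal c L k : teval (tscal c L) k = (c * teval L k)%C.
Proof. unfold teval, tscal. rewrite csum_map, <- csum_scal. apply csum_ext; intros; simpl; ring. Qed.
Lemma teval_mul A B k : teval (tmul A B) k = (teval A k * teval B k)%C.
Proof.
  unfold teval, tmul. rewrite csum_flat_map, csum_mult. apply csum_ext; intros p _. rewrite csum_map. apply csum_ext; intros q _.
  cbn [fst snd]. rewrite plus_INR, Rmult_plus_distr_r, cis_plus. ring.
Qed.
Lemma teval_pow X n k : teval (tpow X n) k = Cpow (teval X k) n.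
Proof.
  induction n as [|n IH]; [|simpl tpow; now rewrite teval_mul, IH].
  unfold teval, tpow. rewrite csum_cons, csum_nil. simpl. rewrite Rmult_0_l, cis_0. ring.
Qed.
Lemma teval_exp K X k : (RtoC 1 + teval (texp K X) k)%C = tayl K (teval X k).
Proof.
  induction K as [|K IH]; [cbn [texp tayl]; unfold teval; rewrite csum_nil; ring|].
  cbn [texp tayl]. rewrite <- IH, <- teval_pow, <- teval_scal. unfold teval at 1. rewrite csum_app. unfold teval. ring.
Qed.

Lemma tnorm_mul A B : tnorm (tmul A B) = tnorm A * tnorm B.
Proof.
  unfold tnorm, tmul. rewrite rsum_flat_map, rsum_mult. apply rsum_ext; intros p _. rewrite rsum_map. apply rsum_ext; intros q _.
  cbn [snd]. apply Cmod_mult.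
Qed.
Lemma tnorm_pow X n : tnorm (tpow X n) = tnorm X ^ n.
Proof.
  induction n as [|n IH]; [|simpl tpow; rewrite tnorm_mul, IH; reflexivity].
  unfold tnorm, rsum; simpl. rewrite Cmod_1. ring.
Qed.
Lemma tnorm_exp K X : 1 + tnorm (texp K X) <= exp (tnorm X).
Proof.
  eapply Rle_trans; [|apply (exp_partial _ K)].
  - induction K as [|K IH].
    + unfold tnorm, texp, rsum; simpl. lra.
    + cbn [texp sum_f_R0]. unfold tnorm at 1. rewrite rsum_app. fold (tnorm (texp K X)).
      assert (E : rsum (fun p => Cmod (snd p)) (tscal (RtoC (/ INR (fact (S K)))) (tpow X (S K))) = tnorm X ^ S K / INR (fact (S K))).
      { unfold tscal. rewrite rsum_map, (rsum_ext _ (fun p => / INR (fact (S K)) * Cmod (snd p))).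
        - rewrite rsum_scal. fold (tnorm (tpow X (S K))). rewrite tnorm_pow. unfold Rdiv. ring.
        - intros p _. cbn [snd]. rewrite Cmod_mult, Cmod_R, Rabs_pos_eq; auto. left. apply Rinv_0_lt_compat, INR_fact_lt_0. }
      rewrite E. lra.
  - apply rsum_pos. intros; apply Cmod_ge_0.
Qed.
Lemma teval_Cmod L k : Cmod (teval L k) <= tnorm L.
Proof. eapply Rle_trans; [apply csum_Cmod|]. apply rsum_le. intros. rewrite Cmod_mult, Cmod_cis. lra. Qed.

Definition freqs (lo hi : nat) (L : tpoly) : Prop := forall p, In p L -> (lo <= fst p <= hi)%nat.
Lemma freqs_mul a b c d A B : freqs a b A -> freqs c d B -> freqs (a + c) (b + d) (tmul A B).
Proof.
  intros HA HB p Hp. apply in_flat_map in Hp. destruct Hp as (x & Hx & Hp). apply in_map_iff in Hp. destruct Hp as (y & <- & Hy).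
  specialize (HA x Hx). specialize (HB y Hy). simpl. lia.
Qed.
Lemma freqs_pow M X n : freqs 1 M X -> freqs n (n * M) (tpow X n).
Proof.
  intros H. induction n as [|n IH]; [intros p [<-|[]]; simpl; lia|]. apply (freqs_mul 1 M n (n * M)); auto.
Qed.
Lemma freqs_exp M X K : freqs 1 M X -> freqs 1 (K * M) (texp K X).
Proof.
  intros H. induction K as [|K IH]; [intros p []|]. cbn [texp]. intros p Hp. apply in_app_or in Hp. destruct Hp as [Hp|Hp].
  - specialize (IH p Hp). lia.
  - unfold tscal in Hp. apply in_map_iff in Hp. destruct Hp as (y & <- & Hy). pose proof (freqs_pow M X (S K) H y Hy). simpl in *. lia.
Qed.

(* the vector with entry [c] at position [i - m] for every [(m, c)] in the list *)
Definition trial (L : tpoly) (i j : nat) : C := csum (fun p => if Nat.eq_dec (fst p + j) i then snd p else RtoC 0) L.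

Lemma csum_delta_nat (F : nat -> C) l a : NoDup l -> In a l -> csum (fun j => if Nat.eq_dec a j then F j else RtoC 0) l = F a.
Proof.
  induction l as [|b l IH]; intros ND Hin; [destruct Hin|]. rewrite csum_cons. inversion ND; subst. destruct Hin as [->|Hin].
  - destruct (Nat.eq_dec a a); [|congruence]. rewrite csum_zero; [ring|]. intros j Hj. destruct (Nat.eq_dec a j); congruence.
  - rewrite IH by auto. destruct (Nat.eq_dec a b); [congruence | ring].
Qed.

Lemma trial_sum (F : nat -> C) L hi i n : freqs 0 hi L -> (hi <= i)%nat -> (i < n)%nat ->
  csum (fun j => (F j * trial L i j)%C) (seq 0 n) = csum (fun p => (F (i - fst p)%nat * snd p)%C) L.
Proof.
  intros HL Hi Hn. rewrite (csum_ext _ (fun j => csum (fun p => if Nat.eq_dec (i - fst p) j then (F j * snd p)%C else RtoC 0) L)).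
  - rewrite csum_exchange. apply csum_ext. intros p Hp. specialize (HL p Hp).
    rewrite (csum_delta_nat (fun j => F j * snd p)%C); [reflexivity | apply seq_NoDup | apply in_seq; lia].
  - intros j _. unfold trial. rewrite <- csum_scal. apply csum_ext. intros p Hp. specialize (HL p Hp).
    destruct (Nat.eq_dec (fst p + j) i), (Nat.eq_dec (i - fst p) j); try lia; ring.
Qed.
Lemma trial_zero L i j hi : freqs 0 hi L -> (i < j \/ j + hi < i)%nat -> trial L i j = RtoC 0.
Proof. intros HL H. apply csum_zero. intros p Hp. specialize (HL p Hp). destruct (Nat.eq_dec _ _); [lia | reflexivity]. Qed.
Lemma trial_one L i hi : freqs 1 hi L -> trial ((O, RtoC 1) :: L) i i = RtoC 1.
Proof.
  intros HL. unfold trial. rewrite csum_cons. cbn [fst snd]. destruct (Nat.eq_dec (0 + i) i); [|lia].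
  rewrite csum_zero; [ring|]. intros p Hp. specialize (HL p Hp). destruct (Nat.eq_dec _ _); [lia | reflexivity].
Qed.

(** The first order term is kept exact, since its contribution cancels under the integral in
    [gam_bounds]; only the remainder is estimated. *)
Lemma exp_quad x : exp x <= 1 + x + x ^ 2 * exp (Rabs x).
Proof.
  destruct (Rle_dec 0 x) as [H|H].
  - rewrite Rabs_pos_eq by auto. pose proof (exp_ineq1_le (- x)). rewrite exp_Ropp in H0. pose proof (exp_pos x).
    assert (exp x * (1 - x) <= 1). { apply (Rmult_le_compat_l (exp x)) in H0; [|lra]. rewrite Rinv_r in H0 by lra. lra. }
    assert (exp x - 1 <= x * exp x) by lra. assert (x * (exp x - 1) <= x * (x * exp x)) by (apply Rmult_le_compat_l; lra). lra.
  - rewrite Rabs_left by lra. set (y := - x). replace x with (- y) by (unfold y; ring). assert (0 < y) by (unfold y; lra).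
    rewrite exp_Ropp. pose proof (exp_ineq1_le y). assert (/ exp y <= / (1 + y)) by (apply Rinv_le_contravar; lra).
    assert (/ (1 + y) <= 1 - y + y ^ 2).
    { apply Rmult_le_reg_l with (1 + y); [lra|]. rewrite Rinv_r by lra. pose proof (pow_lt y 3 H0). lra. }
    assert (y ^ 2 <= y ^ 2 * exp y). { rewrite <- (Rmult_1_r (y ^ 2)) at 1. apply Rmult_le_compat_l; [apply pow2_ge_0 | lra]. }
    replace ((- y) ^ 2) with (y ^ 2) by ring. lra.
Qed.

Lemma C2_gcont f : C2 f -> gcont f.
Proof. intros H k. now apply C2_cont. Qed.

Section Site.
Variables (N : nat) (kappa bL bR : R).
Hypothesis (hk : 0 < kappa) (hL : 0 < bL) (hLR : bL <= bR).
Variable x0 : Z.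

Lemma ampR_trial L hi i n k : freqs 0 hi L -> (hi <= i)%nat -> (i < n)%nat -> (Z.of_nat hi <= site x0 i)%Z ->
  ampR kappa x0 0 (trial L i) n k = (cis (- (INR (yp x0 i) * k)) * teval L k + rC kappa k * cis (INR (yp x0 i) * k) * teval L (- k))%C.
Proof.
  intros HL Hi Hn Hy. unfold ampR. rewrite (trial_sum (fun j => fAp kappa 0 (INR (yp x0 j)) k) L hi) by auto.
  unfold teval. rewrite <- !csum_scal, <- csum_plus. apply csum_ext. intros p Hp. specialize (HL p Hp). unfold fAp.
  replace (INR (yp x0 (i - fst p))) with (INR (yp x0 i) - INR (fst p)) by (rewrite <- minus_INR; unfold yp, site in *; [f_equal|]; lia).
  replace (0 * k) with 0 by ring. rewrite cis_0.
  replace (- ((INR (yp x0 i) - INR (fst p)) * k)) with (- (INR (yp x0 i) * k) + INR (fst p) * k) by ring.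
  replace ((INR (yp x0 i) - INR (fst p)) * k) with (INR (yp x0 i) * k + INR (fst p) * - k) by ring.
  rewrite !cis_plus. ring.
Qed.
Lemma ampL_trial L hi i n k : freqs 0 hi L -> (hi <= i)%nat -> (i < n)%nat -> (Z.of_nat hi <= site x0 i)%Z ->
  ampL kappa x0 0 (trial L i) n k = (tauC kappa k * cis (INR (yp x0 i) * k) * teval L (- k))%C.
Proof.
  intros HL Hi Hn Hy. unfold ampL. rewrite (trial_sum (fun j => fBp kappa 0 (INR (yp x0 j)) k) L hi) by auto.
  unfold teval. rewrite <- !csum_scal. apply csum_ext. intros p Hp. specialize (HL p Hp). unfold fBp.
  replace (INR (yp x0 (i - fst p))) with (INR (yp x0 i) - INR (fst p)) by (rewrite <- minus_INR; unfold yp, site in *; [f_equal|]; lia).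
  replace (0 * k) with 0 by ring. rewrite cis_0.
  replace ((INR (yp x0 i) - INR (fst p)) * k) with (INR (yp x0 i) * k + INR (fst p) * - k) by ring.
  rewrite !cis_plus. ring.
Qed.

(* interference between the incoming and the reflected wave: a Hankel form in the coefficients *)
Definition hank (L : tpoly) (y : nat) (k : R) : R :=
  rsum (fun p => rsum (fun q => fst (Cconj (snd p) * snd q)%C * rr kappa k (2 * INR y - INR (fst p) - INR (fst q))) L) L.

(** [G] depends only on the sum of the indices, so exchanging them conjugates the coefficient
    product; its imaginary part cancels. *)
Lemma symm_form (L : tpoly) (G : nat -> C) :
  fst (csum (fun p => csum (fun q => (Cconj (snd p) * snd q * G (fst p + fst q)%nat)%C) L) L) =
  rsum (fun p => rsum (fun q => fst (Cconj (snd p) * snd q)%C * fst (G (fst p + fst q)%nat)) L) L.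
Proof.
  assert (S : csum (fun p => csum (fun q => (Cconj (snd p) * snd q * G (fst p + fst q)%nat)%C) L) L =
              csum (fun p => csum (fun q => (Cconj (snd q) * snd p * G (fst p + fst q)%nat)%C) L) L).
  { rewrite csum_exchange. apply csum_ext; intros p _; apply csum_ext; intros q _. rewrite (Nat.add_comm (fst q)). reflexivity. }
  set (X := csum _ L) in *. set (Y := csum (fun p => csum (fun q => (Cconj (snd q) * snd p * G (fst p + fst q)%nat)%C) L) L) in *.
  assert (F : fst X = / 2 * (fst X + fst Y)) by (rewrite <- S; field). rewrite F. unfold X, Y. rewrite !csum_fst, <- rsum_plus, <- rsum_scal.
  apply rsum_ext; intros p _. rewrite !csum_fst, <- rsum_plus, <- rsum_scal. apply rsum_ext; intros q _. simpl. field.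
Qed.

(** Expansion of |a + b|^2. In the interference term the frequencies add up to 2 y - p - q, which is
    large when the site is far from the impurity. *)
Lemma cross_term L y k :
  Cn2 (cis (- (INR y * k)) * teval L k + rC kappa k * cis (INR y * k) * teval L (- k))%C =
  Cn2 (teval L k) + (1 - sigmaB kappa k) * Cn2 (teval L (- k)) + 2 * hank L y k.
Proof.
  set (P := teval L k). set (Q := teval L (- k)).
  assert (E : forall a b : C, Cn2 (a + b)%C = Cn2 a + Cn2 b + 2 * fst (Cconj a * b)%C) by (intros; unfold Cn2; simpl; ring).
  rewrite E, !Cn2_mult, !Cn2_cis, (Cn2_rC kappa hk). rewrite Rmult_1_l, Rmult_1_r. do 2 f_equal.
  replace (Cconj (cis (- (INR y * k)) * P) * (rC kappa k * cis (INR y * k) * Q))%C with (Cconj P * Q * (rC kappa k * cis (2 * INR y * k)))%C.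
  2:{ rewrite Cmult_conj, cis_conj. replace (2 * INR y * k) with (INR y * k + - - (INR y * k)) by ring. rewrite cis_plus. ring. }
  assert (PQ : (Cconj P * Q * (rC kappa k * cis (2 * INR y * k)))%C =
     csum (fun p => csum (fun q => (Cconj (snd p) * snd q * (rC kappa k * cis ((2 * INR y - INR (fst p + fst q)) * k)))%C) L) L).
  { unfold P, Q, teval. rewrite csum_conj, csum_mult, <- csum_scal_r. apply csum_ext; intros p _. rewrite <- csum_scal_r. apply csum_ext; intros q _.
    rewrite Cmult_conj, cis_conj, plus_INR.
    replace ((2 * INR y - (INR (fst p) + INR (fst q))) * k) with (- (INR (fst p) * k) + INR (fst q) * - k + 2 * INR y * k) by ring.
    rewrite !cis_plus. ring. }
  rewrite PQ, (symm_form L (fun s => (rC kappa k * cis ((2 * INR y - INR s) * k))%C)). apply rsum_ext; intros p _; apply rsum_ext; intros q _.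
  f_equal. rewrite plus_INR, <- (rC_cis kappa hk). f_equal. ring.
Qed.

Lemma teval_CC2 L : CC2 (teval L).
Proof. apply CC2_csum. intros p _. apply (CC2_mult (fun _ => snd p)); [apply CC2_const | apply CC2_cis_lin]. Qed.
Lemma teval_neg_CC2 L : CC2 (fun k => teval L (- k)).
Proof.
  apply CC2_csum. intros p _. apply (CC2_mult (fun _ => snd p)); [apply CC2_const|].
  apply (CC2_cis (fun k => INR (fst p) * - k)). c2.
Qed.
Lemma hank_cont L y : gcont (hank L y).
Proof.
  intros k. apply rsum_cont; intros p _. apply rsum_cont; intros q _. apply cmult; [apply cconst|]. apply C2_cont. now apply rr_C2.
Qed.

Definition mainint (L : tpoly) : R := / (2 * PI) * RInt (fun k => fR bR k * Cn2 (teval L k) + fB kappa bL bR k * Cn2 (teval L (- k))) 0 PI.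
Definition hankint (L : tpoly) (y : nat) : R := / PI * RInt (fun k => fR bR k * hank L y k) 0 PI.

Lemma IRL_trial L hi i n : freqs 0 hi L -> (hi <= i)%nat -> (i < n)%nat -> (Z.of_nat hi <= site x0 i)%Z ->
  IR kappa bR x0 (trial L i) n + IL kappa bL x0 (trial L i) n = mainint L + hankint L (yp x0 i).
Proof.
  intros HL Hi Hn Hy. pose proof PI_RGT_0. unfold IR, IL, mainint, hankint.
  assert (cR : gcont (fR bR)) by (apply C2_gcont, fR_C2). assert (cB : gcont (fB kappa bL bR)) by (apply C2_gcont; now apply fB_C2).
  assert (c1 : gcont (fun k => Cn2 (teval L k))) by (intros k; apply (Cc_Cn2 (teval L)), CC2_Cc, teval_CC2).
  assert (c2' : gcont (fun k => Cn2 (teval L (- k)))) by (intros k; apply (Cc_Cn2 (fun k => teval L (- k))), CC2_Cc, teval_neg_CC2).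
  pose proof (hank_cont L (yp x0 i)) as ch.
  assert (cM : gcont (fun k => fR bR k * Cn2 (teval L k) + fB kappa bL bR k * Cn2 (teval L (- k)))).
  { intros k. apply cplus; apply cmult; auto. }
  assert (cH : gcont (fun k => fR bR k * hank L (yp x0 i) k)). { intros k. apply cmult; [apply cR | apply ch]. }
  rewrite <- Rmult_plus_distr_l. rewrite <- RIplus.
  2:{ intros k. apply cmult; [apply cR|]. apply (Cc_Cn2 (ampR kappa x0 0 (trial L i) n)), CC2_Cc. now apply ampR_CC2. }
  2:{ intros k. apply cmult; [apply (C2_cont _ (logis_C2 bL))|]. apply (Cc_Cn2 (ampL kappa x0 0 (trial L i) n)), CC2_Cc. now apply ampL_CC2. }
  rewrite (RIext _ (fun k => (fR bR k * Cn2 (teval L k) + fB kappa bL bR k * Cn2 (teval L (- k))) + 2 * (fR bR k * hank L (yp x0 i) k))); [|lra|].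
  - rewrite RIplus by (auto; apply (fscal _ _ cH)). rewrite RIscal by apply cH. fld. lra.
  - intros k _. rewrite (ampR_trial L hi), (ampL_trial L hi), cross_term by auto. rewrite !Cn2_mult, Cn2_cis, (Cn2_tau kappa hk).
    unfold fB, fR, fL. ring.
Qed.

(** The support of the trial vector stays at distance at least [hi] from the impurity, where the
    bound state is at most z0^hi. *)
Lemma psiv_trial L hi i n : freqs 0 hi L -> (hi <= i)%nat -> (i < n)%nat -> (2 * Z.of_nat hi <= site x0 i)%Z ->
  Cmod (psiv kappa x0 (trial L i) n) <= tnorm L * z0 kappa ^ hi.
Proof.
  intros HL Hi Hn Hy. unfold psiv. rewrite (trial_sum (fun j => RtoC (psi kappa (site x0 j))) L hi) by auto.
  eapply Rle_trans; [apply csum_Cmod|]. unfold tnorm. rewrite <- rsum_scal_r. apply rsum_le. intros p Hp. specialize (HL p Hp).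
  rewrite Cmod_mult, Cmod_R, Rmult_comm. apply Rmult_le_compat_l; [apply Cmod_ge_0|].
  pose proof (z0_pos kappa hk). pose proof (z0_lt1 kappa hk). unfold psi.
  assert (0 <= kappa / En kappa <= 1). { pose proof (En_gt kappa hk). split; [apply Rle_div_r|apply Rle_div_l]; lra. }
  assert (0 <= sqrt (kappa / En kappa) <= 1). { split; [apply sqrt_pos|]. rewrite <- sqrt_1. apply sqrt_le_1; lra. }
  set (e := Z.abs_nat (site x0 (i - fst p))). assert (He : (hi <= e)%nat) by (unfold e, site in *; lia).
  assert (z0 kappa ^ e <= z0 kappa ^ hi). { replace e with (hi + (e - hi))%nat by lia. rewrite pow_add. rewrite <- (Rmult_1_r (z0 kappa ^ hi)) at 2.
    apply Rmult_le_compat_l; [apply pow_le; lra|]. rewrite <- (pow1 (e - hi)). apply pow_incr. lra. }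
  assert (0 < z0 kappa ^ e) by (apply pow_lt; lra). rewrite Rabs_mult, !Rabs_pos_eq by lra. nra.
Qed.

(** The cosine part of [rr] falls under [ibp_cos]; its sine part carries a factor sin k, which
    provides the zeros at both ends demanded by [ibp_sin]. *)
Lemma hankel_coef : exists Ch, 0 < Ch /\ forall m, (1 <= m)%nat -> Rabs (RInt (fun k => fR bR k * rr kappa k (INR m)) 0 PI) <= Ch / INR m ^ 2.
Proof.
  set (F1 := fun k => (- kappa * kappa) * (fR bR k * / den kappa k)). set (F2 := fun k => (- kappa) * (sin k * (fR bR k * / den kappa k))).
  assert (C0 : C2 (fun k => fR bR k * / den kappa k)) by (apply (C2_mult (fR bR)); [apply fR_C2 | now apply iden_C2]).
  assert (C1 : C2 F1) by (apply (C2_mult (fun _ => _)); [c2 | exact C0]).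
  assert (C2' : C2 F2) by (apply (C2_mult (fun _ => - kappa)); [c2 | apply (C2_mult sin); [c2 | exact C0]]).
  destruct (ibp_cos F1 C1) as (B1 & P1 & H1).
  destruct (ibp_sin F2 C2') as (B2 & P2 & H2); [unfold F2; rewrite sin_0; ring | unfold F2; rewrite sin_PI; ring|].
  exists (B1 + B2). split; [lra|]. intros m Hm. specialize (H1 m Hm). specialize (H2 m Hm).
  rewrite (RIext _ (fun k => F1 k * cos (INR m * k) + F2 k * sin (INR m * k))).
  - rewrite RIplus.
    + eapply Rle_trans; [apply Rabs_triang|]. unfold Rdiv in *. lra.
    + intros k. apply cmult; [now apply C2_cont | apply cos_lin_gcont].
    + intros k. apply cmult; [now apply C2_cont | apply sin_lin_gcont].
  - pose proof PI_RGT_0; lra.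
  - intros k _. unfold F1, F2, rr. pose proof (den_pos kappa hk k). field. lra.
Qed.

(** With y >= 2 hi every frequency 2 y - p - q is at least [hi], so all matrix elements are O(hi^-2)
    and the coefficients enter only through [tnorm]. *)
Lemma hankint_bound : exists Ch, 0 < Ch /\ forall L hi y, freqs 0 hi L -> (1 <= hi)%nat -> (2 * hi <= y)%nat ->
  hankint L y <= Ch * tnorm L ^ 2 / INR hi ^ 2.
Proof.
  destruct hankel_coef as (Ch & C0 & HC). exists Ch. split; auto. intros L hi y HL Hh Hy. pose proof PI_RGT_0.
  assert (h1 : 1 <= INR hi) by (apply (le_INR 1); lia).
  assert (cR : gcont (fR bR)) by (apply C2_gcont, fR_C2).
  assert (cr : forall m, gcont (fun k => fR bR k * rr kappa k m)) by (intros m k; apply cmult; [apply cR | apply C2_cont; now apply rr_C2]).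
  unfold hankint, hank.
  assert (Ex : RInt (fun k => fR bR k * rsum (fun p => rsum (fun q => fst (Cconj (snd p) * snd q)%C * rr kappa k (2 * INR y - INR (fst p) - INR (fst q))) L) L) 0 PI
    = rsum (fun p => rsum (fun q => fst (Cconj (snd p) * snd q)%C * RInt (fun k => fR bR k * rr kappa k (2 * INR y - INR (fst p) - INR (fst q))) 0 PI) L) L).
  { rewrite (RIext _ (fun k => rsum (fun p => rsum (fun q => fst (Cconj (snd p) * snd q)%C * (fR bR k * rr kappa k (2 * INR y - INR (fst p) - INR (fst q)))) L) L)).
    - rewrite RIrsum by (intros p k; apply rsum_cont; intros q _; apply (fscal _ _ (cr _))). apply rsum_ext; intros p _.
      rewrite RIrsum by (intros q; apply (fscal _ _ (cr _))). apply rsum_ext; intros q _. apply RIscal, cr.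
    - lra.
    - intros k _. rewrite <- rsum_scal. apply rsum_ext; intros p _. rewrite <- rsum_scal. apply rsum_ext; intros; ring. }
  rewrite Ex. clear Ex.
  assert (Bd : rsum (fun p => rsum (fun q => fst (Cconj (snd p) * snd q)%C * RInt (fun k => fR bR k * rr kappa k (2 * INR y - INR (fst p) - INR (fst q))) 0 PI) L) L
    <= Ch / INR hi ^ 2 * (tnorm L * tnorm L)).
  { unfold tnorm. rewrite rsum_mult, <- rsum_scal. apply rsum_le; intros p Hp. rewrite <- rsum_scal. apply rsum_le; intros q Hq.
    specialize (HC (2 * y - fst p - fst q)%nat). pose proof (HL p Hp). pose proof (HL q Hq). specialize (HC ltac:(lia)).
    replace (INR (2 * y - fst p - fst q)) with (2 * INR y - INR (fst p) - INR (fst q)) in HC by (rewrite !minus_INR, mult_INR by lia; simpl; ring).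
    set (I := RInt _ 0 PI) in *. set (m := 2 * INR y - INR (fst p) - INR (fst q)) in *.
    assert (hm : INR hi <= m). { pose proof (le_INR _ _ (proj2 H0)). pose proof (le_INR _ _ (proj2 H1)). apply le_INR in Hy. rewrite mult_INR in Hy. simpl in Hy. unfold m. lra. }
    eapply Rle_trans; [apply Rle_abs|]. rewrite Rabs_mult. eapply Rle_trans; [apply Rmult_le_compat_r; [apply Rabs_pos | apply Re_le_Cmod]|].
    rewrite Cmod_mult, Cmod_conj. rewrite (Rmult_comm (Ch / _)). apply Rmult_le_compat_l.
    - apply Rmult_le_pos; apply Cmod_ge_0.
    - eapply Rle_trans; [exact HC|]. unfold Rdiv. apply Rmult_le_compat_l; [lra|]. apply Rinv_le_contravar; [apply pow_lt; lra|]. apply pow_incr. lra. }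
  assert (0 < / PI <= 1). { split; [now apply Rinv_0_lt_compat|]. rewrite <- Rinv_1. apply Rinv_le_contravar; [lra|]. pose proof PI2_1. lra. }
  set (Z := rsum _ L) in *. replace (Ch * tnorm L ^ 2 / INR hi ^ 2) with (Ch / INR hi ^ 2 * (tnorm L * tnorm L)) by (field; lra).
  assert (0 <= Ch / INR hi ^ 2 * (tnorm L * tnorm L)).
  { apply Rmult_le_pos; [|apply Rle_0_sqr]. apply Rlt_le, Rdiv_lt_0_compat; auto. apply pow_lt; lra. }
  nra.
Qed.
End Site.

(** * Superpolynomial decay, expressed as O(q^-6); the constant 720 is 6! *)

Lemma exp_term x n : 0 <= x -> x ^ n / INR (fact n) <= exp x.
Proof.
  intros Hx. eapply Rle_trans; [|apply (exp_partial x n Hx)]. destruct n as [|n]; [simpl; lra|]. cbn [sum_f_R0].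
  assert (0 <= sum_f_R0 (fun n => x ^ n / INR (fact n)) n); [|lra].
  apply cond_pos_sum. intros m. apply Rmult_le_pos; [now apply pow_le|]. left. apply Rinv_0_lt_compat, INR_fact_lt_0.
Qed.
Lemma pow_exp x n : 0 < x -> x ^ n = exp (INR n * ln x).
Proof. intros Hx. rewrite <- Rpower_pow by auto. reflexivity. Qed.
Lemma poly_exp x : 0 <= x -> x ^ 6 <= 720 * exp x.
Proof. intros Hx. pose proof (exp_term x 6 Hx) as H. replace (INR (fact 6)) with 720 in H by (simpl; ring). lra. Qed.
Lemma geom_poly z q : 0 < z < 1 -> (1 <= q)%nat -> z ^ q <= 720 / (- ln z) ^ 6 / INR q ^ 6.
Proof.
  intros [Z0 Z1] Hq. assert (l : 0 < - ln z) by (pose proof (ln_increasing z 1 Z0 Z1) as H; rewrite ln_1 in H; lra).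
  assert (q0 : 1 <= INR q) by (apply (le_INR 1); lia).
  pose proof (poly_exp (INR q * - ln z) ltac:(nra)) as H. rewrite pow_exp by auto.
  replace (INR q * ln z) with (- (INR q * - ln z)) by ring. rewrite exp_Ropp. pose proof (exp_pos (INR q * - ln z)).
  rewrite Rpow_mult_distr in H. assert (0 < (- ln z) ^ 6) by (apply pow_lt; lra). assert (0 < INR q ^ 6) by (apply pow_lt; lra).
  apply Rmult_le_reg_r with (exp (INR q * - ln z)); auto. rewrite Rinv_l by lra.
  replace (720 / (- ln z) ^ 6 / INR q ^ 6 * exp (INR q * - ln z)) with (720 * exp (INR q * - ln z) / (INR q ^ 6 * (- ln z) ^ 6)) by (field; lra).
  apply Rle_div_r; [apply Rmult_lt_0_compat; auto|]. lra.
Qed.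
Lemma fact_poly A q : 0 <= A -> (1 <= q)%nat -> A ^ q / INR (fact q) <= 720 * exp (exp 1 * A) / INR q ^ 6.
Proof.
  intros HA Hq. assert (q0 : 1 <= INR q) by (apply (le_INR 1); lia). assert (0 < INR q ^ 6) by (apply pow_lt; lra).
  apply (proj1 (Rle_div_r _ _ (INR q ^ 6) H)). pose proof (poly_exp (INR q) ltac:(lra)) as H1.
  assert (E : exp (INR q) = exp 1 ^ q) by (rewrite pow_exp, ln_exp, Rmult_1_r by apply exp_pos; reflexivity). rewrite E in H1.
  pose proof (exp_term (exp 1 * A) q ltac:(apply Rmult_le_pos; [left; apply exp_pos | auto])) as H2. rewrite Rpow_mult_distr in H2.
  assert (F0 : 0 <= A ^ q / INR (fact q)) by (apply Rmult_le_pos; [now apply pow_le | left; apply Rinv_0_lt_compat, INR_fact_lt_0]).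
  apply Rle_trans with (A ^ q / INR (fact q) * (720 * exp 1 ^ q)); [now apply Rmult_le_compat_l|]. unfold Rdiv in *. lra.
Qed.

Lemma sum_inv_sq_all M : rsum (fun m => / INR m ^ 2) (seq 1 M) <= 2.
Proof.
  destruct M as [|M]; [unfold rsum; simpl; lra|]. cbn [seq]. rewrite rsum_cons. pose proof (sum_inv_sq 1 M (le_n _)) as H.
  assert (0 < / INR (1 + M)) by (apply Rinv_0_lt_compat, lt_0_INR; lia). simpl (INR 1) in *.
  replace (/ 1 ^ 2) with 1 by field. rewrite Rinv_1 in H. lra.
Qed.

(** |e^z|^2 = e^{2 Re z}, with the relative error of [tayl_bound] squared. *)
Lemma tayl_Cn2 K z A : Cmod z <= A -> Cn2 (tayl K z) <= (1 + A ^ S K / INR (fact K) * exp A) ^ 2 * exp (2 * fst z).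
Proof.
  intros HA. pose proof (tayl_bound K z) as H. set (e := A ^ S K / INR (fact K) * exp A). pose proof (Cmod_ge_0 z) as z0.
  assert (He : Cmod z ^ S K / INR (fact K) * exp (Cmod z) <= e).
  { unfold e. assert (0 < / INR (fact K)) by apply Rinv_0_lt_compat, INR_fact_lt_0. pose proof (exp_pos (Cmod z)).
    apply Rmult_le_compat; [apply Rmult_le_pos; [now apply pow_le | lra] | lra | | now apply exp_le_compat].
    apply Rmult_le_compat_r; [lra|]. apply pow_incr. lra. }
  assert (H1 : Cmod (tayl K z * cexp (- z))%C <= 1 + e).
  { replace (tayl K z * cexp (- z))%C with (RtoC 1 + (tayl K z * cexp (- z) - RtoC 1))%C by ring.
    eapply Rle_trans; [apply Cmod_triangle|]. rewrite Cmod_1. lra. }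
  assert (H2 : Cn2 (tayl K z) * exp (- (2 * fst z)) <= (1 + e) ^ 2).
  { replace (exp (- (2 * fst z))) with (Cn2 (cexp (- z))).
    - rewrite <- Cn2_mult, Cn2_Cmod. apply pow_incr. split; [apply Cmod_ge_0 | auto].
    - unfold cexp. rewrite Cn2_mult, Cn2_cis, Cn2_RtoC. simpl fst. simpl. rewrite !Rmult_1_r, <- exp_plus. f_equal. ring. }
  rewrite exp_Ropp in H2. pose proof (exp_pos (2 * fst z)). apply Rmult_le_reg_r with (/ exp (2 * fst z)); [now apply Rinv_0_lt_compat|].
  rewrite Rmult_assoc, Rinv_r by lra. lra.
Qed.

(** * Approximate Szego minimisers and the bound at one site *)

Section Bound.
Variables (N : nat) (kappa bL bR : R).
Hypothesis (hk : 0 < kappa) (hL : 0 < bL) (hLR : bL <= bR).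
Variable x0 : Z.
Notation fR := (fR bR).
Notation fB := (fB kappa bL bR).
Notation lR := (lR bR).
Notation lB := (lB kappa bL bR).
Notation alpha := (alpha kappa bL bR).
Notation beta := (beta kappa bL bR).

(* truncation of [- sum_m c_m z^m] where [2 Re (sum_m c_m e^{imk}) = lR k - c0] and
   [2 Re (sum_m c_m e^{-imk}) = lB k - c0] on [0, pi] *)
Definition logsym (M : nat) : tpoly := map (fun m => (m, (- (alpha m / 2), beta m / 2))) (seq 1 M).
(** q terms of the exponential and q^3 Fourier modes: the factorial error of the first is
    negligible, the second determines the precision, and the degree is q^4. *)
Definition gam (q : nat) : tpoly := (O, RtoC 1) :: texp q (logsym (q ^ 3)).

Lemma logsym_freqs M : freqs 1 M (logsym M).
Proof. intros p Hp. apply in_map_iff in Hp. destruct Hp as (m & <- & Hm). apply in_seq in Hm. simpl. lia. Qed.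
Lemma logsym_re M k : 2 * fst (teval (logsym M) k) = - rsum (fun m => alpha m * cos (INR m * k) + beta m * sin (INR m * k)) (seq 1 M).
Proof.
  unfold teval, logsym. rewrite csum_map, csum_fst, <- rsum_scal. replace (- rsum _ _) with (-1 * rsum (fun m => alpha m * cos (INR m * k) + beta m * sin (INR m * k)) (seq 1 M)) by ring.
  rewrite <- rsum_scal. apply rsum_ext; intros. simpl. field.
Qed.

Lemma gam_eval q k : teval (gam q) k = tayl q (teval (logsym (q ^ 3)) k).
Proof. rewrite <- teval_exp. unfold gam. unfold teval at 1. rewrite csum_cons. cbn [fst snd INR]. rewrite Rmult_0_l, cis_0. f_equal. ring. Qed.
Lemma gam_freqs q : freqs 0 (q * q ^ 3) (gam q).
Proof. intros p [<-|Hp]; [simpl; lia|]. pose proof (freqs_exp _ _ q (logsym_freqs (q ^ 3)) p Hp). lia. Qed.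

(** The truncated logarithm has uniform error r = O(q^-3). In exp x <= 1 + x + O(x^2) the first
    order terms of both halves add up to lR + lB - 2 c0 minus a cosine polynomial without constant
    term, which integrates to 0; what remains is r^2 = O(q^-6). *)
Lemma gam_bounds : exists A Cm, 0 < A /\ 0 < Cm /\ forall q, (1 <= q)%nat ->
  tnorm (gam q) <= A /\ mainint kappa bL bR (gam q) <= exp (c0 kappa bL bR) * (1 + Cm / INR q ^ 6).
Proof.
  destruct (expansion kappa bL bR hk hL hLR) as (Ca & Ca0 & Hco & Hexp). pose proof PI_RGT_0 as HP.
  set (A := 2 * Ca). assert (A0 : 0 < A) by (unfold A; lra).
  assert (HX : forall M, tnorm (logsym M) <= A).
  { intros M. unfold tnorm, logsym. rewrite rsum_map. apply Rle_trans with (rsum (fun m => Ca * / INR m ^ 2) (seq 1 M)).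
    - apply rsum_le. intros m Hm. apply in_seq in Hm. cbn [snd]. eapply Rle_trans; [apply Cmod_le_parts|]. cbn [fst snd].
      destruct (Hco m ltac:(lia)) as [H1 H2]. rewrite Rabs_Ropp. unfold Rdiv in *. rewrite !Rabs_mult, (Rabs_pos_eq (/ 2)) by lra. lra.
    - rewrite rsum_scal. pose proof (sum_inv_sq_all M). unfold A. nra. }
  set (Ce := A * (720 * exp (exp 1 * A)) * exp A). assert (Ce0 : 0 < Ce).
  { unfold Ce. repeat apply Rmult_lt_0_compat; auto using exp_pos; lra. }
  set (Cq := Ca ^ 2 * exp Ca). assert (Cq0 : 0 < Cq) by (unfold Cq; apply Rmult_lt_0_compat; [apply pow_lt; lra | apply exp_pos]).
  exists (exp A), ((1 + Ce) ^ 2 * (1 + Cq) ). split; [apply exp_pos|]. split.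
  { apply Rmult_lt_0_compat; [apply pow_lt; lra | lra]. }
  intros q Hq. split.
  { unfold gam, tnorm. rewrite rsum_cons. cbn [snd]. rewrite Cmod_1. eapply Rle_trans; [apply tnorm_exp|]. apply exp_le_compat, HX. }
  set (M := (q ^ 3)%nat). assert (M1 : (1 <= M)%nat) by (unfold M; simpl; nia).
  assert (q1 : 1 <= INR q) by (apply (le_INR 1); lia). assert (m1 : 1 <= INR M) by (apply (le_INR 1); lia).
  assert (q6 : 1 <= INR q ^ 6) by (apply pow_R1_Rle; lra).
  set (s := / INR q ^ 6). assert (s01 : 0 < s <= 1). { split; [apply Rinv_0_lt_compat; lra|]. unfold s. rewrite <- Rinv_1. apply Rinv_le_contravar; lra. }
  set (e := A ^ S q / INR (fact q) * exp A).
  assert (He : 0 <= e <= Ce * s).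
  { split.
    - unfold e. apply Rmult_le_pos; [|left; apply exp_pos]. apply Rmult_le_pos; [apply pow_le; lra | left; apply Rinv_0_lt_compat, INR_fact_lt_0].
    - unfold e, Ce, s. pose proof (fact_poly A q ltac:(lra) Hq) as F. change (A ^ S q) with (A * A ^ q).
      replace (A * A ^ q / INR (fact q) * exp A) with (A * exp A * (A ^ q / INR (fact q))) by (field; apply INR_fact_neq_0).
      replace (A * (720 * exp (exp 1 * A)) * exp A * / INR q ^ 6) with (A * exp A * (720 * exp (exp 1 * A) / INR q ^ 6)) by (field; lra).
      apply Rmult_le_compat_l; auto. apply Rmult_le_pos; [lra | left; apply exp_pos]. }
  set (r := Ca / INR M). assert (r0 : 0 < r <= Ca). { unfold r. split; [apply Rdiv_lt_0_compat; lra | apply Rle_div_l; nra]. }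
  set (SR := fun k => rsum (fun m => alpha m * cos (INR m * k) + beta m * sin (INR m * k)) (seq 1 M)).
  set (SB := fun k => rsum (fun m => alpha m * cos (INR m * k) - beta m * sin (INR m * k)) (seq 1 M)).
  assert (Tq : r ^ 2 * exp Ca = Cq * s).
  { unfold r, Cq, s, M. rewrite pow_INR. field. lra. }
  assert (Ebd : forall x, Rabs x <= r -> exp x <= 1 + x + Cq * s).
  { intros x Hx. eapply Rle_trans; [apply exp_quad|]. apply Rplus_le_compat_l. rewrite <- Tq. apply Rmult_le_compat; [apply pow2_ge_0 | left; apply exp_pos | |].
    - rewrite <- (pow2_abs x). apply pow_incr. split; [apply Rabs_pos | auto].
    - apply exp_le_compat. lra. }
  assert (Pt : forall k, 0 <= k <= PI -> fR k * Cn2 (teval (gam q) k) + fB k * Cn2 (teval (gam q) (- k)) <=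
     (1 + e) ^ 2 * exp (c0 kappa bL bR) * (2 * (1 + Cq * s - (c0 kappa bL bR)) + ((lR k + lB k) - rsum (fun m => 2 * alpha m * cos (INR m * k)) (seq 1 M)))).
  { intros k Hk. destruct (Hexp k M Hk M1) as [ER EB]. fold r in ER, EB. fold (SR k) in ER. fold (SB k) in EB.
    assert (ES : rsum (fun m => 2 * alpha m * cos (INR m * k)) (seq 1 M) = SR k + SB k).
    { unfold SR, SB. rewrite <- rsum_plus. apply rsum_ext; intros; ring. }
    assert (Eneg : - rsum (fun m => alpha m * cos (INR m * - k) + beta m * sin (INR m * - k)) (seq 1 M) = - SB k).
    { unfold SB. f_equal. apply rsum_ext; intros. replace (INR a * - k) with (- (INR a * k)) by ring. rewrite cos_neg, sin_neg. ring. }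
    pose proof (tayl_Cn2 q _ A (Rle_trans _ _ _ (teval_Cmod (logsym M) k) (HX M))) as T1. fold e in T1. rewrite logsym_re in T1. fold (SR k) in T1.
    pose proof (tayl_Cn2 q _ A (Rle_trans _ _ _ (teval_Cmod (logsym M) (- k)) (HX M))) as T2. fold e in T2. rewrite logsym_re, Eneg in T2.
    rewrite !gam_eval. fold M.
    pose proof (Ebd _ ER) as E1. pose proof (Ebd _ EB) as E2.
    assert (pR : 0 < fR k) by apply logis_pos.
    assert (pB : 0 < fB k) by (pose proof (fB_bd kappa bL bR hk hL hLR k); pose proof (fmin_pos bR); lra).
    assert (G : forall f l S, 0 < f -> l = ln f -> exp (l - (c0 kappa bL bR) - S) <= 1 + (l - (c0 kappa bL bR) - S) + Cq * s -> forall c, c <= (1 + e) ^ 2 * exp (- S) ->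
       f * c <= (1 + e) ^ 2 * exp (c0 kappa bL bR) * (1 + (l - (c0 kappa bL bR) - S) + Cq * s)).
    { intros f l S0 Hf -> H c Hc. apply Rle_trans with (f * ((1 + e) ^ 2 * exp (- S0))); [apply Rmult_le_compat_l; lra|].
      replace (f * ((1 + e) ^ 2 * exp (- S0))) with ((1 + e) ^ 2 * exp (c0 kappa bL bR) * exp (ln f - (c0 kappa bL bR) - S0)).
      - apply Rmult_le_compat_l; auto. apply Rmult_le_pos; [apply pow2_ge_0 | left; apply exp_pos].
      - unfold Rminus. rewrite !exp_plus, exp_ln, (exp_Ropp (c0 kappa bL bR)) by auto. field. pose proof (exp_pos (c0 kappa bL bR)); lra. }
    pose proof (G (fR k) (lR k) (SR k) pR eq_refl E1 _ T1) as G1. pose proof (G (fB k) (lB k) (SB k) pB eq_refl E2 _ T2) as G2.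
    rewrite ES. eapply Rle_trans; [apply Rplus_le_compat; [exact G1 | exact G2]|]. right. ring. }
  assert (cR : gcont fR) by (apply C2_gcont, fR_C2). assert (cB : gcont fB) by (apply C2_gcont; now apply fB_C2).
  assert (cl : gcont (fun k => lR k + lB k)). { intros k. apply cplus; apply C2_cont; [exact (lR_C2 bL bR hL hLR) | now apply lB_C2]. }
  assert (cc : gcont (fun k => rsum (fun m => 2 * alpha m * cos (INR m * k)) (seq 1 M))).
  { intros k. apply rsum_cont; intros m _. apply cmult; [apply cconst | apply cos_lin_gcont]. }
  (* The mean of lR + lB cancels 2 c0 and every cosine integrates to zero over (0, PI). *)
  assert (Int : RInt (fun k => (1 + e) ^ 2 * exp (c0 kappa bL bR) * (2 * (1 + Cq * s - (c0 kappa bL bR)) + ((lR k + lB k) - rsum (fun m => 2 * alpha m * cos (INR m * k)) (seq 1 M)))) 0 PI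
     = (1 + e) ^ 2 * exp (c0 kappa bL bR) * (2 * PI * (1 + Cq * s))).
  { rewrite RIscal by (intros k; apply cplus; [apply cconst | apply cminus; auto]). rewrite RIplus; [|intros k; apply cconst | intros k; apply cminus; auto].
    rewrite RIminus by auto. rewrite RIconst, RIrsum by (intros m k; apply cmult; [apply cconst | apply cos_lin_gcont]).
    rewrite rsum_zero.
    - assert (E0 : 2 * PI * (c0 kappa bL bR) = RInt (fun k => lR k + lB k) 0 PI) by (unfold c0; field; lra). rewrite <- E0. rng.
    - intros m Hm. apply in_seq in Hm. rewrite RIscal by apply cos_lin_gcont.
      rewrite (RIext _ (fun k => cos (IZR (Z.of_nat m) * k))) by (try lra; intros; now rewrite INR_IZR_INZ). rewrite RI_cos_PI.
      destruct (Z.eq_dec _ _); [lia | ring]. }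
  assert (Main : mainint kappa bL bR (gam q) <= (1 + e) ^ 2 * exp (c0 kappa bL bR) * (1 + Cq * s)).
  { unfold mainint. apply Rle_trans with (/ (2 * PI) * ((1 + e) ^ 2 * exp (c0 kappa bL bR) * (2 * PI * (1 + Cq * s)))).
    - apply Rmult_le_compat_l; [left; apply Rinv_0_lt_compat; lra|]. rewrite <- Int. apply RIle; [lra| | | intros k Hk; apply Pt; lra].
      + intros k. apply cplus; apply cmult; auto; [apply (Cc_Cn2 (teval (gam q))), CC2_Cc, teval_CC2 | apply (Cc_Cn2 (fun k => teval (gam q) (- k))), CC2_Cc, teval_neg_CC2].
      + intros k. apply cmult; [apply cconst|]. apply cplus; [apply cconst | apply cminus; auto].
    - right. field. lra. }
  eapply Rle_trans; [exact Main|]. pose proof (exp_pos (c0 kappa bL bR)).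
  replace ((1 + e) ^ 2 * exp (c0 kappa bL bR) * (1 + Cq * s)) with (exp (c0 kappa bL bR) * ((1 + e) ^ 2 * (1 + Cq * s))) by ring. apply Rmult_le_compat_l; [lra|].
  unfold Rdiv. fold s.
  assert (P1 : (1 + e) ^ 2 <= (1 + Ce * s) ^ 2) by (apply pow_incr; lra).
  assert (P2 : (1 + Ce * s) ^ 2 <= 1 + (2 * Ce + Ce ^ 2) * s). { assert (s ^ 2 <= s) by nra. pose proof (pow2_ge_0 Ce). nra. }
  apply Rle_trans with ((1 + (2 * Ce + Ce ^ 2) * s) * (1 + Cq * s)).
  { apply Rmult_le_compat_r; [|lra]. assert (0 < Cq * s) by (apply Rmult_lt_0_compat; lra). lra. }
  set (X := 2 * Ce + Ce ^ 2). replace ((1 + Ce) ^ 2 * (1 + Cq)) with ((1 + X) * (1 + Cq)) by (unfold X; ring).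
  assert (0 <= X) by (unfold X; nra). assert (0 <= X * Cq) by nra. assert (s ^ 2 <= s) by nra.
  replace ((1 + X * s) * (1 + Cq * s)) with (1 + (X + Cq) * s + X * Cq * s ^ 2) by ring.
  assert (X * Cq * s ^ 2 <= X * Cq * s) by (apply Rmult_le_compat_l; auto). lra.
Qed.

(** Four errors of order q^-6 are collected: truncation of the minimiser, interference with the
    reflected wave, overlap with the bound state, and finite time. *)
Lemma site_bound : exists C0, 0 < C0 /\ forall q i, (1 <= q)%nat -> (Z.to_nat (- x0) + 2 * (q * q ^ 3) <= i)%nat ->
  forall n, (i < n)%nat -> exists T, 0 < T /\ forall t, T <= t ->
    fst (qform (S_ N kappa bL bR x0 t) (trial (gam q) i) n) <= exp (c0 kappa bL bR) * (1 + C0 / INR q ^ 6).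
Proof.
  destruct gam_bounds as (A & Cm & A0 & Cm0 & Hg). destruct (hankint_bound kappa bR hk) as (Ch & Ch0 & Hh).
  pose proof (z0_pos kappa hk) as zp. pose proof (z0_lt1 kappa hk) as zl.
  set (Cd := 720 / (- ln (z0 kappa)) ^ 6).
  assert (Cd0 : 0 < Cd). { apply Rdiv_lt_0_compat; [lra|]. apply pow_lt. pose proof (ln_increasing _ 1 zp zl) as H. rewrite ln_1 in H. lra. }
  set (Cz := 2 / (1 - z0 kappa)). assert (Cz0 : 0 < Cz) by (apply Rdiv_lt_0_compat; lra).
  set (rho := exp (c0 kappa bL bR)). assert (rp : 0 < rho) by apply exp_pos.
  set (H1 := Ch * A ^ 2). assert (H10 : 0 < H1) by (apply Rmult_lt_0_compat; auto; now apply pow_lt).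
  set (Z := rho * (1 + Cm) + H1).
  assert (Z0 : 0 < Z) by (unfold Z; apply Rplus_lt_0_compat; auto; apply Rmult_lt_0_compat; lra).
  set (B := H1 + Cd * Z + 2 * Cz * A ^ 2 * Cd).
  assert (B0 : 0 < B). { unfold B. assert (0 < Cd * Z) by now apply Rmult_lt_0_compat. assert (0 < A ^ 2) by now apply pow_lt.
    assert (0 < 2 * Cz * A ^ 2 * Cd) by (apply Rmult_lt_0_compat; auto; apply Rmult_lt_0_compat; auto; lra). lra. }
  exists (Cm + B / rho + 1). split. { assert (0 < B / rho) by now apply Rdiv_lt_0_compat. lra. }
  intros q i Hq Hi. set (hi := (q * q ^ 3)%nat) in *.
  assert (Hhi : (q <= hi)%nat) by (unfold hi; pose proof (Nat.pow_le_mono_l 1 q 3 Hq) as HP; rewrite Nat.pow_1_l in HP; nia).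
  intros n Hn. destruct (Hg q Hq) as [HA HM].
  assert (q1 : 1 <= INR q) by (apply (le_INR 1); lia). assert (q6 : 1 <= INR q ^ 6) by (apply pow_R1_Rle; lra).
  set (s := / INR q ^ 6). assert (s01 : 0 < s <= 1). { split; [apply Rinv_0_lt_compat; lra|]. unfold s. rewrite <- Rinv_1. apply Rinv_le_contravar; lra. }
  (* The overlap with the bound state is at most A d. With this weight the loss (1 + d) on the main
     part and (1 + / d) d^2 on the bound state are both O(d). *)
  set (d := z0 kappa ^ q). assert (dp : 0 < d) by now apply pow_lt.
  assert (d1 : d <= 1) by (unfold d; rewrite <- (pow1 q); apply pow_incr; lra).
  assert (ds : d <= Cd * s) by (apply (geom_poly (z0 kappa) q); auto).
  assert (Hv : forall j, (j < n)%nat -> (site x0 j < 0)%Z -> trial (gam q) i j = RtoC 0).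
  { intros j _ Hj. apply (trial_zero _ _ _ hi); [apply gam_freqs|]. right. unfold site in Hj. lia. }
  destruct (main_form N kappa bL bR hk hL hLR x0 (trial (gam q) i) n Hv d (rho * s)) as (T & T0 & HT); auto.
  { apply Rmult_lt_0_compat; lra. }
  exists T. split; auto. intros t Ht. eapply Rle_trans; [now apply HT|]. fold Cz.
  assert (HF : freqs 0 hi (gam q)) by apply gam_freqs.
  assert (Hi1 : (hi <= i)%nat) by lia. assert (Hi2 : (2 * Z.of_nat hi <= site x0 i)%Z) by (unfold site; lia). assert (Hi3 : (Z.of_nat hi <= site x0 i)%Z) by lia.
  rewrite (fun h => IRL_trial kappa bL bR h x0 (gam q) hi) by auto.
  assert (HK : hankint kappa bR (gam q) (yp x0 i) <= H1 * s).
  { eapply Rle_trans; [apply (Hh _ hi); [apply gam_freqs | lia | unfold yp, site; lia]|].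
    assert (tn : 0 <= tnorm (gam q)) by (apply rsum_pos; intros; apply Cmod_ge_0).
    unfold H1, Rdiv. apply Rmult_le_compat; [apply Rmult_le_pos; [lra | apply pow2_ge_0] | left; apply Rinv_0_lt_compat, pow_lt, lt_0_INR; lia | |].
    - apply Rmult_le_compat_l; [lra|]. apply pow_incr. lra.
    - unfold s, hi. apply Rinv_le_contravar; [lra|]. rewrite mult_INR, pow_INR. replace ((INR q * INR q ^ 3) ^ 2) with (INR q ^ 6 * INR q ^ 2) by ring.
      assert (1 <= INR q ^ 2) by (apply pow_R1_Rle; lra). nra. }
  assert (PS : Cn2 (psiv kappa x0 (trial (gam q) i) n) <= A ^ 2 * d ^ 2).
  { rewrite Cn2_Cmod, <- Rpow_mult_distr. apply pow_incr. split; [apply Cmod_ge_0|].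
    eapply Rle_trans; [apply (psiv_trial kappa hk x0 _ hi); auto|].
    apply Rmult_le_compat; [apply rsum_pos; intros; apply Cmod_ge_0 | apply pow_le; lra | auto |].
    unfold d. replace hi with (q + (hi - q))%nat by lia. rewrite pow_add. rewrite <- (Rmult_1_r (z0 kappa ^ q)) at 2.
    apply Rmult_le_compat_l; [left; exact dp|]. rewrite <- (pow1 (hi - q)). apply pow_incr. lra. }
  fold rho in HM. unfold Rdiv in HM. fold s in HM.
  assert (X1 : (1 + d) * (mainint kappa bL bR (gam q) + hankint kappa bR (gam q) (yp x0 i)) <= rho * (1 + Cm * s) + H1 * s + Cd * s * Z).
  { apply Rle_trans with ((1 + d) * (rho * (1 + Cm * s) + H1 * s)); [apply Rmult_le_compat_l; lra|].
    rewrite Rmult_plus_distr_r, Rmult_1_l. apply Rplus_le_compat_l.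
    assert (mul1 : forall x, 0 < x -> x * s <= x) by (intros x Hx; rewrite <- (Rmult_1_r x) at 2; apply Rmult_le_compat_l; lra).
    pose proof (mul1 Cm Cm0). pose proof (mul1 H1 H10).
    assert (rho * (1 + Cm * s) <= rho * (1 + Cm)) by (apply Rmult_le_compat_l; lra).
    apply Rmult_le_compat; [lra | | exact ds | unfold Z; lra].
    assert (0 < Cm * s) by (apply Rmult_lt_0_compat; lra). assert (0 < H1 * s) by (apply Rmult_lt_0_compat; lra).
    assert (0 < rho * (1 + Cm * s)) by (apply Rmult_lt_0_compat; lra). lra. }
  assert (X2 : (1 + / d) * Cz * Cn2 (psiv kappa x0 (trial (gam q) i) n) <= 2 * Cz * A ^ 2 * Cd * s).
  { assert (0 < / d) by now apply Rinv_0_lt_compat. assert (0 < A ^ 2) by now apply pow_lt.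
    apply Rle_trans with ((1 + / d) * Cz * (A ^ 2 * d ^ 2)); [apply Rmult_le_compat_l; auto; apply Rmult_le_pos; lra|].
    replace ((1 + / d) * Cz * (A ^ 2 * d ^ 2)) with (Cz * A ^ 2 * (d + d ^ 2)) by (field; lra).
    replace (2 * Cz * A ^ 2 * Cd * s) with (Cz * A ^ 2 * (2 * (Cd * s))) by ring. apply Rmult_le_compat_l; [apply Rmult_le_pos; lra|]. nra. }
  unfold Rdiv. fold s. replace (rho * (1 + (Cm + B * / rho + 1) * s)) with (rho * (1 + Cm * s) + B * s + rho * s) by (field; lra).
  unfold B. lra.
Qed.
End Bound.

(** * Time averages and conclusion *)

(* [Lim_seq] is total, the mean of the limsup and the liminf: convergence is not needed. *)
Lemma real_Lim_seq_bound (u : nat -> R) B : Hierarchy.eventually (fun n => Rabs (u n) <= B) -> Rabs (real (Lim_seq u)) <= B.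
Proof.
  intros H.
  assert (H1 : Rbar_le (Lim_seq u) B).
  { rewrite <- (Lim_seq_const B). apply Lim_seq_le_loc. eapply filter_imp; [|exact H]. intros n Hn. apply Rabs_le_between in Hn. lra. }
  assert (H2 : Rbar_le (- B) (Lim_seq u)).
  { rewrite <- (Lim_seq_const (- B)). apply Lim_seq_le_loc. eapply filter_imp; [|exact H]. intros n Hn. apply Rabs_le_between in Hn. lra. }
  destruct (Lim_seq u) as [l| |]; simpl in *; try contradiction. apply Rabs_le. lra.
Qed.

(** Once the averaging time exceeds M / B + T0, the initial segment contributes at most B to the
    mean, which accounts for the factor 2. *)
Lemma average_bound (f : R -> R) B T0 : (forall t, continuous f t) -> 0 < B -> 0 < T0 -> (forall t, T0 <= t -> Rabs (f t) <= B) ->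
  Rabs (real (Lim (fun T => / T * RInt f 0 T) p_infty)) <= 2 * B.
Proof.
  intros cf HB HT Hf. unfold Lim. apply real_Lim_seq_bound.
  set (M := Rabs (RInt f 0 T0)). destruct (INR_unbounded (M / B + T0)) as [n0 Hn0].
  exists n0. intros n Hn. apply le_INR in Hn. change (Rbar_loc_seq p_infty n) with (INR n).
  assert (M0 : 0 <= M / B) by (apply Rmult_le_pos; [apply Rabs_pos | left; now apply Rinv_0_lt_compat]).
  assert (n1 : T0 <= INR n) by lra. rewrite <- (RI_Chasles f 0 T0 (INR n)) by auto.
  rewrite Rabs_mult, Rabs_pos_eq by (left; apply Rinv_0_lt_compat; lra).
  assert (H1 : Rabs (RInt f T0 (INR n)) <= (INR n - T0) * B) by (apply RIabs_bound; auto; intros; apply Hf; lra).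
  pose proof (Rabs_triang (RInt f 0 T0) (RInt f T0 (INR n))) as H2. fold M in H2.
  apply Rmult_le_reg_l with (INR n); [lra|]. rewrite <- Rmult_assoc, Rinv_r, Rmult_1_l by lra.
  eapply Rle_trans; [exact H2|]. assert (M <= INR n * B); [|nra].
  apply Rmult_lt_compat_r with (r := B) in Hn0; auto. replace ((M / B + T0) * B) with (M + T0 * B) in Hn0 by (field; lra). nra.
Qed.

Lemma rprod_exp {A} (a : A -> R) l : rprod (fun i => exp (a i)) l = exp (rsum a l).
Proof.
  induction l as [|i l IH]; [unfold rprod, rsum; simpl; now rewrite exp_0|].
  rewrite rsum_cons, exp_plus, <- IH. reflexivity.
Qed.
Lemma rprod_le {A} (f g : A -> R) l : (forall i, In i l -> 0 <= f i <= g i) -> 0 <= rprod f l <= rprod g l.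
Proof.
  induction l as [|i l IH]; intros H; [unfold rprod; simpl; lra|].
  destruct (H i (or_introl eq_refl)). destruct (IH (fun j Hj => H j (or_intror Hj))).
  change (rprod f (i :: l)) with (f i * rprod f l). change (rprod g (i :: l)) with (g i * rprod g l).
  split; [now apply Rmult_le_pos | now apply Rmult_le_compat].
Qed.
Lemma common_time {A} (P : A -> R -> Prop) l : (forall i, In i l -> exists T, 0 < T /\ forall t, T <= t -> P i t) ->
  exists T, 0 < T /\ forall t, T <= t -> forall i, In i l -> P i t.
Proof.
  induction l as [|i l IH]; intros H; [exists 1; split; [lra | intros t _ j []]|].
  destruct (IH (fun j Hj => H j (or_intror Hj))) as (T1 & P1 & H1). destruct (H i (or_introl eq_refl)) as (T2 & P2 & H2).
  exists (T1 + T2). split; [lra|]. intros t Ht j [<-|Hj]; [apply H2 | apply H1]; auto; lra.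
Qed.

Lemma inv_three_halves D : 2 <= D -> / (D * sqrt D) <= 2 * (/ sqrt (D - 1) - / sqrt D).
Proof.
  intros HD. set (a := sqrt (D - 1)). set (b := sqrt D).
  assert (a0 : 0 < a) by (apply sqrt_lt_R0; lra). assert (ab : a <= b) by (apply sqrt_le_1; lra).
  assert (a2 : a * a = D - 1) by (apply sqrt_sqrt; lra). assert (b2 : b * b = D) by (apply sqrt_sqrt; lra).
  replace (2 * (/ a - / b)) with (2 * (b - a) / (a * b)) by (field; lra).
  assert (E : b - a = / (a + b)). { apply Rmult_eq_reg_r with (a + b); [|lra]. rewrite Rinv_l by lra. nra. }
  rewrite E. replace (2 * / (a + b) / (a * b)) with (/ (a * b * (a + b) / 2)) by (field; lra).
  apply Rinv_le_contravar; [|rewrite <- b2 at 1].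
  - apply Rmult_lt_0_compat; [|lra]. apply Rmult_lt_0_compat; [apply Rmult_lt_0_compat; lra | lra].
  - assert (a * b <= b * b) by (apply Rmult_le_compat_r; lra). assert (0 < a * b) by (apply Rmult_lt_0_compat; lra). nra.
Qed.

(** The shift by PI reflects that [shat] is the Fermi function at - cos k; the symmetry about PI
    then reduces the circle to (0, PI). *)
Lemma RI_circle (f : R -> R) : (forall x, continuous f x) -> (forall x, f (2 * PI - x) = f x) ->
  RInt (fun k => f (k + PI)) (- PI) PI = 2 * RInt f 0 PI.
Proof.
  intros cf Hs. pose proof PI_RGT_0.
  assert (E1 : RInt (fun k => f (k + PI)) (- PI) PI = RInt f 0 (2 * PI)).
  { pose proof (RInt_comp_lin f 1 PI (- PI) PI) as H1. replace (1 * - PI + PI) with 0 in H1 by ring. replace (1 * PI + PI) with (2 * PI) in H1 by ring.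
    rewrite <- H1 by (apply cexR, cf). apply RIext; [lra|]. intros x _. unfold scal; simpl; unfold mult; simpl. rewrite !Rmult_1_l. reflexivity. }
  assert (E2 : RInt f 0 PI = RInt f PI (2 * PI)).
  { pose proof (RInt_comp_lin f (-1) (2 * PI) 0 PI) as H1. replace (-1 * 0 + 2 * PI) with (2 * PI) in H1 by ring. replace (-1 * PI + 2 * PI) with PI in H1 by ring.
    specialize (H1 (cexR f _ _ cf)). rewrite <- (opp_RInt_swap f) in H1 by (apply cexR, cf).
    rewrite (RIext _ (fun y => -1 * f y)) in H1; [|lra|intros x _; unfold scal; simpl; unfold mult; simpl; rewrite <- Hs; f_equal; f_equal; ring].
    rewrite RIscal in H1 by auto. unfold opp in H1; simpl in H1. lra. }
  rewrite E1, <- (RI_Chasles f 0 PI (2 * PI)), <- E2 by auto. rng.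
Qed.

(** * Assembly over the sites *)

Section Final.
Variables (x0 : Z) (N : nat) (kappa bL bR : R).
Hypothesis (hk : 0 < kappa) (hL : 0 < bL) (hLR : bL <= bR).

Lemma shat_logis b k : shat b k = logis b (cos (k + PI)).
Proof.
  rewrite neg_cos. unfold shat, logis, tanh, sinh, cosh. set (z := b * cos k / 2).
  replace (- (b * - cos k)) with (z + z) by (unfold z; field). rewrite exp_plus, exp_Ropp. pose proof (exp_pos z).
  assert (0 < exp z * exp z) by (apply Rmult_lt_0_compat; auto). field. repeat split; lra.
Qed.
Lemma sigma_PI k : sigmaB kappa (k + PI) = sigmaB kappa k.
Proof. unfold sigmaB. rewrite neg_sin. now replace ((- sin k) ^ 2) with (sin k ^ 2) by ring. Qed.

Lemma Gamma_c0 : Gamma kappa bL bR = - (c0 kappa bL bR).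
Proof.
  pose proof PI_RGT_0.
  assert (cR : forall x, continuous (lR bR) x) by (apply C2_cont; exact (lR_C2 bL bR hL hLR)).
  assert (cB : forall x, continuous (lB kappa bL bR) x) by (apply C2_cont; now apply lB_C2).
  assert (sym : forall x, cos (2 * PI - x) = cos x) by (intros; rewrite cos_minus, cos_2PI, sin_2PI; ring).
  assert (syms : forall x, sin (2 * PI - x) = - sin x) by (intros; rewrite sin_minus, cos_2PI, sin_2PI; ring).
  unfold Gamma, GammaR, GammaB, c0.
  rewrite (RIext (fun k => ln (shat bR k)) (fun k => lR bR (k + PI))); [|lra|intros x _; unfold lR, fR; now rewrite shat_logis].
  rewrite (RIext (fun k => ln (sigmaB kappa k * shat bL k + (1 - sigmaB kappa k) * shat bR k)) (fun k => lB kappa bL bR (k + PI))); [|lra|].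
  2:{ intros x _. unfold lB, fB, fL, fR. rewrite !shat_logis, sigma_PI. f_equal. ring. }
  rewrite !RI_circle; auto.
  - rewrite RIplus by auto. fld. lra.
  - intros x. unfold lB, fB, fL, fR, sigmaB. rewrite sym, syms. now replace ((- sin x) ^ 2) with (sin x ^ 2) by ring.
  - intros x. unfold lR, fR. now rewrite sym.
Qed.

(** Strictness comes from the right reservoir: [lR] is bounded by the negative constant ln (logis bR
    1), while f_B < 1 gives only lB <= 0. *)
Lemma c0_neg : (c0 kappa bL bR) < 0.
Proof.
  pose proof PI_RGT_0. unfold c0.
  assert (M1 : ln (logis bR 1) < 0) by (rewrite <- ln_1; apply ln_increasing; [apply logis_pos | apply logis_lt1]).
  assert (RInt (fun k => lR bR k + lB kappa bL bR k) 0 PI <= (PI - 0) * ln (logis bR 1)).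
  { rewrite <- RIconst. apply RIle; [lra| | |].
    - intros k. apply cplus; apply C2_cont; [exact (lR_C2 bL bR hL hLR) | now apply lB_C2].
    - intros k; apply cconst.
    - intros k _. pose proof (fmin_pos bR). pose proof (fB_bd kappa bL bR hk hL hLR k).
      assert (lB kappa bL bR k <= 0). { unfold lB. rewrite <- ln_1. apply Rlt_le, ln_increasing; lra. }
      assert (lR bR k <= ln (logis bR 1)). { unfold lR. apply Rcomplements.ln_le; [apply logis_pos|]. apply logis_mono; [lra|]. pose proof (COS_bound k). lra. }
      lra. }
  assert (0 < / (2 * PI)) by (apply Rinv_0_lt_compat; lra).
  assert ((PI - 0) * ln (logis bR 1) < 0) by nra.
  set (I := RInt _ 0 PI) in *. nra.
Qed.

(* from the index [i0] on, the [i + 2 - i0 >= 2] sites just before that of [i] lie in [x >= 0] *)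
Definition i0 : nat := (Z.to_nat (- x0) + 2)%nat.
(** The largest q with 2 q^4 <= D, where D = i + 2 - i0 measures the available room, as [site_bound]
    requires. *)
Definition qq (i : nat) : nat := Nat.sqrt (Nat.sqrt ((i + 2 - i0) / 2)).
Definition Dr (i : nat) : R := INR (i + 2 - i0).
Definition Wv (i j : nat) : C :=
  if (i <? i0)%nat then if Nat.eq_dec j i then RtoC 1 else RtoC 0 else trial (gam kappa bL bR (qq i)) i j.

(** Rounding loses at most (q + 1)^4 <= 16 q^4, and halving D another factor 2, whence 32. *)
Lemma qq_spec i : (i0 <= i)%nat -> (1 <= qq i)%nat /\ (2 * (qq i * qq i ^ 3) <= i + 2 - i0)%nat /\ (i + 2 - i0 <= 32 * qq i ^ 4)%nat.
Proof.
  intros Hi. unfold qq. set (D := (i + 2 - i0)%nat). assert (2 <= D)%nat by (unfold D; lia).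
  pose proof (Nat.div_mod_eq D 2) as E. pose proof (Nat.mod_upper_bound D 2 ltac:(lia)). set (h := (D / 2)%nat) in *.
  pose proof (Nat.sqrt_spec' h) as [A1 A2]. set (s := Nat.sqrt h) in *. pose proof (Nat.sqrt_spec' s) as [B1 B2]. set (q := Nat.sqrt s) in *.
  assert (1 <= s)%nat by (destruct s; [lia | lia]). assert (1 <= q)%nat by (destruct q; [lia | lia]).
  assert (q * q ^ 3 = (q * q) * (q * q))%nat as -> by (simpl; ring). assert (q ^ 4 = (q * q) * (q * q))%nat as -> by (simpl; ring).
  split; [auto|]. split.
  - assert ((q * q) * (q * q) <= s * s)%nat by (apply Nat.mul_le_mono; auto). lia.
  - assert (S s <= (S q) * (S q))%nat by lia. assert (S q <= 2 * q)%nat by lia.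
    assert (S q * S q <= 4 * (q * q))%nat by nia. assert (S s * S s <= (4 * (q * q)) * (4 * (q * q)))%nat by (apply Nat.mul_le_mono; lia). nia.
Qed.

(** 216 = 6^3: the cube of sqrt D <= 6 q^2, which follows from D <= 32 q^4. *)
Lemma inv_q6 i : (i0 <= i)%nat -> / INR (qq i) ^ 6 <= 216 * / (Dr i * sqrt (Dr i)).
Proof.
  intros Hi. destruct (qq_spec i Hi) as (H1 & _ & H3). apply le_INR in H3. fold (Dr i) in H3. rewrite mult_INR, pow_INR in H3.
  replace (INR 32) with 32 in H3 by (simpl; ring). set (q := INR (qq i)) in *. assert (q1 : 1 <= q) by (apply (le_INR 1); auto).
  assert (D2 : 2 <= Dr i) by (apply (le_INR 2); lia). set (D := Dr i) in *.
  assert (Hs : sqrt D <= 6 * q ^ 2).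
  { rewrite <- (sqrt_pow2 (6 * q ^ 2)) by (pose proof (pow2_ge_0 q); lra). apply sqrt_le_1; [lra | apply pow2_ge_0|].
    replace ((6 * q ^ 2) ^ 2) with (36 * q ^ 4) by ring. assert (0 < q ^ 4) by (apply pow_lt; lra). lra. }
  assert (0 < sqrt D) by (apply sqrt_lt_R0; lra). assert (ED : D = sqrt D * sqrt D) by (symmetry; apply sqrt_sqrt; lra).
  assert (0 < q ^ 6) by (apply pow_lt; lra). assert (0 < q ^ 2) by (apply pow_lt; lra).
  assert (D * sqrt D <= 216 * q ^ 6).
  { rewrite ED at 1. replace (216 * q ^ 6) with (6 * q ^ 2 * (6 * q ^ 2) * (6 * q ^ 2)) by ring.
    apply Rmult_le_compat; [apply Rmult_le_pos; lra | lra | apply Rmult_le_compat; lra | lra]. }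
  assert (P : 0 < D * sqrt D) by (apply Rmult_lt_0_compat; lra).
  apply Rmult_le_reg_r with (q ^ 6 * (D * sqrt D)); [apply Rmult_lt_0_compat; auto|].
  replace (/ q ^ 6 * (q ^ 6 * (D * sqrt D))) with (D * sqrt D) by (field; lra).
  replace (216 * / (D * sqrt D) * (q ^ 6 * (D * sqrt D))) with (216 * q ^ 6) by (field; lra). auto.
Qed.

(** Logarithm of the excess over e^{c0} allowed at site i; before [i0] the trivial bound 1 costs -
    c0. *)
Definition gg (C1 : R) (i : nat) : R := if (i <? i0)%nat then - (c0 kappa bL bR) else C1 * / (Dr i * sqrt (Dr i)).

Lemma gg_sum C1 n : 0 <= C1 -> rsum (gg C1) (seq 0 n) <= INR i0 * - (c0 kappa bL bR) + 2 * C1.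
Proof.
  intros HC. pose proof c0_neg.
  assert (pos : forall i, 0 <= gg C1 i).
  { intros i. unfold gg. destruct (Nat.ltb_spec i i0) as [|Hi]; [lra|]. apply Rmult_le_pos; auto. left. apply Rinv_0_lt_compat.
    assert (2 <= Dr i) by (apply (le_INR 2); lia). apply Rmult_lt_0_compat; [lra | apply sqrt_lt_R0; lra]. }
  assert (T : forall k, rsum (gg C1) (seq i0 k) <= 2 * C1 * (1 - / sqrt (INR (k + 1)))).
  { induction k as [|m IH].
    - unfold rsum; cbn [seq map fold_right]. assert (E1 : INR (0 + 1) = 1) by (simpl; ring). rewrite E1, sqrt_1, Rinv_1. lra.
    - rewrite seq_S, rsum_app. unfold rsum at 2; cbn [map fold_right]. rewrite Rplus_0_r.
      unfold gg at 2. destruct (Nat.ltb_spec (i0 + m) i0) as [|_]; [lia|]. unfold Dr. replace (i0 + m + 2 - i0)%nat with (S m + 1)%nat by lia.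
      pose proof (inv_three_halves (INR (S m + 1)) ltac:(apply (le_INR 2); lia)) as I.
      replace (INR (S m + 1) - 1) with (INR (m + 1)) in I by (rewrite !plus_INR, (S_INR m); ring).
      apply (Rmult_le_compat_l C1) in I; auto. lra. }
  apply Rle_trans with (rsum (gg C1) (seq 0 (i0 + n))).
  { replace (i0 + n)%nat with (n + i0)%nat by lia. rewrite seq_app, rsum_app. pose proof (rsum_pos (gg C1) (seq (0 + n) i0) ltac:(auto)). lra. }
  rewrite seq_app, rsum_app. apply Rplus_le_compat.
  - rewrite (rsum_ext _ (fun _ => - (c0 kappa bL bR))); [rewrite rsum_const, length_seq; lra|]. intros i Hi. apply in_seq in Hi. unfold gg.
    destruct (Nat.ltb_spec i i0); [reflexivity | lia].
  - eapply Rle_trans; [apply T|]. assert (0 < / sqrt (INR (n + 1))). { apply Rinv_0_lt_compat, sqrt_lt_R0, lt_0_INR. lia. } nra.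
Qed.

(** K is chosen before n, since the excesses [gg] have bounded sum; only the time threshold, common
    to the n sites, depends on n. *)
Lemma Pt_decay : exists K, 0 < K /\ forall n, exists T, 0 < T /\ forall t, T <= t -> Cmod (Pt x0 N kappa bL bR n t) <= K * exp (c0 kappa bL bR * INR n).
Proof.
  destruct (site_bound N kappa bL bR hk hL hLR x0) as (C0 & C00 & HS). set (C1 := 216 * C0).
  exists (exp (INR i0 * - (c0 kappa bL bR) + 2 * C1)). split; [apply exp_pos|]. intros n.
  assert (site : forall i, In i (seq 0 n) -> exists T, 0 < T /\ forall t, T <= t -> fst (qform (S_ N kappa bL bR x0 t) (Wv i) n) <= exp (c0 kappa bL bR + gg C1 i)).
  { intros i Hi. apply in_seq in Hi. unfold Wv, gg. destruct (Nat.ltb_spec i i0) as [Hlt|Hge].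
    - exists 1. split; [lra|]. intros t _. replace (c0 kappa bL bR + - (c0 kappa bL bR)) with 0 by ring. rewrite exp_0. apply qform_delta_le; auto; lia.
    - destruct (qq_spec i Hge) as (Q1 & Q2 & _). destruct (HS (qq i) i Q1) with (n := n) as (T & T0 & HT); [unfold i0 in *; lia | lia |].
      exists T. split; auto. intros t Ht. eapply Rle_trans; [now apply HT|]. rewrite exp_plus. apply Rmult_le_compat_l; [left; apply exp_pos|].
      eapply Rle_trans; [apply exp_ineq1_le|]. apply exp_le_compat. unfold C1, Rdiv. pose proof (inv_q6 i Hge). nra. }
  destruct (common_time (fun i t => fst (qform (S_ N kappa bL bR x0 t) (Wv i) n) <= exp (c0 kappa bL bR + gg C1 i)) _ site) as (T & T0 & HT).
  exists T. split; auto. intros t Ht. eapply Rle_trans; [apply (Pt_le N kappa bL bR hk hL hLR x0 n t Wv)|].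
  - intros i j Hij. unfold Wv. destruct (Nat.ltb_spec i i0) as [|Hge]; [destruct (Nat.eq_dec j i); [lia | reflexivity]|].
    apply (trial_zero _ _ _ _ (gam_freqs kappa bL bR (qq i))). now left.
  - intros i. unfold Wv. destruct (Nat.ltb_spec i i0) as [|Hge]; [destruct (Nat.eq_dec i i); [reflexivity | congruence]|].
    eapply trial_one, freqs_exp, logsym_freqs.
  - eapply Rle_trans; [apply (rprod_le _ (fun i => exp (c0 kappa bL bR + gg C1 i)))|].
    + intros i Hi. split; [now apply qform_pos | now apply HT].
    + rewrite rprod_exp, rsum_plus, rsum_const, length_seq, <- exp_plus. apply exp_le_compat.
      pose proof (gg_sum C1 n ltac:(unfold C1; lra)). lra.
Qed.

(** The factor 4 is 2 from [average_bound] times 2 for adding real and imaginary parts. *)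
Lemma Pness_decay : exists K, forall n, Cmod (Pness x0 N kappa bL bR n) <= K * exp (- Gamma kappa bL bR * INR n).
Proof.
  destruct Pt_decay as (K & K0 & HK). exists (4 * K). intros n. destruct (HK n) as (T & T0 & HT).
  rewrite Gamma_c0, Ropp_involutive. set (B := K * exp (c0 kappa bL bR * INR n)) in *.
  assert (B0 : 0 < B) by (apply Rmult_lt_0_compat; auto using exp_pos).
  destruct (Pt_Cc N kappa bL bR hk hL hLR x0 n) as [c1 c2'].
  eapply Rle_trans; [apply Cmod_le_parts|]. unfold Pness; cbn [fst snd].
  pose proof (average_bound (fun t => Re (Pt x0 N kappa bL bR n t)) B T c1 B0 T0
    ltac:(intros t Ht; eapply Rle_trans; [apply Re_le_Cmod | now apply HT])) as A1.
  pose proof (average_bound (fun t => Im (Pt x0 N kappa bL bR n t)) B T c2' B0 T0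
    ltac:(intros t Ht; eapply Rle_trans; [apply Im_le_Cmod | now apply HT])) as A2.
  unfold B in *. lra.
Qed.
End Final.

Theorem mainTheorem1 (x0 : Z) (N : nat) (kappa betaL betaR : R)
  (hkappa : 0 < kappa) (hbL : 0 < betaL) (hbLR : betaL <= betaR) :
  0 < Gamma kappa betaL betaR /\
  exists (K : R) (n0 : nat), forall n : nat, (n0 <= n)%nat ->
    Cmod (Pness x0 N kappa betaL betaR n) <= K * exp (- Gamma kappa betaL betaR * INR n).
Proof.
  split; [rewrite Gamma_c0 by auto; pose proof (c0_neg kappa betaL betaR hkappa hbL hbLR); lra|].
  destruct (Pness_decay x0 N kappa betaL betaR hkappa hbL hbLR) as [K HK]. exists K, 0%nat. intros n _. apply HK.
Qed.
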